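(* Let $\alpha\in(1,2)$ and let $\rho\in C_c^2(\mathbb{R}^2)$ be nonnegative (the initial mass density). For each $n\ge 1$ let $\nu_n$ be the final mass distribution of the truncated $\alpha$-stable divisible sandpile on $\frac1n\mathbb{Z}^2$ started from the initial distribution $\rho_n=\rho|_{\frac1n\mathbb{Z}^2}$. Then $$\nu_n^{\square}\longrightarrow \rho+L_M u\qquad\text{as } n\to\infty$$ in the weak-$*$ topology, i.e. for every $\phi\in C_c^\infty(\mathbb{R}^2)$, $$\lim_{n\to\infty}\int_{\mathbb{R}^2}\nu_n^{\square}\phi\,dx=\int_{\mathbb{R}^2}\rho\,\phi\,dx+\int_{\mathbb{R}^2}u\,L_M\phi\,dx,$$ where $u=s-\gamma$ is the continuous odometer function.
   Context: **Jump laws.** $B_R=\{x\in\mathbb{R}^2:|x|<R\}$, $\mu$ is Lebesgue measure on $\mathbb{R}^2$. Fix $\alpha\in(1,2)$ and $0<r<M$. For $n\ge1$ and $y\in\frac1n\mathbb{Z}^2$ put $y^{\square}=y+[-\frac1{2n},\frac1{2n}]^2$, $F_n(y)=n^2\mu\big(y^{\square}\cap(B_M\setminus B_{r/n})\big)$, $$k_n=\frac{n^{2-\alpha}}4\Big(\int_{B_M}\frac{dy}{|y|^\alpha}-\frac1{n^2}\sum_{y\in\frac1n\mathbb{Z}^2\setminus\{0\}}\frac{F_n(y)}{|y|^\alpha}\Big),$$ $$p_n(y)=c_n\Big(k_n\mathbf 1_{\{|y|=1/n\}}+\frac{F_n(y)}{(n|y|)^{2+\alpha}}\Big)\ (y\neq0),\qquad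 p_n(0)=0,$$ with $c_n$ chosen so that $\sum_y p_n(y)=1$. Standing assumption: $r,M$ are such that $M>1$ and $k_n>0$ for all $n$ (possible: it holds for $r$ large, $M>r$). The limit $c=\lim_n c_n\in(0,\infty)$ exists. **Sandpile on $\frac1n\mathbb{Z}^2$.** A mass configuration is a nonnegative function on $\frac1n\mathbb{Z}^2$; a site is full if its mass is at least $1$. Toppling a full site $x$ with mass $m$: $x$ keeps mass $1$ and each site $x+y$ receives mass $(m-1)p_n(y)$. Starting from $\rho_n$, topple full sites one at a time, in an infinite sequence in which only full sites are toppled and every site that is initially full or becomes full is toppled infinitely often (if there is no full site, nothing happens). The mass configurations converge to a final distribution $\nu_n\le 1$, which does not depend on the order of topplings. **Extension.** For a function $f$ on $\frac1n\mathbb{Z}^2$, $f^{\square}(x)=f(x^{n})$ for $x\in\mathbb{R}^2$, where $x^{n}$ is the unique point of $\frac1n\mathbb{Z}^2$ in $\prod_{i=1,2}(x_i-\frac1{2n},x_i+\frac1{2n}]$. **Continuous objects.** For $f\in C^2$, $$L_Mf(x)=\frac c2\int_{B_M}\frac{f(x+y)+f(x-y)-2f(x)}{|y|^{2+\alpha}}dy,$$ and for $f\in L^1_{loc}$, $L_Mf$ is the distribution $\langle L_Mf,\phi\rangle=\langle f,L_M\phi\rangle$, $\phi\in C_c^\infty$. A function $f\in L^1_{loc}(\mathbb{R}^2)$ is superharmonic in an open set $V$ if $\langle f,L_M\phi\rangle\le0$ for all nonnegative $\phi\in C_c^\infty(\mathbb{R}^2)$ supported in $V$; superharmonic means superharmonic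 in $\mathbb{R}^2$. Let $\psi_M(\theta)=c\int_{B_M}\frac{1-\cos(\theta\cdot y)}{|y|^{2+\alpha}}dy$, fix $x_0\in\mathbb{R}^2$ with $|x_0|=1$, and let $$G_M(x)=\frac1{(2\pi)^2}\int_{\mathbb{R}^2}\frac{\cos(\theta\cdot x)-\cos(\theta\cdot x_0)}{\psi_M(\theta)}d\theta\quad(x\ne0),$$ an improper integral ($\lim_{R\to\infty}\int_{B_R}$). With $\sigma_M^2=c\int_{B_M}|y|^{-\alpha}dy$, the obstacle is $\gamma(x)=-\frac{|x|^2}{\sigma_M^2}-\int_{\mathbb{R}^2}G_M(x-y)\rho(y)dy$; its least superharmonic majorant is $s(x)=\inf\{f(x): f \text{ continuous, superharmonic, } f\ge\gamma\}$; the continuous odometer is $u=s-\gamma$. *)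

(* Defs.v *)
From HB Require Import structures.
From mathcomp Require Import all_boot all_order all_algebra.
From mathcomp Require Import all_classical all_reals all_analysis.
From mathcomp Require Import lra.

Set Implicit Arguments.
Unset Strict Implicit.
Unset Printing Implicit Defensive.

Import Order.TTheory GRing.Theory Num.Theory.
Import numFieldNormedType.Exports.

Local Open Scope classical_set_scope.
Local Open Scope ring_scope.

Notation mu2 := (lebesgue_measure \x lebesgue_measure)%E.

Section Plane.
Context {R : realType}.

(* The library norm of [R * R] is the sup norm, hence a separate Euclidean
   norm; the topology is the same for both. *)
Definition enorm (x : R * R) : R := Num.sqrt (x.1 ^+ 2 + x.2 ^+ 2).

Definition edot (x y : R * R) : R := x.1 * y.1 + x.2 * y.2.

Definition eball (rad : R) : set (R * R) := [set x | enorm x < rad].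

Fixpoint Ck (k : nat) (f : R * R -> R) : Prop :=
  match k with
  | 0 => continuous f
  | k'.+1 => [/\ forall x, differentiable f x,
                 Ck k' ('D_(1, 0) f) & Ck k' ('D_(0, 1) f)]
  end.

Definition tsupport (f : R * R -> R) : set (R * R) :=
  closure [set x | f x != 0].

Definition Cck (k : nat) (f : R * R -> R) : Prop :=
  Ck k f /\ compact (tsupport f).

Definition test_function (f : R * R -> R) : Prop := forall k, Cck k f.

Definition locally_integrable2 (f : R * R -> R) : Prop :=
  measurable_fun setT f /\
  forall K : set (R * R), compact K -> mu2.-integrable K (EFin \o f).

End Plane.

(* The site [y : int * int] stands for the point y / n of the lattice
   (1/n) Z^2. *)
Definition site : Type := (int * int)%type.

Section Lattice.
Context {R : realType}.

Definition pt (n : nat) (y : site) : R * R :=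
  (y.1%:~R / n%:R, y.2%:~R / n%:R).

Definition square (n : nat) (y : site) : set (R * R) :=
  [set x | `|x.1 - (pt n y).1| <= (2 * n%:R)^-1 /\
           `|x.2 - (pt n y).2| <= (2 * n%:R)^-1].

(* The lattice point of the half-open square
   ]x.1 - 1/(2n), x.1 + 1/(2n)] * ]x.2 - 1/(2n), x.2 + 1/(2n)];
   see [nearestP]. *)
Definition nearest (n : nat) (x : R * R) : site :=
  (Num.floor (n%:R * x.1 + 2^-1), Num.floor (n%:R * x.2 + 2^-1)).

Lemma nearestP (n : nat) (x : R * R) (y : site) : (0 < n)%N ->
  y = nearest n x <->
  (x.1 - (2 * n%:R)^-1 < (pt n y).1 <= x.1 + (2 * n%:R)^-1) /\
  (x.2 - (2 * n%:R)^-1 < (pt n y).2 <= x.2 + (2 * n%:R)^-1).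
Proof.
move=> n_gt0; have nR : 0 < n%:R :> R by rewrite ltr0n.
have key (t : R) (m : int) : (m == Num.floor (n%:R * t + 2^-1)) =
    (t - (2 * n%:R)^-1 < m%:~R / n%:R <= t + (2 * n%:R)^-1).
  have e : (2 * n%:R)^-1 * n%:R = 2^-1 :> R.
    by rewrite invfM -mulrA mulVf ?mulr1// gt_eqF.
  rewrite ltr_pdivlMr// ler_pdivrMr// mulrBl [(t + _) * _]mulrDl e (mulrC t).
  apply/eqP/andP => [->|[h1 h2]].
    have := floor_itv (n%:R * t + 2^-1 : R); rewrite intrD => /andP[h1 h2].
    by split => //; lra.
  by apply/esym/floor_def; rewrite h2 intrD /=; lra.
rewrite -!key; case: y => a b; rewrite /nearest.
by split=> [[<- <-]|[/eqP <- /eqP <-]] //=; rewrite !eqxx.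
Qed.

End Lattice.

Section Sandpile.
Context {R : realType}.
Context (r M alpha : R).

Definition Fn (n : nat) (y : site) : R :=
  n%:R ^+ 2 * fine (mu2 (square n y `&` (eball M `\` eball (r / n%:R)))).

(* [Fn] has finite support for n > 0, so the sums over sites below, which are
   [fsbigop] sums, are genuine finite sums. *)
Definition kn (n : nat) : R :=
  n%:R `^ (2 - alpha) / 4 *
  (\int[mu2]_(y in eball M) (enorm y `^ alpha)^-1
   - (n%:R ^+ 2)^-1 *
     \sum_(y \in [set y : site | y != 0]) Fn n y / enorm (pt n y) `^ alpha).

Definition wn (n : nat) (y : site) : R :=
  kn n * (enorm (pt n y) == n%:R^-1 :> R)%:R
  + Fn n y / (n%:R * enorm (pt n y)) `^ (2 + alpha).

Definition cn (n : nat) : R := (\sum_(y \in [set y : site | y != 0]) wn n y)^-1.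

Definition pn (n : nat) (y : site) : R := if y == 0 then 0 else cn n * wn n y.

(* Toppling is only applied to full sites, except when no site is full: then it
   does nothing. *)
Definition topple (n : nat) (x : site) (m : site -> R) : site -> R :=
  if 1 <= m x then
    fun z => (if z == x then 1 else m z) + (m x - 1) * pn n (z - x)
  else m.

Fixpoint mass (n : nat) (m0 : site -> R) (xs : nat -> site) (k : nat) :
    site -> R :=
  if k is k'.+1 then topple n (xs k') (mass n m0 xs k') else m0.

(* If no site of [m0] is full, [xs] is arbitrary and [mass n m0 xs] is
   constantly [m0]. *)
Definition toppling_sequence (n : nat) (m0 : site -> R) (xs : nat -> site) :
    Prop :=
  ((exists x, 1 <= m0 x) -> forall k, 1 <= mass n m0 xs k (xs k)) /\
  (forall x k, 1 <= mass n m0 xs k x ->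
     forall j, exists2 l, (j <= l)%N & xs l = x).

Definition final_mass (n : nat) (m0 : site -> R) (xs : nat -> site) :
    site -> R :=
  fun x => lim (mass n m0 xs k x @[k --> \oo]).

Definition step_ext (n : nat) (f : site -> R) : R * R -> R :=
  fun x => f (nearest n x).

Definition cc : R := lim (cn n @[n --> \oo]).

Definition LM (f : R * R -> R) (x : R * R) : R :=
  cc / 2 * \int[mu2]_(y in eball M)
    ((f (x + y) + f (x - y) - 2 * f x) / enorm y `^ (2 + alpha)).

Definition superharmonic_in (V : set (R * R)) (f : R * R -> R) : Prop :=
  locally_integrable2 f /\
  forall phi : R * R -> R, test_function phi -> (forall x, 0 <= phi x) ->
    tsupport phi `<=` V -> \int[mu2]_x (f x * LM phi x) <= 0.

Definition superharmonic (f : R * R -> R) : Prop := superharmonic_in setT f.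

Definition psiM (theta : R * R) : R :=
  cc * \int[mu2]_(y in eball M)
    ((1 - cos (edot theta y)) / enorm y `^ (2 + alpha)).

(* At x = 0 the improper integral diverges and the value is irrelevant. *)
Definition GM (x0 x : R * R) : R :=
  ((2 * pi) ^+ 2)^-1 *
  lim ((\int[mu2]_(theta in eball rad)
     ((cos (edot theta x) - cos (edot theta x0)) / psiM theta))
   @[rad --> +oo]).

Definition sigma2 : R := cc * \int[mu2]_(y in eball M) (enorm y `^ alpha)^-1.

Definition obstacle (x0 : R * R) (rho : R * R -> R) (x : R * R) : R :=
  - (enorm x ^+ 2 / sigma2) - \int[mu2]_y (GM x0 (x - y) * rho y).

Definition majorant (gamma : R * R -> R) (x : R * R) : R :=
  inf [set f x | f in [set f : R * R -> R |
    [/\ continuous f, superharmonic f & forall z, gamma z <= f z]]].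

Definition odometer (x0 : R * R) (rho : R * R -> R) (x : R * R) : R :=
  majorant (obstacle x0 rho) x - obstacle x0 rho x.

End Sandpile.

(* Main.v *)
(** Let u_n be n^(-alpha) times the total mass emitted by the sites. A toppling
    never takes the emitted mass above a nonnegative W that stabilizes the initial
    mass, since rho - 1 + P W <= W. The explicit barriers
    b (sqrt (|x|^2 + eps) - a / (2 b))^2 are of this kind, so the u_n are bounded
    with supports in one ball; the same comparison, applied to u_n translated, or
    mollified, plus a small paraboloid, makes them equicontinuous and uniformly
    Cauchy, and their limit v is the least continuous w >= 0 with
    <w, L_M phi> <= <1 - rho, phi> for all test functions phi >= 0. Since the
    discrete generators converge to L_M and are symmetric, <nu_n, phi> tends to
    <rho, phi> + <v, L_M phi>.

    On the other side G_M is a fundamental solution: truncating its Fourier integral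
    at radius R leaves an error O(R^(-tau) (1 + 1 / |x|)), because the symbol psi_M
    is radially increasing, and the truncated identity follows from Fubini and
    Fourier inversion. Hence <gamma, L_M phi> = <rho - 1, phi>, so w |-> w + gamma
    maps the competitors for v onto the superharmonic majorants of gamma, that is,
    v = s - gamma. *)

From HB Require Import structures.
From mathcomp Require Import all_boot all_order all_algebra.
From mathcomp Require Import all_classical all_reals all_analysis.
From mathcomp Require Import measurable_realfun lra ring zify.
Require Import Defs.

Set Implicit Arguments.
Unset Strict Implicit.
Unset Printing Implicit Defensive.

Import Order.TTheory GRing.Theory Num.Theory.
Import numFieldNormedType.Exports.

Local Open Scope classical_set_scope.
Local Open Scope ring_scope.

(** The limit odometer is only known to be Lipschitz, so L_M never acts on it pointwise: every
    passage to the limit moves the generator to a smooth function, by symmetry or by convolution. At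
    a fixed mollification scale t the generator error is C_t E_n, with no control of C_t as t tends
    to 0; hence n goes to infinity first and t to 0 last. Comparison survives this because it
    tolerates a violation e of the supersolution inequality: a paraboloid, on which the discrete
    generators are close to sigma^2 up to sign and scale, pays for it with an increase of order e.

    The condition alpha < 2 makes |y|^(-alpha) integrable at 0, so that the generator error depends
    only on a second-difference constant, and it removes the nearest-neighbour part, of order
    n^(alpha - 2) k_n. The condition alpha > 1 gives the convergence of k_n, whose rescaled
    integrand is O(|w|^(-1-alpha)), and that of the Fourier integral of G_M: cancellation leaves
    only a strip of width pi / |x|, along which 1 / psi_M, being O(|th|^(-alpha)), is integrable at
    infinity. *)

Definition image_measure (R : realType) d1 d2 (T1 : measurableType d1)
    (T2 : measurableType d2) (m : {measure set T1 -> \bar R}) (f : T1 -> T2)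
    (mf : measurable_fun setT f) (k : {nonneg R}) : {measure set T2 -> \bar R} :=
  mscale k (measure_function_pushforward__canonical__measure_function_Measure m mf).

Lemma image_measureE (R : realType) d1 d2 (T1 : measurableType d1)
    (T2 : measurableType d2) (m : {measure set T1 -> \bar R}) (f : T1 -> T2)
    (mf : measurable_fun setT f) (k : {nonneg R}) A :
  image_measure m mf k A = (k%:num%:E * m (f @^-1` A))%E.
Proof. by []. Qed.

(** * Invariance of plane Lebesgue measure under affine maps *)

Section PlaneMeasure.
Context {R : realType}.
Local Notation mu := (@lebesgue_measure R).
Local Notation R1 := (measurableTypeR R).
Local Notation P := (measurableTypeR R * measurableTypeR R)%type.
Local Notation measurable2 := (@measurable _ P).
Local Notation mfun2 f := (@measurable_fun _ _ P R setT f).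
Local Notation mmap2 T := (@measurable_fun _ _ P P setT T).
Implicit Types (A B D : set (R * R)) (f g : R * R -> R).

(** Multiplied by [l], the measure of preimages agrees with Lebesgue measure on half-open intervals,
    and this determines it. *)
Lemma lebesgue_affine (a l : R) (A : set R) : 0 < l -> measurable A ->
  (mu ((fun t => (a + l * t)%R) @^-1` A) = (l^-1)%:E * mu A)%E.
Proof.
move=> l0 mA.
have mf : measurable_fun [set: measurableTypeR R]
    (fun t : measurableTypeR R => a + l * t : measurableTypeR R).
  by apply: measurable_funD => //; apply: measurable_funM.
pose l' : {nonneg R} := NngNum (ltW l0).
have -> : (mu A = image_measure mu mf l' A)%E.
  apply: lebesgue_measure_unique => // X -[[x y] _ <-].
  rewrite image_measureE.
  have -> : (fun t => a + l * t) @^-1` [set` `]x, y]] =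
      [set` `](x - a) / l, (y - a) / l]].
    apply/seteqP; split => t /=; rewrite !in_itv/= ltr_pdivrMr // ler_pdivlMr //
      => /andP[h1 h2]; apply/andP; split; nra.
  rewrite lebesgue_measure_itv /= lte_fin.
  rewrite lebesgue_measure_itv /= lte_fin ltr_pM2r ?invr_gt0// ltrD2r.
  case: ifPn => xy; last by rewrite mule0.
  by rewrite -!EFinD -EFinM; congr EFin; field; rewrite gt_eqF.
by rewrite image_measureE muleA -EFinM mulVf ?gt_eqF// mul1e.
Qed.

(** The sigma-algebra of the plane is the product one, so open sets must be produced from
    rectangles: an open set is the countable union of the boxes with rational centre and radius
    1/(n+1) that it contains. *)
Lemma open_measurable2 A : open A -> measurable2 A.
Proof.
move=> oA.
pose bx (p q : rat) (n : nat) : set (R * R) :=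
  ball (ratr p : R) n.+1%:R^-1 `*` ball (ratr q : R) n.+1%:R^-1.
have -> : A = \bigcup_(p in [set: rat]) \bigcup_(q in [set: rat]) \bigcup_(n in [set: nat])
   (if `[< bx p q n `<=` A >] then bx p q n else set0).
  apply/seteqP; split => [[x y] Axy|[x y]]; last first.
    by move=> [p _ [q _ [n _]]]; case: asboolP => // h /h.
  have /nbhs_ballP[e /= e0 eA] : nbhs (x, y) A by exact: oA.
  have [n _ hn] : \forall n \near \oo, n.+1%:R^-1 < e / 2 :> R.
    by apply: near_infty_natSinv_lt (PosNum (divr_gt0 e0 (ltr0Sn _ 1))).
  have {hn} hn := hn n (leqnn n).
  have [d dE] : exists d : R, d = n.+1%:R^-1 by eexists.
  have d0 : 0 < d by rewrite dE invr_gt0.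
  rewrite -dE in hn.
  have xp : x - d < x + d by lra.
  have yp : y - d < y + d by lra.
  have [p] := rat_in_itvoo xp.
  have [q] := rat_in_itvoo yp.
  rewrite !in_itv/= => /andP[q1 q2] /andP[p1 p2].
  exists p => //; exists q => //; exists n => //; rewrite /bx -dE.
  case: asboolP => [_|]; first by split; rewrite /= /ball /= ltr_norml; lra.
  case=> -[u v] [/=]; rewrite /ball /= !ltr_norml => /andP[u1 u2] /andP[v1 v2].
  by apply: eA; split; rewrite /= /ball /= ltr_norml; lra.
apply: bigcupT_measurable_rat => p; apply: bigcupT_measurable_rat => q.
apply: bigcupT_measurable => n; case: asboolP => // _.
by apply: measurableX; exact: measurable_ball.
Qed.

Lemma closed_measurable2 A : closed A -> measurable2 A.
Proof.
move=> cA; rewrite -(setCK A); apply: measurableC.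
by apply: open_measurable2; exact: closed_openC.
Qed.

Lemma compact_measurable2 A : compact A -> measurable2 A.
Proof.
move=> cA; apply: closed_measurable2; exact: compact_closed.
Qed.

Lemma continuous_measurable2 f : continuous f -> mfun2 f.
Proof.
move=> /continuousP cf; apply: (measurability _ (RGenOpens.measurableE R)).
move=> _ [_ [a [b ->] <-]]; rewrite setTI; apply: open_measurable2.
exact/cf/interval_open.
Qed.

Lemma mu2_setX (X Y : set R1) : measurable X -> measurable Y ->
  mu2 (X `*` Y) = (mu X * mu Y)%E.
Proof. by move=> mX mY; rewrite product_measure1E. Qed.

Lemma image_mu2E (T : P -> P) (mT : measurable_fun setT T) k A :
  image_measure mu2 mT k A = (k%:num%:E * mu2 (T @^-1` A))%E.
Proof. by []. Qed.

(** Preimages are measured, so [k] is the inverse of the Jacobian determinant. *)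
Definition scales_measure (T : R * R -> R * R) (k : R) :=
  mmap2 T /\
  forall A, measurable2 A -> (mu2 (T @^-1` A) = k%:E * mu2 A)%E.

Lemma scales_measure_comp S T k h : scales_measure S k -> scales_measure T h ->
  scales_measure (S \o T) (h * k).
Proof.
move=> [mS hS] [mT hT]; split; first exact: measurableT_comp.
move=> A mA; rewrite comp_preimage hT ?hS ?EFinM ?muleA//.
by rewrite -[X in measurable X]setTI; exact: mS.
Qed.

Lemma affine_scales_measure (a b l : R) : 0 < l ->
  scales_measure (fun z => (a + l * z.1, b + l * z.2)) (l ^- 2).
Proof.
move=> l0; set T := fun z : R * R => _.
have mT : mmap2 T.
  by apply: measurable_fun_pair; apply: measurable_funD => //; apply: measurable_funM.
split=> // A mA.
pose l' : {nonneg R} := NngNum (ltW (exprn_gt0 2 l0)).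
have -> : (mu2 A = image_measure mu2 mT l' A)%E.
  apply: product_measure_unique => // X Y mX mY.
  rewrite image_mu2E.
  have -> : T @^-1` (X `*` Y) = ((fun t => a + l * t) @^-1` X) `*` ((fun t => b + l * t) @^-1` Y).
    by apply/seteqP; split.
  have mpre (c : R) (Z : set R1) : measurable Z ->
      @measurable _ R1 ((fun t => c + l * t) @^-1` Z).
    move=> mZ; rewrite -[X in measurable X]setTI.
    suff : @measurable_fun _ _ R1 R1 setT (fun t : R1 => c + l * t) by exact.
    by apply: measurable_funD => //; apply: measurable_funM.
  rewrite (mu2_setX (mpre a X mX) (mpre b Y mY)).
  rewrite !lebesgue_affine// muleACA -EFinM !muleA -EFinM /=.
  by rewrite (_ : l ^+ 2 * (l^-1 / l) = 1) ?mul1e//; field; rewrite gt_eqF.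
by rewrite image_mu2E muleA -EFinM mulVf ?gt_eqF ?exprn_gt0// mul1e.
Qed.

Lemma swap_scales_measure : scales_measure (fun z => (z.2, z.1)) 1.
Proof.
have mT : mmap2 (fun z : R * R => (z.2, z.1)).
  exact: measurable_fun_pair.
split=> // A mA; rewrite mul1e.
have -> : (mu2 A = image_measure mu2 mT (NngNum ler01) A)%E; last first.
  by rewrite image_mu2E mul1e.
apply: product_measure_unique => // X Y mX mY.
rewrite image_mu2E mul1e.
have -> : (fun z : R * R => (z.2, z.1)) @^-1` (X `*` Y) = Y `*` X.
  by apply/seteqP; split => -[x y] [].
by rewrite mu2_setX// muleC.
Qed.

(** Each vertical section of the preimage is a translate of the corresponding section of [A]. *)
Lemma shear_scales_measure (a : R) :
  scales_measure (fun z => (z.1, z.2 + a * z.1)) 1.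
Proof.
have mT : mmap2 (fun z : R * R => (z.1, z.2 + a * z.1)).
  by apply: measurable_fun_pair => //; apply: measurable_funD => //; apply: measurable_funM.
split=> // A mA; rewrite mul1e /= /product_measure1; apply: eq_integral => x _ /=.
have -> : xsection ((fun z : R * R => (z.1, z.2 + a * z.1)) @^-1` A) x =
   (fun t => a * x + 1 * t) @^-1` (xsection A x).
  by apply/seteqP; split => t; rewrite /xsection /= !inE /= mul1r addrC.
by rewrite lebesgue_affine ?invr1 ?mul1e//; exact: measurable_xsection.
Qed.

(** For s <> 0 a rotation is a product of three shears, the outer two with slope (c - 1) / s = - tan
    (angle / 2). For s = 0 it is the identity, that is, the swap applied twice, or the square of a
    quarter turn. *)
Lemma rotation_scales_measure (c s : R) : c ^+ 2 + s ^+ 2 = 1 ->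
  scales_measure (fun z => (c * z.1 - s * z.2, s * z.1 + c * z.2)) 1.
Proof.
have key (c' s' : R) : s' != 0 -> c' ^+ 2 + s' ^+ 2 = 1 ->
    scales_measure (fun z => (c' * z.1 - s' * z.2, s' * z.1 + c' * z.2)) 1.
  move=> s0 cs; pose a := (c' - 1) / s'.
  pose sw := fun z : R * R => (z.2, z.1).
  pose sh b := fun z : R * R => (z.1, z.2 + b * z.1).
  have shear2 b : scales_measure (sw \o sh b \o sw) 1.
    have := scales_measure_comp (scales_measure_comp swap_scales_measure
      (shear_scales_measure b)) swap_scales_measure.
    by rewrite !mulr1.
  have := scales_measure_comp (scales_measure_comp (shear2 a) (shear_scales_measure s')) (shear2 a).
  rewrite !mulr1; congr scales_measure; apply/funext => -[x y] /=.
  rewrite /sw /sh /a /=; congr pair; last by field.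
  have -> : s' * y = (1 - c' ^+ 2) / s' * y by rewrite -cs; field.
  by field.
have [->|s0] := eqVneq s 0; last exact: key.
rewrite expr0n addr0 => /eqP; rewrite sqrf_eq1 => /orP[|] /eqP ->.
  have := scales_measure_comp swap_scales_measure swap_scales_measure.
  rewrite mulr1; congr scales_measure; apply/funext => -[x y] /=.
  by congr pair; ring.
have k01 : scales_measure (fun z => (0 * z.1 - 1 * z.2, 1 * z.1 + 0 * z.2)) 1.
  by apply: key; rewrite ?oner_eq0//; ring.
have := scales_measure_comp k01 k01.
by rewrite mulr1; congr scales_measure; apply/funext => -[x y] /=; congr pair; ring.
Qed.

Local Notation L1 D f := (mu2.-integrable (D : set P) (EFin \o f)).

Lemma ge0_scales_integral (T : P -> P) k D (g : P -> \bar R) :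
  scales_measure T k -> 0 < k -> measurable2 D -> measurable_fun setT g ->
  (forall x, (0 <= g x)%E) ->
  (\int[mu2]_(x in (T @^-1` D : set P)) g (T x) = k%:E * \int[mu2]_(x in (D : set P)) g x)%E.
Proof.
move=> [mT hT] k0 mD mg g0.
pose k' : {nonneg R} := NngNum (ltW k0).
have mgD : @measurable_fun _ _ P _ D g by exact: measurable_funTS.
transitivity (\int[pushforward mu2 T]_(x in (D : set P)) g x)%E.
  by rewrite ge0_integral_pushforward.
rewrite -(@ge0_integral_mscale _ _ R mu2 D mD k' g mgD)//.
by apply: eq_measure_integral => A mA _; exact: hT.
Qed.

(** Integrability is not assumed: the positive and negative parts scale separately, and if one of
    them has infinite integral then [fine] returns 0 on both sides. *)
Lemma scales_Rintegral (T : P -> P) k D f :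
  scales_measure T k -> 0 < k -> measurable2 D -> mfun2 f ->
  \int[mu2]_(x in (T @^-1` D : set P)) f (T x) = k * \int[mu2]_(x in D) f x.
Proof.
move=> hT k0 mD mf; rewrite /Rintegral integralE [in RHS]integralE.
have h1 := ge0_scales_integral hT k0 mD
  (measurable_funepos ((measurable_EFinP setT f).2 mf)) (funepos_ge0 (EFin \o f)).
have h2 := ge0_scales_integral hT k0 mD
  (measurable_funeneg ((measurable_EFinP setT f).2 mf)) (funeneg_ge0 (EFin \o f)).
have -> : (\int[mu2]_(x in (T @^-1` D : set P)) ((fun x => (f (T x))%:E)^\+) x =
   k%:E * \int[mu2]_(x in (D : set P)) (((EFin \o f)^\+) x))%E.
  by rewrite -h1; apply: eq_integral => x _; rewrite /= !funeposE.
have -> : (\int[mu2]_(x in (T @^-1` D : set P)) ((fun x => (f (T x))%:E)^\-) x =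
   k%:E * \int[mu2]_(x in (D : set P)) (((EFin \o f)^\-) x))%E.
  by rewrite -h2; apply: eq_integral => x _; rewrite /= !funenegE.
set a := (\int[mu2]_(x in _) _)%E; set b := (\int[mu2]_(x in _) _)%E.
have : (0 <= a)%E by apply: integral_ge0 => x _; exact: funepos_ge0.
have : (0 <= b)%E by apply: integral_ge0 => x _; exact: funeneg_ge0.
move: a b => [a| |] [b| |] //= b0 a0; rewrite ?gt0_muley ?lte_fin//=; ring.
Qed.

Lemma scales_integrable (T : P -> P) k D f :
  scales_measure T k -> 0 < k -> measurable2 D -> mfun2 f ->
  L1 D f -> L1 (T @^-1` D) (f \o T).
Proof.
move=> hT k0 mD mf /integrableP[_ fi]; apply/integrableP; split.
  apply/measurable_EFinP; apply: measurable_funTS.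
  by apply: measurableT_comp => //; case: hT.
have h := ge0_scales_integral hT k0 mD
  (measurableT_comp (@abse_measurable _ setT) ((measurable_EFinP setT f).2 mf)) (fun x => abse_ge0 _).
by rewrite [ltLHS]h; apply: lte_mul_pinfty => //; rewrite lee_fin ltW.
Qed.

Lemma bounded_integrable D f (C : R) : measurable2 D -> (mu2 D < +oo)%E -> mfun2 f ->
  (forall x, D x -> `|f x| <= C) -> L1 D f.
Proof.
move=> mD Doo mf fC; apply: (@le_integrable _ _ _ mu2 D mD _ (EFin \o cst C)).
- by apply/measurable_EFinP; apply: measurable_funTS.
- by move=> x Dx /=; rewrite lee_fin (le_trans (fC x Dx))// ler_norm.
- apply/integrableP; split; first exact/measurable_EFinP.
  rewrite (eq_integral (cst `|C|%:E))// integral_cst// lte_mul_pinfty//.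
Qed.

Lemma dominated_integrable2 D f g : measurable2 D -> mfun2 f -> L1 D g ->
  (forall x, D x -> `|f x| <= g x) -> L1 D f.
Proof.
move=> mD mf Lg fg; apply: (@le_integrable _ _ _ mu2 D mD _ (EFin \o g)) => //.
- by apply/measurable_EFinP; apply: measurable_funTS.
- by move=> x Dx /=; rewrite lee_fin (le_trans (fg x Dx))// ler_norm.
Qed.

Lemma norm_Rintegral_le D f g : measurable2 D -> mfun2 f -> L1 D g ->
  (forall x, D x -> `|f x| <= g x) ->
  `|\int[mu2]_(x in D) f x| <= \int[mu2]_(x in D) g x.
Proof.
move=> mD mf Lg fg; have Lf := dominated_integrable2 mD mf Lg fg.
apply: (le_trans (le_normr_Rintegral mD Lf)); apply: le_Rintegral => //.
by apply: dominated_integrable2 Lg _ => //; [exact: measurableT_comp|move=> x /fg; rewrite normr_id].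
Qed.

Lemma norm_Rintegral_bounded D f C : measurable2 D -> (mu2 D < +oo)%E -> mfun2 f ->
  (forall x, D x -> `|f x| <= C) ->
  `|\int[mu2]_(x in D) f x| <= C * fine (mu2 D).
Proof.
move=> mD Doo mf fC; rewrite -Rintegral_cst//; apply: norm_Rintegral_le => //.
by apply: (bounded_integrable (C := `|C|)) => // x _ /=.
Qed.

Lemma Rintegral_dominated_cvg D (f_ : nat -> R * R -> R) f g : measurable2 D ->
  (forall n, mfun2 (f_ n)) -> L1 D g ->
  (forall x, D x -> f_ n x @[n --> \oo] --> f x) ->
  (forall n x, D x -> `|f_ n x| <= g x) ->
  L1 D f /\ \int[mu2]_(x in D) f_ n x @[n --> \oo] --> \int[mu2]_(x in D) f x.
Proof.
move=> mD mf Lg ff fg.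
have mfD n : @measurable_fun _ _ P _ D (EFin \o f_ n).
  by apply/measurable_EFinP; apply: measurable_funTS.
have ff' x : D x -> (EFin \o f_ n) x @[n --> \oo] --> (EFin \o f) x.
  by move=> Dx; apply: cvg_EFin; [near=> n|exact: ff].
have mfl : @measurable_fun _ _ P _ D (EFin \o f).
  by apply: (emeasurable_fun_cvg (fun n => EFin \o f_ n)).
have [] := @dominated_convergence _ _ _ mu2 D mD (fun n => EFin \o f_ n) (EFin \o f) (EFin \o g) mfD mfl.
- by apply: aeW => x Dx; exact: ff'.
- exact: Lg.
- by apply: aeW => x n Dx /=; rewrite lee_fin; exact: fg.
move=> Lf _ h; split=> //.
apply: fine_cvg; move: h; rewrite /Rintegral fineK//.
exact: integrable_fin_num.
Unshelve. all: by end_near. Qed.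

End PlaneMeasure.

(** * Euclidean norm and power integrals *)

Section PlaneNorm.
Context {R : realType}.
Local Notation mu := (@lebesgue_measure R).
Local Notation P := (measurableTypeR R * measurableTypeR R)%type.
Local Notation measurable2 := (@measurable _ P).
Local Notation mfun2 f := (@measurable_fun _ _ P R setT f).
Local Notation L1 D f := (mu2.-integrable (D : set P) (EFin \o f)).
Implicit Types (x y z : R * R).

Lemma enorm_ge0 x : 0 <= enorm x.
Proof. exact: sqrtr_ge0. Qed.

Lemma enorm_sqr x : enorm x ^+ 2 = x.1 ^+ 2 + x.2 ^+ 2.
Proof. by rewrite sqr_sqrtr// addr_ge0// sqr_ge0. Qed.

Lemma enorm_le x a : 0 <= a -> (enorm x <= a) = (x.1 ^+ 2 + x.2 ^+ 2 <= a ^+ 2).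
Proof. by move=> a0; rewrite -enorm_sqr ler_sqr ?nnegrE ?enorm_ge0. Qed.

Lemma enorm_lt x a : 0 <= a -> (enorm x < a) = (x.1 ^+ 2 + x.2 ^+ 2 < a ^+ 2).
Proof. by move=> a0; rewrite -enorm_sqr ltr_sqr ?nnegrE ?enorm_ge0. Qed.

Lemma enorm0 : enorm (0 : R * R) = 0.
Proof. by rewrite /enorm /= expr0n addr0 sqrtr0. Qed.

Lemma enorm_eq0 x : (enorm x == 0) = (x == 0).
Proof.
apply/eqP/eqP => [e0|->]; last exact: enorm0.
have := enorm_sqr x; rewrite e0 expr0n /= => /esym /eqP.
rewrite paddr_eq0 ?sqr_ge0// !sqrf_eq0 => /andP[/eqP h1 /eqP h2].
by case: x h1 h2 {e0} => a b /= -> ->.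
Qed.

Lemma enormN x : enorm (- x) = enorm x.
Proof. by rewrite /enorm /= !sqrrN. Qed.

Lemma normr_edot_le x y : `|edot x y| <= enorm x * enorm y.
Proof.
rewrite -[leLHS]sqrtr_sqr /enorm -sqrtrM ?addr_ge0 ?sqr_ge0//.
rewrite ler_sqrt ?mulr_ge0 ?addr_ge0 ?sqr_ge0// /edot.
have := sqr_ge0 (x.1 * y.2 - x.2 * y.1); nra.
Qed.

Lemma enormD x y : enorm (x + y) <= enorm x + enorm y.
Proof.
rewrite enorm_le ?addr_ge0 ?enorm_ge0//.
have := normr_edot_le x y; rewrite ler_norml /edot => /andP[_].
have := enorm_sqr x; have := enorm_sqr y; rewrite /=; nra.
Qed.

Lemma enormB x y : enorm (x - y) <= enorm x + enorm y.
Proof. by rewrite -(enormN y) enormD. Qed.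

Lemma enorm_ge_fst x : `|x.1| <= enorm x.
Proof. by rewrite -[leLHS]sqrtr_sqr ler_wsqrtr// lerDl sqr_ge0. Qed.

Lemma enorm_ge_snd x : `|x.2| <= enorm x.
Proof. by rewrite -[leLHS]sqrtr_sqr ler_wsqrtr// lerDr sqr_ge0. Qed.

Lemma enorm_le_sum x : enorm x <= `|x.1| + `|x.2|.
Proof.
rewrite enorm_le ?addr_ge0// sqrrD !real_normK ?num_real//.
by have := mulr_ge0 (normr_ge0 x.1) (normr_ge0 x.2); lra.
Qed.

Lemma enorm_scale (l : R) x : enorm (l * x.1, l * x.2) = `|l| * enorm x.
Proof.
by rewrite /enorm /= !exprMn -mulrDr sqrtrM ?sqr_ge0// sqrtr_sqr.
Qed.

Lemma enorm_le_norm x : enorm x <= 2 * `|x|.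
Proof.
apply: (le_trans (enorm_le_sum x)); rewrite prod_normE/=.
have : `|x.1| <= Num.max `|x.1| `|x.2| by rewrite le_max lexx.
have : `|x.2| <= Num.max `|x.1| `|x.2| by rewrite le_max lexx orbT.
lra.
Qed.

Lemma continuous_enorm : continuous (@enorm R).
Proof.
move=> x; apply: (@continuous_comp _ _ _ (fun x : R * R => x.1 ^+ 2 + x.2 ^+ 2) Num.sqrt); last exact: sqrt_continuous.
by apply: cvgD; apply: (@continuous_comp _ _ _ _ (fun t : R => t ^+ 2));
  [exact: cvg_fst|exact: exprn_continuous|exact: cvg_snd|exact: exprn_continuous].
Qed.

Lemma measurable_enorm : mfun2 (@enorm R).
Proof. exact: continuous_measurable2 continuous_enorm. Qed.

Lemma measurable_edot (th : R * R) : mfun2 (edot th).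
Proof. by apply: measurable_funD; apply: measurable_funM. Qed.

Lemma open_eball (rad : R) : open (eball rad).
Proof.
rewrite (_ : eball rad = @enorm R @^-1` [set t | t < rad])//.
by apply: open_comp => [x _|]; [exact: continuous_enorm|exact: open_lt].
Qed.

Lemma measurable_eball (rad : R) : measurable2 (eball rad).
Proof. by apply: open_measurable2; exact: open_eball. Qed.

Lemma mu2_box (a b a' b' : R) : a <= b -> a' <= b' ->
  mu2 ([set x : P | a <= x.1 <= b /\ a' <= x.2 <= b'] : set P) = ((b - a) * (b' - a'))%:E.
Proof.
move=> ab ab'.
have -> : [set x : P | a <= x.1 <= b /\ a' <= x.2 <= b'] = `[a, b]%classic `*` `[a', b']%classic.
  by apply/seteqP; split => -[u v] /=; rewrite !in_itv.
rewrite mu2_setX; [|exact: measurable_itv|exact: measurable_itv].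
rewrite !lebesgue_measure_itv /= !lte_fin.
move: ab ab'; rewrite !le_eqVlt => /predU1P[->|ab] /predU1P[->|ab'];
  by rewrite ?ltxx ?ab ?ab' ?subrr ?mulr0 ?mul0r ?mule0 ?mul0e -?EFinD -?EFinM.
Qed.

Lemma measurable_box (a b a' b' : R) :
  measurable2 [set x : P | a <= x.1 <= b /\ a' <= x.2 <= b'].
Proof.
have -> : [set x : P | a <= x.1 <= b /\ a' <= x.2 <= b'] = `[a, b]%classic `*` `[a', b']%classic.
  by apply/seteqP; split => -[u v] /=; rewrite !in_itv.
by apply: measurableX; exact: measurable_itv.
Qed.

Lemma mu2_eball_le (rad : R) : 0 <= rad -> (mu2 (eball rad) <= (4 * rad ^+ 2)%:E)%E.
Proof.
move=> r0.
have -> : 4 * rad ^+ 2 = (rad - - rad) * (rad - - rad) by ring.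
rewrite -(@mu2_box (- rad) rad (- rad) rad); [|lra|lra].
apply: le_measure; rewrite ?inE; [exact: measurable_eball|exact: measurable_box|].
move=> x /= /ltW h; have := enorm_ge_fst x; have := enorm_ge_snd x.
by rewrite !ler_norml => /andP[h1 h2] /andP[h3 h4]; split; apply/andP; split; lra.
Qed.

Lemma mu2_eball_lty (rad : R) : (mu2 (eball rad) < +oo)%E.
Proof.
have [r0|r0] := leP 0 rad; first by rewrite (le_lt_trans (mu2_eball_le r0))// ltry.
rewrite (_ : eball rad = set0) ?measure0//.
by apply/seteqP; split => // x /= h; have := enorm_ge0 x; rewrite leNgt (lt_trans h).
Qed.

Lemma compact_sub_eball (K : set (R * R)) : compact K ->
  exists2 rad : R, 0 < rad & K `<=` eball rad.
Proof.
move=> /compact_bounded[N [_ hN]]; exists (2 * (`|N| + 1) + 1).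
  by have := normr_ge0 N; lra.
have NN : N < `|N| + 1 by have := ler_norm N; lra.
by move=> x /(hN _ NN) /= h; rewrite /eball /=; have := enorm_le_norm x; lra.
Qed.

(* The integral is compared with the series of the masses of [a k] on [B k]; in the
   applications [B k] is a dyadic ball and [a k] a bound on a dyadic annulus. *)
Lemma dyadic_integrable (D : set P) (f : R * R -> R) (B : nat -> set P)
    (a b : nat -> R) (C q : R) :
  measurable2 D -> mfun2 f -> (forall z, D z -> 0 <= f z) ->
  (forall k, measurable2 (B k)) -> (forall k, (mu2 (B k) <= (b k)%:E)%E) ->
  (forall k, 0 <= a k) -> (forall k, a k * b k <= C * q ^+ k) -> 0 <= q < 1 ->
  (forall z, D z -> f z = 0 \/ exists2 k, B k z & f z <= a k) ->
  L1 D f /\ \int[mu2]_(z in D) f z <= C / (1 - q).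
Proof.
move=> mD mf f0 mB Bb a0 abC /andP[q0 q1] fB.
have C0 : 0 <= C.
  have := abC 0; rewrite expr0 mulr1; apply: le_trans.
  rewrite mulr_ge0// -lee_fin; apply: le_trans (Bb 0); exact: measure_ge0.
have key : (\int[mu2]_(z in D) (f z)%:E <= (C / (1 - q))%:E)%E.
  apply: (@le_trans _ _ (\int[mu2]_(z in D) (\sum_(0 <= k <oo) (a k * \1_(B k) z)%:E))%E).
    apply: ge0_le_integral => //.
    - by apply/measurable_EFinP; apply: measurable_funTS.
    - apply: ge0_emeasurable_sum => [k z _ _|k _]; first by rewrite lee_fin mulr_ge0.
      by apply/measurable_EFinP/measurable_funTS; apply: measurable_funM => //; exact: measurable_indic.
    - move=> z Dz; have [->|[k Bz fk]] := fB z Dz.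
        by apply: nneseries_ge0 => k _ _; rewrite lee_fin mulr_ge0.
      apply: (@le_trans _ _ (a k * \1_(B k) z)%:E).
        by rewrite lee_fin indicE mem_set// mulr1.
      rewrite (nneseriesD1 (n := k))//; last by move=> i _; rewrite lee_fin mulr_ge0.
      rewrite leeDl//; apply: nneseries_ge0 => i _ _; by rewrite lee_fin mulr_ge0.
  rewrite integral_nneseries//; last 2 first.
  - by move=> k; apply/measurable_EFinP/measurable_funTS; apply: measurable_funM => //; exact: measurable_indic.
  - by move=> k z _; rewrite lee_fin mulr_ge0.
  apply: (@le_trans _ _ (\sum_(0 <= k <oo) (C * q ^+ k)%:E)%E).
    apply: lee_nneseries => [k _ _|k _].
      by apply: integral_ge0 => z _; rewrite lee_fin mulr_ge0.
    under eq_integral do rewrite EFinM.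
    rewrite ge0_integralZl_EFin//; last by apply/measurable_EFinP/measurable_funTS; exact: measurable_indic.
    rewrite integral_indic//.
    apply: (@le_trans _ _ ((a k)%:E * mu2 (B k))%E).
      by apply: lee_wpmul2l => //; rewrite ?lee_fin//; apply: le_measure; rewrite ?inE//; exact: measurableI.
    by apply: le_trans (_ : ((a k)%:E * (b k)%:E <= _)%E); [apply: lee_wpmul2l; rewrite ?lee_fin|rewrite -EFinM lee_fin].
  apply: lime_le; first by apply: is_cvg_nneseries => k _ _; rewrite lee_fin mulr_ge0// exprn_ge0.
  apply: nearW => n; rewrite sumEFin lee_fin.
  have q1' : 0 < 1 - q by lra.
  rewrite ler_pdivlMr//.
  have -> : (\sum_(0 <= k < n) C * q ^+ k) * (1 - q) = C * (1 - q ^+ n).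
    rewrite -mulr_sumr; elim: n => [|n IHn]; first by rewrite big_nil expr0 subrr mulr0 mul0r.
    rewrite big_nat_recr//= exprS.
    move: (\sum_(0 <= i < n) q ^+ i) IHn => S IHn.
    transitivity (C * S * (1 - q) + C * q ^+ n * (1 - q)); first by ring.
    by rewrite IHn; ring.
  by rewrite ler_piMr// lerBlDr lerDl exprn_ge0.
have Lf : L1 D f.
  apply/integrableP; split; first by apply/measurable_EFinP; apply: measurable_funTS.
  have -> : (\int[mu2]_(x in D) `|(EFin \o f) x| = \int[mu2]_(z in D) (f z)%:E)%E.
    by apply: eq_integral => z /set_mem Dz /=; rewrite ger0_norm// f0.
  by rewrite (le_lt_trans key)// ltry.
split=> //; rewrite /Rintegral -lee_fin fineK//.
exact: integrable_fin_num.
Qed.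

Lemma dyadic_scale_near (M x : R) : 0 < x < M ->
  exists k : nat, M * 2^-1 ^+ k.+1 <= x < M * 2^-1 ^+ k.
Proof.
move=> /andP[x0 xM]; have M0 : 0 < M := lt_trans x0 xM.
have ex : exists k : nat, M * 2^-1 ^+ k.+1 <= x.
  have : M * 2^-1 ^+ n @[n --> \oo] --> (0 : R).
    rewrite -[X in _ --> X](mulr0 M); apply: cvgMr.
    by apply: cvg_expr; rewrite ger0_norm ?invr_ge0// invf_lt1 ?ltr1n.
  move=> /cvgr_lt /(_ x x0)[n _ hn]; exists n.
  by apply/ltW/hn => /=.
exists (ex_minn ex); case: ex_minnP => k hk kmin; rewrite hk /=.
case: k hk kmin => [_ _|k _ kmin]; first by rewrite expr0 mulr1.
rewrite ltNge; apply/negP => h; have := kmin _ h; by rewrite ltnn.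
Qed.

Lemma dyadic_scale_far (x : R) : 1 <= x -> exists k : nat, 2 ^+ k <= x < 2 ^+ k.+1.
Proof.
move=> x1; have ex : exists k : nat, x < 2 ^+ k.+1.
  exists (Num.truncn x).+1; apply: (lt_trans (truncnS_gt x)).
  rewrite -natrX ltr_nat; apply: (leq_trans (ltn_expl _ (ltnSn 1))).
  by rewrite leq_exp2l.
exists (ex_minn ex); case: ex_minnP => k hk kmin; rewrite hk andbT.
case: k hk kmin => [_ _|k _ kmin]; first by rewrite expr0.
rewrite leNgt; apply/negP => h; have := kmin _ h; by rewrite ltnn.
Qed.

Lemma powR_exprn (x b : R) n : 0 <= x -> (x ^+ n) `^ b = (x `^ b) ^+ n.
Proof. by move=> x0; rewrite -powR_mulrn// -powRrM mulrC powRrM powR_mulrn// powR_ge0. Qed.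

Lemma ltr_powR2 (b c : R) : b < c -> 2 `^ b < 2 `^ c.
Proof.
move=> bc; rewrite /powR pnatr_eq0/= ltr_expR ltr_pM2r// ln_gt0//.
by rewrite ltr1n.
Qed.

Lemma powR2_2 : 2 `^ 2 = 4 :> R.
Proof. by rewrite powR_mulrn//; ring. Qed.

Lemma powR_half (b : R) : 2^-1 `^ b = (2 `^ b)^-1.
Proof. by rewrite -powRN -mulN1r powRrM powR_inv1. Qed.

Lemma measurable_enorm_powR (b : R) : mfun2 (fun z => (enorm z `^ b)^-1).
Proof.
rewrite (_ : (fun z => _) = (fun t => t `^ (- b)) \o @enorm R).
  by apply: measurableT_comp; [exact: measurable_powR|exact: measurable_enorm].
by apply/funext => z /=; rewrite powRN.
Qed.

Lemma integrable_near0 (M b : R) : 0 < b < 2 ->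
  L1 (eball M) (fun z => (enorm z `^ b)^-1).
Proof.
move=> /andP[b0 b2]; have [M0|M0] := leP M 0.
  rewrite (_ : eball M = set0); first exact: integrable_set0.
  by apply/seteqP; split => // x /= h; have := enorm_ge0 x; rewrite leNgt (lt_le_trans h).
(* On the k-th annulus the integrand is at most (M^b h^(k+1))^-1, and the k-th ball has area at most
   4 M^2 4^(-k); the products are geometric of ratio (4 h)^-1 = 2^b / 4 < 1. *)
pose h : R := 2^-1 `^ b.
have h4 : 4^-1 < h.
  by rewrite /h powR_half ltf_pV2 ?posrE ?powR_gt0// -powR2_2 ltr_powR2.
have h0 : 0 < h by lra.
pose C := (M `^ b * h)^-1 * (4 * M ^+ 2).
have [] // := @dyadic_integrable (eball M) (fun z => (enorm z `^ b)^-1) (fun k => eball (M * 2^-1 ^+ k))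
  (fun k => (M `^ b * h ^+ k.+1)^-1) (fun k => 4 * (M * 2^-1 ^+ k) ^+ 2)
  C ((4 * h)^-1).
- exact: measurable_eball.
- exact: measurable_enorm_powR.
- by move=> z _; rewrite invr_ge0 powR_ge0.
- by move=> k; exact: measurable_eball.
- by move=> k; apply: mu2_eball_le; rewrite mulr_ge0 ?exprn_ge0 ?invr_ge0// ltW.
- by move=> k; rewrite invr_ge0 mulr_ge0 ?powR_ge0// exprn_ge0// ltW.
- move=> k; rewrite /C; have Mb := powR_gt0 b M0.
  have hk := exprn_gt0 k h0.
  rewrite exprS exprMn -exprM mulnC exprM exprVn.
  rewrite (_ : (2 ^- 2 : R) = 4^-1); last by field.
  rewrite le_eqVlt; apply/orP; left; apply/eqP.
  by rewrite !exprVn exprMn; field; rewrite !gt_eqF// exprn_gt0.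
- rewrite invr_ge0 invf_lt1; last by lra. by apply/andP; split; lra.
(* The origin lies in no annulus; there the integrand is 0, because 0 to the power [b] is 0 and so
   is its inverse. *)
- move=> z /= zM; have [z0|z0] := eqVneq (enorm z) 0.
    by left; rewrite z0 powR0 ?invr0// gt_eqF.
  have zp : 0 < enorm z by rewrite lt_neqAle eq_sym z0 enorm_ge0.
  have [k /andP[k1 k2]] := @dyadic_scale_near M (enorm z) ltac:(by rewrite zp zM).
  right; exists k => //.
  rewrite lef_pV2 ?posrE ?powR_gt0// ?mulr_gt0 ?powR_gt0 ?exprn_gt0//.
  rewrite /h -powR_exprn ?invr_ge0// -powRM ?exprn_ge0 ?invr_ge0 ?(ltW M0)//.
  by apply: ge0_ler_powR; rewrite ?nnegrE ?mulr_ge0 ?exprn_ge0 ?invr_ge0 ?(ltW M0) ?(ltW b0) ?(ltW zp).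
Qed.

Lemma integrable_far (b : R) : 2 < b ->
  L1 (~` eball 1) (fun z => (enorm z `^ b)^-1).
Proof.
(* Here the k-th dyadic ball has area of order 4^k and the integrand is at most h^(-k) on the k-th
   annulus, hence the ratio 4 / h < 1. *)
move=> b2; pose h : R := 2 `^ b.
have h4 : 4 < h.
  by rewrite -powR2_2 ltr_powR2.
have h0 : 0 < h by lra.
have [] // := @dyadic_integrable (~` eball 1) (fun z => (enorm z `^ b)^-1) (fun k => eball (2 ^+ k.+1))
  (fun k => (h ^+ k)^-1) (fun k => 4 * (2 ^+ k.+1) ^+ 2) 16 (4 / h).
- by apply: measurableC; exact: measurable_eball.
- exact: measurable_enorm_powR.
- by move=> z _; rewrite invr_ge0 powR_ge0.
- by move=> k; exact: measurable_eball.
- by move=> k; apply: mu2_eball_le; rewrite exprn_ge0.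
- by move=> k; rewrite invr_ge0 exprn_ge0// ltW.
- move=> k; rewrite expr_div_n (exprS 2) exprMn -exprM mulnC (exprM 2).
  rewrite (_ : (2 ^+ 2 : R) = 4); last by ring.
  by rewrite le_eqVlt; apply/orP; left; apply/eqP; field; rewrite gt_eqF// exprn_gt0.
- by rewrite divr_ge0 ?ltW// ltr_pdivrMr ?mul1r.
- move=> z /= /negP; rewrite -leNgt => z1.
  have z0 : 0 < enorm z by rewrite (lt_le_trans ltr01).
  have [k /andP[k1 k2]] := dyadic_scale_far z1.
  right; exists k => //.
  rewrite lef_pV2 ?posrE ?powR_gt0 ?exprn_gt0//.
  rewrite /h -powR_exprn//.
  by apply: ge0_ler_powR; rewrite ?nnegrE ?exprn_ge0 ?(ltW z0)//; lra.
Qed.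

End PlaneNorm.

(** * Lattice sums as integrals *)

Section Lattice.
Context {R : realType}.
Local Notation mu := (@lebesgue_measure R).
Local Notation P := (measurableTypeR R * measurableTypeR R)%type.
Local Notation measurable2 := (@measurable _ P).
Local Notation mfun2 f := (@measurable_fun _ _ P R setT f).
Local Notation L1 D f := (mu2.-integrable (D : set P) (EFin \o f)).

Lemma integrable_big_sum (I : Type) (s : seq I) (D : set P) (f : I -> R * R -> R) :
  measurable2 D -> (forall i, L1 D (f i)) -> L1 D (fun z => \sum_(i <- s) f i z).
Proof.
move=> mD Lf; elim: s => [|i s IHs].
  apply: (eq_integrable _ (cst 0)) => //; first by move=> z _ /=; rewrite big_nil.
  exact: integrable0.
rewrite (_ : _ \o _ = (EFin \o f i) \+ (EFin \o (fun z => (\sum_(j <- s) f j z)%R)))%E.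
  exact: integrableD.
by apply/funext => z /=; rewrite big_cons.
Qed.

Lemma Rintegral_big_sum (I : Type) (s : seq I) (D : set P) (f : I -> R * R -> R) :
  measurable2 D -> (forall i, L1 D (f i)) ->
  \int[mu2]_(z in D) (\sum_(i <- s) f i z) = \sum_(i <- s) \int[mu2]_(z in D) f i z.
Proof.
move=> mD Lf; elim: s => [|i s IHs].
  rewrite big_nil (@eq_Rintegral _ _ _ mu2 D (cst 0)) ?Rintegral_cst ?mul0r// => z _.
  by rewrite big_nil.
rewrite big_cons -IHs -RintegralD//; last exact: integrable_big_sum.
by apply: eq_Rintegral => z _; rewrite big_cons.
Qed.

(** Divided by a^(-p), the upper bound reads 1 - p (b/a - 1) <= (a/b)^p = exp (- p ln (b/a)), which
    follows from 1 + x <= exp x and ln x <= x - 1. *)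
Lemma powRN_diff (a b p : R) : 0 < a -> a <= b -> 0 < p ->
  0 <= (a `^ p)^-1 - (b `^ p)^-1 <= p * (b - a) * (a `^ (p + 1))^-1.
Proof.
move=> a0 ab p0; have b0 : 0 < b := lt_le_trans a0 ab.
have ap : 0 < a `^ p := powR_gt0 p a0.
have bp : 0 < b `^ p := powR_gt0 p b0.
apply/andP; split.
  by rewrite subr_ge0 lef_pV2// ge0_ler_powR ?nnegrE ?(ltW a0) ?(ltW b0) ?(ltW p0).
have -> : (a `^ (p + 1))^-1 = (a `^ p)^-1 * a^-1.
  by rewrite powRD ?(gt_eqF a0) ?implybT// powRr1 ?(ltW a0)// invfM.
suff h : 1 - p * (b / a - 1) <= a `^ p / b `^ p.
  have -> : (b `^ p)^-1 = (a `^ p)^-1 * (a `^ p / b `^ p).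
    by rewrite mulrA mulVf ?mul1r// gt_eqF.
  rewrite lerBlDr -lerBlDl.
  have -> : (a `^ p)^-1 - p * (b - a) * ((a `^ p)^-1 * a^-1) =
     (a `^ p)^-1 * (1 - p * (b / a - 1)).
    by field; rewrite !gt_eqF.
  by rewrite ler_pM2l// invr_gt0.
have -> : a `^ p / b `^ p = expR (- (p * ln (b / a))).
  rewrite /powR !gt_eqF// -expRN -expRD lnM ?posrE ?invr_gt0// lnV ?posrE//.
  by congr expR; ring.
apply: le_trans (expR_ge1Dx _); rewrite lerD2l lerN2 ler_pM2l//.
have ba : 0 < b / a by rewrite divr_gt0.
have := @le_ln1Dx R (b / a - 1); rewrite [1 + _]addrC subrK; apply; lra.
Qed.

Lemma sum_support (T : eqType) (s t : seq T) (f : T -> R) : uniq s -> uniq t ->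
  (forall y, f y != 0 -> y \in s) -> (forall y, f y != 0 -> y \in t) ->
  \sum_(y <- s) f y = \sum_(y <- t) f y.
Proof.
move=> us ut fs ft.
rewrite (bigID (fun y => f y == 0)) /= big1 ?add0r; last by move=> y /eqP.
rewrite [RHS](bigID (fun y => f y == 0)) /= [X in _ = X + _]big1 ?add0r; last by move=> y /eqP.
rewrite -big_filter -[RHS]big_filter; apply: perm_big; apply: uniq_perm.
- exact: filter_uniq.
- exact: filter_uniq.
- by move=> y; rewrite !mem_filter; case: eqP => //= /eqP h; rewrite fs// ft.
Qed.

Definition zrange (N : nat) : seq int := [seq (k%:Z - N%:Z)%R | k <- iota 0 (N.*2.+1)].

Lemma mem_zrange N i : (i \in zrange N) = (`|i| <= N%:Z).
Proof.
apply/mapP/idP => [[k]|].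
  rewrite mem_iota add0n /= => /= kN ->; rewrite ler_norml.
  by move: kN; rewrite -addnn => kN; apply/andP; split; lia.
move=> h; exists (absz (i + N%:Z)).
  by rewrite mem_iota -addnn; lia.
lia.
Qed.

Lemma uniq_zrange N : uniq (zrange N).
Proof. by rewrite map_inj_uniq ?iota_uniq// => a b /addIr []. Qed.

Definition sites (N : nat) : seq site := [seq (i, j) | i <- zrange N, j <- zrange N].

Lemma mem_sites N (y : site) : (y \in sites N) = (`|y.1| <= N%:Z) && (`|y.2| <= N%:Z).
Proof.
case: y => i j; rewrite -!mem_zrange; apply/allpairsP/andP => /=.
  by move=> [[a b] [/= ha hb [-> ->]]].
by move=> [ha hb]; exists (i, j).
Qed.

Lemma uniq_sites N : uniq (sites N).
Proof.
by apply: allpairs_uniq; [exact: uniq_zrange|exact: uniq_zrange|move=> [a b] [c d] _ _ [-> ->]].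
Qed.

(** The half-open counterpart of [square]: the cells partition the plane, which turns lattice sums
    into integrals of step functions. *)
Definition cell (n : nat) (y : site) : set P := [set z | nearest n z = y].

Lemma floor_eqP (x : R) (k : int) : Num.floor x = k <-> k%:~R <= x < k%:~R + 1.
Proof.
split=> [<-|]; first by have := floor_itv x; rewrite intrD.
by move=> h; apply: floor_def; rewrite intrD.
Qed.

Lemma cellE n (y : site) : (0 < n)%N -> cell n y =
  `[(y.1%:~R - 2^-1) / n%:R, (y.1%:~R + 2^-1) / n%:R[%classic `*`
  `[(y.2%:~R - 2^-1) / n%:R, (y.2%:~R + 2^-1) / n%:R[%classic.
Proof.
move=> n0; have nR : 0 < n%:R :> R by rewrite ltr0n.
have key (x : R) (k : int) : (k%:~R - 2^-1) / n%:R <= x < (k%:~R + 2^-1) / n%:R <->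
   Num.floor (n%:R * x + 2^-1) = k.
  rewrite floor_eqP ler_pdivrMr// ltr_pdivlMr// mulrC.
  by split => /andP[h1 h2]; apply/andP; split; lra.
apply/seteqP; split => -[a b]; rewrite /cell /= !in_itv /= /nearest.
  by move=> yE; rewrite -yE; split; apply/key.
by move=> [/key -> /key ->]; case: y.
Qed.

Lemma measurable_cell n y : (0 < n)%N -> measurable2 (cell n y).
Proof.
by move=> n0; rewrite cellE//; apply: measurableX; exact: measurable_itv.
Qed.

Lemma countable_site : countable [set: site].
Proof. exact: countableP. Qed.

Lemma measurable_nearest n (g : site -> R) : (0 < n)%N -> mfun2 (fun z => g (nearest n z)).
Proof.
move=> n0 _ B mB; rewrite setTI.
rewrite (_ : _ @^-1` _ = \bigcup_(y in [set: site]) (if `[< B (g y) >] then cell n y else set0)).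
  apply: countable_bigcupT_measurable; first exact: countable_site.
  by move=> y; case: asboolP => // _; exact: measurable_cell.
apply/seteqP; split => z /=.
  by move=> Bz; exists (nearest n z) => //; case: asboolP.
by move=> [y _]; case: asboolP => // By; rewrite /cell /= => ->.
Qed.

Lemma nearest_dist n (z : R * R) : (0 < n)%N ->
  `|z.1 - (pt n (nearest n z)).1| <= (2 * n%:R)^-1 /\
  `|z.2 - (pt n (nearest n z)).2| <= (2 * n%:R)^-1.
Proof.
move=> n0; have [/andP[h1 h2] /andP[h3 h4]] := (@nearestP R n z _ n0).1 erefl.
by rewrite !ler_norml; split; apply/andP; split; lra.
Qed.

Lemma enorm_nearest n (z : R * R) : (0 < n)%N ->
  enorm (z - pt n (nearest n z)) <= n%:R^-1.
Proof.
move=> n0; apply: (le_trans (enorm_le_sum _)); have [h1 h2] := nearest_dist z n0.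
have : (2 * n%:R)^-1 = 2^-1 / n%:R :> R by rewrite invfM.
rewrite /=; move: h1 h2 => /=; lra.
Qed.

(** The square exceeds the cell by its right and upper edges, two degenerate boxes of measure 0. *)
Lemma mu2_square_cell n (y : site) (A : set P) : (0 < n)%N -> measurable2 A ->
  mu2 (square n y `&` A) = mu2 (cell n y `&` A).
Proof.
move=> n0 mA; have nR : 0 < n%:R :> R by rewrite ltr0n.
set a := (y.1%:~R - 2^-1) / n%:R : R; set b := (y.1%:~R + 2^-1) / n%:R : R.
set a' := (y.2%:~R - 2^-1) / n%:R : R; set b' := (y.2%:~R + 2^-1) / n%:R : R.
have e : (2 * n%:R)^-1 = 2^-1 / n%:R :> R by rewrite invfM.
have ab : a <= b by rewrite ler_pM2r ?invr_gt0//; lra.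
have ab' : a' <= b' by rewrite ler_pM2r ?invr_gt0//; lra.
have sqE : square n y = [set z : P | a <= z.1 <= b /\ a' <= z.2 <= b'].
  apply/seteqP; split => z; rewrite /square /= !ler_norml e /a /b /a' /b' !mulrDl !mulNr.
    by move=> [/andP[h1 h2] /andP[h3 h4]]; split; apply/andP; split; lra.
  by move=> [/andP[h1 h2] /andP[h3 h4]]; split; apply/andP; split; lra.
have msq : measurable2 (square n y) by rewrite sqE; exact: measurable_box.
have mc := measurable_cell y n0.
apply/eqP; rewrite eq_le; apply/andP; split; last first.
  apply: le_measure; rewrite ?inE; [exact: measurableI|exact: measurableI|].
  apply: setSI; rewrite cellE// sqE => z /=; rewrite !in_itv /= -/a -/b -/a' -/b'.
  by move=> [/andP[h1 h2] /andP[h3 h4]]; rewrite h1 h3 !ltW.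
pose N1 := [set z : P | b <= z.1 <= b /\ a' <= z.2 <= b'].
pose N2 := [set z : P | a <= z.1 <= b /\ b' <= z.2 <= b'].
have N10 : mu2 (N1 : set P) = 0%E by rewrite mu2_box// subrr mul0r.
have N20 : mu2 (N2 : set P) = 0%E by rewrite mu2_box// subrr mulr0.
have mN1 : measurable2 N1 by exact: measurable_box.
have mN2 : measurable2 N2 by exact: measurable_box.
apply: (@le_trans _ _ (mu2 ((cell n y `&` A) `|` (N1 `|` N2) : set P))).
  apply: le_measure; rewrite ?inE; [exact: measurableI|by apply: measurableU; [exact: measurableI|exact: measurableU]|].
  rewrite cellE// sqE => z /=; rewrite !in_itv /= -/a -/b -/a' -/b'.
  move=> [[/andP[h1 h2] /andP[h3 h4]] Az].
  have /orP[/eqP zb|{}h2] : (z.1 == b) || (z.1 < b) by rewrite -le_eqVlt.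
    by right; left; rewrite /N1 /= zb lexx h3 h4.
  have /orP[/eqP zb|{}h4] : (z.2 == b') || (z.2 < b') by rewrite -le_eqVlt.
    by right; right; rewrite /N2 /= zb lexx h1 (ltW h2).
  by left; split => //; split; apply/andP; split.
apply: (le_trans (measureU2 _ _ _)); [exact: measurableI|exact: measurableU|].
rewrite [X in (_ + X)%E](_ : _ = 0%E) ?adde0//.
exact: null_set_setU.
Qed.

Lemma integrable2D (D : set P) (f g : R * R -> R) : measurable2 D ->
  L1 D f -> L1 D g -> L1 D (fun x => f x + g x).
Proof.
move=> mD Lf Lg.
rewrite (_ : _ \o _ = (EFin \o f) \+ (EFin \o g))%E; first exact: integrableD.
by apply/funext.
Qed.

Lemma integrable2Z (D : set P) (k : R) (f : R * R -> R) : measurable2 D ->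
  L1 D f -> L1 D (fun x => k * f x).
Proof.
move=> mD Lf; rewrite (_ : _ \o _ = fun x => (k%:E * (EFin \o f) x)%E).
  exact: integrableZl.
by apply/funext.
Qed.

Lemma integrable2B (D : set P) (f g : R * R -> R) : measurable2 D ->
  L1 D f -> L1 D g -> L1 D (fun x => f x - g x).
Proof.
move=> mD Lf Lg; rewrite (_ : (fun x => f x - g x) = (fun x => f x + (-1) * g x)).
  by apply: integrable2D => //; exact: integrable2Z.
by apply/funext => x; rewrite mulN1r.
Qed.

Lemma integrable2_cst (D : set P) (c : R) : measurable2 D -> (mu2 D < +oo)%E ->
  L1 D (fun=> c).
Proof. by move=> mD Doo; apply: (bounded_integrable (C := `|c|)). Qed.

Lemma norm_indicM_le (D : set (R * R)) (w : R * R) (x : R) : `|\1_D w * x| <= `|x|.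
Proof. by rewrite normrM indicE; case: (_ \in _); rewrite ?normr1 ?mul1r// normr0 mul0r. Qed.

Lemma integrable_indic (D : set P) (f : R * R -> R) : measurable2 D ->
  L1 D f -> L1 setT (fun x => \1_D x * f x).
Proof.
move=> mD Lf; have : mu2.-integrable setT ((EFin \o f) \_ D).
  by rewrite -integrable_mkcond.
congr (_.-integrable _ _); apply/funext => x /=; rewrite patchE indicE.
by case: (x \in D); rewrite ?mul1r ?mul0r.
Qed.

Lemma Rintegral_indicM (D : set P) (f : R * R -> R) :
  \int[mu2]_(x in D) f x = \int[mu2]_x (\1_D x * f x).
Proof.
rewrite Rintegral_mkcond; apply: eq_Rintegral => x _; rewrite patchE indicE.
by case: (x \in D); rewrite ?mul1r ?mul0r.
Qed.

Lemma measurable_indic2 (D : set P) : measurable2 D -> mfun2 (\1_D : R * R -> R).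
Proof. by move=> mD; exact: measurable_indic. Qed.

Lemma nearest_scale n (w : R * R) : (0 < n)%N ->
  nearest n (n%:R^-1 * w.1, n%:R^-1 * w.2) = nearest 1 w.
Proof.
move=> n0; rewrite /nearest /= !mulrA mulfV ?mul1r//.
by rewrite pnatr_eq0 -lt0n.
Qed.

Lemma enorm_pt n (y : site) : (0 < n)%N -> enorm (pt n y) = enorm (pt 1 y : R * R) / n%:R.
Proof.
move=> n0; have := enorm_scale n%:R^-1 (pt 1 y : R * R).
by rewrite /pt /= !divr1 mulrC [in RHS]mulrC ger0_norm ?invr_ge0// => <-; congr enorm; congr pair; rewrite mulrC.
Qed.

Lemma enorm_pt1_ge1 (y : site) : y != 0 -> 1 <= enorm (pt 1 y : R * R).
Proof.
move=> y0; rewrite -(@ler_pXn2r _ 2)// ?nnegrE ?enorm_ge0// expr1n.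
rewrite enorm_sqr /pt /= !divr1 !expr2 -!intrM -intrD.
rewrite ler1z; case: y y0 => a b /= ab.
have [a0|a0] := eqVneq a 0; have [b0|b0] := eqVneq b 0; try nia.
by move: ab; rewrite a0 b0 eqxx.
Qed.

Lemma pt0 n : pt n 0 = 0 :> R * R.
Proof. by rewrite /pt /= !mul0r. Qed.

Lemma ptD n (y z : site) : pt n (y + z) = pt n y + pt n z :> R * R.
Proof. by rewrite /pt /=; congr pair; rewrite -mulrDl -intrD. Qed.

Lemma ptN n (y : site) : pt n (- y) = - pt n y :> R * R.
Proof. by rewrite /pt /=; congr pair; rewrite -mulNr -intrN. Qed.

Lemma nearestD n (z : R * R) (y : site) : (0 < n)%N ->
  nearest n (z + pt n y) = nearest n z + y.
Proof.
move=> n0; have nR : n%:R != 0 :> R by rewrite pnatr_eq0 -lt0n.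
have key (t : R) (k : int) : Num.floor (n%:R * (t + k%:~R / n%:R) + 2^-1) =
    Num.floor (n%:R * t + 2^-1) + k.
  apply/floor_eqP; have := floor_itv (n%:R * t + 2^-1); rewrite !intrD.
  by rewrite mulrDr [n%:R * (_ / _)]mulrC divfK// => /andP[h1 h2]; apply/andP; split; lra.
by rewrite /nearest /= !key; case: y.
Qed.

Lemma nearest_pt n (y : site) : (0 < n)%N -> nearest n (pt n y : R * R) = y.
Proof.
move=> n0; rewrite -[pt n y]add0r nearestD// (_ : nearest n (0 : R * R) = 0) ?add0r//.
rewrite /nearest /= mulr0 add0r; congr pair; apply/floor_eqP; rewrite /=; apply/andP; split; lra.
Qed.

(** As f vanishes at 0, the origin may be put back, so that sums run over boxes invariant under y ->
    -y and under quarter turns. *)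
Lemma fsbig_sites N (f : site -> R) : f 0 = 0 ->
  (forall y, f y != 0 -> y \in sites N) ->
  \sum_(y \in [set y : site | y != 0]) f y = \sum_(y <- sites N) f y.
Proof.
move=> f0 fs; rewrite (fsbig_widen [set y : site | y != 0] setT)//; last first.
  by move=> y /= [_ /negP]; rewrite negbK => /eqP ->.
rewrite -(fsbig_widen [set` sites N] setT)//; last first.
  move=> y /= [_ ys]; apply/eqP; apply: contrapT => /negP h; apply: ys; exact: fs.
by rewrite -fsbig_seq// uniq_sites.
Qed.

End Lattice.

(** * Convergence of the normalizing constants *)

Section Kernel.
Context {R : realType}.
Local Notation mu := (@lebesgue_measure R).
Local Notation P := (measurableTypeR R * measurableTypeR R)%type.
Local Notation measurable2 := (@measurable _ P).
Local Notation mfun2 f := (@measurable_fun _ _ P R setT f).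
Local Notation L1 D f := (mu2.-integrable (D : set P) (EFin \o f)).

Context (alpha r M : R) (halpha : 1 < alpha < 2) (hr : 0 < r < M) (hM : 1 < M).
Context (hk : forall n : nat, (0 < n)%N -> 0 < kn r M alpha n).

Local Notation k_ := (kn r M alpha).
Local Notation F_ := (Fn r M).
Local Notation w_ := (wn r M alpha).
Local Notation c_ := (cn r M alpha).
Local Notation p_ := (pn r M alpha).

Let alpha_gt1 : 1 < alpha. Proof. by case/andP: halpha. Qed.
Let alpha_lt2 : alpha < 2. Proof. by case/andP: halpha. Qed.
Let alpha_gt0 : 0 < alpha. Proof. exact: lt_trans ltr01 alpha_gt1. Qed.
Let r_gt0 : 0 < r. Proof. by case/andP: hr. Qed.
Lemma powRDp (x a b : R) : 0 < x -> x `^ (a + b) = x `^ a * x `^ b.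
Proof. by move=> x0; rewrite powRD// (gt_eqF x0) implybT. Qed.

Lemma powRMp (x y a : R) : 0 < x -> 0 <= y -> (y / x) `^ a = y `^ a * x `^ (- a).
Proof.
move=> x0 y0; rewrite powRM ?invr_ge0 ?(ltW x0)//; congr (_ * _).
by rewrite -powR_inv1 ?(ltW x0)// -powRrM mulN1r.
Qed.

Lemma inv_pt1_powR_le1 (y : site) (b : R) : 0 < b ->
  0 <= (enorm (pt 1 y : R * R) `^ b)^-1 <= 1.
Proof.
move=> b0; rewrite invr_ge0 powR_ge0 /=.
have [->|y0] := eqVneq y 0.
  by rewrite pt0 enorm0 powR0 ?invr0 ?ler01// gt_eqF.
have y1 := @enorm_pt1_ge1 R _ y0; have y2 := lt_le_trans ltr01 y1.
rewrite invf_le1 ?powR_gt0//; have : 1 `^ b <= enorm (pt 1 y : R * R) `^ b.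
  by apply: ge0_ler_powR => //; rewrite ?nnegrE ?(ltW b0) ?enorm_ge0.
by rewrite powR1.
Qed.

Definition annulus (n : nat) : set P := eball M `\` eball (r / n%:R).

Lemma measurable_annulus n : measurable2 (annulus n).
Proof. by apply: measurableD; exact: measurable_eball. Qed.

Lemma annulus_lty n : (mu2 (annulus n) < +oo)%E.
Proof.
apply: le_lt_trans (mu2_eball_lty M); apply: le_measure; rewrite ?inE.
- exact: measurable_annulus.
- exact: measurable_eball.
- exact: subDsetl.
Qed.

Lemma FnE n y : (0 < n)%N ->
  F_ n y = n%:R ^+ 2 * fine (mu2 (cell n y `&` annulus n)).
Proof. by move=> n0; rewrite /Fn mu2_square_cell//; exact: measurable_annulus. Qed.

Lemma Fn_ge0 n y : 0 <= F_ n y.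
Proof. by rewrite mulr_ge0 ?exprn_ge0 ?fine_ge0. Qed.

(** A site whose cell meets B_M is within M + 1/n <= M + 1 of the origin, and so are the nearest
    neighbours; one box then carries every sum over jumps. *)
Definition Nbox (n : nat) : nat := (Num.truncn (n%:R * (M + 1))).+1.

Lemma Nbox_gt n (i : int) : (0 < n)%N -> `|i%:~R / n%:R| <= M + 1 :> R -> `|i| <= (Nbox n)%:Z.
Proof.
move=> n0; have nR : 0 < n%:R :> R by rewrite ltr0n.
rewrite normrM normfV (ger0_norm (ltW nR)) ler_pdivrMr// => h.
have : `|i|%:~R < (Nbox n)%:Z%:~R :> R.
  rewrite intr_norm; apply: (le_lt_trans h); rewrite mulrC /Nbox.
  by rewrite -pmulrn truncnS_gt.
by rewrite ltr_int => /ltW.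
Qed.

Lemma mem_Nbox n (y : site) : (0 < n)%N -> enorm (pt n y : R * R) <= M + 1 -> y \in sites (Nbox n).
Proof.
move=> n0 h; rewrite mem_sites; apply/andP; split; apply: Nbox_gt => //.
- exact: le_trans (enorm_ge_fst (pt n y)) h.
- exact: le_trans (enorm_ge_snd (pt n y)) h.
Qed.

Lemma Nbox_nearest n (z : R * R) : (0 < n)%N -> enorm z < M -> nearest n z \in sites (Nbox n).
Proof.
move=> n0 zM; apply: mem_Nbox => //.
have := enormB z (z - pt n (nearest n z)); rewrite subKr => /le_trans; apply.
have := enorm_nearest z n0; have : n%:R^-1 <= 1 :> R by rewrite invf_le1 ?ler1n ?ltr0n.
lra.
Qed.

Lemma Fn_enorm n y : (0 < n)%N -> F_ n y != 0 -> enorm (pt n y : R * R) <= M + 1.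
Proof.
move=> n0; rewrite FnE// mulf_eq0 negb_or => /andP[_].
have [->|/set0P[z [/= yz zM _]]] := eqVneq (cell n y `&` annulus n) set0.
  by rewrite measure0 eqxx.
case: zM => zM _; rewrite /cell /= in yz; rewrite -yz.
have := enormB z (z - pt n (nearest n z)); rewrite subKr => /le_trans; apply.
have := enorm_nearest z n0; have : n%:R^-1 <= 1 :> R by rewrite invf_le1 ?ler1n ?ltr0n.
by move: zM; rewrite /eball /=; lra.
Qed.

(** [Fn n y] is n^2 times the area of the part of the cell of y inside the annulus, so weighting by
    it integrates a step function. *)
Lemma sum_Fn n (g : site -> R) : (0 < n)%N ->
  \sum_(y <- sites (Nbox n)) F_ n y * g y =
  n%:R ^+ 2 * \int[mu2]_(z in annulus n) g (nearest n z).
Proof.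
move=> n0; have mA := measurable_annulus n.
transitivity (n%:R ^+ 2 * \int[mu2]_(z in annulus n)
   (\sum_(y <- sites (Nbox n)) g y * \1_(cell n y) z)); last first.
  congr (_ * _); apply: eq_Rintegral => z /set_mem[zM _].
  rewrite (bigD1_seq (nearest n z)) ?uniq_sites ?Nbox_nearest//=.
  rewrite indicE mem_set ?mulr1// big1 ?addr0// => y yz.
  by rewrite indicE memNset ?mulr0// /cell /= => h; rewrite h eqxx in yz.
have L1c y : L1 (annulus n) (\1_(cell n y) : R * R -> R).
  apply: (bounded_integrable (C := 1)) => //; first exact: annulus_lty.
    by apply: measurable_indic2; exact: measurable_cell.
  by move=> z _; rewrite indicE; case: (_ \in _); rewrite ?normr1 ?normr0 ?ler01.
rewrite Rintegral_big_sum//; last first.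
  move=> y; rewrite (_ : _ \o _ = fun z => ((g y)%:E * (EFin \o \1_(cell n y)) z)%E).
    exact: integrableZl.
  by apply/funext => z /=; rewrite EFinM.
rewrite mulr_sumr; apply: eq_bigr => y _; rewrite FnE// RintegralZl//.
rewrite -mulrA [in LHS](mulrC (fine _)); congr (_ * (_ * _)).
rewrite /Rintegral integral_indic//; exact: measurable_cell.
Qed.

(** After dilation by n the lattice is Z^2 and the hole has the fixed radius [r]; n survives only in
    the outer radius, and limits in n become exhaustions of the plane. *)
Lemma scale_annulus n (h : site -> R) : (0 < n)%N ->
  n%:R ^+ 2 * \int[mu2]_(z in annulus n) h (nearest n z) =
  \int[mu2]_(z in eball (n%:R * M) `\` eball r) h (nearest 1 z).
Proof.
move=> n0; have nR : 0 < n%:R :> R by rewrite ltr0n.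
have ni : 0 < n%:R^-1 :> R by rewrite invr_gt0.
have := @scales_Rintegral R _ _ (annulus n) (fun z => h (nearest n z))
  (affine_scales_measure 0 0 ni) _ (measurable_annulus n) (measurable_nearest h n0).
have i2 : n%:R^-1 ^- 2 = n%:R ^+ 2 :> R by rewrite exprVn invrK.
rewrite i2 => <-; last by rewrite exprn_gt0.
rewrite (_ : _ @^-1` _ = eball (n%:R * M) `\` eball r); last first.
  have nE (w : R * R) : enorm (0 + n%:R^-1 * w.1, 0 + n%:R^-1 * w.2) = enorm w / n%:R.
    by rewrite !add0r enorm_scale ger0_norm ?ltW// mulrC.
  by apply/seteqP; split => w; rewrite /annulus /eball /= nE ltr_pdivrMr// ltr_pM2r// [M * _]mulrC.
by apply: eq_Rintegral => z _; rewrite !add0r nearest_scale.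
Qed.

Local Notation I_a := (\int[mu2]_(y in eball M) (enorm y `^ alpha)^-1).

Lemma scale_Ialpha n : (0 < n)%N ->
  n%:R `^ (2 - alpha) * I_a = \int[mu2]_(w in eball (n%:R * M)) (enorm w `^ alpha)^-1.
Proof.
move=> n0; have nR : 0 < n%:R :> R by rewrite ltr0n.
have ni : 0 < n%:R^-1 :> R by rewrite invr_gt0.
have := @scales_Rintegral R _ _ (eball M) (fun z => (enorm z `^ alpha)^-1)
  (affine_scales_measure 0 0 ni) _ (measurable_eball M) (measurable_enorm_powR alpha).
have i2 : n%:R^-1 ^- 2 = n%:R ^+ 2 :> R by rewrite exprVn invrK.
have nE (w : R * R) : enorm (0 + n%:R^-1 * w.1, 0 + n%:R^-1 * w.2) = enorm w / n%:R.
  by rewrite !add0r enorm_scale ger0_norm ?ltW// mulrC.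
rewrite i2 (_ : _ @^-1` _ = eball (n%:R * M)); last first.
  by apply/seteqP; split => w; rewrite /eball /= nE ltr_pdivrMr// [M * _]mulrC.
move=> /(_ (exprn_gt0 _ nR)) h.
have -> : n%:R `^ (2 - alpha) * I_a = n%:R `^ (- alpha) * (n%:R ^+ 2 * I_a).
  by rewrite mulrA (powRDp _ _ nR) (@powR_mulrn _ n%:R 2) ?ler0n// [n%:R ^+ 2 * _]mulrC.
rewrite -h -RintegralZl; last 2 first.
- exact: measurable_eball.
- have := @scales_integrable R _ _ (eball M) (fun z => (enorm z `^ alpha)^-1)
    (affine_scales_measure 0 0 ni) _ (measurable_eball M) (measurable_enorm_powR alpha).
  rewrite i2 => /(_ (exprn_gt0 _ nR)) hh.
  rewrite (_ : eball (n%:R * M) = (fun z : R * R => (0 + n%:R^-1 * z.1, 0 + n%:R^-1 * z.2)) @^-1` eball M).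
    by apply: hh; apply: integrable_near0; apply/andP.
  by apply/seteqP; split => w; rewrite /eball /= nE ltr_pdivrMr// [M * _]mulrC.
apply: eq_Rintegral => w _; rewrite nE powRMp ?enorm_ge0// invfM mulrCA.
by rewrite mulfV ?mulr1// gt_eqF// powR_gt0.
Qed.

(** The factor n^(2 - alpha) in [kn] is exactly what the dilation by n absorbs in both integrals. *)
Lemma knE n : (0 < n)%N ->
  k_ n = 4^-1 * (\int[mu2]_(w in eball (n%:R * M)) (enorm w `^ alpha)^-1 -
     \int[mu2]_(w in eball (n%:R * M) `\` eball r) (enorm (pt 1 (nearest 1 w) : R * R) `^ alpha)^-1).
Proof.
move=> n0; have nR : 0 < n%:R :> R by rewrite ltr0n.
rewrite -scale_Ialpha// /kn (@fsbig_sites R (Nbox n)); last 2 first.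
- by rewrite pt0 enorm0 powR0 ?invr0 ?mulr0// gt_eqF//; lra.
- by move=> y; rewrite mulf_eq0 negb_or => /andP[h _]; apply: mem_Nbox => //; exact: Fn_enorm h.
rewrite (sum_Fn (fun y => (enorm (pt n y : R * R) `^ alpha)^-1) n0).
rewrite [n%:R ^- 2 * _]mulrA mulVf ?mul1r; last by rewrite gt_eqF// exprn_gt0.
suff <- : n%:R `^ (2 - alpha) *
    \int[mu2]_(z in annulus n) (enorm (pt n (nearest n z) : R * R) `^ alpha)^-1 =
    \int[mu2]_(w in eball (n%:R * M) `\` eball r) (enorm (pt 1 (nearest 1 w) : R * R) `^ alpha)^-1.
  move: (\int[mu2]_(y in eball M) _) (\int[mu2]_(z in annulus n) _) => a b.
  by rewrite -mulrBr mulrA [4^-1 * _]mulrC.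
rewrite -(scale_annulus (fun y => (enorm (pt 1 y : R * R) `^ alpha)^-1) n0).
rewrite -RintegralZl; last 2 first.
- exact: measurable_annulus.
- have h := measurable_nearest (fun y => (enorm (pt n y : R * R) `^ alpha)^-1) n0.
  apply: (bounded_integrable (C := n%:R `^ alpha) _ _ h); [exact: measurable_annulus|exact: annulus_lty|].
  move=> z _; rewrite ger0_norm ?invr_ge0 ?powR_ge0//.
  rewrite enorm_pt// powRMp ?enorm_ge0// powRN invfM invrK ler_piMl ?powR_ge0//.
  by case/andP: (inv_pt1_powR_le1 (nearest n z) alpha_gt0).
rewrite -RintegralZl; last 2 first.
- exact: measurable_annulus.
- have h := measurable_nearest (fun y => (enorm (pt 1 y : R * R) `^ alpha)^-1) n0.
  apply: (bounded_integrable (C := 1) _ _ h); [exact: measurable_annulus|exact: annulus_lty|].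
  move=> z _; rewrite ger0_norm ?invr_ge0 ?powR_ge0//.
  by case/andP: (inv_pt1_powR_le1 (nearest n z) alpha_gt0).
apply: eq_Rintegral => z _; rewrite enorm_pt// powRMp ?enorm_ge0//.
rewrite invfM powRN invrK mulrCA -(powRDp _ _ nR) subrK.
by rewrite (@powR_mulrn _ n%:R 2) ?ler0n// mulrC.
Qed.

Local Opaque kn Fn.

(** The condition |y| = 1/n in integer coordinates, where it no longer involves n. *)
Definition is_neighbor (y : site) : bool := y.1 * y.1 + y.2 * y.2 == 1.

Lemma enorm_pt_neighbor n (y : site) : (0 < n)%N ->
  (enorm (pt n y : R * R) == n%:R^-1) = is_neighbor y.
Proof.
move=> n0; have nR : 0 < n%:R :> R by rewrite ltr0n.
rewrite enorm_pt// -[X in _ == X]mul1r (inj_eq (mulIf _)); last by rewrite gt_eqF// invr_gt0.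
rewrite -(@eqrXn2 _ 2)// ?enorm_ge0// expr1n enorm_sqr /pt /= !divr1 !expr2 -!intrM -intrD.
by rewrite -[1]/(1%:~R) eqr_int.
Qed.

Definition num_neighbors : R := \sum_(y <- sites 1) (is_neighbor y)%:R.

Lemma is_neighbor_mem (y : site) : is_neighbor y -> y \in sites 1.
Proof.
rewrite /is_neighbor mem_sites => /eqP h; apply/andP; split; nia.
Qed.

Lemma is_neighbor_box n (y : site) : (0 < n)%N -> is_neighbor y -> y \in sites (Nbox n).
Proof.
move=> n0; rewrite -(enorm_pt_neighbor y n0) => /eqP h; apply: mem_Nbox => //; rewrite h.
have : n%:R^-1 <= 1 :> R by rewrite invf_le1 ?ler1n ?ltr0n.
by move: hM; lra.
Qed.

Lemma sum_neighbors n : (0 < n)%N ->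
  \sum_(y <- sites (Nbox n)) (is_neighbor y)%:R = num_neighbors.
Proof.
move=> n0; apply: sum_support; rewrite ?uniq_sites// => y.
  by case h : (is_neighbor y); rewrite ?eqxx// => _; exact: is_neighbor_box.
by case h : (is_neighbor y); rewrite ?eqxx// => _; exact: is_neighbor_mem.
Qed.

Lemma num_neighbors_ge0 : 0 <= num_neighbors.
Proof. exact: sumr_ge0. Qed.

Lemma wnE n (y : site) : (0 < n)%N ->
  w_ n y = k_ n * (is_neighbor y)%:R + F_ n y * (enorm (pt 1 y : R * R) `^ (2 + alpha))^-1.
Proof.
move=> n0; rewrite /wn enorm_pt_neighbor// enorm_pt//.
by rewrite mulrCA mulfV ?mulr1// pnatr_eq0 -lt0n.
Qed.

Lemma wn_ge0 n (y : site) : (0 < n)%N -> 0 <= w_ n y.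
Proof.
move=> n0; rewrite wnE// addr_ge0//; first by rewrite mulr_ge0// ltW// hk.
by rewrite mulr_ge0 ?Fn_ge0// invr_ge0 powR_ge0.
Qed.

Lemma wn0 n : (0 < n)%N -> w_ n 0 = 0.
Proof.
move=> n0; rewrite wnE// pt0 enorm0 powR0 ?invr0 ?mulr0 ?addr0//.
by rewrite gt_eqF// addr_gt0.
Qed.

Lemma wn_box n y : (0 < n)%N -> w_ n y != 0 -> y \in sites (Nbox n).
Proof.
move=> n0; rewrite wnE//; case h : (is_neighbor y).
  by move=> _; exact: is_neighbor_box.
by rewrite mulr0 add0r mulf_eq0 negb_or => /andP[hF _]; apply: mem_Nbox => //; exact: Fn_enorm hF.
Qed.

Lemma wn_enorm n y : (0 < n)%N -> w_ n y != 0 -> enorm (pt n y : R * R) <= M + 1.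
Proof.
move=> n0; rewrite wnE//; case h : (is_neighbor y).
  move=> _; move: h; rewrite -(enorm_pt_neighbor y n0) => /eqP ->.
  have : n%:R^-1 <= 1 :> R by rewrite invf_le1 ?ler1n ?ltr0n.
  by move: hM; lra.
by rewrite mulr0 add0r mulf_eq0 negb_or => /andP[hF _]; exact: Fn_enorm hF.
Qed.

Lemma sum_wn n (g : site -> R) : (0 < n)%N ->
  \sum_(y <- sites (Nbox n)) w_ n y * g y =
  k_ n * (\sum_(y <- sites (Nbox n)) (is_neighbor y)%:R * g y) +
  n%:R ^+ 2 * \int[mu2]_(z in annulus n)
    (g (nearest n z) * (enorm (pt 1 (nearest n z) : R * R) `^ (2 + alpha))^-1).
Proof.
move=> n0.
rewrite -(sum_Fn (fun y => g y * (enorm (pt 1 y : R * R) `^ (2 + alpha))^-1) n0).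
rewrite mulr_sumr -big_split /=; apply: eq_bigr => y _.
by rewrite wnE// mulrDl mulrA -mulrA; congr (_ + _); rewrite -[in LHS]mulrA [X in _ * X]mulrC.
Qed.

Definition J_ n : R :=
  \int[mu2]_(w in eball (n%:R * M) `\` eball r) (enorm (pt 1 (nearest 1 w) : R * R) `^ (2 + alpha))^-1.

Lemma sum_wn1 n : (0 < n)%N ->
  \sum_(y <- sites (Nbox n)) w_ n y = k_ n * num_neighbors + J_ n.
Proof.
move=> n0; rewrite -(sum_neighbors n0) /J_.
rewrite -(scale_annulus (fun y => (enorm (pt 1 y : R * R) `^ (2 + alpha))^-1) n0).
have := sum_wn (fun=> 1) n0; under eq_bigr do rewrite mulr1.
move=> ->; congr (_ * _ + _ * _); first by apply: eq_bigr => y _; rewrite mulr1.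
by apply: eq_Rintegral => z _; rewrite mul1r.
Qed.

Lemma cnE n : (0 < n)%N -> c_ n = (k_ n * num_neighbors + J_ n)^-1.
Proof.
move=> n0; rewrite -sum_wn1// /cn (@fsbig_sites R (Nbox n))//; first exact: wn0.
by move=> y; exact: wn_box.
Qed.

Lemma eventually_cst_cvg (f : nat -> R) (l : R) N :
  (forall n, (N <= n)%N -> f n = l) -> f n @[n --> \oo] --> l.
Proof.
move=> h; apply/cvgrPdist_le => e e0; exists N => // n /= Nn.
by rewrite h// subrr normr0 ltW.
Qed.

Lemma indic_eball_cvg (w : R * R) (a : R) :
  \1_(eball (n%:R * M)) w * a @[n --> \oo] --> a.
Proof.
apply: (@eventually_cst_cvg _ _ (Num.truncn (enorm w)).+1) => n hn.
rewrite indicE mem_set ?mul1r// /eball /=.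
apply: (lt_le_trans (truncnS_gt _)); apply: (@le_trans _ _ n%:R); first by rewrite ler_nat.
by rewrite ler_peMr// ltW.
Qed.

Lemma Rintegral_exhaust (f : R * R -> R) : mfun2 f -> L1 setT f ->
  \int[mu2]_w (\1_(eball (n%:R * M)) w * f w) @[n --> \oo] --> \int[mu2]_w f w.
Proof.
move=> mf Lf.
have [|||||_] // := @Rintegral_dominated_cvg R setT
  (fun n w => \1_(eball (n%:R * M)) w * f w) f (fun w => `|f w|).
- move=> n; apply: measurable_funM => //.
  by apply: measurable_indic2; exact: measurable_eball.
- exact: integrable_norm.
- by move=> w _; exact: indic_eball_cvg.
- by move=> n w _; exact: norm_indicM_le.
Qed.

Lemma enorm_nearest1_ge (w : R * R) : 2 <= enorm w ->
  enorm w / 2 <= enorm (pt 1 (nearest 1 w) : R * R) /\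
  `|enorm w - enorm (pt 1 (nearest 1 w) : R * R)| <= 1.
Proof.
move=> w2; have h := @enorm_nearest R 1 w erefl; rewrite invr1 in h.
have h1 := enormD (w - pt 1 (nearest 1 w)) (pt 1 (nearest 1 w)); rewrite subrK in h1.
have h2 := enormB w (w - pt 1 (nearest 1 w)); rewrite subKr in h2.
by split; [lra|rewrite ler_norml; apply/andP; split; lra].
Qed.

(* Rescaling the sum by [n] turns [kn n] into a quarter of the integral of [H_] over
   the ball of radius [n M]; [H_] is O(|w|^(-1-alpha)) at infinity since moving to the
   nearest lattice point costs one power. *)
Definition H_ (w : R * R) : R := (enorm w `^ alpha)^-1 -
  \1_(~` eball r) w * (enorm (pt 1 (nearest 1 w) : R * R) `^ alpha)^-1.

Lemma measurable_pt1_powR (b : R) :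
  mfun2 (fun w => (enorm (pt 1 (nearest 1 w) : R * R) `^ b)^-1).
Proof. exact: (measurable_nearest (fun y => (enorm (pt 1 y : R * R) `^ b)^-1)). Qed.

Lemma measurable_H : mfun2 H_.
Proof.
apply: measurable_funB; first exact: measurable_enorm_powR.
apply: measurable_funM; last exact: measurable_pt1_powR.
by apply: measurable_indic2; apply: measurableC; exact: measurable_eball.
Qed.

Lemma knH n : (0 < n)%N -> k_ n = 4^-1 * \int[mu2]_w (\1_(eball (n%:R * M)) w * H_ w).
Proof.
move=> n0; rewrite knE//; congr (_ * _).
have mB := measurable_eball (n%:R * M).
have mD : measurable2 (eball (n%:R * M) `\` eball r) by apply: measurableD => //; exact: measurable_eball.
have mC : measurable2 (~` eball r) by apply: measurableC; exact: measurable_eball.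
rewrite -(Rintegral_indicM (eball (n%:R * M))) RintegralB//; last 2 first.
- by apply: integrable_near0; apply/andP.
- apply: (bounded_integrable (C := 1)) => //; first exact: mu2_eball_lty.
    by apply: measurable_funM; [exact: measurable_indic2|exact: measurable_pt1_powR].
  move=> z _; case/andP: (inv_pt1_powR_le1 (nearest 1 z) alpha_gt0) => h1 h2.
  rewrite normrM (ger0_norm h1) indicE; case: (_ \in _); rewrite ?normr1 ?normr0 ?mul1r// mul0r; exact: ler01.
congr (_ - _); rewrite Rintegral_indicM [RHS]Rintegral_indicM; apply: eq_Rintegral => z _.
by rewrite setDE indicI mulrA.
Qed.

(** An integrable majorant of [H_]. For |w| < r + 2 its two terms are bounded separately, the
    lattice term by 1; beyond, the mean value bound applies to their difference, and the tail is
    integrable because alpha + 1 > 2. *)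
Definition G_ (w : R * R) : R := \1_(eball (r + 2)) w * ((enorm w `^ alpha)^-1 + 1) +
  \1_(~` eball 1) w * (alpha * 2 `^ (alpha + 1) * (enorm w `^ (alpha + 1))^-1).

Lemma integrable_G : L1 setT G_.
Proof.
have mB : measurable2 (~` eball 1) by apply: measurableC; exact: measurable_eball.
apply: integrable2D => //.
- apply: integrable_indic; first exact: measurable_eball.
  apply: integrable2D; [exact: measurable_eball|by apply: integrable_near0; apply/andP|].
  by apply: integrable2_cst; [exact: measurable_eball|exact: mu2_eball_lty].
- apply: integrable_indic => //; apply: integrable2Z => //.
  by apply: integrable_far; move: alpha_gt1; lra.
Qed.

Lemma norm_H_le (w : R * R) : `|H_ w| <= G_ w.
Proof.
have al := alpha_gt0; have r0 := r_gt0.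
rewrite /H_ /G_ !indicE; have [w2|w2] := ltP (enorm w) (r + 2).
  rewrite (mem_set (_ : eball (r + 2) w)) ?mul1r//.
  apply: (@le_trans _ _ ((enorm w `^ alpha)^-1 + 1)); last first.
    by rewrite lerDl !mulr_ge0 ?invr_ge0 ?powR_ge0// ltW.
  apply: (le_trans (ler_normB _ _)); apply: lerD.
    by rewrite ger0_norm// invr_ge0 powR_ge0.
  case/andP: (inv_pt1_powR_le1 (nearest 1 w) alpha_gt0) => h1 h2.
  by rewrite normrM (ger0_norm h1); case: (_ \in _); rewrite ?normr1 ?normr0 ?mul1r// mul0r; exact: ler01.
rewrite (memNset (_ : ~ eball (r + 2) w)) ?mul0r ?add0r; last by rewrite /eball /=; apply/negP; rewrite -leNgt.
rewrite (mem_set (_ : (~` eball r) w)); last by rewrite /eball /=; apply/negP; rewrite -leNgt; lra.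
rewrite (mem_set (_ : (~` eball 1) w)); last by rewrite /eball /=; apply/negP; rewrite -leNgt; lra.
rewrite !mul1r; have w2' : 2 <= enorm w by lra.
have [h1 h2] := enorm_nearest1_ge w2'.
have half : (enorm w / 2) `^ (alpha + 1) = enorm w `^ (alpha + 1) / 2 `^ (alpha + 1).
  by rewrite powRMp ?enorm_ge0// powRN.
have pw : 0 < enorm w `^ (alpha + 1) by apply: powR_gt0; lra.
have p2 : 0 < 2 `^ (alpha + 1) :> R by apply: powR_gt0.
set v := enorm (pt 1 _) in h1 h2 *.
(* To be used with the norms of w and of its nearest site, in whichever order they come: both are at
   least |w| / 2 and they differ by at most 1. *)
have key (a b : R) : 0 < a -> a <= b -> enorm w / 2 <= a -> b - a <= 1 ->
    0 <= (a `^ alpha)^-1 - (b `^ alpha)^-1 <= alpha * 2 `^ (alpha + 1) * (enorm w `^ (alpha + 1))^-1.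
  move=> a0 ab wa ba; have /andP[k1 k2] := powRN_diff a0 ab al.
  rewrite k1 /=; apply: (le_trans k2); rewrite -!mulrA ler_pM2l//.
  have -> : 2 `^ (alpha + 1) / enorm w `^ (alpha + 1) = ((enorm w / 2) `^ (alpha + 1))^-1.
    by rewrite half invf_div.
  apply: (@le_trans _ _ (1 * (a `^ (alpha + 1))^-1)).
    by rewrite ler_wpM2r// invr_ge0 powR_ge0.
  rewrite mul1r lef_pV2 ?posrE ?powR_gt0//; last by lra.
  by apply: ge0_ler_powR; rewrite ?nnegrE; lra.
move: h2; rewrite ler_norml => /andP[h2 h3].
have [wv|vw] := leP (enorm w) v.
  have w0 : 0 < enorm w by lra.
  have wh : enorm w / 2 <= enorm w by lra.
  have vw1 : v - enorm w <= 1 by lra.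
  have /andP[k1 k2] := key _ _ w0 wv wh vw1.
  by rewrite ger0_norm.
have v0 : 0 < v by lra.
have /andP[k1 k2] := key _ _ v0 (ltW vw) h1 h3.
by rewrite ler0_norm ?opprB// -oppr_ge0 opprB.
Qed.

Lemma kn_cvg : k_ n @[n --> \oo] --> 4^-1 * \int[mu2]_w H_ w.
Proof.
have LH : L1 setT H_.
  by apply: dominated_integrable2 integrable_G _ => // [|w _]; [exact: measurable_H|exact: norm_H_le].
have h := Rintegral_exhaust measurable_H LH.
rewrite -cvg_shiftS /=.
under eq_fun do rewrite knH//.
apply: cvgMr; move: h; rewrite -cvg_shiftS; exact.
Qed.

Definition Jlim : R := \int[mu2]_w (\1_(~` eball r) w * (enorm (pt 1 (nearest 1 w) : R * R) `^ (2 + alpha))^-1).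

Let a2_gt0 : 0 < 2 + alpha. Proof. by move: alpha_gt0; lra. Qed.

Lemma J_cvg : L1 setT (fun w => \1_(~` eball r) w * (enorm (pt 1 (nearest 1 w) : R * R) `^ (2 + alpha))^-1)
  /\ J_ n @[n --> \oo] --> Jlim.
Proof.
pose g w := \1_(eball 2) w + \1_(~` eball 1) w * (2 `^ (2 + alpha) * (enorm w `^ (2 + alpha))^-1) : R.
pose f w := \1_(~` eball r) w * (enorm (pt 1 (nearest 1 w) : R * R) `^ (2 + alpha))^-1 : R.
have mC (a : R) : measurable2 (~` eball a) by apply: measurableC; exact: measurable_eball.
have Lg : L1 setT g.
  apply: integrable2D => //.
    rewrite (_ : \1_(eball 2) = fun w => \1_(eball 2) w * 1); last by apply/funext => w; rewrite mulr1.
    apply: integrable_indic; first exact: measurable_eball.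
    by apply: integrable2_cst; [exact: measurable_eball|exact: mu2_eball_lty].
  apply: integrable_indic => //; apply: integrable2Z => //.
  by apply: integrable_far; move: alpha_gt1; lra.
have mf : mfun2 f.
  by apply: measurable_funM; [exact: measurable_indic2|exact: measurable_pt1_powR].
have f0 w : 0 <= f w by rewrite mulr_ge0 ?invr_ge0 ?powR_ge0// indicE.
have fg w : `|f w| <= g w.
  rewrite ger0_norm// /f /g !indicE.
  case/andP: (inv_pt1_powR_le1 (nearest 1 w) a2_gt0) => h1 h2.
  have [w2|w2] := ltP (enorm w) 2.
    rewrite (mem_set (_ : eball 2 w)) ?mul1r//.
    apply: (@le_trans _ _ 1); last by rewrite lerDl !mulr_ge0 ?invr_ge0 ?powR_ge0.
    by case: (w \in ~` _); rewrite ?mul1r// mul0r ler01.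
  rewrite (mem_set (_ : (~` eball 1) w)); last by rewrite /eball /=; apply/negP; rewrite -leNgt; lra.
  apply: (@le_trans _ _ (2 `^ (2 + alpha) / enorm w `^ (2 + alpha))); last first.
    by rewrite mul1r lerDr.
  have [h3 _] := enorm_nearest1_ge w2.
  have -> : 2 `^ (2 + alpha) / enorm w `^ (2 + alpha) = ((enorm w / 2) `^ (2 + alpha))^-1.
    by rewrite powRMp ?enorm_ge0// powRN invf_div.
  apply: (@le_trans _ _ (enorm (pt 1 (nearest 1 w) : R * R) `^ (2 + alpha))^-1).
    by rewrite ler_piMl//; case: (_ \in _) => //; exact: ler01.
  rewrite lef_pV2 ?posrE ?powR_gt0//; [|by lra..].
  by apply: ge0_ler_powR; rewrite ?nnegrE; move: a2_gt0; lra.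
have Lf : L1 setT f.
  by apply: dominated_integrable2 Lg _ => // w _; exact: fg.
have h := Rintegral_exhaust mf Lf.
split=> //; rewrite (_ : J_ = fun n => \int[mu2]_w (\1_(eball (n%:R * M)) w * f w))//.
apply/funext => n.
rewrite /J_ [LHS]Rintegral_indicM; apply: eq_Rintegral => w _.
by rewrite setDE indicI /f mulrA.
Qed.

Lemma Jlim_gt0 : 0 < Jlim.
Proof.
have [Lf _] := J_cvg; set f := fun w => _ in Lf.
have f0 w : 0 <= f w by rewrite mulr_ge0 ?invr_ge0 ?powR_ge0// indicE.
(* A unit square outside the hole, whose points have nearest sites of norm at most r + 6; the
   integrand is at least [d] there. *)
pose B := [set z : P | r + 1 <= z.1 <= r + 2 /\ 0 <= z.2 <= 1].
have mB : measurable2 B by exact: measurable_box.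
have muB : mu2 (B : set P) = 1%:E by rewrite mu2_box; [congr EFin; ring|lra|lra].
pose d := ((r + 6) `^ (2 + alpha))^-1.
have d0 : 0 < d by rewrite invr_gt0 powR_gt0//; move: r_gt0; lra.
apply: (lt_le_trans d0).
have -> : d = \int[mu2]_(w in B) d.
  by transitivity (d * fine (mu2 (B : set P))); [rewrite muB mulr1|rewrite Rintegral_cst].
apply: (@le_trans _ _ (\int[mu2]_(w in B) f w)).
  apply: le_Rintegral => //.
  - by apply: (bounded_integrable (C := `|d|)) => //; rewrite muB ltry.
  - exact: integrableS Lf.
  - move=> w [/andP[w1 w2] /andP[w3 w4]].
    have e1 := enorm_ge_fst w; have e2 := enorm_le_sum w; have r0 := r_gt0.
    rewrite ger0_norm ?(ger0_norm w3) in e1 e2; [|lra..].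
    rewrite /f indicE mem_set ?mul1r; last by rewrite /eball /=; apply/negP; rewrite -leNgt; lra.
    have h := @enorm_nearest R 1 w erefl; rewrite invr1 in h.
    have h1 := enormD (w - pt 1 (nearest 1 w)) (pt 1 (nearest 1 w)); rewrite subrK in h1.
    have h2 := enormB w (w - pt 1 (nearest 1 w)); rewrite subKr in h2.
    rewrite lef_pV2 ?posrE ?powR_gt0//; [|lra..].
    by apply: ge0_ler_powR; rewrite ?nnegrE; move: a2_gt0; lra.
rewrite Rintegral_indicM; apply: le_Rintegral => //.
- by apply: integrable_indic => //; exact: integrableS Lf.
- by move=> w _; rewrite indicE; case: (_ \in _); rewrite ?mul1r// mul0r; exact: f0.
Qed.

(** In the limit kn > 0 leaves only K >= 0; it is [Jlim] > 0 that keeps the denominators away from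
    0. *)
Lemma cn_cvg : exists2 c : R, 0 < c & c_ n @[n --> \oo] --> c.
Proof.
have [_ hJ] := J_cvg; have hK := kn_cvg.
pose K := 4^-1 * \int[mu2]_w H_ w.
have K0 : 0 <= K.
  apply: (cvgr_to_ge hK).
  by exists 1%N => // n /= n1; apply/ltW/hk.
have S0 : 0 < K * num_neighbors + Jlim by rewrite ltr_wpDl ?Jlim_gt0// mulr_ge0// num_neighbors_ge0.
exists (K * num_neighbors + Jlim)^-1; first by rewrite invr_gt0.
rewrite -cvg_shiftS /=; under eq_fun do rewrite cnE//.
apply: cvgV; first by rewrite gt_eqF.
move: hJ hK; rewrite -cvg_shiftS -[X in _ -> X -> _]cvg_shiftS => hJ hK.
by apply: cvgD => //; apply: cvgMl.
Qed.

Lemma cc_gt0 : 0 < cc r M alpha.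
Proof. by have [c c0 /cvg_lim] := cn_cvg; rewrite /cc => ->. Qed.

Lemma cn_cvg_cc : c_ n @[n --> \oo] --> cc r M alpha.
Proof. by have [c c0 h] := cn_cvg; rewrite /cc (cvg_lim _ h). Qed.

End Kernel.

(** * Convergence of the discrete generators *)

Section Generator.
Context {R : realType}.
Local Notation mu := (@lebesgue_measure R).
Local Notation P := (measurableTypeR R * measurableTypeR R)%type.
Local Notation measurable2 := (@measurable _ P).
Local Notation mfun2 f := (@measurable_fun _ _ P R setT f).
Local Notation L1 D f := (mu2.-integrable (D : set P) (EFin \o f)).

Context (alpha r M : R) (halpha : 1 < alpha < 2) (hr : 0 < r < M) (hM : 1 < M).
Context (hk : forall n : nat, (0 < n)%N -> 0 < kn r M alpha n).

Local Notation k_ := (kn r M alpha).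
Local Notation F_ := (Fn r M).
Local Notation w_ := (wn r M alpha).
Local Notation c_ := (cn r M alpha).
Local Notation p_ := (pn r M alpha).
Local Notation c := (cc r M alpha).
Local Notation box n := (sites (Nbox M n)).
Local Notation L_M := (LM r M alpha).

Let alpha_gt1 : 1 < alpha. Proof. by case/andP: halpha. Qed.
Let alpha_lt2 : alpha < 2. Proof. by case/andP: halpha. Qed.
Let alpha_gt0 : 0 < alpha. Proof. exact: lt_trans ltr01 alpha_gt1. Qed.
Let r_gt0 : 0 < r. Proof. by case/andP: hr. Qed.
Implicit Types (f : R * R -> R) (x : R * R).

(** The quarter turn preserves the jump law. Applied twice it shows that [pn] is even; applied once
    it makes the second moments isotropic. *)
Definition rot (y : site) : site := (- y.2, y.1).

Lemma rot_inj : injective rot.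
Proof. by move=> [a b] [a' b'] [/oppr_inj -> ->]. Qed.

Lemma rotrot (y : site) : rot (rot y) = - y.
Proof. by case: y. Qed.

Lemma perm_rot N : perm_eq (map rot (sites N)) (sites N).
Proof.
apply: uniq_perm; rewrite ?uniq_sites ?(map_inj_uniq rot_inj) ?uniq_sites//.
move=> [a b]; apply/mapP/idP => [[[a' b']]|].
  by rewrite !mem_sites => /= /andP[h1 h2] [-> ->]; rewrite normrN h1 h2.
rewrite mem_sites /= => /andP[h1 h2]; exists (b, - a); last by rewrite /rot /= opprK.
by rewrite mem_sites /= normrN h1 h2.
Qed.

Lemma sum_rot N (g : site -> R) : \sum_(y <- sites N) g (rot y) = \sum_(y <- sites N) g y.
Proof. by rewrite -[RHS](perm_big _ (perm_rot N)) big_map. Qed.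

Lemma sum_opp N (g : site -> R) : \sum_(y <- sites N) g (- y) = \sum_(y <- sites N) g y.
Proof.
rewrite -(sum_rot N g) -(sum_rot N (fun y => g (rot y))).
by apply: eq_bigr => y _; rewrite rotrot.
Qed.

Lemma enorm_pt_rot n (y : site) : enorm (pt n (rot y) : R * R) = enorm (pt n y : R * R).
Proof. by rewrite /enorm /pt /= intrN mulNr sqrrN addrC. Qed.

Lemma Fn_rot n (y : site) : F_ n (rot y) = F_ n y.
Proof.
rewrite /Fn; suff -> : mu2 (square n (rot y) `&` (eball M `\` eball (r / n%:R))) =
  mu2 (square n y `&` (eball M `\` eball (r / n%:R))) by [].
have [_ h] := @rotation_scales_measure R 0 (-1) ltac:(ring).
rewrite -[RHS]mul1e -h; last first.
  apply: measurableI; last exact: measurable_annulus.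
  have e : square n y = [set z : P | (pt n y).1 - (2 * n%:R)^-1 <= z.1 <= (pt n y).1 + (2 * n%:R)^-1 /\
     (pt n y).2 - (2 * n%:R)^-1 <= z.2 <= (pt n y).2 + (2 * n%:R)^-1].
    by apply/seteqP; split => z; rewrite /square /= !ler_norml => -[/andP[h1 h2] /andP[h3 h4]];
      split; apply/andP; split; lra.
  by rewrite e; exact: measurable_box.
congr (mu2 _); apply/seteqP; split => -[a b] [].
  rewrite /square /annulus /eball /= intrN mulNr opprK => -[h1 h2] [h3 h4].
  have eE : enorm (0 * a - -1 * b, -1 * a + 0 * b) = enorm (a, b).
    by rewrite /enorm /=; congr Num.sqrt; ring.
  rewrite !eE; split=> //; split.
    by rewrite (_ : 0 * a - -1 * b - _ = b - y.1%:~R / n%:R)//; ring.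
  by rewrite (_ : -1 * a + 0 * b - _ = - (a + y.2%:~R / n%:R)) ?normrN//; ring.
have eE : enorm (0 * a - -1 * b, -1 * a + 0 * b) = enorm (a, b).
  by rewrite /enorm /=; congr Num.sqrt; ring.
rewrite /square /annulus /eball /= !eE intrN mulNr opprK => -[h1 h2] [h3 h4].
split=> //; split.
  by move: h2; rewrite (_ : -1 * a + 0 * b - _ = - (a - (- y.2%:~R) / n%:R)) ?normrN//; ring.
by move: h1; rewrite (_ : 0 * a + 1 * b - _ = b - y.1%:~R / n%:R)//; ring.
Qed.

Lemma pn_rot n (y : site) : p_ n (rot y) = p_ n y.
Proof.
rewrite /pn /wn Fn_rot enorm_pt_rot (_ : (rot y == 0) = (y == 0))//.
by case: y => a b; rewrite /rot /= /eq_op /= oppr_eq0 andbC.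
Qed.

Lemma pn_opp n (y : site) : p_ n (- y) = p_ n y.
Proof. by rewrite -rotrot !pn_rot. Qed.

Local Opaque kn Fn wn cn.

Lemma pnE n (y : site) : (0 < n)%N -> p_ n y = c_ n * w_ n y.
Proof.
move=> n0; rewrite /pn; case: eqP => // ->.
by rewrite wn0// mulr0.
Qed.

Lemma J_ge0 n : 0 <= J_ alpha r M n.
Proof. by apply: Rintegral_ge0 => w _; rewrite invr_ge0 powR_ge0. Qed.

Lemma cn_ge0 n : (0 < n)%N -> 0 <= c_ n.
Proof.
move=> n0; rewrite cnE// invr_ge0 addr_ge0 ?J_ge0// mulr_ge0 ?num_neighbors_ge0//.
exact/ltW/hk.
Qed.

Lemma pn_ge0 n (y : site) : (0 < n)%N -> 0 <= p_ n y.
Proof. by move=> n0; rewrite pnE// mulr_ge0 ?cn_ge0 ?wn_ge0. Qed.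

Lemma pn_box n y : (0 < n)%N -> p_ n y != 0 -> y \in box n.
Proof. by move=> n0; rewrite pnE// mulf_eq0 negb_or => /andP[_]; exact: wn_box. Qed.

Lemma pn_enorm n y : (0 < n)%N -> p_ n y != 0 -> enorm (pt n y : R * R) <= M + 1.
Proof. by move=> n0; rewrite pnE// mulf_eq0 negb_or => /andP[_]; exact: wn_enorm. Qed.

Definition d2 f x y := f (x + y) + f (x - y) - 2 * f x.

(** Defined on functions on the whole plane, so that step functions, smooth functions and test
    functions can be handled by the same operator. *)
Definition Ln n f x := n%:R `^ alpha * \sum_(y <- box n) p_ n y * (f (x + pt n y) - f x).

Lemma Ln_d2 n f x : Ln n f x = n%:R `^ alpha / 2 * \sum_(y <- box n) p_ n y * d2 f x (pt n y).
Proof.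
rewrite /Ln -mulrA; congr (_ * _).
rewrite (_ : \sum_(y <- box n) p_ n y * d2 f x (pt n y) =
  \sum_(y <- box n) p_ n y * (f (x + pt n y) - f x) + \sum_(y <- box n) p_ n (- y) * (f (x + pt n (- y)) - f x)).
  by rewrite (sum_opp _ (fun y => p_ n y * (f (x + pt n y) - f x))); field.
rewrite -big_split /=; apply: eq_bigr => y _.
by rewrite pn_opp ptN /d2; ring.
Qed.

Lemma sum_pn n (g : site -> R) : (0 < n)%N ->
  n%:R `^ alpha * \sum_(y <- box n) p_ n y * g y =
  c_ n * (n%:R `^ alpha * k_ n * (\sum_(y <- box n) (is_neighbor y)%:R * g y) +
    \int[mu2]_(z in annulus r M n) (g (nearest n z) * (enorm (pt n (nearest n z) : R * R) `^ (2 + alpha))^-1)).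
Proof.
move=> n0; have nR : 0 < n%:R :> R by rewrite ltr0n.
have -> : \sum_(y <- box n) p_ n y * g y = c_ n * \sum_(y <- box n) w_ n y * g y.
  by rewrite mulr_sumr; apply: eq_bigr => y _; rewrite pnE// mulrA.
rewrite mulrCA; congr (_ * _).
rewrite sum_wn// mulrDr mulrA; congr (_ + _).
have mg := measurable_nearest (fun y => g y * (enorm (pt 1 y : R * R) `^ (2 + alpha))^-1) n0.
have [B hB] : exists B, forall y, y \in box n -> `|g y * (enorm (pt 1 y : R * R) `^ (2 + alpha))^-1| <= B.
  exists (\sum_(y <- box n) `|g y * (enorm (pt 1 y : R * R) `^ (2 + alpha))^-1|) => y yb.
  rewrite (bigD1_seq y) ?uniq_sites//= lerDl; exact: sumr_ge0.
rewrite mulrA -RintegralZl; last 2 first.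
- exact: measurable_annulus.
- apply: (bounded_integrable (C := B)) => //; [exact: measurable_annulus|exact: annulus_lty|].
  by move=> z [zM _]; apply: hB; exact: Nbox_nearest.
apply: eq_Rintegral => z _; rewrite mulrCA; congr (_ * _).
rewrite [in RHS]enorm_pt// powRMp ?enorm_ge0// powRN invfM invrK mulrC; congr (_ * _).
by rewrite -(@powR_mulrn _ n%:R 2) ?ler0n// -powRDp// addrC.
Qed.

(* Holds for functions with Lipschitz gradient; it is all that the convergence of [Ln] to
   [LM] uses. *)
Definition d2_lip (C : R) f x := forall y z,
  `|d2 f x y - d2 f x z| <= C * enorm (y - z) * (enorm y + enorm z).

Lemma d2_0 f x : d2 f x 0 = 0.
Proof. by rewrite /d2 subr0 addr0; ring. Qed.

Lemma d2_lip_bound C f x y : d2_lip C f x -> `|d2 f x y| <= C * enorm y ^+ 2.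
Proof. by move=> /(_ y 0); rewrite d2_0 !subr0 enorm0 addr0 expr2 mulrA. Qed.

Lemma measurable_d2 f x : mfun2 f -> mfun2 (d2 f x).
Proof.
move=> mf; apply: measurable_funB => //; apply: measurable_funD.
  have [mT _] := @affine_scales_measure R x.1 x.2 1 ltr01.
  rewrite (_ : (fun y => f (x + y)) = f \o (fun z => (x.1 + 1 * z.1, x.2 + 1 * z.2))).
    exact: measurableT_comp.
  by apply/funext => -[a b] /=; rewrite !mul1r; case: x {mT}.
have [mT _] := @affine_scales_measure R x.1 x.2 1 ltr01.
rewrite (_ : (fun y => f (x - y)) = f \o (fun z => (x.1 - z.1, x.2 - z.2))).
  apply: measurableT_comp => //.
  by apply: measurable_fun_pair; apply: measurable_funB.
by apply/funext => -[a b] /=; case: x {mT}.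
Qed.

(** [s] is half the room between alpha and 2: |z|^(-alpha-s) is still integrable at 0, and the rate
    n^(-s) is gained in exchange. From |z| = [kap] / n on, z is outside the hole and the norm of its
    nearest site is between |z| / 2 and 2 |z|. [K1] adds the constants of the regions below and
    above this threshold. *)
Let s : R := (2 - alpha) / 2.
Let kap : R := Num.max r 2.
Let b : R := 2 + alpha.
Let K1 : R := (1 + 2 `^ alpha) * kap `^ s + (3 * 2 `^ b + b * 2 `^ (b + 1)).

Let s_gt0 : 0 < s. Proof. by rewrite /s; move: alpha_lt2; lra. Qed.
Let s_lt1 : s < 1. Proof. by rewrite /s; move: alpha_gt1; lra. Qed.
Let kap_ge2 : 2 <= kap. Proof. by rewrite /kap le_max lexx orbT. Qed.
Let kap_ger : r <= kap. Proof. by rewrite /kap le_max lexx. Qed.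
Let kap_gt0 : 0 < kap. Proof. by move: kap_ge2; lra. Qed.
Let b_gt0 : 0 < b. Proof. by rewrite /b; move: alpha_gt0; lra. Qed.

Lemma le_powR_inv (a t q : R) : 0 < t -> t <= a -> 0 < q -> (a `^ q)^-1 <= (t `^ q)^-1.
Proof.
move=> t0 ta q0; have a0 := lt_le_trans t0 ta.
rewrite lef_pV2 ?posrE ?powR_gt0//.
by apply: ge0_ler_powR; rewrite ?nnegrE ?(ltW t0) ?(ltW a0) ?(ltW q0).
Qed.

Lemma d2_kernel_bound C f x z : 0 <= C -> d2_lip C f x ->
  `|d2 f x z * (enorm z `^ b)^-1| <= C * (enorm z `^ alpha)^-1.
Proof.
move=> C0 hf; have [z0|z0] := eqVneq (enorm z) 0.
  by rewrite z0 !powR0 ?invr0 ?mulr0 ?normr0// gt_eqF.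
have zp : 0 < enorm z by rewrite lt_neqAle eq_sym z0 enorm_ge0.
rewrite normrM [X in _ * X]ger0_norm ?invr_ge0 ?powR_ge0//.
apply: (@le_trans _ _ (C * enorm z ^+ 2 * (enorm z `^ b)^-1)).
  by rewrite ler_wpM2r ?invr_ge0 ?powR_ge0//; exact: d2_lip_bound.
rewrite -mulrA ler_wpM2l// /b powRDp// (@powR_mulrn _ _ 2) ?enorm_ge0// invfM mulrA.
by rewrite mulfV ?mul1r// gt_eqF// exprn_gt0.
Qed.

(** For |z| < kap / n both terms are O(|z|^(-alpha)), and |z|^s <= (kap / n)^s. For larger |z|
    moving to the nearest site costs O(|z|^(-alpha-1) / n), by [d2_lip] and the mean value bound for
    the power, and n^(-(1-s)) <= |z|^(1-s). *)
Lemma kernel_sum_error C f x n z : (0 < n)%N -> 0 <= C -> d2_lip C f x -> eball M z ->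
  `|\1_(annulus r M n) z * (d2 f x (pt n (nearest n z)) * (enorm (pt n (nearest n z) : R * R) `^ b)^-1)
     - d2 f x z * (enorm z `^ b)^-1|
  <= C * (K1 * n%:R `^ (- s) * (enorm z `^ (alpha + s))^-1).
Proof.
move=> n0 C0 hf zM; have nR : 0 < n%:R :> R by rewrite ltr0n.
have ni0 : 0 < n%:R^-1 :> R by rewrite invr_gt0.
have nsp : 0 < n%:R `^ (- s) :> R by exact: powR_gt0.
have K1ge : 0 <= 3 * 2 `^ b + b * 2 `^ (b + 1).
  by rewrite addr_ge0 ?mulr_ge0 ?powR_ge0// ltW.
have K2ge : 0 <= (1 + 2 `^ alpha) * kap `^ s.
  by rewrite mulr_ge0 ?addr_ge0 ?powR_ge0.
set v := pt n (nearest n z).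
have hzv : enorm (z - v) <= n%:R^-1 := enorm_nearest z n0.
have [z0|z0] := eqVneq (enorm z) 0.
  have -> : z = 0 by apply/eqP; rewrite -enorm_eq0 z0.
  rewrite d2_0 mul0r subr0 indicE memNset ?mul0r ?normr0.
    by rewrite !mulr_ge0 ?invr_ge0 ?powR_ge0//; rewrite /K1 addr_ge0.
  by rewrite /annulus /= => -[_]; rewrite /eball /= enorm0; apply; rewrite divr_gt0.
have zp : 0 < enorm z by rewrite lt_neqAle eq_sym z0 enorm_ge0.
have e1 := enormD (z - v) v; rewrite subrK in e1.
have e2 := enormB z (z - v); rewrite subKr in e2.
have zinv : 0 <= (enorm z `^ (alpha + s))^-1 by rewrite invr_ge0 powR_ge0.
have [zk|zk] := ltP (enorm z) (kap / n%:R).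
  apply: (@le_trans _ _ (C * ((1 + 2 `^ alpha) * (enorm z `^ alpha)^-1))).
    apply: (le_trans (ler_normB _ _)).
    have -> : C * ((1 + 2 `^ alpha) * (enorm z `^ alpha)^-1) =
      C * (2 `^ alpha * (enorm z `^ alpha)^-1) + C * (enorm z `^ alpha)^-1 by ring.
    apply: lerD; last exact: d2_kernel_bound.
    apply: (le_trans (norm_indicM_le _ _ _)); apply: (le_trans (d2_kernel_bound _ C0 hf)).
    (* If the nearest site is the origin, its term is 0 by the conventions for powers and inverses
       of 0. Any other site has norm at least 1/n, hence at least |z| / 2. *)
    rewrite ler_wpM2l//; have [y0|y0] := eqVneq (nearest n z) 0.
      by rewrite /v y0 pt0 enorm0 powR0 ?invr0 ?mulr_ge0 ?invr_ge0 ?powR_ge0// gt_eqF.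
    have v1 : n%:R^-1 <= enorm v.
      by rewrite /v enorm_pt// -[leLHS]mul1r ler_wpM2r ?invr_ge0// enorm_pt1_ge1.
    have zv : enorm z / 2 <= enorm v by lra.
    apply: (@le_trans _ _ ((enorm z / 2) `^ alpha)^-1).
      by apply: le_powR_inv => //; lra.
    by rewrite powRMp ?enorm_ge0// powRN invf_div.
  rewrite ler_wpM2l// -mulrA.
  apply: (@le_trans _ _ ((1 + 2 `^ alpha) * kap `^ s * (n%:R `^ (- s) * (enorm z `^ (alpha + s))^-1))); last first.
    by rewrite ler_wpM2r ?mulr_ge0 ?(ltW nsp)// /K1 lerDl.
  rewrite -!mulrA ler_wpM2l ?addr_ge0 ?powR_ge0//.
  have -> : (enorm z `^ alpha)^-1 = enorm z `^ s * (enorm z `^ (alpha + s))^-1.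
    rewrite powRDp// invfM mulrCA mulfV ?mulr1// gt_eqF// powR_gt0//.
  rewrite mulrA ler_wpM2r//.
  rewrite powRN -[X in _ <= _ * X]powRN -powRMp ?(ltW kap_gt0)//.
  by apply: ge0_ler_powR; rewrite ?nnegrE ?(ltW s_gt0) ?(ltW zp) ?divr_ge0 ?(ltW kap_gt0) ?(ltW zk)// ltW.
have kn2 : 2 * n%:R^-1 <= enorm z by apply: le_trans zk; rewrite ler_wpM2r// ltW.
have knr : r / n%:R <= enorm z by apply: le_trans zk; rewrite ler_wpM2r// ltW.
rewrite indicE mem_set ?mul1r; last by split => //; rewrite /eball /=; apply/negP; rewrite -leNgt.
have zv : enorm z / 2 <= enorm v by lra.
have vz : enorm v <= 2 * enorm z by lra.
have vp : 0 < enorm v by lra.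
have half (q : R) : 2 `^ q / enorm z `^ q = ((enorm z / 2) `^ q)^-1.
  by rewrite powRMp ?enorm_ge0// powRN invf_div.
have -> : d2 f x v * (enorm v `^ b)^-1 - d2 f x z * (enorm z `^ b)^-1 =
   (d2 f x v - d2 f x z) * (enorm v `^ b)^-1 + d2 f x z * ((enorm v `^ b)^-1 - (enorm z `^ b)^-1) by ring.
apply: (@le_trans _ _ (C * (n%:R^-1 * enorm z * (3 * 2 `^ b) * (enorm z `^ b)^-1) +
   C * (enorm z ^+ 2 * (b * n%:R^-1 * (2 `^ (b + 1) * (enorm z `^ (b + 1))^-1))))).
  apply: (le_trans (ler_normD _ _)); apply: lerD; rewrite normrM.
    rewrite [X in _ * X]ger0_norm ?invr_ge0 ?powR_ge0//.
    apply: (@le_trans _ _ (C * (n%:R^-1 * (3 * enorm z)) * ((enorm z / 2) `^ b)^-1)).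
      apply: ler_pM => //; rewrite ?invr_ge0 ?powR_ge0//; last first.
        by apply: le_powR_inv => //; lra.
      apply: (le_trans (hf v z)); rewrite -mulrA ler_wpM2l//.
      have := enormN (v - z); rewrite opprB => <-.
      by apply: ler_pM => //; rewrite ?addr_ge0 ?enorm_ge0//; lra.
    by rewrite -half; rewrite le_eqVlt; apply/orP; left; apply/eqP; ring.
  rewrite [leRHS]mulrA; apply: ler_pM => //; first exact: d2_lip_bound.
  have hb (p q : R) : enorm z / 2 <= p -> p <= q -> q - p <= n%:R^-1 ->
      0 <= (p `^ b)^-1 - (q `^ b)^-1 <= b * n%:R^-1 * (2 `^ (b + 1) * (enorm z `^ (b + 1))^-1).
    move=> zp2 pq qp; have p0 : 0 < p by lra.
    have /andP[h1 h2] := powRN_diff p0 pq b_gt0; rewrite h1 /=; apply: (le_trans h2).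
    apply: ler_pM; rewrite ?invr_ge0 ?powR_ge0 ?mulr_ge0 ?subr_ge0 ?(ltW b_gt0)//.
      by rewrite ler_wpM2l// ltW.
    by rewrite half; apply: le_powR_inv => //; move: b_gt0; lra.
  have zle : enorm z / 2 <= enorm z by lra.
  have [vz'|zv'] := leP (enorm v) (enorm z).
    have /andP[k1 k2] := hb _ _ zv vz' ltac:(lra).
    by rewrite ger0_norm.
  have /andP[k1 k2] := hb _ _ zle (ltW zv') ltac:(lra).
  by rewrite distrC ger0_norm.
rewrite -mulrDr ler_wpM2l//.
have E : (enorm z `^ (b + 1))^-1 = (enorm z `^ 2)^-1 * ((enorm z `^ alpha)^-1 * (enorm z)^-1).
  by rewrite powRDp// /b powRDp// powRr1 ?enorm_ge0// !invfM mulrA.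
have E' : (enorm z `^ b)^-1 = (enorm z `^ 2)^-1 * (enorm z `^ alpha)^-1.
  by rewrite /b powRDp// invfM.
rewrite E E' (@powR_mulrn _ _ 2) ?enorm_ge0//.
have -> : n%:R^-1 * enorm z * (3 * 2 `^ b) * ((enorm z ^+ 2)^-1 * (enorm z `^ alpha)^-1) +
  enorm z ^+ 2 * (b * n%:R^-1 * (2 `^ (b + 1) * ((enorm z ^+ 2)^-1 * ((enorm z `^ alpha)^-1 * (enorm z)^-1)))) =
  (3 * 2 `^ b + b * 2 `^ (b + 1)) * (n%:R^-1 * ((enorm z)^-1 * (enorm z `^ alpha)^-1)).
  move: (2 `^ b) (2 `^ (b + 1)) ((enorm z `^ alpha)^-1) (n%:R^-1 : R) => a1 a2 a3 a4.
  by field; rewrite gt_eqF.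
rewrite -mulrA.
apply: (@le_trans _ _ ((3 * 2 `^ b + b * 2 `^ (b + 1)) * (n%:R `^ (- s) * (enorm z `^ (alpha + s))^-1))); last first.
  by rewrite ler_wpM2r ?mulr_ge0 ?(ltW nsp)// /K1 lerDr.
rewrite ler_wpM2l//.
have -> : (n%:R^-1 : R) = n%:R `^ (- s) * n%:R `^ (- (1 - s)).
  by rewrite -powRDp// -powR_inv1 ?ler0n//; congr (_ `^ _); ring.
rewrite -mulrA ler_wpM2l ?(ltW nsp)//.
have -> : (enorm z `^ (alpha + s))^-1 = enorm z `^ (1 - s) * ((enorm z)^-1 * (enorm z `^ alpha)^-1).
  rewrite -!powRN -powR_inv1 ?enorm_ge0// -!powRDp//; congr (_ `^ _); ring.
rewrite ler_wpM2r ?mulr_ge0 ?invr_ge0 ?powR_ge0 ?enorm_ge0//.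
have -> : n%:R `^ (- (1 - s)) = (n%:R^-1) `^ (1 - s) :> R.
  by rewrite -powR_inv1 ?ler0n// -powRrM; congr (_ `^ _); ring.
apply: ge0_ler_powR; rewrite ?nnegrE ?enorm_ge0 ?(ltW ni0)//; last by lra.
by move: s_lt1; lra.
Qed.

Lemma natr_powRN_cvg0 (q : R) : 0 < q -> n%:R `^ (- q) @[n --> \oo] --> (0 : R).
Proof.
move=> q0; apply/cvgrPdist_le => e e0.
exists (Num.truncn (e^-1 `^ q^-1)).+1 => // n /= hn.
rewrite sub0r normrN ger0_norm ?powR_ge0//.
have e1 : 0 < e^-1 by rewrite invr_gt0.
have h : e^-1 `^ q^-1 <= n%:R.
  by apply: (le_trans (ltW (truncnS_gt _))); rewrite ler_nat.
have n0 : 0 < n%:R :> R by apply: lt_le_trans h; exact: powR_gt0.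
rewrite powRN -[e]invrK lef_pV2 ?posrE ?powR_gt0//.
have -> : e^-1 = (e^-1 `^ q^-1) `^ q.
  by rewrite -powRrM mulVf ?gt_eqF// powRr1 ?(ltW e1).
by apply: ge0_ler_powR; rewrite ?nnegrE ?powR_ge0 ?(ltW q0) ?(ltW n0).
Qed.

Let Ia : R := \int[mu2]_(z in eball M) (enorm z `^ alpha)^-1.
Let Is : R := \int[mu2]_(z in eball M) (enorm z `^ (alpha + s))^-1.

Let as_lt2 : 0 < alpha + s < 2.
Proof. by apply/andP; rewrite /s; move: alpha_gt0 alpha_lt2; split; lra. Qed.

Lemma measurable_kernel f x (q : R) : mfun2 f -> mfun2 (fun z => d2 f x z * (enorm z `^ q)^-1).
Proof.
by move=> mf; apply: measurable_funM; [exact: measurable_d2|exact: measurable_enorm_powR].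
Qed.

Lemma integrable_kernel C f x : 0 <= C -> mfun2 f -> d2_lip C f x ->
  L1 (eball M) (fun z => d2 f x z * (enorm z `^ b)^-1).
Proof.
move=> C0 mf hf.
apply: (@dominated_integrable2 _ _ _ (fun z => C * (enorm z `^ alpha)^-1)).
- exact: measurable_eball.
- exact: measurable_kernel.
- apply: integrable2Z; first exact: measurable_eball.
  by apply: integrable_near0; rewrite alpha_gt0 alpha_lt2.
- by move=> z _; exact: d2_kernel_bound.
Qed.

(** The three sources of error are c_n - c, the nearest-neighbour part and the replacement of the
    integral by a lattice sum. The rate sees [f] and [x] only through C, so it is uniform in the
    point and over families with a common constant. *)
Theorem generator_cvg : exists2 eps : nat -> R, eps n @[n --> \oo] --> 0 &
  forall n f x C, (0 < n)%N -> 0 <= C -> mfun2 f -> d2_lip C f x ->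
    `|Ln n f x - L_M f x| <= C * eps n.
Proof.
pose eps n := 2^-1 * (`|c_ n - c| * Ia + `|c_ n| * (n%:R `^ (- (2 - alpha)) * `|k_ n| * num_neighbors
  + K1 * n%:R `^ (- s) * Is)).
exists eps.
  have c0 := cc_gt0 halpha hr hM hk.
  have hc := cn_cvg_cc halpha hr hM hk.
  have hkk := kn_cvg halpha hr hM.
  rewrite (_ : 0 = 2^-1 * (`|c - c| * Ia + `|c| * (0 * `|4^-1 * \int[mu2]_w H_ alpha r w| * num_neighbors + K1 * 0 * Is))); last first.
    by rewrite subrr normr0; ring.
  apply: cvgMr; apply: cvgD.
    by apply: cvgMl; apply: cvg_norm; apply: cvgB => //; exact: cvg_cst.
  apply: cvgM; first exact: cvg_norm.
  apply: cvgD; apply: cvgMl; last by apply: cvgMr; exact: natr_powRN_cvg0.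
  apply: cvgM; last exact: cvg_norm.
  by apply: natr_powRN_cvg0; move: alpha_lt2; lra.
move=> n f x C n0 C0 mf hf; have nR : 0 < n%:R :> R by rewrite ltr0n.
rewrite Ln_d2 mulrAC sum_pn//.
set S := \sum_(y <- _) _; set I2 := \int[mu2]_(z in annulus r M n) _.
have -> : L_M f x = c / 2 * \int[mu2]_(z in eball M) (d2 f x z * (enorm z `^ b)^-1) by [].
set I1 := \int[mu2]_(z in eball M) _.
have mB := measurable_eball M.
have I1le : `|I1| <= C * Ia.
  rewrite /Ia -RintegralZl//; last by apply: integrable_near0; rewrite alpha_gt0 alpha_lt2.
  apply: norm_Rintegral_le => //; first exact: measurable_kernel.
    by apply: integrable2Z => //; apply: integrable_near0; rewrite alpha_gt0 alpha_lt2.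
  by move=> z _; exact: d2_kernel_bound.
have I2E : I2 = \int[mu2]_(z in eball M) (\1_(annulus r M n) z * (d2 f x (pt n (nearest n z)) * (enorm (pt n (nearest n z) : R * R) `^ b)^-1)).
  rewrite /I2 Rintegral_indicM [RHS]Rintegral_indicM; apply: eq_Rintegral => z _.
  rewrite !indicE; have [zA|zA] := pselect (annulus r M n z).
    by rewrite (mem_set zA) (mem_set zA.1) !mul1r.
  by rewrite (memNset zA) !mul0r mulr0.
have mN : mfun2 (fun z => d2 f x (pt n (nearest n z)) * (enorm (pt n (nearest n z) : R * R) `^ b)^-1).
  exact: (measurable_nearest (fun y => d2 f x (pt n y) * (enorm (pt n y : R * R) `^ b)^-1)).
have mA := measurable_annulus r M n.
have LIs : L1 (eball M) (fun z => C * (K1 * n%:R `^ (- s)) * (enorm z `^ (alpha + s))^-1).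
  by apply: integrable2Z => //; exact: integrable_near0.
have m1 : mfun2 (fun z => \1_(annulus r M n) z * (d2 f x (pt n (nearest n z)) * (enorm (pt n (nearest n z) : R * R) `^ b)^-1)
     - d2 f x z * (enorm z `^ b)^-1).
  apply: measurable_funB; last exact: measurable_kernel.
  by apply: measurable_funM => //; exact: measurable_indic2.
have LI1 := integrable_kernel C0 mf hf.
have hI z : eball M z -> `|\1_(annulus r M n) z * (d2 f x (pt n (nearest n z)) * (enorm (pt n (nearest n z) : R * R) `^ b)^-1)
     - d2 f x z * (enorm z `^ b)^-1| <= C * (K1 * n%:R `^ (- s)) * (enorm z `^ (alpha + s))^-1.
  by move=> zM; rewrite -mulrA; exact: kernel_sum_error.
have I21 : `|I2 - I1| <= C * (K1 * n%:R `^ (- s)) * Is.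
  rewrite I2E /I1 -RintegralB//; last first.
    rewrite (_ : (fun z => _) = (fun z => (\1_(annulus r M n) z * (d2 f x (pt n (nearest n z)) * (enorm (pt n (nearest n z) : R * R) `^ b)^-1)
     - d2 f x z * (enorm z `^ b)^-1) + d2 f x z * (enorm z `^ b)^-1)).
      by apply: integrable2D => //; exact: dominated_integrable2 LIs hI.
    by apply/funext => z; rewrite subrK.
  rewrite /Is -RintegralZl//; last exact: integrable_near0.
  exact: norm_Rintegral_le.
have Sle : `|S| <= C * (num_neighbors * n%:R ^- 2).
  rewrite -(sum_neighbors halpha hr hM n0) mulr_suml mulr_sumr.
  apply: (le_trans (ler_norm_sum _ _ _)); apply: ler_sum => y _.
  case hy : (is_neighbor y); last by rewrite !mul0r normr0 mulr0.
  rewrite !mul1r; apply: (le_trans (d2_lip_bound _ hf)).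
  move: hy; rewrite -(@enorm_pt_neighbor R n y n0) => /eqP ->.
  by rewrite exprVn.
have -> : c_ n * (n%:R `^ alpha * k_ n * S + I2) / 2 - c / 2 * I1 =
  2^-1 * ((c_ n - c) * I1 + c_ n * (n%:R `^ alpha * k_ n * S + (I2 - I1))) by field.
rewrite normrM ger0_norm ?invr_ge0//.
have -> : C * eps n = 2^-1 * (`|c_ n - c| * (C * Ia) + `|c_ n| *
    (n%:R `^ (- (2 - alpha)) * `|k_ n| * (C * num_neighbors) + C * (K1 * n%:R `^ (- s)) * Is)).
  by rewrite /eps; move: Ia Is K1 => A B D; ring.
rewrite ler_pM2l ?invr_gt0//.
apply: (le_trans (ler_normD _ _)); apply: lerD.
  by rewrite normrM; apply: ler_wpM2l.
rewrite normrM; apply: ler_wpM2l => //.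
apply: (le_trans (ler_normD _ _)); apply: lerD => //.
rewrite normrM [`|n%:R `^ alpha * _|]normrM (ger0_norm (powR_ge0 _ _)).
apply: (@le_trans _ _ (n%:R `^ alpha * `|k_ n| * (C * (num_neighbors * n%:R ^- 2)))).
  by apply: ler_wpM2l => //; rewrite mulr_ge0 ?powR_ge0.
have -> : n%:R `^ (- (2 - alpha)) = n%:R `^ alpha * n%:R ^- 2 :> R.
  by rewrite opprB powRDp// powRN (@powR_mulrn _ _ 2) ?ler0n.
by rewrite le_eqVlt; apply/orP; left; apply/eqP; ring.
Qed.

End Generator.

(** * Least action principle *)

Section Toppling.
Context {R : realType}.
Local Notation mu := (@lebesgue_measure R).
Local Notation P := (measurableTypeR R * measurableTypeR R)%type.
Local Notation measurable2 := (@measurable _ P).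
Local Notation mfun2 f := (@measurable_fun _ _ P R setT f).
Local Notation L1 D f := (mu2.-integrable (D : set P) (EFin \o f)).

Context (alpha r M : R) (halpha : 1 < alpha < 2) (hr : 0 < r < M) (hM : 1 < M).
Context (hk : forall n : nat, (0 < n)%N -> 0 < kn r M alpha n).

Local Notation k_ := (kn r M alpha).
Local Notation F_ := (Fn r M).
Local Notation w_ := (wn r M alpha).
Local Notation c_ := (cn r M alpha).
Local Notation p_ := (pn r M alpha).
Local Notation c := (cc r M alpha).
Local Notation box n := (sites (Nbox M n)).
Local Notation L_M := (LM r M alpha).

Context (n : nat) (n_gt0 : (0 < n)%N) (m0 : site -> R) (xs : nat -> site).
Context (hxs : toppling_sequence r M alpha n m0 xs).

Local Notation mass_ := (mass r M alpha n m0 xs).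
Local Opaque pn.

(** As [pn] is even, this is also the mass that [z] receives when every site emits [e]. *)
Definition avg (e : site -> R) (z : site) : R := \sum_(y <- box n) p_ n y * e (z + y).

Fixpoint emitted (k : nat) : site -> R :=
  if k is k'.+1 then
    fun z => emitted k' z + (if (z == xs k') && (1 <= mass_ k' z) then mass_ k' z - 1 else 0)
  else fun=> 0.

Lemma avgD (e e' : site -> R) z : avg (fun x => e x + e' x) z = avg e z + avg e' z.
Proof. by rewrite /avg -big_split /=; apply: eq_bigr => y _; rewrite mulrDr. Qed.

Lemma avg_delta (a : R) (x z : site) :
  avg (fun z => if z == x then a else 0) z = a * p_ n (z - x).
Proof.
rewrite /avg; have [xb|xb] := boolP (x - z \in box n).
  rewrite (bigD1_seq (x - z)) ?uniq_sites//= big1 ?addr0.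
    have -> : z + (x - z) = x by rewrite addrC subrK.
    by rewrite eqxx mulrC -(pn_opp _ _ _ n (x - z)) opprB.
  move=> y /negP yx; case: eqP => [h|]; last by rewrite mulr0.
  by case: yx; rewrite -h addrC addKr.
rewrite big1_seq => [|y /= yb].
  have [->|h] := eqVneq (p_ n (z - x)) 0; first by rewrite mulr0.
  case/negP: xb; apply: (@pn_box R alpha r M) => //.
  by rewrite -opprB pn_opp.
case: eqP => [h|]; last by rewrite mulr0.
by case/negP: xb; rewrite -h addrC addKr.
Qed.

(** The order of the topplings has disappeared: the current mass depends only on the emitted
    masses. *)
Lemma mass_emitted k z : mass_ k z = m0 z + avg (emitted k) z - emitted k z.
Proof.
elim: k z => [|k IHk] z.
  by rewrite /avg /= big1 ?addr0 ?subr0// => y _; rewrite mulr0.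
rewrite [LHS]/= /topple; set x := xs k; set m := mass_ k.
have [mx|mx] := leP 1 (m x); last first.
  rewrite {1}/m IHk; congr (_ + _ - _).
    apply: eq_bigr => y _; congr (_ * _); rewrite /= -/x -/m.
    by case: eqP => [->|] /=; rewrite ?addr0//; case: leP mx; rewrite ?addr0.
  rewrite /= -/x -/m; case: eqP => [->|] /=; rewrite ?addr0//.
  by case: leP mx; rewrite ?addr0.
have -> : emitted k.+1 = fun z => emitted k z + (if z == x then m x - 1 else 0).
  apply/funext => w /=; rewrite -/x -/m; case: eqP => [->|] //=.
  by rewrite mx.
rewrite avgD avg_delta -/m.
have := IHk z; rewrite -/m; case: eqP => [->|_] ->; last by ring.
by ring.
Qed.

Lemma mass_ge_emitted_ge0 k z : 0 <= emitted k z.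
Proof.
elim: k => //= k IHk; rewrite addr_ge0//.
by case: ifP => // /andP[_]; rewrite subr_ge0.
Qed.

Lemma emitted_le k z : emitted k z <= emitted k.+1 z.
Proof.
rewrite /= lerDl; by case: ifP => // /andP[_]; rewrite subr_ge0.
Qed.

Lemma emitted_nd z : nondecreasing_seq (fun k => emitted k z).
Proof. by apply/nondecreasing_seqP => k; exact: emitted_le. Qed.

Lemma avg_le (e e' : site -> R) z :
  (forall y, p_ n y != 0 -> e (z + y) <= e' (z + y)) -> avg e z <= avg e' z.
Proof.
move=> h; apply: ler_sum => y _; have [->|p0] := eqVneq (p_ n y) 0; first by rewrite !mul0r.
by apply: ler_wpM2l; [exact: (pn_ge0 halpha hr hM hk)|exact: h].
Qed.

(* A site just toppled has emitted exactly [m0 + avg - 1] so far, and [W] dominates this. *)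
Lemma least_action (D D' : site -> Prop) (W : site -> R) :
  (forall k z, 0 < emitted k z -> D z) ->
  (forall z, D z -> m0 z + avg W z - W z <= 1) ->
  (forall z y, D z -> p_ n y != 0 -> D' (z + y)) ->
  (forall z, D' z -> 0 <= W z) ->
  forall k z, D' z -> emitted k z <= W z.
Proof.
move=> eD DW DD' W0; elim=> [|k IHk] z D'z /=; first exact: W0.
case: ifP => [/andP[/eqP zx mz]|_]; last by rewrite addr0 IHk.
(* A site of mass exactly 1 emits nothing. Otherwise its emitted mass becomes positive, so it
   belongs to [D], where [W] stabilizes. *)
have [m1|m1] := eqVneq (mass_ k z) 1; first by rewrite m1 subrr addr0 IHk.
have Dz : D z.
  apply: (eD k.+1) => /=; rewrite zx eqxx -zx mz /= ltr_wpDl ?mass_ge_emitted_ge0//.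
  by rewrite subr_gt0 lt_neqAle eq_sym m1.
rewrite mass_emitted; apply: (@le_trans _ _ (m0 z + avg W z - 1)); last first.
  by have := DW z Dz; lra.
have : avg (emitted k) z <= avg W z.
  by apply: avg_le => y py; apply: IHk; exact: DD'.
lra.
Qed.

(** * Limits of the emitted masses *)

Context (W0 : site -> R) (hW0 : forall z, 0 <= W0 z).
Context (W0_stable : forall z, m0 z + avg W0 z - W0 z <= 1).

Definition odo (z : site) : R := lim (emitted k z @[k --> \oo]).

Lemma emitted_le_W0 k z : emitted k z <= W0 z.
Proof. exact: (@least_action (fun=> True) (fun=> True)). Qed.

Lemma emitted_cvg z : emitted k z @[k --> \oo] --> odo z.
Proof.
apply: nondecreasing_is_cvgn; first exact: emitted_nd.
by exists (W0 z) => _ [k _ <-]; exact: emitted_le_W0.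
Qed.

Lemma emitted_le_odo k z : emitted k z <= odo z.
Proof.
apply: nondecreasing_cvgn_le; first exact: emitted_nd.
by apply/cvg_ex; exists (odo z); exact: emitted_cvg.
Qed.

Lemma odo_ge0 z : 0 <= odo z.
Proof. exact: emitted_le_odo 0%N z. Qed.

Lemma odo_le (B : R) z : (forall k, emitted k z <= B) -> odo z <= B.
Proof. by move=> h; apply: (cvgr_to_le (@emitted_cvg z)); apply: nearW. Qed.

Lemma avg_cvg z : avg (emitted k) z @[k --> \oo] --> avg odo z.
Proof.
rewrite /avg; elim: (box n) => [|y s IHs].
  under eq_fun do rewrite big_nil.
  by rewrite big_nil; exact: cvg_cst.
under eq_fun do rewrite big_cons.
by rewrite big_cons; apply: cvgD => //; apply: cvgMr; exact: emitted_cvg.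
Qed.

Lemma mass_cvg z : mass_ k z @[k --> \oo] --> m0 z + avg odo z - odo z.
Proof.
under eq_fun do rewrite mass_emitted.
by apply: cvgB; [apply: cvgD; [exact: cvg_cst|exact: avg_cvg]|exact: emitted_cvg].
Qed.

Lemma final_massE z : final_mass r M alpha n m0 xs z = m0 z + avg odo z - odo z.
Proof. by rewrite /final_mass; apply/cvg_lim => //; exact: mass_cvg. Qed.

Lemma mass_toppled k : mass_ k.+1 (xs k) <= 1.
Proof.
rewrite /= /topple; case: (leP 1 (mass_ k (xs k))) => [h|]; last exact: ltW.
by rewrite eqxx subrr (_ : p_ n 0 = 0) ?mulr0 ?addr0// /pn eqxx.
Qed.

(** A limit above 1 would keep the mass above 1 from some time on, but a site that is ever full is
    toppled again after that time, and just after a toppling its mass is at most 1. A site that is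
    never full has mass below 1 throughout. *)
Lemma final_mass_le1 z : final_mass r M alpha n m0 xs z <= 1.
Proof.
rewrite final_massE; have hc := @mass_cvg z.
have [[k hk1]|hn] := pselect (exists k, 1 <= mass_ k z); last first.
  apply: (cvgr_to_le hc); apply: nearW => k; apply/ltW; rewrite ltNge; apply/negP => h.
  by apply: hn; exists k.
rewrite leNgt; apply/negP => h1.
have [N _ hN] : \forall k \near \oo, 1 < mass_ k z by exact: (cvgr_gt _ hc).
have [l Nl xl] := hxs.2 z k hk1 N.
have := hN l.+1 (leqW Nl); rewrite /= ltNge.
by rewrite -/(mass_ l.+1 z) -xl mass_toppled.
Qed.

End Toppling.

(** * Smooth compactly supported functions *)

Section Calculus.
Context {R : realType}.
Local Notation mu := (@lebesgue_measure R).
Local Notation P := (measurableTypeR R * measurableTypeR R)%type.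
Local Notation measurable2 := (@measurable _ P).
Local Notation mfun2 f := (@measurable_fun _ _ P R setT f).
Local Notation L1 D f := (mu2.-integrable (D : set P) (EFin \o f)).
Implicit Types (f g : R * R -> R).

Lemma is_derive_line f (x v : R * R) (s : R) : differentiable f (x + s *: v) ->
  is_derive s (1 : R) (fun t : R => f (x + t *: v)) ('D_v f (x + s *: v)).
Proof.
move=> df; have := @diff_derivable _ _ _ _ _ v df.
rewrite /derivable /= => dv.
have e : (fun h : R => h^-1 *: (((fun t : R => f (x + t *: v)) \o shift s) (h *: (1 : R)) - f (x + s *: v)))
   = (fun h : R => h^-1 *: ((f \o shift (x + s *: v)) (h *: v) - f (x + s *: v))).
  apply/funext => h /=; congr (_ *: (f _ - _)).
  by rewrite (_ : h *: (1 : R) = h) ?scalerDl 1?addrCA//; exact: mulr1.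
by split; rewrite ?/derivable ?/derive /= e.
Qed.

Lemma derive_partials f (x v : R * R) : differentiable f x ->
  'D_v f x = v.1 * 'D_(1, 0) f x + v.2 * 'D_(0, 1) f x.
Proof.
move=> df; rewrite !deriveE//.
have {1}-> : v = v.1 *: ((1, 0) : R * R) + v.2 *: ((0, 1) : R * R).
  case: v => a b; rewrite /GRing.scale /= /scale_pair /= /GRing.add /= /add_pair /=.
  by rewrite /GRing.scale /= !mulr0 !mulr1 addr0 add0r.
by have /= -> := linearP ('d f x) v.1 (1, 0) (v.2 *: (0, 1)); rewrite linearZ.
Qed.

Lemma mean_value (f df : R -> R) (C : R) : (forall s, is_derive s (1 : R) f (df s)) ->
  (forall s, 0 <= s <= 1 -> `|df s| <= C) -> `|f 1 - f 0| <= C.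
Proof.
move=> hf hC; have [|s] := @MVT_segment R f df 0 1 ler01.
- apply: derivable_within_continuous => s _; exact: ex_derive.
by rewrite in_itv /= => hs ->; rewrite subr0 mulr1; exact: hC.
Qed.

Lemma bounded_partials_lip f (C : R) : (forall x, differentiable f x) ->
  (forall x, `|'D_(1, 0) f x| <= C) -> (forall x, `|'D_(0, 1) f x| <= C) ->
  forall x v, `|f (x + v) - f x| <= 2 * C * enorm v.
Proof.
move=> df h1 h2 x v.
have := @mean_value (fun t : R => f (x + t *: v)) (fun t => 'D_v f (x + t *: v)) (2 * C * enorm v).
rewrite scale1r scale0r addr0; apply => s.
  exact: is_derive_line.
move=> _; rewrite derive_partials//.
apply: (le_trans (ler_normD _ _)); rewrite !normrM.
have C0 : 0 <= C by exact: le_trans (h1 x).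
rewrite (_ : 2 * C * enorm v = enorm v * C + enorm v * C); last by ring.
by apply: lerD; apply: ler_pM => //; rewrite ?enorm_ge_fst ?enorm_ge_snd.
Qed.

Lemma compact_support_bounded f (K : set (R * R)) : compact K -> continuous f ->
  (forall x, ~ K x -> f x = 0) -> exists C : R, forall x, `|f x| <= C.
Proof.
move=> cK cf f0; have : compact (f @` K).
  by apply: continuous_compact => //; exact: continuous_subspaceT.
move=> /compact_bounded [C [_ hC]]; exists (Num.max 0 (C + 1)) => x.
rewrite le_max; have [Kx|/f0 ->] := pselect (K x); last by rewrite normr0 lexx.
by apply/orP; right; apply: hC; [rewrite ltrDl|exists x].
Qed.

Lemma derive_outside f (K : set (R * R)) (v x : R * R) : closed K ->
  (forall x, ~ K x -> f x = 0) -> ~ K x -> 'D_v f x = 0.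
Proof.
move=> cK f0 Kx; rewrite -(@derive_cst R (R * R)%type R 0 x v).
apply: near_eq_derive; have : nbhs x (~` K).
  by apply: open_nbhs_nbhs; split => //; exact: closed_openC.
by apply: filterS => y /f0 ->.
Qed.

Lemma tsupport_closed f : closed (tsupport f).
Proof. exact: closed_closure. Qed.

Lemma tsupport0 f x : ~ tsupport f x -> f x = 0.
Proof. by move=> h; apply/eqP; apply: contra_notT h => fx; exact: subset_closure. Qed.

Lemma Ck_continuous k f : Ck k f -> continuous f.
Proof.
by case: k => [//|k] [df _ _] x; exact: differentiable_continuous.
Qed.

Lemma Ck1_lip f (K : set (R * R)) : compact K -> Ck 1 f -> (forall x, ~ K x -> f x = 0) ->
  exists2 C : R, 0 <= C & forall x v, `|f (x + v) - f x| <= C * enorm v.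
Proof.
move=> cK [df c1 c2] f0.
have clK : closed K by exact: compact_closed cK.
have [C1 h1] := compact_support_bounded cK c1 (fun x => @derive_outside f K (1, 0) x clK f0).
have [C2 h2] := compact_support_bounded cK c2 (fun x => @derive_outside f K (0, 1) x clK f0).
exists (2 * Num.max C1 C2).
  by rewrite mulr_ge0// le_max (le_trans _ (h1 0)).
apply: (@bounded_partials_lip f (Num.max C1 C2) df) => x.
  by rewrite le_max h1.
by rewrite le_max h2 orbT.
Qed.

Lemma dot_bound (w : R * R) (a b C1 C2 e : R) : `|a| <= C1 * e -> `|b| <= C2 * e ->
  `|w.1 * a + w.2 * b| <= (C1 + C2) * e * enorm w.
Proof.
move=> h1 h2; apply: (le_trans (ler_normD _ _)); rewrite !normrM.
have -> : (C1 + C2) * e * enorm w = enorm w * (C1 * e) + enorm w * (C2 * e) by ring.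
by apply: lerD; apply: ler_pM => //; rewrite ?enorm_ge_fst ?enorm_ge_snd.
Qed.

(** Along the segment zeta from z to y, the derivative of f (x + zeta) + f (x - zeta) is a
    difference of gradients at points 2 |zeta| apart; the gradient is Lipschitz and |zeta| <= |y| +
    |z|. *)
Lemma Ck2_d2_lip f (K : set (R * R)) : compact K -> Ck 2 f -> (forall x, ~ K x -> f x = 0) ->
  exists2 C : R, 0 <= C & forall x, d2_lip C f x.
Proof.
move=> cK [df c1 c2] f0; have clK : closed K by exact: compact_closed cK.
have [C1 C10 h1] := Ck1_lip cK c1 (fun x => @derive_outside f K (1, 0) x clK f0).
have [C2 C20 h2] := Ck1_lip cK c2 (fun x => @derive_outside f K (0, 1) x clK f0).
exists (2 * (C1 + C2)); first by rewrite mulr_ge0// addr_ge0.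
move=> x y z; set w := y - z.
have nd (a b : R * R) : derivable f a b by exact: diff_derivable.
pose zeta (s : R) := z + s *: w.
have hz s : 0 <= s <= 1 -> enorm (zeta s) <= enorm y + enorm z.
  move=> /andP[s0 s1].
  have -> : zeta s = ((1 - s) * z.1, (1 - s) * z.2) + (s * y.1, s * y.2).
    rewrite /zeta /w; case: (y) (z) => a b [a' b'].
    by congr pair; rewrite /= /GRing.scale /=; ring.
  apply: (le_trans (enormD _ _)); rewrite !enorm_scale addrC !ger0_norm ?subr_ge0//.
  by apply: lerD; rewrite ler_piMl ?enorm_ge0// gerBl.
have := @mean_value (fun t : R => f (x + z + t *: w) + f (x - z + t *: - w))
  (fun t => 'D_w f (x + z + t *: w) + 'D_(- w) f (x - z + t *: - w))
  (2 * (C1 + C2) * enorm w * (enorm y + enorm z)).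
have -> : d2 f x y - d2 f x z = f (x + z + 1 *: w) + f (x - z + 1 *: - w) - (f (x + z + 0 *: w) + f (x - z + 0 *: - w)).
  rewrite /d2 !scale1r !scale0r !addr0.
  rewrite (_ : x + z + w = x + y); last by rewrite /w -addrA; congr (_ + _); rewrite addrC subrK.
  rewrite (_ : x - z - w = x - y); last by rewrite /w opprB addrA subrK.
  by ring.
apply => s; first by apply: is_deriveD; apply: is_derive_line.
move=> s01; rewrite (derive_partials w (df _)) (derive_partials (- w) (df _)).
have -> : x + z + s *: w = (x - zeta s) + (zeta s + zeta s) by rewrite addrA subrK /zeta addrA.
have -> : x - z + s *: - w = x - zeta s by rewrite /zeta scalerN opprD addrA.
set a := x - zeta s; set b := zeta s + zeta s.
have hb : enorm b <= 2 * (enorm y + enorm z).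
  by rewrite mulrDl !mul1r; apply: (le_trans (enormD _ _)); apply: lerD; exact: hz.
have {}h1 := le_trans (h1 a b) (ler_wpM2l C10 hb).
have {}h2 := le_trans (h2 a b) (ler_wpM2l C20 hb).
move: h1 h2; move: ('D_(1, 0) f (a + b)) ('D_(1, 0) f a) ('D_(0, 1) f (a + b)) ('D_(0, 1) f a).
move=> p q p' q' h1 h2.
have -> : w.1 * p + w.2 * p' + ((- w).1 * q + (- w).2 * q') = w.1 * (p - q) + w.2 * (p' - q').
  by rewrite /=; ring.
by apply: (le_trans (dot_bound w h1 h2)); rewrite le_eqVlt; apply/orP/or_introl/eqP; ring.
Qed.

Definition supported (rad : R) f := forall x, rad <= enorm x -> f x = 0.

Lemma compact_supported f (K : set (R * R)) : compact K -> (forall x, ~ K x -> f x = 0) ->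
  exists2 rad : R, 0 < rad & supported rad f.
Proof.
move=> /compact_sub_eball[rad [r0 h]] f0; exists rad => // x hx; apply: f0 => /h.
by rewrite /eball /= ltNge hx.
Qed.

(** What the limits use of a test function; it holds for compactly supported C^2 functions too, and
    thus for [rho]. *)
Definition nice f := [/\ continuous f, exists C : R, forall x, `|f x| <= C,
  exists2 rad : R, 0 < rad & supported rad f &
  exists2 C : R, 0 <= C & forall x, d2_lip C f x].

Lemma Cck2_nice f : Cck 2 f -> nice f.
Proof.
move=> [cf cK]; have f0 := @tsupport0 f.
split; [exact: Ck_continuous cf| | |].
- by apply: compact_support_bounded cK _ f0; exact: Ck_continuous cf.
- exact: compact_supported cK f0.
- exact: Ck2_d2_lip cK cf f0.
Qed.

Lemma test_nice f : test_function f -> nice f.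
Proof. by move=> h; exact: Cck2_nice. Qed.

Lemma measurable_translate f (a : R * R) : mfun2 f -> mfun2 (fun x => f (x + a)).
Proof.
move=> mf; have [mT _] := @affine_scales_measure R a.1 a.2 1 ltr01.
rewrite (_ : (fun x => f (x + a)) = f \o (fun z => (a.1 + 1 * z.1, a.2 + 1 * z.2))).
  exact: measurableT_comp.
by apply/funext => -[u v] /=; rewrite !mul1r addrC; case: a {mT}.
Qed.

Lemma Rintegral_translate f (a : R * R) : mfun2 f ->
  \int[mu2]_x f (x + a) = \int[mu2]_x f x.
Proof.
move=> mf; have hT := @affine_scales_measure R a.1 a.2 1 ltr01.
have := @scales_Rintegral R _ _ setT f hT _ (measurableT) mf.
rewrite expr1n invr1 mul1r preimage_setT => <- //.
apply: eq_Rintegral => -[u v] _ /=; rewrite !mul1r addrC.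
by case: a {hT} => a b.
Qed.

Lemma reflection_scales_measure (a : R * R) : scales_measure (fun z : R * R => a - z) 1.
Proof.
have h1 := @rotation_scales_measure R (-1) 0.
have h2 := @affine_scales_measure R a.1 a.2 1 ltr01.
have := scales_measure_comp h2 (h1 _); rewrite expr1n invr1 mul1r.
rewrite (_ : _ \o _ = (fun z : R * R => a - z)); first by apply; ring.
by apply/funext => -[u v] /=; case: a {h1 h2} => a b; congr pair => /=; ring.
Qed.

Lemma measurable_reflect f (a : R * R) : mfun2 f -> mfun2 (fun x => f (a - x)).
Proof. by move=> mf; have [mT _] := reflection_scales_measure a; apply: measurableT_comp. Qed.

Lemma Rintegral_reflect f (a : R * R) : mfun2 f ->
  \int[mu2]_x f (a - x) = \int[mu2]_x f x.
Proof.
move=> mf; have := @scales_Rintegral R _ _ setT f (reflection_scales_measure a) ltr01 measurableT mf.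
by rewrite mul1r preimage_setT.
Qed.

Lemma supported_integrable f (rad C : R) : mfun2 f -> supported rad f ->
  (forall x, enorm x < rad -> `|f x| <= C) -> L1 setT f.
Proof.
move=> mf f0 hC; have mB := @measurable_eball R rad.
have LB : L1 setT (fun x => \1_(eball rad) x * f x).
  apply: integrable_indic => //; apply: (bounded_integrable (C := C)) => //.
  exact: mu2_eball_lty.
rewrite (_ : f = (fun x => \1_(eball rad) x * f x))//; apply/funext => x.
rewrite indicE; have [xr|xr] := ltP (enorm x) rad.
  by rewrite mem_set// mul1r.
by rewrite f0// mulr0.
Qed.

Lemma supported_Rintegral f (rad : R) : supported rad f ->
  \int[mu2]_x f x = \int[mu2]_(x in eball rad) f x.
Proof.
move=> f0; rewrite [RHS]Rintegral_indicM; apply: eq_Rintegral => x _.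
rewrite indicE; have [xr|xr] := ltP (enorm x) rad; first by rewrite mem_set// mul1r.
by rewrite f0// mulr0.
Qed.

Definition loc_bounded f := forall rad : R, exists C : R, forall x, enorm x <= rad -> `|f x| <= C.

Lemma continuous_loc_bounded f : continuous f -> loc_bounded f.
Proof.
move=> cf rad.
have cK : compact ([set` `[- rad, rad]] `*` [set` `[- rad, rad]] : set (R * R)).
  by apply: compact_setX; exact: segment_compact.
have : compact (f @` ([set` `[- rad, rad]] `*` [set` `[- rad, rad]])).
  by apply: continuous_compact => //; exact: continuous_subspaceT.
move=> /compact_bounded [C [_ hC]]; exists (C + 1) => x hx.
apply: hC; first by rewrite ltrDl.
exists x => //; split; rewrite /= in_itv /= -ler_norml.
  exact: le_trans (enorm_ge_fst _) hx.
exact: le_trans (enorm_ge_snd _) hx.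
Qed.

Lemma supportedW f (a b : R) : a <= b -> supported a f -> supported b f.
Proof. by move=> ab h x /(le_trans ab); exact: h. Qed.

Lemma loc_bounded_integrableM f g (rad C : R) : mfun2 f -> loc_bounded f -> mfun2 g ->
  supported rad g -> (forall x, `|g x| <= C) -> L1 setT (fun x => f x * g x).
Proof.
move=> mf /(_ rad)[Cf hf] mg g0 hg.
apply: (@supported_integrable _ rad (Cf * C)).
- exact: measurable_funM.
- by move=> x /g0 ->; rewrite mulr0.
- by move=> x /ltW /hf h; rewrite normrM; apply: ler_pM.
Qed.

Lemma loc_bounded_translate f (a : R * R) : loc_bounded f -> loc_bounded (fun x => f (x + a)).
Proof.
move=> h rad; have [C hC] := h (rad + enorm a); exists C => x hx; apply: hC.
by apply: (le_trans (enormD _ _)); rewrite lerD2r.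
Qed.

End Calculus.

(** * Symmetry of the generator *)

Section Duality.
Context {R : realType}.
Local Notation mu := (@lebesgue_measure R).
Local Notation P := (measurableTypeR R * measurableTypeR R)%type.
Local Notation measurable2 := (@measurable _ P).
Local Notation mfun2 f := (@measurable_fun _ _ P R setT f).
Local Notation L1 D f := (mu2.-integrable (D : set P) (EFin \o f)).

Context (alpha r M : R) (halpha : 1 < alpha < 2) (hr : 0 < r < M) (hM : 1 < M).
Context (hk : forall n : nat, (0 < n)%N -> 0 < kn r M alpha n).

Local Notation k_ := (kn r M alpha).
Local Notation F_ := (Fn r M).
Local Notation w_ := (wn r M alpha).
Local Notation c_ := (cn r M alpha).
Local Notation p_ := (pn r M alpha).
Local Notation c := (cc r M alpha).
Local Notation box n := (sites (Nbox M n)).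
Local Notation L_M := (LM r M alpha).

Let alpha_gt1 : 1 < alpha. Proof. by case/andP: halpha. Qed.
Let alpha_lt2 : alpha < 2. Proof. by case/andP: halpha. Qed.
Let alpha_gt0 : 0 < alpha. Proof. exact: lt_trans ltr01 alpha_gt1. Qed.
Let M_gt0 : 0 < M. Proof. exact: lt_trans ltr01 hM. Qed.

Implicit Types (f g phi : R * R -> R).
Local Opaque kn Fn wn cn pn.

Lemma measurable_Ln n f : mfun2 f -> mfun2 (Ln alpha r M n f).
Proof.
move=> mf; apply: measurable_funM => //.
under eq_fun => x do rewrite (big_nth 0) big_mkord.
apply: measurable_sum => i.
apply: measurable_funM => //; apply: measurable_funB => //.
exact: measurable_translate.
Qed.

Lemma Ln_supported n f rad : (0 < n)%N -> supported rad f ->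
  supported (rad + (M + 1)) (Ln alpha r M n f).
Proof.
move=> n0 h x hx; rewrite /Ln big1 ?mulr0// => y _.
have [->|py] := eqVneq (p_ n y) 0; first by rewrite mul0r.
have hy := @pn_enorm R alpha r M halpha hM n y n0 py.
rewrite !h ?subrr ?mulr0//.
  by apply: le_trans hx; rewrite lerDl addr_ge0// (ltW M_gt0).
have := enormB (x + pt n y) (pt n y); rewrite addrK => h2.
by rewrite -(lerD2r (enorm (pt n y))); apply: (le_trans _ (le_trans hx h2)); rewrite lerD2l.
Qed.

Lemma LM_supported f rad : supported rad f -> supported (rad + M) (L_M f).
Proof.
move=> h x hx; rewrite /LM.
rewrite (@eq_Rintegral _ _ _ mu2 (eball M) (cst 0)) ?Rintegral_cst; first by rewrite mul0r mulr0.
- exact: measurable_eball.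
- move=> y; rewrite inE /eball /= => hy.
  have h1 : rad <= enorm (x + y).
    have := enormB (x + y) y; rewrite addrK => h2.
    by rewrite -(lerD2r (enorm y)); apply: (le_trans _ (le_trans hx h2)); rewrite lerD2l ltW.
  have h2 : rad <= enorm (x - y).
    have := enormD (x - y) y; rewrite subrK => h2.
    by rewrite -(lerD2r (enorm y)); apply: (le_trans _ (le_trans hx h2)); rewrite lerD2l ltW.
  rewrite !h ?mulr0 ?subr0 ?addr0 ?mul0r//.
  by apply: le_trans hx; rewrite lerDl (ltW M_gt0).
Qed.

Lemma LM_kernelE f x : L_M f x = c / 2 * \int[mu2]_(y in eball M) (d2 f x y * (enorm y `^ (2 + alpha))^-1).
Proof. by []. Qed.

Lemma LM_bound f x C : 0 <= C -> mfun2 f -> d2_lip C f x ->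
  `|L_M f x| <= C * (c / 2 * \int[mu2]_(y in eball M) (enorm y `^ alpha)^-1).
Proof.
move=> C0 mf hf; have c0 := cc_gt0 halpha hr hM hk.
rewrite LM_kernelE normrM ger0_norm ?divr_ge0 ?(ltW c0)//.
rewrite mulrCA ler_wpM2l ?divr_ge0 ?(ltW c0)//.
have LA : L1 (eball M) (fun y => (enorm y `^ alpha)^-1).
  by apply: integrable_near0; rewrite alpha_gt0 alpha_lt2.
rewrite -RintegralZl//; last exact: measurable_eball.
apply: norm_Rintegral_le.
- exact: measurable_eball.
- exact: measurable_kernel.
- by apply: integrable2Z => //; exact: measurable_eball.
- by move=> y _; exact: d2_kernel_bound.
Qed.

Lemma Ln_cvg f x C : 0 <= C -> mfun2 f -> d2_lip C f x ->
  Ln alpha r M n f x @[n --> \oo] --> L_M f x.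
Proof.
move=> C0 mf hf; have [eps e0 he] := generator_cvg halpha hr hM hk.
apply/cvgrPdist_le => e ep.
have : C * eps n @[n --> \oo] --> 0 by rewrite -[X in _ --> X](mulr0 C); exact: cvgMr.
move=> /cvgrPdist_le /(_ e ep) [N _ hN]; exists N.+1 => // n /= Nn.
rewrite distrC; apply: (le_trans (he n f x C _ C0 mf hf)).
  exact: leq_ltn_trans Nn.
apply: (le_trans (ler_norm _)); have := hN n (ltnW Nn); by rewrite sub0r normrN.
Qed.

(** A pointwise limit of the functions [Ln f], which are finite sums of translates of [f]. *)
Lemma measurable_LM f : nice f -> mfun2 (L_M f).
Proof.
move=> [cf _ _ [C C0 hC]]; have mf := continuous_measurable2 cf.
apply: (@measurable_fun_cvg _ _ R setT (fun n => Ln alpha r M n f)) => [n|x _].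
  exact: measurable_Ln.
exact: Ln_cvg C0 mf (hC x).
Qed.

Lemma LM_bounded f : nice f -> exists C : R, forall x, `|L_M f x| <= C.
Proof.
move=> [cf _ _ [C C0 hC]]; have mf := continuous_measurable2 cf.
by eexists => x; exact: LM_bound C0 mf (hC x).
Qed.

(** Translating the integral moves a jump y from [f] to a jump -y of [g], and [pn] is even. *)
Lemma Ln_dual n f g rad C : (0 < n)%N -> mfun2 f -> loc_bounded f -> mfun2 g ->
  supported rad g -> (forall x, `|g x| <= C) ->
  \int[mu2]_x (Ln alpha r M n f x * g x) = \int[mu2]_x (f x * Ln alpha r M n g x).
Proof.
move=> n0 mf bf mg sg bg.
have E u v x : v x * Ln alpha r M n u x =
    \sum_(y <- box n) n%:R `^ alpha * p_ n y * (v x * u (x + pt n y) - v x * u x).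
  by rewrite /Ln mulrCA mulr_sumr mulr_sumr; apply: eq_bigr => y _; ring.
have L y : L1 setT (fun x => f (x + y) * g x).
  apply: (@loc_bounded_integrableM _ (fun x => f (x + y)) g rad C) => //.
    exact: measurable_translate.
  exact: loc_bounded_translate.
have L' y : L1 setT (fun x => f x * g (x + y)).
  apply: (@loc_bounded_integrableM _ f (fun x => g (x + y)) (rad + enorm y) C) => //.
    exact: measurable_translate.
  move=> x hx; apply: sg; have := enormB (x + y) y; rewrite addrK => h.
  by rewrite -(lerD2r (enorm y)); exact: le_trans hx h.
have L0 : L1 setT (fun x => f x * g x) by exact: loc_bounded_integrableM sg bg.
transitivity (\int[mu2]_x (\sum_(y <- box n) n%:R `^ alpha * p_ n y * (f (x + pt n y) * g x - f x * g x))).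
  apply: eq_Rintegral => x _; rewrite mulrC E; apply: eq_bigr => y _.
  by rewrite [g x * _]mulrC [g x * f x]mulrC.
transitivity (\int[mu2]_x (\sum_(y <- box n) n%:R `^ alpha * p_ n y * (f x * g (x + pt n y) - f x * g x))); last first.
  by apply: eq_Rintegral => x _; rewrite E.
rewrite !Rintegral_big_sum//; last 2 first.
- by move=> y; apply: integrable2Z => //; exact: integrable2B.
- by move=> y; apply: integrable2Z => //; exact: integrable2B.
rewrite -sum_opp; apply: eq_bigr => y _.
rewrite RintegralZl//; last exact: integrable2B.
rewrite RintegralZl//; last exact: integrable2B.
rewrite RintegralB// RintegralB// pn_opp ptN; congr (_ * (_ - _)).
have := @Rintegral_translate R (fun x => f x * g (x + pt n y)) (- pt n y).
rewrite (_ : (fun x => f (x - pt n y) * g (x - pt n y + pt n y)) = (fun x => f (x + - pt n y) * g x)).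
  by apply; apply: measurable_funM => //; exact: measurable_translate.
by apply/funext => x; rewrite subrK.
Qed.

(** No smoothness is asked of [f]: the generator is moved to [phi], where it converges uniformly
    with all supports in one ball. *)
Lemma LM_dual_cvg f phi : mfun2 f -> loc_bounded f -> nice phi ->
  \int[mu2]_x (Ln alpha r M n f x * phi x) @[n --> \oo] --> \int[mu2]_x (f x * L_M phi x).
Proof.
move=> mf bf np; have [cp [B hB] [rad r0 sp] [C C0 hC]] := np.
have mp := continuous_measurable2 cp; have mLp := measurable_LM np.
have [B' hB'] := LM_bounded np.
set K := rad + (M + 1); have [Cf hf] := bf K.
have sL n : (0 < n)%N -> supported K (Ln alpha r M n phi) by move=> n0; exact: Ln_supported.
have sLM : supported K (L_M phi).
  by apply: supportedW (LM_supported sp); rewrite lerD2l lerDl.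
have [eps e0 he] := generator_cvg halpha hr hM hk.
have Cf0 : 0 <= Cf by apply: le_trans (hf 0 _); rewrite ?enorm0 ?addr_ge0 ?(ltW r0) ?(ltW M_gt0).
have key n : (0 < n)%N -> `|\int[mu2]_x (Ln alpha r M n f x * phi x) - \int[mu2]_x (f x * L_M phi x)|
    <= Cf * C * fine (mu2 (eball K)) * eps n.
  move=> n0; rewrite (Ln_dual n0 mf bf mp sp hB).
  have hL x : `|Ln alpha r M n phi x| <= B' + C * eps n.
    rewrite -[Ln _ _ _ _ _ _](subrK (L_M phi x)) addrC.
    apply: (le_trans (ler_normD _ _)); apply: lerD; first exact: hB'.
    exact: he.
  have I1 := loc_bounded_integrableM mf bf (measurable_Ln n mp) (sL n n0) hL.
  have I2 := loc_bounded_integrableM mf bf mLp sLM hB'.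
  rewrite -RintegralB//.
  rewrite (@supported_Rintegral _ (fun x => f x * Ln alpha r M n phi x - f x * L_M phi x) K); last first.
    by move=> x hx; rewrite (sL n n0 x hx) (sLM x hx) !mulr0 subr0.
  rewrite -[_ * eps n]mulrAC; apply: norm_Rintegral_bounded.
  - exact: measurable_eball.
  - exact: mu2_eball_lty.
  - apply: measurable_funB; apply: measurable_funM => //; exact: measurable_Ln.
  - move=> x /ltW hx; rewrite -mulrBr normrM -mulrA; apply: ler_pM => //; first exact: hf.
    exact: he.
apply/cvgrPdist_le => e ep.
have : Cf * C * fine (mu2 (eball K)) * eps n @[n --> \oo] --> 0.
  by rewrite -[X in _ --> X](mulr0 (Cf * C * fine (mu2 (eball K)))); exact: cvgMr.
move=> /cvgrPdist_le /(_ e ep) [N _ hN]; exists N.+1 => // n /= Nn.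
rewrite distrC; apply: (le_trans (key n (leq_ltn_trans (leq0n N) Nn))).
by apply: (le_trans (ler_norm _)); have := hN n (ltnW Nn); rewrite sub0r normrN.
Qed.

(** The pairings of [Ln f] with [phi] converge to both sides. The conditions on [f] are those met by
    plane waves and by |x|^2, for which the identity is wanted. *)
Lemma LM_dual f phi C : mfun2 f -> loc_bounded f -> 0 <= C -> (forall x, d2_lip C f x) -> nice phi ->
  mfun2 (L_M f) /\ \int[mu2]_x (L_M f x * phi x) = \int[mu2]_x (f x * L_M phi x).
Proof.
move=> mf bf C0 hC np; have [cp [B hB] [rad r0 sp] _] := np.
have mp := continuous_measurable2 cp.
have mLf : mfun2 (L_M f).
  apply: (@measurable_fun_cvg _ _ R setT (fun n => Ln alpha r M n f)) => [n|x _].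
    exact: measurable_Ln.
  exact: Ln_cvg C0 mf (hC x).
split => //; have h1 := LM_dual_cvg mf bf np.
have [eps e0 he] := generator_cvg halpha hr hM hk.
pose K := C * (c / 2 * \int[mu2]_(y in eball M) (enorm y `^ alpha)^-1).
have hK x : `|L_M f x| <= K by exact: LM_bound.
have key n : (0 < n)%N -> `|\int[mu2]_x (Ln alpha r M n f x * phi x) - \int[mu2]_x (L_M f x * phi x)|
    <= C * B * fine (mu2 (eball rad)) * eps n.
  move=> n0.
  have hL x : `|Ln alpha r M n f x| <= K + C * eps n.
    rewrite -[Ln _ _ _ _ _ _](subrK (L_M f x)) addrC.
    by apply: (le_trans (ler_normD _ _)); apply: lerD; [exact: hK|exact: he].
  have lb : loc_bounded (Ln alpha r M n f) by move=> ?; eexists => x _; exact: hL.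
  have lb' : loc_bounded (L_M f) by move=> ?; eexists => x _; exact: hK.
  have I1 := loc_bounded_integrableM (measurable_Ln n mf) lb mp sp hB.
  have I2 := loc_bounded_integrableM mLf lb' mp sp hB.
  rewrite -RintegralB//.
  rewrite (@supported_Rintegral _ (fun x => Ln alpha r M n f x * phi x - L_M f x * phi x) rad); last first.
    by move=> x hx; rewrite (sp x hx) !mulr0 subr0.
  rewrite -[_ * eps n]mulrAC; apply: norm_Rintegral_bounded.
  - exact: measurable_eball.
  - exact: mu2_eball_lty.
  - by apply: measurable_funB; apply: measurable_funM => //; exact: measurable_Ln.
  - move=> x /ltW hx; rewrite -mulrBl normrM mulrAC; apply: ler_pM => //.
    exact: he.
have h2 : \int[mu2]_x (Ln alpha r M n f x * phi x) @[n --> \oo] --> \int[mu2]_x (L_M f x * phi x).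
  apply/cvgrPdist_le => e ep.
  have : C * B * fine (mu2 (eball rad)) * eps n @[n --> \oo] --> 0.
    by rewrite -[X in _ --> X](mulr0 (C * B * fine (mu2 (eball rad)))); exact: cvgMr.
  move=> /cvgrPdist_le /(_ e ep) [N _ hN]; exists N.+1 => // n /= Nn.
  rewrite distrC; apply: (le_trans (key n (leq_ltn_trans (leq0n N) Nn))).
  by apply: (le_trans (ler_norm _)); have := hN n (ltnW Nn); rewrite sub0r normrN.
exact: cvg_unique h2 h1.
Qed.

End Duality.

(** * A smooth approximate identity *)

Section Bump.
Context {R : realType}.
Local Notation mu := (@lebesgue_measure R).
Local Notation P := (measurableTypeR R * measurableTypeR R)%type.
Local Notation measurable2 := (@measurable _ P).
Local Notation mfun2 f := (@measurable_fun _ _ P R setT f).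
Local Notation L1 D f := (mu2.-integrable (D : set P) (EFin \o f)).
Implicit Types (f g : R * R -> R).

Lemma Ck_ext k f g : f =1 g -> Ck k f -> Ck k g.
Proof. by move=> /funext ->. Qed.

Lemma Ck_pred k f : Ck k.+1 f -> Ck k f.
Proof.
elim: k f => [|k IHk] f; first by move=> [df _ _] x; exact: differentiable_continuous.
by case=> df h1 h2; split; [exact: df|exact: IHk h1|exact: IHk h2].
Qed.

Lemma CkD k f g : Ck k f -> Ck k g -> Ck k (fun x => f x + g x).
Proof.
elim: k f g => [|k IHk] f g; first by move=> cf cg x; apply: cvgD; [exact: cf|exact: cg].
move=> [df f1 f2] [dg g1 g2]; split.
- by move=> x; apply: differentiableD.
- apply: Ck_ext (IHk _ _ f1 g1) => x.
  by rewrite [RHS]deriveD//; exact: diff_derivable.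
- apply: Ck_ext (IHk _ _ f2 g2) => x.
  by rewrite [RHS]deriveD//; exact: diff_derivable.
Qed.

Lemma CkM k f g : Ck k f -> Ck k g -> Ck k (fun x => f x * g x).
Proof.
elim: k f g => [|k IHk] f g; first by move=> cf cg x; apply: cvgM; [exact: cf|exact: cg].
move=> cf cg; have [df f1 f2] := cf; have [dg g1 g2] := cg.
have {}cf := Ck_pred cf; have {}cg := Ck_pred cg; split.
- by move=> x; apply: differentiableM.
- apply: Ck_ext (CkD (IHk _ _ cf g1) (IHk _ _ cg f1)) => x.
  by rewrite [RHS]deriveM//; exact: diff_derivable.
- apply: Ck_ext (CkD (IHk _ _ cf g2) (IHk _ _ cg f2)) => x.
  by rewrite [RHS]deriveM//; exact: diff_derivable.
Qed.

Lemma Ck_cst k (a : R) : Ck k (cst a).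
Proof.
elim: k a => [|k IHk] a; first by move=> x; exact: cvg_cst.
split; first by move=> x; exact: differentiable_cst.
- by apply: Ck_ext (IHk 0) => x; rewrite derive_cst.
- by apply: Ck_ext (IHk 0) => x; rewrite derive_cst.
Qed.

Lemma fst_diff (x v : R * R) : differentiable (@fst R R) x /\ 'D_v (@fst R R) x = v.1.
Proof.
have c : continuous (@fst R R) by move=> y; exact: cvg_fst.
have d : differentiable (@fst R R) x by exact: linear_differentiable.
by split => //; rewrite deriveE// diff_lin.
Qed.

Lemma snd_diff (x v : R * R) : differentiable (@snd R R) x /\ 'D_v (@snd R R) x = v.2.
Proof.
have c : continuous (@snd R R) by move=> y; exact: cvg_snd.
have d : differentiable (@snd R R) x by exact: linear_differentiable.
by split => //; rewrite deriveE// diff_lin.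
Qed.

Lemma comp_diff (h dh : R -> R) (l : R * R -> R) (x v : R * R) :
  (forall s, is_derive s (1 : R) h (dh s)) -> differentiable l x ->
  differentiable (h \o l) x /\ 'D_v (h \o l) x = dh (l x) * 'D_v l x.
Proof.
move=> hh dl; have dhh : differentiable h (l x).
  by apply/derivable1_diffP; exact: ex_derive.
have dc : differentiable (h \o l) x by exact: differentiable_comp.
split => //; rewrite !deriveE// diff_comp//=; move: ('d l x v) => y.
have -> : y = y *: (1 : R) by rewrite /GRing.scale /= mulr1.
by rewrite linearZ /= -deriveE// derive_val /GRing.scale /= mulr1 mulrC.
Qed.

(** The factor s^(-k) closes the family under differentiation: the derivative of one member is a
    combination of two others, and smoothness follows by induction for all k at once. *)
Definition flat (k : nat) (s : R) : R := if 0 < s then s^-1 ^+ k * expR (- s^-1) else 0.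

Lemma flat_ge0 k s : 0 <= flat k s.
Proof.
by rewrite /flat; case: ifPn => // s0; rewrite mulr_ge0 ?exprn_ge0 ?expR_ge0// invr_ge0 ltW.
Qed.

(** From exp (1/s) >= s^(-k-2) / (k+2)!. A quadratic bound is what gives derivative 0 at the
    origin. *)
Lemma flat_quadratic k s : `|flat k s| <= k.+2`!%:R * s ^+ 2.
Proof.
rewrite ger0_norm ?flat_ge0// /flat; case: ifPn => s0; last by rewrite mulr_ge0// sqr_ge0.
have i0 : 0 < s^-1 by rewrite invr_gt0.
have h := expR_ge1Dxn k.+1 (ltW i0).
have {}h : s^-1 ^+ k.+2 <= k.+2`!%:R * expR s^-1.
  rewrite mulrC -ler_pdivrMr ?ltr0n ?fact_gt0//; apply: le_trans h; by rewrite lerDr.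
rewrite expRN ler_pdivrMr ?expR_gt0//.
rewrite -(@ler_pM2l _ (s^-1 ^+ 2)) ?exprn_gt0// -exprD add2n.
apply: (le_trans h); rewrite le_eqVlt; apply/orP/or_introl/eqP.
by field; rewrite gt_eqF.
Qed.

Lemma quadratic_is_derive0 (h : R -> R) C : (forall s, `|h s| <= C * s ^+ 2) ->
  is_derive (0 : R) (1 : R) h 0.
Proof.
move=> hC; have h0 : h 0 = 0 by apply/eqP; rewrite -normr_eq0 eq_le normr_ge0 (le_trans (hC 0))// expr0n mulr0.
have lim0 : (fun t : R => t^-1 *: ((h \o shift 0) (t *: (1 : R)) - h 0)) t @[t --> 0^'] --> (0 : R).
  apply/cvgrPdist_le => e e0; have C1 : 0 < `|C| + 1 by rewrite ltr_wpDl.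
  exists (e / (`|C| + 1)); first by rewrite /= divr_gt0.
  move=> t /=; rewrite sub0r normrN => te t0.
  rewrite h0 subr0 sub0r normrN addr0 /GRing.scale /= mulr1 normrM normfV.
  rewrite ler_pdivrMl ?normr_gt0//.
  apply: (le_trans (hC t)); rewrite -real_normK ?num_real// expr2 mulrA.
  have tp : 0 < `|t| by rewrite normr_gt0.
  rewrite mulrC ler_pM2l//; move: te; rewrite ltr_pdivlMr// => /ltW; apply: le_trans.
  rewrite mulrC ler_pM2l//; apply: (le_trans (ler_norm C)); by rewrite lerDl.
split; first by apply/cvg_ex; exists 0.
exact: cvg_lim lim0.
Qed.

Lemma is_derive_flat k (s : R) : is_derive s (1 : R) (flat k) (flat k.+2 s - k%:R * flat k.+1 s).
Proof.
have [s0|s0|->] := ltgtP s 0.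
- have e (j : nat) : flat j s = 0 by rewrite /flat ltNge (ltW s0).
  rewrite !e mulr0 subr0.
  apply: (@near_eq_is_derive _ _ _ (cst 0)).
  near=> t; rewrite /flat /= ltNge ltW//; near: t; exact: lt_nbhsl.
- have e (j : nat) : flat j s = s^-1 ^+ j * expR (- s^-1) by rewrite /flat s0.
  have sn : s != 0 by rewrite gt_eqF.
  apply: (@near_eq_is_derive _ _ _ (fun t : R => t^-1 ^+ k * expR (- t^-1))).
    near=> t; rewrite /flat ifT//; near: t; exact: lt_nbhsr.
  have dV : is_derive s (1 : R) (fun t : R => t^-1) (- s ^- 2).
    apply: is_derive_eq; first by apply: is_deriveV => //; exact: is_derive_id.
    by rewrite /GRing.scale /= mulr1.
  have dN : is_derive s (1 : R) (fun t : R => - t^-1) (s ^- 2).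
    by apply: is_derive_eq; rewrite opprK.
  have dE : is_derive s (1 : R) (expR \o (fun t : R => - t^-1)) (expR (- s^-1) * s ^- 2).
    by apply: is_derive1_comp; exact: is_derive_expR.
  have dX : is_derive s (1 : R) (fun t : R => t^-1 ^+ k) (k%:R * s^-1 ^+ k.-1 * - s ^- 2).
    case: k {e} => [|k].
      by apply: is_derive_eq; [exact: is_derive_cst|rewrite mul0r mul0r].
    rewrite (_ : (fun t : R => t^-1 ^+ k.+1) = (fun t : R => t^-1) ^+ k.+1).
      exact: is_deriveX dV.
    by apply/funext => t; rewrite exprfctE.
  apply: (is_derive_eq (is_deriveM dX dE)).
  rewrite !e /GRing.scale /=; move: (expR _) => E; case: k {e dX} => [|k] /=.
    by rewrite expr0 !exprVn; field.
  by rewrite !exprVn !exprS; field; rewrite sn expf_neq0.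
- rewrite /flat ltxx mulr0 subr0; exact: (@quadratic_is_derive0 _ _ (flat_quadratic k)).
Unshelve. all: by end_near.
Qed.

Lemma Ck_flat_comp k j (a b : R) (l : R * R -> R) (lv : R * R -> R) :
  (forall x v, differentiable l x /\ 'D_v l x = lv v) ->
  Ck k (fun x => flat j (a + b * l x)).
Proof.
move=> hl; pose l' x := a + b * l x.
have hl' x v : differentiable l' x /\ 'D_v l' x = b * lv v.
  have [dl lvE] := hl x v.
  have d1 : differentiable (fun z => b * l z) x.
    by apply: (@differentiableM _ _ (cst b) l) => //; exact: differentiable_cst.
  have d2 : differentiable (cst a : R * R -> R) x by exact: differentiable_cst.
  split; first exact: (differentiableD d2 d1).
  rewrite (_ : l' = cst a + b *: l)//.
  rewrite deriveD ?derive_cst ?add0r; [|exact: diff_derivable|exact: diff_derivable].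
  by rewrite deriveZ ?lvE//; exact: diff_derivable.
elim: k j => [|k IHk] j.
  move=> x; apply: differentiable_continuous.
  by have [] := @comp_diff (flat j) _ l' x 0 (is_derive_flat j) (hl' x 0).1.
have hc x v := @comp_diff (flat j) _ l' x v (is_derive_flat j) (hl' x v).1.
have Cd v : Ck k ('D_v (flat j \o l')).
  apply: Ck_ext (CkM (CkD (IHk j.+2) (CkM (Ck_cst k (- j%:R)) (IHk j.+1))) (Ck_cst k (b * lv v))) => x.
  by rewrite (hc x v).2 (hl' x v).2 /= mulNr.
by split; [move=> x; exact: (hc x 0).1|exact: Cd|exact: Cd].
Qed.

(** Positive exactly on the open square of centre [a] and half-side [t]; the product form reduces
    smoothness to one variable. *)
Definition bump0 (t : R) (a x : R * R) : R :=
  flat 0 (t + (x.1 - a.1)) * flat 0 (t - (x.1 - a.1)) *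
  (flat 0 (t + (x.2 - a.2)) * flat 0 (t - (x.2 - a.2))).

Lemma bump0_out t a x : t <= `|x.1 - a.1| \/ t <= `|x.2 - a.2| -> bump0 t a x = 0.
Proof.
have key (u : R) : t <= `|u| -> flat 0 (t + u) * flat 0 (t - u) = 0.
  have [u0|u0] := ger0P u => h.
    by rewrite [X in _ * X]/flat subr_gt0 ltNge h mulr0.
  by rewrite /flat ltNge -[u]opprK subr_le0 h mul0r.
by rewrite /bump0 => -[/key ->|/key ->]; rewrite ?mul0r ?mulr0.
Qed.

Lemma bump0_ge0 t a x : 0 <= bump0 t a x.
Proof. by rewrite /bump0 !mulr_ge0 ?flat_ge0. Qed.

Lemma bump0_Ck k t a : Ck k (bump0 t a).
Proof.
have E (u v w : R) : u + v * w = u + v * w by [].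
apply: CkM; apply: CkM.
- apply: Ck_ext (@Ck_flat_comp k 0 (t - a.1) 1 fst fst fst_diff) => x.
  by congr flat; ring.
- apply: Ck_ext (@Ck_flat_comp k 0 (t + a.1) (-1) fst fst fst_diff) => x.
  by congr flat; ring.
- apply: Ck_ext (@Ck_flat_comp k 0 (t - a.2) 1 snd snd snd_diff) => x.
  by congr flat; ring.
- apply: Ck_ext (@Ck_flat_comp k 0 (t + a.2) (-1) snd snd snd_diff) => x.
  by congr flat; ring.
Qed.

Lemma test_functionP f rad : (forall k, Ck k f) -> supported rad f -> test_function f.
Proof.
move=> hf sf k; split => //.
have cK : compact ([set` `[- rad, rad]] `*` [set` `[- rad, rad]] : set (R * R)).
  by apply: compact_setX; exact: segment_compact.
apply: (subclosed_compact _ cK); first exact: tsupport_closed.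
have -> : [set` `[- rad, rad]] `*` [set` `[- rad, rad]] = closure ([set` `[- rad, rad]] `*` [set` `[- rad, rad]] : set (R * R)).
  by apply/closure_id; apply: compact_closed cK.
apply: closure_subset => x /=; apply: contra_neqP => h; apply: sf.
rewrite leNgt; apply: contra_notN h => h; split; rewrite /= in_itv /= -ler_norml.
  exact: (le_trans (enorm_ge_fst _) (ltW h)).
exact: (le_trans (enorm_ge_snd _) (ltW h)).
Qed.

Lemma bump0_test t a : test_function (bump0 t a).
Proof.
apply: (@test_functionP _ (`|t| + `|t| + enorm a)); first by move=> k; exact: bump0_Ck.
move=> x hx; apply: bump0_out.
have [h1|h1] := leP t `|x.1 - a.1|; first by left.
have [h2|h2] := leP t `|x.2 - a.2|; first by right.
exfalso; move: hx; rewrite leNgt => /negP; apply.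
have := enormD (x - a) a; rewrite subrK => /le_lt_trans; apply.
rewrite ltrD2r; apply: (le_lt_trans (enorm_le_sum _)).
by apply: ltrD; rewrite (lt_le_trans _ (ler_norm t)).
Qed.

Lemma bump0_translate t a x : bump0 t a x = bump0 t 0 (x - a).
Proof. by rewrite /bump0 /= !subr0. Qed.

Lemma bump0_int_gt0 t a : 0 < t -> 0 < \int[mu2]_x bump0 t a x.
Proof.
move=> t0; have [cb [B hB] [rad r0 sb] _] := test_nice (bump0_test t 0).
have mb := continuous_measurable2 cb.
rewrite (_ : \int[mu2]_x bump0 t a x = \int[mu2]_x bump0 t 0 x); last first.
  rewrite -(Rintegral_translate (- a) mb); apply: eq_Rintegral => x _.
  exact: bump0_translate.
pose m := (flat 0 (t / 2)) ^+ 4.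
have m0 : 0 < m by rewrite exprn_gt0// /flat divr_gt0// mul1r expR_gt0.
have hm x : `|x.1| <= t / 2 -> `|x.2| <= t / 2 -> m <= bump0 t 0 x.
  have mono (u v : R) : 0 < u -> u <= v -> flat 0 u <= flat 0 v.
    move=> u0 uv; rewrite /flat u0 (lt_le_trans u0 uv) !mul1r ler_expR lerN2.
    by rewrite lef_pV2 ?posrE// (lt_le_trans u0 uv).
  rewrite !ler_norml => /andP[h1 h2] /andP[h3 h4].
  have p0 : 0 <= flat 0 (t / 2) by exact: flat_ge0.
  have t2 : 0 < t / 2 by rewrite divr_gt0.
  rewrite /m /bump0 (_ : flat 0 (t / 2) ^+ 4 = flat 0 (t / 2) * flat 0 (t / 2) * (flat 0 (t / 2) * flat 0 (t / 2))); last by ring.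
  apply: ler_pM; rewrite ?mulr_ge0//; apply: ler_pM => //; apply: mono => //=; lra.
pose D : set P := [set x | - (t / 2) <= x.1 <= t / 2 /\ - (t / 2) <= x.2 <= t / 2].
have mD : measurable2 D by exact: measurable_box.
have t2 : - (t / 2) <= t / 2 by lra.
have hD := mu2_box t2 t2; rewrite -/D in hD.
have LB : L1 setT (bump0 t 0) by exact: supported_integrable mb sb (fun x _ => hB x).
apply: (@lt_le_trans _ _ (\int[mu2]_x (\1_D x * m))).
  rewrite -(@Rintegral_indicM R D (cst m)) Rintegral_cst//.
  apply: (mulr_gt0 m0); rewrite (_ : fine (mu2 D) = (t / 2 - - (t / 2)) * (t / 2 - - (t / 2))).
    by rewrite mulr_gt0//; lra.
  exact: (congr1 fine hD).
apply: le_Rintegral => //.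
  by apply: integrable_indic => //; apply: integrable2_cst => //; rewrite hD ltry.
move=> x _; rewrite indicE; case: (boolP (x \in D)) => [|_]; last by rewrite mul0r bump0_ge0.
by rewrite inE => -[h1 h2]; rewrite mul1r; apply: hm; rewrite ler_norml.
Qed.

Definition bump (t : R) (a x : R * R) : R := (\int[mu2]_z bump0 t a z)^-1 * bump0 t a x.

Lemma bump_test t a : test_function (bump t a).
Proof.
have [_ _ [rad _ sb] _] := test_nice (bump0_test t a).
apply: (@test_functionP _ rad).
  by move=> k; apply: CkM; [exact: Ck_cst|exact: bump0_Ck].
by move=> x /sb h; rewrite /bump h mulr0.
Qed.

Lemma bump_ge0 t a x : 0 <= bump t a x.
Proof.
by rewrite mulr_ge0 ?bump0_ge0// invr_ge0 Rintegral_ge0// => z _; exact: bump0_ge0.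
Qed.

Lemma Rintegral_bump t a : 0 < t -> \int[mu2]_x bump t a x = 1.
Proof.
move=> t0; have [cb [B hB] [rad r0 sb] _] := test_nice (bump0_test t a).
rewrite RintegralZl//; last exact: supported_integrable (continuous_measurable2 cb) sb (fun x _ => hB x).
by rewrite mulVf// gt_eqF// bump0_int_gt0.
Qed.

Lemma bump_translate t a x : bump t a x = bump t 0 (x - a).
Proof.
have [cb _ _ _] := test_nice (bump0_test t 0).
rewrite /bump bump0_translate; suff -> : \int[mu2]_z bump0 t a z = \int[mu2]_z bump0 t 0 z by [].
rewrite -(Rintegral_translate (- a) (continuous_measurable2 cb)); apply: eq_Rintegral => x' _.
exact: bump0_translate.
Qed.

Lemma bump_out t a x : 2 * t <= enorm (x - a) -> bump t a x = 0.
Proof.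
move=> h; rewrite /bump bump0_out ?mulr0//.
have [h1|h1] := leP t `|x.1 - a.1|; first by left.
have [h2|h2] := leP t `|x.2 - a.2|; first by right.
exfalso; move: h; rewrite leNgt => /negP; apply.
by apply: (le_lt_trans (enorm_le_sum _)); rewrite mulrDl mul1r; exact: ltrD.
Qed.

End Bump.

(** * Barriers for the discrete odometers *)

Section Barrier.
Context {R : realType}.
Local Notation mu := (@lebesgue_measure R).
Local Notation P := (measurableTypeR R * measurableTypeR R)%type.
Local Notation measurable2 := (@measurable _ P).
Local Notation mfun2 f := (@measurable_fun _ _ P R setT f).
Local Notation L1 D f := (mu2.-integrable (D : set P) (EFin \o f)).

Context (alpha r M : R) (halpha : 1 < alpha < 2) (hr : 0 < r < M) (hM : 1 < M).
Context (hk : forall n : nat, (0 < n)%N -> 0 < kn r M alpha n).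

Local Notation k_ := (kn r M alpha).
Local Notation F_ := (Fn r M).
Local Notation w_ := (wn r M alpha).
Local Notation c_ := (cn r M alpha).
Local Notation p_ := (pn r M alpha).
Local Notation c := (cc r M alpha).
Local Notation box n := (sites (Nbox M n)).
Local Notation L_M := (LM r M alpha).

Let alpha_gt1 : 1 < alpha. Proof. by case/andP: halpha. Qed.
Let alpha_lt2 : alpha < 2. Proof. by case/andP: halpha. Qed.
Let alpha_gt0 : 0 < alpha. Proof. exact: lt_trans ltr01 alpha_gt1. Qed.
Let M_gt0 : 0 < M. Proof. exact: lt_trans ltr01 hM. Qed.

Local Opaque kn Fn wn cn pn.
Implicit Types (x : R * R).

Local Notation m := (M + 1).
Local Notation sq := (fun x : R * R => enorm x ^+ 2).

Lemma enorm_sqrD x y : enorm (x + y) ^+ 2 = enorm x ^+ 2 + (2 * edot x y + enorm y ^+ 2).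
Proof. by rewrite !enorm_sqr /edot /=; ring. Qed.

Lemma d2_sq x y : d2 sq x y = 2 * enorm y ^+ 2.
Proof. by rewrite /d2 !enorm_sqr /=; ring. Qed.

Lemma d2_lip_sq x : d2_lip 2 sq x.
Proof.
move=> y z; rewrite !d2_sq -mulrBr normrM ger0_norm// -mulrA ler_pM2l// subr_sqr normrM.
rewrite [X in _ * X]ger0_norm ?addr_ge0 ?enorm_ge0//.
apply: ler_wpM2r; first by rewrite addr_ge0 ?enorm_ge0.
rewrite ler_norml; apply/andP; split.
  by have := enormD (y - z) (- y); rewrite enormN addrAC subrr add0r enormN; lra.
by have := enormD (y - z) z; rewrite subrK; lra.
Qed.

Lemma measurable_sq : mfun2 sq.
Proof. by apply: measurable_funX; exact: measurable_enorm. Qed.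

Lemma LM_sq x : L_M sq x = sigma2 r M alpha.
Proof.
rewrite LM_kernelE /sigma2.
have -> : \int[mu2]_(y in eball M) (d2 sq x y * (enorm y `^ (2 + alpha))^-1) =
  \int[mu2]_(y in eball M) (2 * (enorm y `^ alpha)^-1).
  apply: eq_Rintegral => y _; rewrite d2_sq.
  have [->|y0] := eqVneq (enorm y) 0.
    by rewrite !powR0 ?expr0n ?mulr0 ?mul0r ?invr0 ?mulr0// gt_eqF// ltr_wpDl.
  have yp : 0 < enorm y by rewrite lt_neqAle eq_sym y0 enorm_ge0.
  rewrite powRD ?y0 ?implybT// powR_mulrn ?enorm_ge0// invfM mulrA.
  by rewrite mulfK// expf_neq0.
rewrite RintegralZl ?mulrA ?divfK//; first exact: measurable_eball.
by apply: integrable_near0; rewrite alpha_gt0 alpha_lt2.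
Qed.

Lemma sigma2_gt0 : 0 < sigma2 r M alpha.
Proof.
rewrite mulr_gt0 ?(cc_gt0 halpha hr hM hk)//.
pose D : set P := [set x | M / 4 <= x.1 <= M / 2 /\ M / 4 <= x.2 <= M / 2].
have M2 : M / 4 <= M / 2 by move: M_gt0; lra.
have mD : measurable2 D by exact: measurable_box.
have hD := mu2_box M2 M2; rewrite -/D in hD.
have M4 : 0 < M / 4 by rewrite divr_gt0.
have DB x : D x -> 0 < enorm x < M.
  move=> [/andP[x1 x2] /andP[x3 x4]]; apply/andP; split.
    by apply: lt_le_trans (enorm_ge_fst x); rewrite normr_gt0 gt_eqF// (lt_le_trans M4).
  rewrite enorm_lt ?(ltW M_gt0)//.
  have p1 : 0 <= x.1 by rewrite (le_trans (ltW M4)).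
  have p2 : 0 <= x.2 by rewrite (le_trans (ltW M4)).
  have M20 : 0 <= M / 2 by rewrite divr_ge0// ltW.
  have : x.1 ^+ 2 <= (M / 2) ^+ 2 by rewrite ler_pXn2r.
  have : x.2 ^+ 2 <= (M / 2) ^+ 2 by rewrite ler_pXn2r.
  have : 0 < M ^+ 2 by rewrite exprn_gt0.
  rewrite (_ : (M / 2) ^+ 2 = M ^+ 2 / 4); last by field.
  lra.
have Doo : (mu2 D < +oo)%E by rewrite hD ltry.
apply: (@lt_le_trans _ _ (\int[mu2]_(x in D) (M `^ alpha)^-1)).
  rewrite Rintegral_cst// mulr_gt0// ?invr_gt0 ?powR_gt0//.
  rewrite (_ : fine (mu2 D) = (M / 2 - M / 4) * (M / 2 - M / 4)); last exact: (congr1 fine hD).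
  by apply: mulr_gt0; lra.
rewrite Rintegral_indicM [leRHS]Rintegral_indicM; apply: le_Rintegral => //.
- by apply: integrable_indic => //; exact: integrable2_cst.
- apply: integrable_indic; first exact: measurable_eball.
  by apply: integrable_near0; rewrite alpha_gt0 alpha_lt2.
move=> x _; rewrite !indicE; case: (boolP (x \in D)) => [|_]; last first.
  by rewrite mul0r mulr_ge0// invr_ge0 powR_ge0.
rewrite inE => Dx; have /andP[x0 xM] := DB x Dx; rewrite mem_set// !mul1r.
by apply: le_powR_inv => //; exact: ltW.
Qed.

(** The discrete counterpart of [sigma2]: the constant value of [Ln] on |x|^2. *)
Definition sig n : R := n%:R `^ alpha * \sum_(y <- box n) p_ n y * enorm (pt n y) ^+ 2.

Lemma sum_odd n (g : site -> R) : (forall y, g (- y) = - g y) ->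
  \sum_(y <- box n) p_ n y * g y = 0.
Proof.
move=> hg; suff : \sum_(y <- box n) p_ n y * g y = - \sum_(y <- box n) p_ n y * g y by lra.
by rewrite -{1}sum_opp -sumrN; apply: eq_bigr => y _; rewrite pn_opp hg mulrN.
Qed.

(** Add the same sum for the rotated jumps: (x . y)^2 + (x . rot y)^2 = |x|^2 |y|^2. *)
Lemma sum_edot_sqr n x : \sum_(y <- box n) p_ n y * edot x (pt n y) ^+ 2 =
  enorm x ^+ 2 / 2 * \sum_(y <- box n) p_ n y * enorm (pt n y) ^+ 2.
Proof.
have : \sum_(y <- box n) p_ n y * edot x (pt n y) ^+ 2 + \sum_(y <- box n) p_ n (rot y) * edot x (pt n (rot y)) ^+ 2 =
   enorm x ^+ 2 * \sum_(y <- box n) p_ n y * enorm (pt n y) ^+ 2.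
  rewrite -big_split mulr_sumr; apply: eq_bigr => y _.
  by rewrite pn_rot !enorm_sqr /edot /pt /rot /= intrN mulNr; ring.
rewrite (sum_rot _ (fun y => p_ n y * edot x (pt n y) ^+ 2)) => h.
by rewrite mulrAC -h; field.
Qed.

Lemma Ln_sq n x : Ln alpha r M n sq x = sig n.
Proof.
rewrite Ln_d2 /sig -!mulrA; congr (_ * _); rewrite mulr_sumr; apply: eq_bigr => y _.
by rewrite d2_sq; field.
Qed.

Lemma sig_cvg : sig n @[n --> \oo] --> sigma2 r M alpha.
Proof.
rewrite -(LM_sq 0); under eq_fun => n do rewrite -(Ln_sq n 0).
exact: Ln_cvg measurable_sq (@d2_lip_sq 0).
Qed.

(** With z = q / s this is 1 + z/2 - z^2/4 <= sqrt (1 + z). The square of the left side is 1 + z -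
    (z^2/4) (2 - (1 - z/2)^2), and 1 - z/2 lies between 1/2 and 5/4. The coefficient 1/4 instead of
    the Taylor coefficient 1/8 makes room for the remainder. *)
Lemma sqrt_lower (s q : R) : 0 < s -> - (s / 2) <= q <= s ->
  q / 2 - q ^+ 2 / (4 * s) <= (Num.sqrt (s + q) - Num.sqrt s) * Num.sqrt s.
Proof.
move=> s0 /andP[q1 q2]; set t := Num.sqrt s.
have t0 : 0 < t by rewrite sqrtr_gt0.
have ts : s = t ^+ 2 by rewrite sqr_sqrtr// ltW.
rewrite mulrBl -expr2 -ts lerBrDl.
have -> : Num.sqrt (s + q) * t = Num.sqrt ((s + q) * s).
  by rewrite sqrtrM//; lra.
apply: le_trans (ler_norm _) _; rewrite -sqrtr_sqr; apply: ler_wsqrtr.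
set z := q / s; have qz : q = z * s by rewrite /z divfK// gt_eqF.
have -> : q ^+ 2 / (4 * s) = z ^+ 2 * s / 4 by rewrite qz; field; rewrite gt_eqF.
have z1 : - 2^-1 <= z by rewrite /z ler_pdivlMr//; lra.
have z2 : z <= 1 by rewrite /z ler_pdivrMr// mul1r.
rewrite qz (_ : (s + _) ^+ 2 = s ^+ 2 * (1 + (z / 2 - z ^+ 2 / 4)) ^+ 2); last by field.
rewrite (_ : (s + _) * s = s ^+ 2 * (1 + z)); last by ring.
apply: ler_wpM2l; first by rewrite sqr_ge0.
have -> : (1 + (z / 2 - z ^+ 2 / 4)) ^+ 2 = 1 + z - z ^+ 2 / 4 * (2 - (1 - z / 2) ^+ 2) by field.
rewrite gerBl mulr_ge0 ?divr_ge0 ?sqr_ge0// subr_ge0.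
have h : (1 - z / 2 - 5 / 4) * (1 - z / 2 + 5 / 4) <= 0.
  by rewrite mulr_le0_ge0//; lra.
rewrite expr2; lra.
Qed.

(** Jumps have length at most m; an eps this large keeps the increment of |x|^2 over one jump in the
    range of [sqrt_lower]. *)
Context (eps : R) (heps : 16 * m ^+ 2 <= eps).

Let m1 : 2 < m. Proof. by move: hM; lra. Qed.
Let eps0 : 0 < eps. Proof. by apply: lt_le_trans heps; rewrite mulr_gt0// exprn_gt0//; move: m1; lra. Qed.

Definition T x := Num.sqrt (enorm x ^+ 2 + eps).

Let S0 x : 0 < enorm x ^+ 2 + eps.
Proof. by rewrite ltr_wpDl// sqr_ge0. Qed.

Lemma T_gt0 x : 0 < T x. Proof. by rewrite sqrtr_gt0. Qed.

Lemma T_sqr x : T x ^+ 2 = enorm x ^+ 2 + eps.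
Proof. by rewrite sqr_sqrtr// ltW. Qed.

Lemma T_ge x : enorm x <= T x.
Proof.
by rewrite -(@ler_pXn2r _ 2) ?nnegrE ?enorm_ge0 ?(ltW (T_gt0 x))// T_sqr lerDl ltW.
Qed.

(** Expand the square root to second order. The terms odd in the jump cancel; by isotropy the
    quadratic ones add up to V/2 - |x|^2 V / (2 s) = eps V / (2 s), with V the second moment; the
    quartic one is at most m^2 V / (4 s), a small part of this. *)
Lemma Ln_T n x : (0 < n)%N -> sig n * (eps / (4 * T x ^+ 3)) <= Ln alpha r M n T x.
Proof.
move=> n0; set s := enorm x ^+ 2 + eps; have s0 : 0 < s := S0 x.
have T0 := T_gt0 x.
pose q y := 2 * edot x (pt n y) + enorm (pt n y : R * R) ^+ 2.
have TD y : T (x + pt n y) = Num.sqrt (s + q y).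
  by rewrite /T enorm_sqrD /s /q addrAC.
have h1 y : p_ n y != 0 -> q y / 2 - q y ^+ 2 / (4 * s) <= (T (x + pt n y) - T x) * T x.
  move=> py; have hy := @pn_enorm R alpha r M halpha hM n y n0 py.
  rewrite TD; apply: sqrt_lower => //.
  have := normr_edot_le x (pt n y); rewrite ler_norml => /andP[e1 e2].
  have y0 := enorm_ge0 (pt n y : R * R); have x0 := enorm_ge0 x.
  have p1 : enorm x * enorm (pt n y) <= enorm x * m by rewrite ler_wpM2l.
  have p2 : enorm (pt n y : R * R) ^+ 2 <= m ^+ 2 by rewrite ler_pXn2r// nnegrE//; move: m1; lra.
  have p3 : 0 <= (enorm x - 4 * m) ^+ 2 by rewrite sqr_ge0.
  have p4 : 0 <= enorm (pt n y : R * R) ^+ 2 by rewrite sqr_ge0.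
  have p5 : 0 <= enorm x ^+ 2 by rewrite sqr_ge0.
  have p6 : 0 <= m ^+ 2 by rewrite sqr_ge0.
  move: p3; rewrite /q /s sqrrB => p3.
  have p7 : (4 * m) ^+ 2 = 16 * m ^+ 2 by ring.
  have p8 : enorm x * (4 * m) *+ 2 = 8 * (enorm x * m) by ring.
  by apply/andP; split; move: heps; lra.
have h2 : n%:R `^ alpha * \sum_(y <- box n) p_ n y * (q y / 2 - q y ^+ 2 / (4 * s)) <= Ln alpha r M n T x * T x.
  rewrite /Ln -mulrA mulr_suml ler_wpM2l ?powR_ge0//; apply: ler_sum => y _.
  have [->|py] := eqVneq (p_ n y) 0; first by rewrite !mul0r.
  by rewrite -mulrA ler_wpM2l ?h1// (pn_ge0 halpha hr hM hk).
have h3 : sig n * ((2 * eps - m ^+ 2) / (4 * s)) <=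
    n%:R `^ alpha * \sum_(y <- box n) p_ n y * (q y / 2 - q y ^+ 2 / (4 * s)).
  rewrite /sig -mulrA ler_wpM2l ?powR_ge0//.
  pose V := \sum_(y <- box n) p_ n y * enorm (pt n y : R * R) ^+ 2.
  have -> : \sum_(y <- box n) p_ n y * (q y / 2 - q y ^+ 2 / (4 * s)) =
     \sum_(y <- box n) p_ n y * (edot x (pt n y) - edot x (pt n y) * enorm (pt n y : R * R) ^+ 2 / s) +
     (V / 2 - s^-1 * (\sum_(y <- box n) p_ n y * edot x (pt n y) ^+ 2) -
      (4 * s)^-1 * \sum_(y <- box n) p_ n y * enorm (pt n y : R * R) ^+ 4).
    rewrite /V mulr_suml !mulr_sumr -!sumrB -big_split /=; apply: eq_bigr => y _.
    by rewrite /q; field; rewrite gt_eqF.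
  rewrite (@sum_odd n (fun y => edot x (pt n y) - edot x (pt n y) * enorm (pt n y : R * R) ^+ 2 / s)) ?add0r; last first.
    move=> y; rewrite ptN enormN (_ : edot x (- pt n y) = - edot x (pt n y)); last by rewrite /edot /=; ring.
    by rewrite !mulNr opprB opprK addrC.
  rewrite sum_edot_sqr -/V.
  have h4 : \sum_(y <- box n) p_ n y * enorm (pt n y : R * R) ^+ 4 <= m ^+ 2 * V.
    rewrite mulr_sumr; apply: ler_sum => y _.
    have [->|py] := eqVneq (p_ n y) 0; first by rewrite !mul0r mulr0.
    rewrite [leRHS]mulrCA ler_wpM2l ?(pn_ge0 halpha hr hM hk)//.
    rewrite (_ : enorm _ ^+ 4 = enorm (pt n y : R * R) ^+ 2 * enorm (pt n y : R * R) ^+ 2); last by ring.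
    rewrite ler_wpM2r ?sqr_ge0// ler_pXn2r ?nnegrE ?enorm_ge0//.
      exact: (@pn_enorm R alpha r M halpha hM n y n0 py).
    by move: m1; lra.
  have h5 : (4 * s)^-1 * \sum_(y <- box n) p_ n y * enorm (pt n y : R * R) ^+ 4 <= (4 * s)^-1 * (m ^+ 2 * V).
    by rewrite ler_wpM2l// invr_ge0 mulr_ge0// ltW.
  apply: (le_trans _ (lerB (lexx _) h5)); rewrite le_eqVlt; apply/orP/or_introl/eqP.
  have -> : 2 * eps = 2 * s - 2 * enorm x ^+ 2 by rewrite /s; ring.
  by rewrite -/V; field; rewrite gt_eqF.
have sig0 : 0 <= sig n.
  rewrite mulr_ge0 ?powR_ge0// sumr_ge0// => y _.
  by rewrite mulr_ge0 ?sqr_ge0// (pn_ge0 halpha hr hM hk).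
rewrite -(ler_pM2r T0); apply: le_trans h2; apply: le_trans h3.
rewrite -mulrA ler_wpM2l// (_ : eps / (4 * T x ^+ 3) * T x = eps / (4 * s)); last first.
  by rewrite /s -T_sqr; field; rewrite gt_eqF.
rewrite ler_pM2r ?invr_gt0 ?mulr_gt0//.
have : m ^+ 2 <= 16 * m ^+ 2 by rewrite ler_peMl ?sqr_ge0//; lra.
by move: heps; lra.
Qed.

(** With sig n <= 2 sigma^2 the paraboloid b |x|^2 has generator at most 1, the mass that a site can
    hold. *)
Let b := (2 * sigma2 r M alpha)^-1.
Let b0 : 0 < b. Proof. by rewrite invr_gt0 mulr_gt0 ?sigma2_gt0. Qed.

(** Up to a constant this is b |x|^2 - a T: the paraboloid takes the capacity 1 and - a T absorbs
    the source. Completing the square makes it nonnegative, with zeros where T x = a / (2 b). *)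
Definition barrier (a : R) x := b * (T x - a / (2 * b)) ^+ 2.

Lemma Ln_barrier n a x : Ln alpha r M n (barrier a) x = b * sig n - a * Ln alpha r M n T x.
Proof.
rewrite -(Ln_sq n x) /Ln mulrCA [a * _]mulrCA -mulrBr; congr (_ * _).
rewrite !mulr_sumr -sumrB; apply: eq_bigr => y _.
suff -> : barrier a (x + pt n y) - barrier a x =
    b * (enorm (x + pt n y) ^+ 2 - enorm x ^+ 2) - a * (T (x + pt n y) - T x).
  by move: (p_ n y) b => p b'; ring.
have -> : barrier a (x + pt n y) = b * T (x + pt n y) ^+ 2 - a * T (x + pt n y) + a ^+ 2 / (4 * b).
  by rewrite /barrier; field; rewrite gt_eqF.
have -> : barrier a x = b * T x ^+ 2 - a * T x + a ^+ 2 / (4 * b).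
  by rewrite /barrier; field; rewrite gt_eqF.
by rewrite !T_sqr; ring.
Qed.

Lemma avg_Ln n (f : R * R -> R) (z : site) : \sum_(y <- box n) p_ n y = 1 ->
  avg alpha r M n (fun y => n%:R `^ alpha * f (pt n y)) z - n%:R `^ alpha * f (pt n z) =
  Ln alpha r M n f (pt n z).
Proof.
move=> p1; have {1}-> : n%:R `^ alpha * f (pt n z) = \sum_(y <- box n) p_ n y * (n%:R `^ alpha * f (pt n z)).
  by rewrite -mulr_suml p1 mul1r.
rewrite /avg /Ln -sumrB mulr_sumr.
by apply: eq_bigr => y _; rewrite ptD; ring.
Qed.

(** These hold for all large n. That the jump law has mass 1 is then derived from c_n > 0, which
    excludes the default inverse of 0 in [cn]. *)
Definition regular n := [/\ (0 < n)%N, \sum_(y <- box n) p_ n y = 1,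
  sigma2 r M alpha / 2 <= sig n & sig n <= 2 * sigma2 r M alpha].

Lemma near_regular : \forall n \near \oo, regular n.
Proof.
have s0 := sigma2_gt0.
have h1 : \forall n \near \oo, sigma2 r M alpha / 2 < sig n.
  by apply: (cvgr_gt _ sig_cvg); lra.
have h2 : \forall n \near \oo, sig n < 2 * sigma2 r M alpha.
  by apply: (cvgr_lt _ sig_cvg); lra.
have c0 := cc_gt0 halpha hr hM hk.
have h3 : \forall n \near \oo, 0 < c_ n.
  exact: (cvgr_gt _ (cn_cvg_cc halpha hr hM hk)).
near=> n; have n0 : (0 < n)%N by near: n; exists 1%N.
split => //.
- under eq_bigr => y _ do rewrite (pnE r M halpha y n0).
  rewrite -mulr_sumr sum_wn1// cnE// mulVf// -invr_eq0 -cnE// gt_eqF//.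
  by near: n.
- by apply/ltW; near: n.
- by apply/ltW; near: n.
Unshelve. all: by end_near.
Qed.

(** * Stabilization of the source by barriers *)

Context (rho : R * R -> R) (B R0 : R).
Hypotheses (hB : forall x, rho x <= B) (R00 : 0 < R0) (srho : supported R0 rho).
Let B0 : 0 <= B. Proof. by rewrite -(srho (x := (R0, 0)))// /enorm /= expr0n addr0 sqrtr_sqr ler_norm. Qed.

Let T0 := Num.sqrt (R0 ^+ 2 + eps).
Let T0_gt0 : 0 < T0. Proof. by rewrite sqrtr_gt0 ltr_wpDl// sqr_ge0. Qed.
(** Chosen so that [a0] times the lower bound of [Ln] on [T] over the ball of radius R0, for sig n
    >= sigma^2 / 2, equals B + 1. *)
Let a0 := 8 * (B + 1) * T0 ^+ 3 / (sigma2 r M alpha * eps).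
Let a0_gt0 : 0 < a0.
Proof.
have B1 : 0 < B + 1 by rewrite ltr_wpDl.
apply: divr_gt0; apply: mulr_gt0; rewrite ?sigma2_gt0 ?exprn_gt0//.
by rewrite mulr_gt0.
Qed.

Lemma barrier_stable n a x : regular n -> a0 <= a -> rho x + Ln alpha r M n (barrier a) x <= 1.
Proof.
move=> [n0 p1 s1 s2] ha; rewrite Ln_barrier.
have s0 := sigma2_gt0.
have a1 : 0 < a by exact: lt_le_trans ha.
have bs : b * sig n <= 1.
  have s20 : 0 < 2 * sigma2 r M alpha by rewrite mulr_gt0.
  by apply: (le_trans (ler_wpM2l (ltW b0) s2)); rewrite /b mulVf// gt_eqF.
have hT := Ln_T x n0.
have T1 := T_gt0 x.
have sn0 : 0 < sig n by apply: lt_le_trans s1; rewrite divr_gt0.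
have LT0 : 0 <= Ln alpha r M n T x.
  by apply: le_trans hT; rewrite mulr_ge0 ?(ltW sn0) ?divr_ge0 ?(ltW eps0)// mulr_ge0// exprn_ge0// ltW.
have [xR|xR] := leP R0 (enorm x).
  rewrite srho// add0r; have := mulr_ge0 (ltW a1) LT0; lra.
suff : B <= a * Ln alpha r M n T x by move: (hB x); lra.
have TT : T x <= T0.
  apply: ler_wsqrtr; rewrite lerD2r ler_pXn2r// ?nnegrE ?enorm_ge0 ?ltW//.
apply: (@le_trans _ _ (a0 * (sigma2 r M alpha / 2 * (eps / (4 * T0 ^+ 3))))).
  rewrite /a0 (_ : _ * _ = B + 1) ?lerDl//; field.
  by rewrite !gt_eqF.
apply: ler_pM => //; first exact: ltW.
  by rewrite mulr_ge0 ?divr_ge0 ?(ltW s0) ?(ltW eps0)// mulr_ge0// exprn_ge0// ltW.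
apply: le_trans hT; apply: ler_pM => //; first by rewrite divr_ge0// ltW.
  by rewrite divr_ge0 ?(ltW eps0)// mulr_ge0// exprn_ge0// ltW.
rewrite ler_wpM2l ?(ltW eps0)// lef_pV2 ?posrE ?mulr_gt0 ?exprn_gt0// ler_pM2l//.
by rewrite ler_pXn2r// nnegrE ltW.
Qed.

Lemma barrier_ge0 a x : 0 <= barrier a x.
Proof. by rewrite mulr_ge0 ?sqr_ge0// ltW. Qed.

Let K := a0 / (2 * b).
Let U := b * K ^+ 2.
Let K0 : 0 < K. Proof. by rewrite divr_gt0// mulr_gt0. Qed.

Context (xs : nat -> nat -> site).
Local Notation emitted_ n := (emitted alpha r M n (fun y => rho (pt n y)) (xs n)).
Local Notation odo_ n := (odo alpha r M n (fun y => rho (pt n y)) (xs n)).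

Lemma emitted_barrier n a k z : regular n -> a0 <= a ->
  emitted_ n k z <= n%:R `^ alpha * barrier a (pt n z).
Proof.
move=> rn ha; have [n0 p1 _ _] := rn.
apply: (@least_action R alpha r M halpha hr hM hk n n0 _ _ (fun=> True) (fun=> True)
  (fun z => n%:R `^ alpha * barrier a (pt n z))) => //.
- by move=> y _; rewrite -addrA avg_Ln//; exact: barrier_stable.
- by move=> y _; rewrite mulr_ge0 ?powR_ge0 ?barrier_ge0.
Qed.

(* At a site far out, the parameter [a] is chosen so that the barrier vanishes there. *)
Lemma odometer_bounds : exists U K : R, [/\ 0 < U, 0 < K & forall n, regular n ->
  (exists2 W : site -> R, forall z, 0 <= W z &
     forall z, rho (pt n z) + avg alpha r M n W z - W z <= 1) /\
  (forall k z, emitted_ n k z <= n%:R `^ alpha * U) /\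
  (forall k z, K <= enorm (pt n z : R * R) -> emitted_ n k z = 0)].
Proof.
exists U, K; split => //; first by rewrite /U mulr_gt0// exprn_gt0.
move=> n rn; have [n0 p1 _ _] := rn; split.
  exists (fun z => n%:R `^ alpha * barrier a0 (pt n z)) => z.
    by rewrite mulr_ge0 ?powR_ge0 ?barrier_ge0.
  by rewrite -addrA avg_Ln//; exact: barrier_stable.
have key k z : K <= T (pt n z) -> emitted_ n k z = 0.
  move=> hz; apply/eqP; rewrite eq_le mass_ge_emitted_ge0 andbT.
  have ha : a0 <= 2 * b * T (pt n z).
    by rewrite mulrC -ler_pdivrMr// mulr_gt0.
  apply: (le_trans (emitted_barrier k z rn ha)).
  rewrite /barrier mulrAC mulfV ?mul1r ?subrr ?expr0n ?mulr0//.
  by rewrite gt_eqF// mulr_gt0.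
split => k z; last by move=> hz; apply: key; exact: le_trans (T_ge _).
have [/key ->|hz] := leP K (T (pt n z)).
  by rewrite mulr_ge0 ?powR_ge0// /U mulr_ge0 ?sqr_ge0// ltW.
apply: (le_trans (emitted_barrier k z rn (lexx a0))).
rewrite ler_wpM2l ?powR_ge0// /barrier /U ler_wpM2l ?(ltW b0)// -/K -sqrrN opprB.
have T1 := T_gt0 (pt n z).
by rewrite ler_pXn2r// ?nnegrE ?subr_ge0 ?(ltW hz) ?(ltW K0)// gerBl ltW.
Qed.

End Barrier.

(** * Convergence of the discrete odometers *)

Section Convergence.
Context {R : realType}.
Local Notation mu := (@lebesgue_measure R).
Local Notation P := (measurableTypeR R * measurableTypeR R)%type.
Local Notation measurable2 := (@measurable _ P).
Local Notation mfun2 f := (@measurable_fun _ _ P R setT f).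
Local Notation L1 D f := (mu2.-integrable (D : set P) (EFin \o f)).

Context (alpha r M : R) (halpha : 1 < alpha < 2) (hr : 0 < r < M) (hM : 1 < M).
Context (hk : forall n : nat, (0 < n)%N -> 0 < kn r M alpha n).

Local Notation k_ := (kn r M alpha).
Local Notation F_ := (Fn r M).
Local Notation w_ := (wn r M alpha).
Local Notation c_ := (cn r M alpha).
Local Notation p_ := (pn r M alpha).
Local Notation c := (cc r M alpha).
Local Notation box n := (sites (Nbox M n)).
Local Notation L_M := (LM r M alpha).

Let M_gt0 : 0 < M. Proof. exact: lt_trans ltr01 hM. Qed.

Local Opaque kn Fn wn cn pn.
Implicit Types (x : R * R) (g : R * R -> R).
Local Notation m := (M + 1).
Local Notation Ln_ := (Ln alpha r M).
Local Notation vol rad := (fine (mu2 (eball rad : set P))).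

Lemma generator_error : exists2 E : nat -> R, E n @[n --> \oo] --> 0 &
  (forall n, 0 <= E n) /\ forall n f x C, (0 < n)%N -> 0 <= C -> mfun2 f -> d2_lip C f x ->
    `|Ln_ n f x - L_M f x| <= C * E n.
Proof.
have [e e0 he] := generator_cvg halpha hr hM hk; exists (fun n => `|e n|).
  by rewrite -(@normr0 _ R); exact: cvg_norm.
split=> [n|n f x C n0 C0 mf hf]; first exact: normr_ge0.
by apply: (le_trans (he n f x C n0 C0 mf hf)); rewrite ler_wpM2l// ler_norm.
Qed.

Lemma natr_inv_cvg0 : n%:R^-1 @[n --> \oo] --> (0 : R).
Proof. by rewrite -cvg_shiftS; exact: cvg_harmonic. Qed.

Lemma lipschitz_continuous (f : R * R -> R) C : (forall x y, `|f x - f y| <= C * enorm (x - y)) ->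
  continuous f.
Proof.
move=> h x; apply/cvgrPdist_le => e e0.
have C1 : 0 < `|C| + 1 by rewrite ltr_wpDl.
have : enorm (x - y) @[y --> x] --> enorm (x - x).
  by apply: continuous_comp; [apply: continuousB => //; exact: cst_continuous|exact: continuous_enorm].
rewrite subrr enorm0 => /cvgrPdist_le /(_ (e / (`|C| + 1))); rewrite divr_gt0// => /(_ isT).
apply: filterS => y; rewrite sub0r normrN ger0_norm ?enorm_ge0// ler_pdivlMr// mulrC.
apply: le_trans; apply: (le_trans (h x y)); rewrite ler_wpM2r ?enorm_ge0//.
by apply: (le_trans (ler_norm C)); rewrite lerDl.
Qed.

(** * Mollification at a fixed scale *)

Section Mollify.
Context (t : R) (t0 : 0 < t).

Lemma bump_nice a : nice (bump t a : R * R -> R).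
Proof. exact/test_nice/bump_test. Qed.

Lemma bump_supported x : supported (enorm x + 2 * t) (bump t x : R * R -> R).
Proof.
move=> w hw; apply: bump_out; have := enormD (w - x) x; rewrite subrK => h.
by rewrite -(lerD2l (enorm x)); apply: (le_trans hw); rewrite addrC.
Qed.

Lemma integrable_bump x : L1 setT (bump t x : R * R -> R).
Proof.
have [cb [C hC] [rad _ sb] _] := bump_nice x.
exact: supported_integrable (continuous_measurable2 cb) sb (fun z _ => hC z).
Qed.

Lemma bump_average_le x (h : R * R -> R) (c0 : R) : L1 setT (fun w => h w * bump t x w) ->
  (forall w, enorm (w - x) <= 2 * t -> h w <= c0) ->
  \int[mu2]_w (h w * bump t x w) <= c0.
Proof.
move=> Lh hc; have Lb := integrable_bump x.
rewrite -[leRHS]mulr1 -(Rintegral_bump x t0) -RintegralZl//.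
apply: le_Rintegral => //; first exact: integrable2Z.
move=> w _; have [hw|/ltW hw] := leP (enorm (w - x)) (2 * t).
  by rewrite ler_wpM2r ?bump_ge0// hc.
by rewrite bump_out// !mulr0.
Qed.

(** Written as a pairing with the test function centred at [x], so that weak inequalities for [g]
    become pointwise ones for the convolution. *)
Definition conv g x : R := \int[mu2]_w (g w * bump t x w).

Context (g : R * R -> R) (G Kg : R).
Hypotheses (mg : mfun2 g) (hG : forall x, `|g x| <= G) (sg : supported Kg g).

Lemma measurable_d2_shift (f : R * R -> R) (y : R * R) : mfun2 f -> mfun2 (fun w => d2 f w y).
Proof.
move=> mf; apply: measurable_funB; last exact: measurable_funM.
by apply: measurable_funD; exact: measurable_translate.
Qed.

Lemma integrable_conv (h : R * R -> R) C : mfun2 h -> (forall w, `|h w| <= C) -> L1 setT (fun w => g w * h w).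
Proof.
move=> mh hC; apply: (@supported_integrable _ _ Kg (G * C)).
- exact: measurable_funM.
- by move=> w /sg ->; rewrite mul0r.
- by move=> w _; rewrite normrM ler_pM.
Qed.

Let mbump a : mfun2 (bump t a : R * R -> R).
Proof. by have [cb _ _ _] := bump_nice a; exact: continuous_measurable2. Qed.

Let Lbump a : L1 setT (fun w => g w * bump t a w).
Proof. by have [_ [C hC] _ _] := bump_nice a; exact: integrable_conv hC. Qed.

Lemma norm_conv_le (h : R * R -> R) C : mfun2 h -> (forall w, `|h w| <= C) ->
  `|\int[mu2]_w (g w * h w)| <= G * C * vol Kg.
Proof.
move=> mh hC; rewrite (@supported_Rintegral _ (fun w => g w * h w) Kg); last by move=> w /sg ->; rewrite mul0r.
apply: norm_Rintegral_bounded.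
- exact: measurable_eball.
- exact: mu2_eball_lty.
- exact: measurable_funM.
- by move=> w _; rewrite normrM ler_pM.
Qed.

(** Second differences in the centre of the bump are second differences in its variable, as they are
    even in the increment. *)
Lemma conv_d2 x y : d2 (conv g) x y = \int[mu2]_w (g w * d2 (bump t 0) (w - x) y).
Proof.
rewrite /d2 /conv -RintegralD// -RintegralZl//.
have L2 : L1 setT (fun w => g w * bump t (x + y) w + g w * bump t (x - y) w) by exact: integrable2D.
rewrite -RintegralB//; last exact: integrable2Z.
apply: eq_Rintegral => w _; rewrite !(bump_translate t _ w) !opprD !addrA opprK.
by rewrite [w - x + y]addrC; move: (bump _ _ _) (bump _ _ _) (bump _ _ _) => a b c; ring.
Qed.

(** The constant involves [g] only through a bound and a support radius, so it is common to all
    discrete odometers. *)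
Lemma conv_nice C : 0 <= C -> (forall x, d2_lip C (bump t 0) x) ->
  [/\ 0 <= G * C * vol Kg, mfun2 (conv g) & forall x, d2_lip (G * C * vol Kg) (conv g) x].
Proof.
move=> C0 hC; have [cb _ [rad r0 sb] _] := bump_nice 0.
have G0 : 0 <= G by exact: le_trans (hG 0).
have V0 : 0 <= vol Kg by rewrite fine_ge0.
have [CK cK] := bump_test t 0 1%N.
have [Lb Lb0 hLb] := Ck1_lip cK CK (fun x => @tsupport0 _ _ x).
split; first by rewrite !mulr_ge0.
  apply: continuous_measurable2; apply: (@lipschitz_continuous _ (G * Lb * vol Kg)) => x y.
  rewrite /conv -RintegralB//.
  under eq_Rintegral => w _ do rewrite -mulrBr.
  have h w : `|bump t x w - bump t y w| <= Lb * enorm (x - y).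
    rewrite !(bump_translate t _ w) distrC.
    by have := hLb (w - x) (x - y); rewrite addrA subrK.
  apply: (le_trans (norm_conv_le _ h)); first exact: measurable_funB.
  by rewrite le_eqVlt; apply/orP/or_introl/eqP; ring.
move=> x y z; rewrite !conv_d2.
have md (a : R * R) : mfun2 (fun w => d2 (bump t 0) (w - x) a).
  exact: (measurable_translate (- x) (measurable_d2_shift a (mbump 0))).
have bd (a : R * R) w : `|d2 (bump t 0) (w - x) a| <= C * enorm a ^+ 2 by exact: d2_lip_bound.
rewrite -RintegralB//; [|exact: integrable_conv (bd y)|exact: integrable_conv (bd z)].
under eq_Rintegral => w _ do rewrite -mulrBr.
apply: (le_trans (@norm_conv_le (fun w => d2 (bump t 0) (w - x) y - d2 (bump t 0) (w - x) z) (C * enorm (y - z) * (enorm y + enorm z)) _ _)).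
- exact: measurable_funB.
- by move=> w; exact: hC.
- by rewrite le_eqVlt; apply/orP/or_introl/eqP; ring.
Qed.

Lemma d2_bump x y w : d2 (bump t x) w y = d2 (bump t 0) (w - x) y.
Proof.
rewrite /d2 !(bump_translate t x).
have -> : w + y - x = w - x + y by rewrite addrAC.
by have -> : w - y - x = w - x - y by rewrite addrAC.
Qed.

Lemma integrable_conv_d2 x y : L1 setT (fun w => g w * d2 (bump t x) w y).
Proof.
have [_ _ _ [C C0 hC]] := bump_nice x.
by apply: (integrable_conv (measurable_d2_shift y (mbump x))) => w; exact: d2_lip_bound (hC w).
Qed.

Lemma conv_Ln n x : Ln_ n (conv g) x = \int[mu2]_w (g w * Ln_ n (bump t x) w).
Proof.
rewrite Ln_d2.
transitivity (\int[mu2]_w \sum_(y <- box n) n%:R `^ alpha / 2 * p_ n y * (g w * d2 (bump t x) w (pt n y))).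
  rewrite Rintegral_big_sum//; last by move=> y; apply: integrable2Z => //; exact: integrable_conv_d2.
  rewrite mulr_sumr; apply: eq_bigr => y _; rewrite RintegralZl//; last exact: integrable_conv_d2.
  rewrite mulrA; suff -> : d2 (conv g) x (pt n y) = \int[mu2]_w (g w * d2 (bump t x) w (pt n y)) by [].
  by rewrite conv_d2; apply: eq_Rintegral => w _; rewrite (d2_bump x).
apply: eq_Rintegral => w _; rewrite Ln_d2 mulrCA mulr_sumr mulr_sumr; apply: eq_bigr => y _.
by rewrite -!mulrA; do 2!congr (_ * _); rewrite mulrCA.
Qed.

(** The identity for [Ln] is a finite sum, and both sides pass to the limit; this avoids exchanging
    two integrals for a merely bounded [g]. *)
Lemma conv_LM x : L_M (conv g) x = \int[mu2]_w (g w * L_M (bump t x) w).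
Proof.
have [_ _ _ [C0 C00 hC0]] := bump_nice 0; have [C1 mc hc] := conv_nice C00 hC0.
have h1 := Ln_cvg halpha hr hM hk C1 mc (hc x).
have bg : loc_bounded g by move=> ?; exists G => w _; exact: hG.
have h2 := LM_dual_cvg halpha hr hM hk mg bg (bump_nice x).
apply: cvg_unique h1 _ => //.
move: h2; rewrite -cvg_shiftS -[X in _ -> X]cvg_shiftS.
under eq_fun => n.
  have [cb [Cb hCb] [rad r0 sb] _] := bump_nice x.
  rewrite (@Ln_dual R alpha r M n.+1 g (bump t x) rad Cb (ltn0Sn n) mg bg (continuous_measurable2 cb) sb hCb) -conv_Ln; over.
by [].
Qed.

End Mollify.

(** * Comparison of the discrete odometers *)

Context (E : nat -> R) (E0 : forall n, 0 <= E n) (Ecvg : E n @[n --> \oo] --> 0).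
Hypothesis hE : forall n f x C, (0 < n)%N -> 0 <= C -> mfun2 f -> d2_lip C f x ->
  `|Ln_ n f x - L_M f x| <= C * E n.

Context (rho : R * R -> R) (Lr : R) (xs : nat -> nat -> site) (U K : R).
Hypotheses (mrho : mfun2 rho) (Lr0 : 0 <= Lr) (rho_lip : forall x y, `|rho x - rho y| <= Lr * enorm (x - y)).
Hypothesis hxs : forall n, (0 < n)%N -> toppling_sequence r M alpha n (fun y => rho (pt n y)) (xs n).
Local Notation emitted_ n := (emitted alpha r M n (fun y => rho (pt n y)) (xs n)).
Local Notation odo_ n := (odo alpha r M n (fun y => rho (pt n y)) (xs n)).
Local Notation regular := (regular alpha r M).
Hypotheses (U0 : 0 < U) (K0 : 0 < K).
Hypothesis hUK : forall n, regular n ->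
  (exists2 W : site -> R, forall z, 0 <= W z &
     forall z, rho (pt n z) + avg alpha r M n W z - W z <= 1) /\
  (forall k z, emitted_ n k z <= n%:R `^ alpha * U) /\
  (forall k z, K <= enorm (pt n z : R * R) -> emitted_ n k z = 0).

Definition scaled_odo n z : R := (n%:R `^ alpha)^-1 * odo_ n z.
Local Notation u n := (scaled_odo n).
Definition odo_ext n x : R := u n (nearest n x).
Local Notation uu n := (odo_ext n).

Let na0 n : regular n -> 0 < n%:R `^ alpha :> R.
Proof. by move=> [n0 _ _ _]; rewrite powR_gt0// ltr0n. Qed.

Lemma scaled_odo_le n B z : regular n -> (forall k, emitted_ n k z <= n%:R `^ alpha * B) -> u n z <= B.
Proof.
move=> rn h; have [[W W0 W1] _] := hUK rn; have [n0 _ _ _] := rn.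
rewrite /scaled_odo mulrC ler_pdivrMr ?na0// mulrC.
exact: (@odo_le R alpha r M halpha hr hM hk n n0 _ _ W W0 W1).
Qed.

Lemma scaled_odo_ge0 n z : regular n -> 0 <= u n z.
Proof.
move=> rn; have [[W W0 W1] _] := hUK rn; have [n0 _ _ _] := rn.
by rewrite mulr_ge0 ?invr_ge0 ?powR_ge0// (@odo_ge0 R alpha r M halpha hr hM hk n n0 _ _ W W0 W1).
Qed.

Lemma scaled_odo_leU n z : regular n -> u n z <= U.
Proof. by move=> rn; apply: scaled_odo_le => // k; have [_ [h _]] := hUK rn. Qed.

Lemma scaled_odo_out n z : regular n -> K <= enorm (pt n z : R * R) -> u n z = 0.
Proof.
move=> rn hz; apply/eqP; rewrite eq_le scaled_odo_ge0// andbT.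
by apply: scaled_odo_le => // k; have [_ [_ ->]] := hUK rn; rewrite ?mulr0.
Qed.

Lemma final_mass_ext n x : regular n ->
  step_ext n (final_mass r M alpha n (fun y => rho (pt n y)) (xs n)) x =
  rho (pt n (nearest n x)) + Ln_ n (uu n) x.
Proof.
move=> rn; have [[W W0 W1] _] := hUK rn; have [n0 p1 _ _] := rn.
rewrite /step_ext (@final_massE R alpha r M halpha hr hM hk n n0 _ (xs n) W W0 W1) -addrA; congr (_ + _).
rewrite /Ln /avg -[X in _ - X]mul1r -{1}p1 mulr_suml -sumrB mulr_sumr; apply: eq_bigr => y _.
rewrite /odo_ext nearestD// /scaled_odo; have := na0 rn; move: (_ `^ _) => a a0.
by field; rewrite gt_eqF.
Qed.

Lemma supersolution n x : regular n -> rho (pt n (nearest n x)) + Ln_ n (uu n) x <= 1.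
Proof.
move=> rn; have [[W W0 W1] _] := hUK rn; have [n0 _ _ _] := rn.
rewrite -final_mass_ext//.
exact: (@final_mass_le1 R alpha r M halpha hr hM hk n n0 _ _ (hxs n0) W W0 W1).
Qed.

(** A e is the maximum of the paraboloid d ((K + m)^2 - |x|^2) with d = 2 e / sigma^2, whose
    generator - d sig n is at most - e for regular n. *)
Let A := 2 * (K + m) ^+ 2 / sigma2 r M alpha.
Let A0 : 0 <= A.
Proof.
apply: divr_ge0; first by rewrite mulr_ge0 ?sqr_ge0.
exact/ltW/sigma2_gt0.
Qed.
Let m0 : 0 < m. Proof. by rewrite addr_gt0. Qed.

(** Least action on the ball of radius K, outside which nothing is emitted. Jumps have length at
    most m, so nonnegativity is asked up to K + m only. *)
Lemma comparison n (g : R * R -> R) e : regular n -> 0 <= e ->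
  (forall z : site, enorm (pt n z : R * R) <= K + m -> 0 <= g (pt n z)) ->
  (forall z : site, enorm (pt n z : R * R) <= K -> rho (pt n z) + Ln_ n g (pt n z) <= 1 + e) ->
  forall z : site, enorm (pt n z : R * R) <= K + m -> u n z <= g (pt n z) + A * e.
Proof.
move=> rn e0 g0 hg z hz; have [n0 p1 s1 _] := rn; have na := na0 rn.
have s0 := sigma2_gt0 halpha hr hM hk.
pose d := 2 * e / sigma2 r M alpha.
have d0 : 0 <= d by apply: divr_ge0; [exact: mulr_ge0|exact: ltW].
pose w x := g x + d * ((K + m) ^+ 2 - enorm x ^+ 2).
have Km0 : 0 <= K + m by rewrite addr_ge0// ltW.
have Lw x : Ln_ n w x = Ln_ n g x - d * sig alpha r M n.
  rewrite -(Ln_sq alpha r M n x) /Ln (mulrCA d) -mulrBr [d * _]mulr_sumr -sumrB; congr (_ * _).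
  by apply: eq_bigr => y _; rewrite /w; move: (p_ n y) => q; ring.
have wA x : w x <= g x + A * e.
  rewrite lerD2l (_ : A * e = d * (K + m) ^+ 2); last by rewrite /A /d; ring.
  by rewrite ler_wpM2l// gerBl sqr_ge0.
apply: le_trans (wA _); apply: scaled_odo_le => // k.
apply: (@least_action R alpha r M halpha hr hM hk n n0 _ _ (fun z => enorm (pt n z : R * R) <= K)
  (fun z => enorm (pt n z : R * R) <= K + m) (fun z => n%:R `^ alpha * w (pt n z))) => //.
- move=> j y; rewrite ltNge => h; apply/ltW; rewrite ltNge; apply: contraNN h => h.
  by have [_ [_ ->]] := hUK rn.
- move=> y hy; rewrite -addrA avg_Ln// Lw; have := hg y hy.
  have : e <= d * sig alpha r M n.
    apply: (@le_trans _ _ (d * (sigma2 r M alpha / 2))); last by rewrite ler_wpM2l.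
    by rewrite /d (_ : _ * _ = e)//; field; rewrite gt_eqF.
  lra.
- move=> y y' hy py; rewrite ptD; apply: (le_trans (enormD _ _)); apply: lerD => //.
  exact: (@pn_enorm R alpha r M halpha hM n y' n0 py).
- move=> y hy; rewrite mulr_ge0 ?(ltW na)// addr_ge0 ?g0// mulr_ge0// subr_ge0.
  by rewrite ler_pXn2r// ?nnegrE ?enorm_ge0.
Qed.

Let C1 := A * Lr.
Let C10 : 0 <= C1. Proof. by rewrite mulr_ge0. Qed.

(** The translate by h is a supersolution for the translated source, which differs from [rho] by at
    most Lr |h|. As z and h are arbitrary, one inequality is enough. *)
Lemma scaled_odo_lip n z h : regular n ->
  u n z <= u n (z + h) + C1 * enorm (pt n h : R * R).
Proof.
move=> rn; have [n0 _ _ _] := rn.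
have [hz|/ltW hz] := leP (enorm (pt n z : R * R)) (K + m); last first.
  rewrite scaled_odo_out//; last by apply: le_trans hz; rewrite lerDl ltW.
  by apply: addr_ge0; [exact: scaled_odo_ge0|rewrite mulr_ge0 ?enorm_ge0].
have e0 : 0 <= Lr * enorm (pt n h : R * R) by rewrite mulr_ge0 ?enorm_ge0.
have -> : u n (z + h) = (fun x => uu n (x + pt n h)) (pt n z).
  by rewrite /= /odo_ext -ptD nearest_pt.
rewrite /C1 -mulrA; apply: (@comparison n (fun x => uu n (x + pt n h))) => //.
  by move=> y _; exact: scaled_odo_ge0.
move=> y _.
have -> : Ln_ n (fun x => uu n (x + pt n h)) (pt n y) = Ln_ n (uu n) (pt n y + pt n h).
  by rewrite /Ln; congr (_ * _); apply: eq_bigr => v _; rewrite (addrAC (pt n y)).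
have := supersolution (pt n y + pt n h) rn.
rewrite -ptD nearest_pt// ptD.
have := rho_lip (pt n y) (pt n y + pt n h).
rewrite opprD addrA subrr add0r enormN => /ler_normlP[_]; lra.
Qed.

Lemma odo_ext_lip n x y : regular n -> uu n x <= uu n y + C1 * (enorm (x - y) + 2 / n%:R).
Proof.
move=> rn; have [n0 _ _ _] := rn.
have := scaled_odo_lip (nearest n x) (nearest n y - nearest n x) rn.
have -> : nearest n x + (nearest n y - nearest n x) = nearest n y by rewrite addrC subrK.
move=> /le_trans; apply; rewrite lerD2l ler_wpM2l//.
rewrite ptD ptN.
have -> : pt n (nearest n y) - pt n (nearest n x) =
   (x - pt n (nearest n x)) - (y - pt n (nearest n y)) - (x - y) :> R * R.
  by rewrite !opprB -addrA subrKA addrC subrKA.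
apply: (le_trans (enormB _ _)); rewrite addrC lerD2l.
apply: (le_trans (enormB _ _)); rewrite (_ : 2 / n%:R = n%:R^-1 + n%:R^-1); last by rewrite mulrDl mul1r.
by apply: lerD; exact: enorm_nearest.
Qed.

Lemma odo_ext_ge0 n x : regular n -> 0 <= uu n x. Proof. exact: scaled_odo_ge0. Qed.
Lemma norm_odo_ext n x : regular n -> `|uu n x| <= U.
Proof. by move=> rn; rewrite ger0_norm ?odo_ext_ge0//; exact: scaled_odo_leU. Qed.
Lemma measurable_odo_ext n : regular n -> mfun2 (uu n).
Proof. by move=> [n0 _ _ _]; exact: measurable_nearest. Qed.
Lemma odo_ext_out n : regular n -> supported (K + 1) (uu n).
Proof.
move=> rn x hx; have [n0 _ _ _] := rn; apply: scaled_odo_out => //.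
have h := @enorm_nearest R n x n0.
have := enormB (pt n (nearest n x)) (pt n (nearest n x) - x); rewrite subKr -[X in _ + X]enormN opprB => h2.
have : n%:R^-1 <= 1 :> R by rewrite invf_le1 ?ltr0n// ler1n.
lra.
Qed.

Lemma Ln_bounded n (f : R * R -> R) G : (forall x, `|f x| <= G) -> exists C : R, forall x, `|Ln_ n f x| <= C.
Proof.
move=> hG; exists (n%:R `^ alpha * \sum_(y <- box n) `|p_ n y| * (G + G)) => x.
rewrite /Ln normrM ger0_norm ?powR_ge0// ler_wpM2l ?powR_ge0//.
apply: (le_trans (ler_norm_sum _ _ _)); apply: ler_sum => y _.
by rewrite normrM ler_wpM2l// (le_trans (ler_normB _ _))// lerD.
Qed.

(** At a fixed scale t a weak inequality for L_M becomes, after mollification, one for [Ln] up to a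
    multiple of E n. The function [g] will be an odometer of another index, or a truncated
    competitor of the limit. *)
Lemma upper_bound n t (g : R * R -> R) G Kg e C : regular n -> 0 < t -> mfun2 g ->
  (forall x, 0 <= g x) -> (forall x, `|g x| <= G) -> supported Kg g ->
  0 <= C -> (forall x, d2_lip C (bump t 0) x) -> 0 <= e ->
  (forall x, enorm x <= K -> \int[mu2]_w (g w * L_M (bump t x) w) <= 1 - rho x + e) ->
  forall z : site, enorm (pt n z : R * R) <= K + m ->
    u n z <= conv t g (pt n z) + A * (e + G * C * vol Kg * E n).
Proof.
move=> rn t0 mg g0 hG sg C0 hC e0 hL; have [n0 _ _ _] := rn.
have [C'0 mc hc] := conv_nice mg hG sg C0 hC.
apply: comparison => //.
- by rewrite addr_ge0// mulr_ge0.
- by move=> z _; rewrite Rintegral_ge0// => w _; rewrite mulr_ge0 ?bump_ge0.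
move=> z hz; have := hE n0 C'0 mc (hc (pt n z)).
rewrite (conv_LM t mg hG sg) => /ler_normlP[_]; have := hL _ hz.
move: (rho _) (\int[mu2]_w _) (Ln_ _ _ _) (G * _ * _ * _) => a b c' d; lra.
Qed.

Lemma d2_lip_bump t x C : 0 < t -> (forall x, d2_lip C (bump t 0) x) -> forall w, d2_lip C (bump t x) w.
Proof. by move=> t0 hC w y z; rewrite !(d2_bump t x); exact: hC. Qed.

(** The n-th odometer is compared with the mollified k-th one. [Ct] may explode as t tends to 0, but
    t is fixed before n and k. *)
Lemma odo_ext_cauchy t : 0 < t -> exists2 Ct : R, 0 <= Ct &
  forall n k x, regular n -> regular k ->
    uu n x <= uu k x + 5 * C1 * (t + n%:R^-1 + k%:R^-1) + Ct * (E n + E k).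
Proof.
move=> t0; have [_ _ _ [C C0 hC]] := bump_nice t (0 : R * R).
have V0 : 0 <= vol (K + 1) by rewrite fine_ge0.
have UC0 : 0 <= U * C * vol (K + 1) by rewrite !mulr_ge0// ltW.
exists (A * (U * C * vol (K + 1))); first exact: mulr_ge0.
move=> n k x rn rk; have [n0 _ _ _] := rn; have [k0 _ _ _] := rk.
have ki0 : 0 <= k%:R^-1 :> R by rewrite invr_ge0.
have ni0 : 0 <= n%:R^-1 :> R by rewrite invr_ge0.
have mk := measurable_odo_ext rk; have bk z := norm_odo_ext z rk; have sk := odo_ext_out rk.
have lk : loc_bounded (uu k) by move=> ?; exists U => z _.
have [hz|/ltW hz] := leP (enorm (pt n (nearest n x) : R * R)) (K + m); last first.
  rewrite /odo_ext scaled_odo_out//; last by apply: le_trans hz; rewrite lerDl ltW.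
  apply: addr_ge0; last by apply: mulr_ge0; [exact: mulr_ge0|exact: addr_ge0].
  apply: addr_ge0; first exact: scaled_odo_ge0.
  by apply: mulr_ge0; [exact: mulr_ge0|rewrite !addr_ge0 ?(ltW t0)].
(* The first term is the oscillation of [rho] over the support of the bump, including the rounding
   to the lattice; the second replaces the k-th generator by L_M on the bump. *)
pose e := Lr * (2 * t + k%:R^-1) + U * C * vol (K + 1) * E k.
have e0 : 0 <= e by rewrite addr_ge0 ?mulr_ge0 ?addr_ge0 ?mulr_ge0// ltW.
have hL y : enorm y <= K -> \int[mu2]_w (uu k w * L_M (bump t y) w) <= 1 - rho y + e.
  move=> _; have [cb [B hB] [rad r0 sb] _] := bump_nice t y.
  have mb := continuous_measurable2 cb.
  have [B' hB'] := LM_bounded halpha hr hM hk (bump_nice t y).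
  have mLM := measurable_LM halpha hr hM hk (bump_nice t y).
  have [B'' hB''] := Ln_bounded k hB.
  have h1 w : `|L_M (bump t y) w - Ln_ k (bump t y) w| <= C * E k.
    rewrite distrC; apply: hE => //; exact: d2_lip_bump.
  have -> : \int[mu2]_w (uu k w * L_M (bump t y) w) =
     \int[mu2]_w (uu k w * (L_M (bump t y) w - Ln_ k (bump t y) w)) + \int[mu2]_w (uu k w * Ln_ k (bump t y) w).
    rewrite -RintegralD//.
    - by apply: eq_Rintegral => w _; rewrite -mulrDr subrK.
    - apply: (integrable_conv mk bk sk _ h1); apply: measurable_funB => //; exact: measurable_Ln.
    - apply: (integrable_conv mk bk sk _ hB''); exact: measurable_Ln.
  have h2 := @norm_conv_le _ U (K + 1) mk bk sk (fun w => L_M (bump t y) w - Ln_ k (bump t y) w) (C * E k).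
  have {}h2 := le_trans (ler_norm _) (h2 (measurable_funB mLM (measurable_Ln _ _ _ k mb)) h1).
  rewrite -(@Ln_dual R alpha r M k (uu k) (bump t y) rad B k0 mk lk mb sb hB).
  have h3 : \int[mu2]_w (Ln_ k (uu k) w * bump t y w) <= 1 - rho y + Lr * (2 * t + k%:R^-1).
    have [B3 hB3] := Ln_bounded k bk.
    apply: bump_average_le => //.
      apply: (loc_bounded_integrableM _ _ mb sb hB); first exact: measurable_Ln.
      by move=> ?; exists B3 => z _.
    move=> w hw; have := supersolution w rk.
    have := rho_lip y (pt k (nearest k w)).
    have h4 : enorm (y - pt k (nearest k w)) <= 2 * t + k%:R^-1.
      rewrite -(subrKA w) ; apply: (le_trans (enormD _ _)); apply: lerD; last exact: enorm_nearest.
      by rewrite -enormN opprB.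
    have h5 : Lr * enorm (y - pt k (nearest k w)) <= Lr * (2 * t + k%:R^-1) by exact: ler_wpM2l.
    by move=> /ler_normlP[h6 h7] h8; lra.
  apply: (le_trans (lerD h2 h3)); rewrite le_eqVlt; apply/orP/or_introl/eqP.
  by rewrite /e; ring.
have := @upper_bound n t (uu k) U (K + 1) e C rn t0 mk (fun z => odo_ext_ge0 z rk) bk sk C0 hC e0 hL (nearest n x) hz.
(* Together with A Lr (2 t + 1/k) = C1 (2 t + 1/k) this gives C1 (4 t + 1/n + 3/k), whence the
   factor 5 in the statement. *)
have h5 : conv t (uu k) (pt n (nearest n x)) <= uu k x + C1 * (n%:R^-1 + 2 * t + 2 / k%:R).
  apply: bump_average_le => //.
    have [cb [B hB] _ _] := bump_nice t (pt n (nearest n x) : R * R).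
    exact: (integrable_conv mk bk sk (continuous_measurable2 cb) hB).
  move=> w hw; apply: (le_trans (odo_ext_lip w x rk)); rewrite lerD2l ler_wpM2l// lerD2r.
  rewrite -(subrKA (pt n (nearest n x))) addrC; apply: (le_trans (enormD _ _)).
  rewrite lerD//; first by rewrite -enormN opprB; exact: enorm_nearest.
move=> /le_trans; apply; apply: (le_trans (lerD h5 (lexx _))).
have -> : A * (e + U * C * vol (K + 1) * E n) = C1 * (2 * t + k%:R^-1) + A * (U * C * vol (K + 1)) * (E n + E k).
  by rewrite /e /C1; ring.
rewrite [leLHS]addrA lerD2r -addrA lerD2l -mulrDr [leRHS]mulrAC [leRHS]mulrC.
rewrite ler_wpM2l//; move: t0 => /ltW; lra.
Qed.

Lemma odo_ext_unif_cauchy e : 0 < e -> exists N, forall n k, (N <= n)%N -> (N <= k)%N ->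
  regular n /\ forall x, `|uu n x - uu k x| <= e.
Proof.
move=> e0; pose D := 5 * C1 + 1.
have D0 : 0 < D by rewrite ltr_wpDl// mulr_ge0.
(* For 1/n and 1/k below t the Lipschitz error is at most 3 D t = e / 2; the summand 1 in [D] keeps
   it positive when C1 = 0. *)
pose t := e / (6 * D).
have t0 : 0 < t by rewrite divr_gt0// mulr_gt0.
have [Ct Ct0 hC] := odo_ext_cauchy t0.
have [N1 _ h1] := near_regular halpha hr hM hk.
have e4 : 0 < e / 4 by rewrite divr_gt0.
have hEn : Ct * E n @[n --> \oo] --> 0 by rewrite -[X in _ --> X](mulr0 Ct); exact: cvgMr.
have [N2 _ h2] := cvgr_lt _ hEn _ e4.
have [N3 _ h3] := near_infty_natSinv_lt (PosNum t0).
exists (maxn (maxn N1 N2) N3.+1) => n k; rewrite !geq_max => /andP[/andP[n1 n2] n3] /andP[/andP[k1 k2] k3].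
have rn := h1 n n1; have rk := h1 k k1; split => // x.
have n4 : n%:R^-1 < t by case: n n3 {n1 n2 rn} => // n n3; exact: h3.
have k4 : k%:R^-1 < t by case: k k3 {k1 k2 rk} => // k k3; exact: h3.
have := h2 n n2; have := h2 k k2; rewrite /= => e1 e2.
have h5 : 5 * C1 * (t + n%:R^-1 + k%:R^-1) <= e / 2.
  apply: (@le_trans _ _ (D * (3 * t))); last first.
    by have -> : D * (3 * t) = e / 2 by rewrite /t; field; rewrite gt_eqF.
  apply: ler_pM; [exact: mulr_ge0|by rewrite !addr_ge0 ?invr_ge0// ltW|by rewrite /D lerDl|].
  by move: n4 k4; lra.
have a1 := hC n k x rn rk; have a2 := hC k n x rk rn.
rewrite [t + k%:R^-1 + _]addrAC in a2; rewrite !mulrDr in a1 a2 h5.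
rewrite ler_norml; apply/andP; split; lra.
Qed.

(** * The limit odometer and its minimality *)

Definition limit_odo x : R := lim (uu n x @[n --> \oo]).
Local Notation v := limit_odo.

Lemma odo_ext_cvg x : uu n x @[n --> \oo] --> v x.
Proof.
apply: cauchy_cvg; apply: cauchy_exP => _/posnumP[e].
have [|N hN] := @odo_ext_unif_cauchy (e%:num / 2); first by rewrite divr_gt0.
exists (uu N x); exists N => // n /= Nn; rewrite /ball /=.
apply: le_lt_trans ((hN N n (leqnn N) Nn).2 x) _; rewrite /= ltr_pdivrMr// ltr_pMr// ltr1n//.
Qed.

Lemma odo_ext_unif e : 0 < e -> \forall n \near \oo, regular n /\ forall x, `|uu n x - v x| <= e.
Proof.
move=> /odo_ext_unif_cauchy[N hN]; exists N => // n /= Nn; split; first by have [] := hN n n Nn Nn.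
move=> x; have h : `|uu n x - uu k x| @[k --> \oo] --> `|uu n x - v x|.
  by apply: cvg_norm; apply: cvgB; [exact: cvg_cst|exact: odo_ext_cvg].
by apply: (cvgr_to_le h); exists N => // k /= Nk; exact: (hN n k Nn Nk).2.
Qed.

Let reg_near : \forall n \near \oo, regular n. Proof. exact: near_regular. Qed.

Lemma limit_odo_ge0 x : 0 <= v x.
Proof. by apply: (cvgr_to_ge (@odo_ext_cvg x)); near=> n; apply: odo_ext_ge0; near: n.
Unshelve. all: by end_near. Qed.

Lemma norm_limit_odo x : `|v x| <= U.
Proof.
rewrite ger0_norm ?limit_odo_ge0//; apply: (cvgr_to_le (@odo_ext_cvg x)); near=> n.
by apply: scaled_odo_leU; near: n.
Unshelve. all: by end_near. Qed.

Lemma limit_odo_out : supported (K + 1) v.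
Proof.
move=> x hx; apply: (cvg_unique _ (@odo_ext_cvg x)) => //.
apply: cvg_near_cst; near=> n; apply: odo_ext_out => //; near: n; exact: reg_near.
Unshelve. all: by end_near. Qed.

Lemma limit_odo_lip x y : `|v x - v y| <= C1 * enorm (x - y).
Proof.
have key x' y' : v x' - v y' <= C1 * enorm (x' - y').
  have h1 : uu n x' - uu n y' - C1 * (2 / n%:R) @[n --> \oo] --> v x' - v y' - C1 * (2 * 0).
    apply: cvgB; first by apply: cvgB; exact: odo_ext_cvg.
    by apply: cvgMr; apply: cvgMr; exact: natr_inv_cvg0.
  rewrite mulr0 mulr0 subr0 in h1.
  apply: (cvgr_to_le h1); near=> n.
  have rn : regular n by near: n; exact: reg_near.
  by have := odo_ext_lip x' y' rn; rewrite mulrDr; lra.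
rewrite ler_norml key andbT lerNl opprB; apply: (le_trans (key y x)).
by rewrite -enormN opprB.
Unshelve. all: by end_near. Qed.

Lemma limit_odo_continuous : continuous v.
Proof. exact: lipschitz_continuous limit_odo_lip. Qed.

(** By symmetry the generator falls on [phi]. Three errors remain: the rounding of [rho] to the
    lattice, [Ln phi] against [L_M phi], and the n-th odometer against its uniform limit. *)
Lemma final_mass_cvg phi : nice phi ->
  \int[mu2]_x (step_ext n (final_mass r M alpha n (fun y => rho (pt n y)) (xs n)) x * phi x) @[n --> \oo]
  --> \int[mu2]_x (rho x * phi x) + \int[mu2]_x (v x * L_M phi x).
Proof.
move=> np; have [cp [B hB] [rad r0 sp] [C C0 hC]] := np.
have mp := continuous_measurable2 cp.
have mLM := measurable_LM halpha hr hM hk np; have [B' hB'] := LM_bounded halpha hr hM hk np.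
have mv := continuous_measurable2 limit_odo_continuous.
have Lp : L1 setT phi by exact: supported_integrable mp sp (fun x _ => hB x).
have Lap : L1 setT (fun x => `|phi x|).
  apply: (@supported_integrable _ _ rad B) => [|x /sp ->|x _]; rewrite ?normr0 ?normr_id//.
  exact: measurableT_comp.
have V0 : 0 <= vol (K + 1) by rewrite fine_ge0.
have B0 : 0 <= B' by exact: le_trans (hB' 0).
have lrho : loc_bounded rho.
  by apply: continuous_loc_bounded; exact: lipschitz_continuous rho_lip.
have LrP : L1 setT (fun x => rho x * phi x) by exact: loc_bounded_integrableM sp hB.
have Lv := integrable_conv mv norm_limit_odo limit_odo_out mLM hB'.
pose D := Lr * (\int[mu2]_x `|phi x|).
have key n e : regular n -> 0 <= e -> (forall x, `|uu n x - v x| <= e) ->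
   `|\int[mu2]_x (rho x * phi x) + \int[mu2]_x (v x * L_M phi x) -
     \int[mu2]_x (step_ext n (final_mass r M alpha n (fun y => rho (pt n y)) (xs n)) x * phi x)|
   <= D * n%:R^-1 + (U * C * vol (K + 1) * E n + e * B' * vol (K + 1)).
  move=> rn e0 hv; have [n0 _ _ _] := rn.
  have mn := measurable_odo_ext rn; have bn z := norm_odo_ext z rn; have sn := odo_ext_out rn.
  have ln : loc_bounded (uu n) by move=> ?; exists U => z _.
  have mLn := measurable_Ln alpha r M n mp.
  have [B2 hB2] := Ln_bounded n hB.
  have [B3 hB3] := Ln_bounded n bn.
  have mr : mfun2 (fun x => rho (pt n (nearest n x))) by exact: (measurable_nearest (fun z => rho (pt n z)) n0).
  have hr1 x : `|rho x - rho (pt n (nearest n x))| <= Lr * n%:R^-1.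
    by apply: (le_trans (rho_lip _ _)); rewrite ler_wpM2l ?enorm_nearest.
  have L2 : L1 setT (fun x => Ln_ n (uu n) x * phi x).
    apply: (loc_bounded_integrableM _ _ mp sp hB); first exact: measurable_Ln.
    by move=> ?; exists B3 => z _.
  have L3 : L1 setT (fun x => (rho x - rho (pt n (nearest n x))) * phi x).
    apply: (loc_bounded_integrableM _ _ mp sp hB); first exact: measurable_funB.
    by move=> ?; exists (Lr * n%:R^-1) => z _.
  have L1' : L1 setT (fun x => rho (pt n (nearest n x)) * phi x).
    rewrite (_ : (fun x => rho (pt n (nearest n x)) * phi x) =
      (fun x => rho x * phi x - (rho x - rho (pt n (nearest n x))) * phi x)); first exact: integrable2B.
    by apply/funext => x; ring.
  have -> : \int[mu2]_x (step_ext n (final_mass r M alpha n (fun y => rho (pt n y)) (xs n)) x * phi x) =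
     \int[mu2]_x (rho (pt n (nearest n x)) * phi x) + \int[mu2]_x (uu n x * Ln_ n phi x).
    rewrite -(Ln_dual alpha r M n0 mn ln mp sp hB) -RintegralD//; apply: eq_Rintegral => x _.
    by rewrite final_mass_ext// mulrDl.
  have h1 : `|\int[mu2]_x (rho x * phi x) - \int[mu2]_x (rho (pt n (nearest n x)) * phi x)| <= D * n%:R^-1.
    rewrite -RintegralB//; under eq_Rintegral => x _ do rewrite -mulrBl.
    rewrite /D mulrAC -RintegralZl//.
    apply: norm_Rintegral_le => //.
    - by apply: measurable_funM => //; exact: measurable_funB.
    - exact: integrable2Z.
    - by move=> x _; rewrite normrM ler_wpM2r.
  have L4 := integrable_conv mn bn sn mLn hB2.
  have L5 := integrable_conv mn bn sn mLM hB'.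
  have h2 : `|\int[mu2]_x (uu n x * L_M phi x) - \int[mu2]_x (uu n x * Ln_ n phi x)| <= U * (C * E n) * vol (K + 1).
    rewrite -RintegralB//; under eq_Rintegral => x _ do rewrite -mulrBr.
    apply: (norm_conv_le mn bn sn) => [|x]; first exact: measurable_funB.
    by rewrite distrC; exact: hE.
  have h3 : `|\int[mu2]_x (v x * L_M phi x) - \int[mu2]_x (uu n x * L_M phi x)| <= e * B' * vol (K + 1).
    rewrite -RintegralB//; under eq_Rintegral => x _ do rewrite -mulrBl.
    apply: (@norm_conv_le (fun x => v x - uu n x) e (K + 1)) => //; first exact: measurable_funB.
      by move=> x; rewrite distrC.
    by move=> x hx; rewrite limit_odo_out// sn// subr0.
  move: h1 h2 h3; rewrite mulrA.
  move: (\int[mu2]_x _) (\int[mu2]_x _) (\int[mu2]_x _) (\int[mu2]_x _) (\int[mu2]_x _) => a b c' d e'.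
  move=> h1 h2 h3; rewrite (_ : e' + a - (d + b) = (e' - d) + ((c' - b) + (a - c'))); last by ring.
  apply: (le_trans (ler_normD _ _)); apply: lerD => //.
  apply: (le_trans (ler_normD _ _)); apply: lerD => //; by rewrite mulrAC.
apply/cvgrPdist_le => e e0.
pose Q := B' * vol (K + 1) + 1.
have Q0 : 0 < Q by rewrite ltr_wpDl// mulr_ge0.
have e2 : 0 < e / 2 / Q by rewrite !divr_gt0.
have hlim : D * n%:R^-1 + U * C * vol (K + 1) * E n @[n --> \oo] --> D * 0 + U * C * vol (K + 1) * 0.
  by apply: cvgD; apply: cvgMr => //; exact: natr_inv_cvg0.
rewrite !mulr0 addr0 in hlim.
have near1 : \forall n \near \oo, D * n%:R^-1 + U * C * vol (K + 1) * E n < e / 2.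
  by apply: (cvgr_lt _ hlim); rewrite divr_gt0.
have near2 := odo_ext_unif e2.
near=> n.
have [rn hn] : regular n /\ forall x, `|uu n x - v x| <= e / 2 / Q by near: n.
apply: (le_trans (key n _ rn (ltW e2) hn)); rewrite addrA.
have h1 : D * n%:R^-1 + U * C * vol (K + 1) * E n < e / 2 by near: n.
have h2 : e / 2 / Q * B' * vol (K + 1) <= e / 2.
  rewrite -mulrA -[leRHS](@divfK _ Q) ?gt_eqF// ler_wpM2l ?(ltW e2)// /Q lerDl//.
by move: h1 h2; lra.
Unshelve. all: by end_near. Qed.

(** The bound 1 on the final masses, paired with phi >= 0, passes to the limit. *)
Lemma limit_odo_super phi : nice phi -> (forall x, 0 <= phi x) ->
  \int[mu2]_x (v x * L_M phi x) <= \int[mu2]_x ((1 - rho x) * phi x).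
Proof.
move=> np p0; have [cp [B hB] [rad r0 sp] _] := np.
have mp := continuous_measurable2 cp.
have Lp : L1 setT phi by exact: supported_integrable mp sp (fun x _ => hB x).
have lrho : loc_bounded rho.
  by apply: continuous_loc_bounded; exact: lipschitz_continuous rho_lip.
have LrP : L1 setT (fun x => rho x * phi x) by exact: loc_bounded_integrableM sp hB.
under [leRHS]eq_Rintegral => x _ do rewrite mulrBl mul1r.
rewrite RintegralB// lerBrDl; apply: (cvgr_to_le (final_mass_cvg np)).
near=> n; have rn : regular n by near: n; exact: reg_near.
have [n0 _ _ _] := rn; apply: le_Rintegral => //; last first.
  move=> x _; rewrite ler_piMl// final_mass_ext//; exact: supersolution.
have [B3 hB3] := Ln_bounded n (fun z => norm_odo_ext z rn).
apply: (loc_bounded_integrableM _ _ mp sp hB).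
  exact: (measurable_nearest (final_mass r M alpha n (fun y => rho (pt n y)) (xs n)) n0).
move=> q; have [Bq hBq] := lrho (q + 1); exists (Bq + B3) => x hx.
rewrite final_mass_ext//; apply: (le_trans (ler_normD _ _)); apply: lerD => //.
apply: hBq; have := @enorm_nearest R n x n0.
have := enormB x (x - pt n (nearest n x)); rewrite subKr.
have : n%:R^-1 <= 1 :> R by rewrite invf_le1 ?ltr0n// ler1n.
move: hx; lra.
Unshelve. all: by end_near. Qed.

Lemma limit_odo_least (w : R * R -> R) : continuous w -> (forall x, 0 <= w x) ->
  (forall phi, test_function phi -> (forall x, 0 <= phi x) ->
     \int[mu2]_x (w x * L_M phi x) <= \int[mu2]_x ((1 - rho x) * phi x)) ->
  forall x, v x <= w x.
Proof.
move=> cw w0 hw x.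
have [xK|xK] := leP (K + 1) (enorm x); first by rewrite limit_odo_out.
suff key e : 0 < e -> v x <= w x + e * (1 + 2 * C1).
  have D0 : 0 < 1 + 2 * C1 by rewrite ltr_wpDr// mulr_ge0.
  apply/ler_addgt0Pr => e e0; have := key (e / (1 + 2 * C1)).
  by rewrite divfK ?gt_eqF//; apply; rewrite divr_gt0.
move=> e0.
have /cvgrPdist_le /(_ e e0) /nbhs_ballP [d /= d0 hd] := cw x.
have {}hd y : enorm (x - y) < d -> w y <= w x + e.
  move=> h; have : ball x d y.
    by split; [exact: le_lt_trans (enorm_ge_fst (x - y)) h|exact: le_lt_trans (enorm_ge_snd (x - y)) h].
  by move/hd; rewrite distrC => /ler_normlP[_]; lra.
(* t <= 1 bounds the supports below, t <= e turns the source error into a multiple of e, and t <=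
   d/4 with 1/n < d/2 keeps the averages of [w] in the ball where it is within e of w x. *)
pose t := Num.min 1 (Num.min e (d / 4)).
have t0 : 0 < t by rewrite !lt_min ltr01 e0 divr_gt0.
have t1 : t <= 1 by rewrite ge_min lexx.
have te : t <= e by rewrite !ge_min lexx orbT.
have td : t <= d / 4 by rewrite !ge_min lexx !orbT.
(* A competitor need not have compact support. For |y| <= K the function L_M (bump t y) lives in the
   ball of radius K + 2 t + M < Q, so truncating [w] at Q does not change the pairing. *)
pose Q := K + M + 3; pose g y := \1_(eball Q) y * w y.
have mw := continuous_measurable2 cw.
have mg : mfun2 g.
  by apply: measurable_funM => //; apply: measurable_indic2; exact: measurable_eball.
have [G hG0] := continuous_loc_bounded cw Q.
have hg y : (enorm y < Q -> g y = w y) /\ (Q <= enorm y -> g y = 0).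
  rewrite /g indicE; split => h; first by rewrite mem_set// mul1r.
  by rewrite memNset ?mul0r// /eball /= ltNge h.
have gw y : g y <= w y.
  by have [h|h] := ltP (enorm y) Q; [rewrite (hg y).1|rewrite (hg y).2].
have g0 y : 0 <= g y.
  by have [h|h] := ltP (enorm y) Q; [rewrite (hg y).1|rewrite (hg y).2].
have G0 : 0 <= G.
  by apply: le_trans (hG0 0 _) => //; rewrite enorm0 /Q !addr_ge0 ?(ltW K0) ?(ltW M_gt0).
have hG y : `|g y| <= G.
  have [h|h] := ltP (enorm y) Q; last by rewrite (hg y).2// normr0.
  by rewrite (hg y).1// hG0// ltW.
have sg : supported Q g by move=> y /(hg y).2.
have [_ _ _ [C C0 hC]] := bump_nice t (0 : R * R).
have hL y : enorm y <= K -> \int[mu2]_z (g z * L_M (bump t y) z) <= 1 - rho y + Lr * (2 * t).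
  move=> yK; have nb := bump_nice t y.
  have -> : \int[mu2]_z (g z * L_M (bump t y) z) = \int[mu2]_z (w z * L_M (bump t y) z).
    apply: eq_Rintegral => z _; have [h|h] := ltP (enorm z) Q; first by rewrite (hg z).1.
    have sL : supported (enorm y + 2 * t + M) (L_M (bump t y)).
      by apply: LM_supported => //; exact: bump_supported.
    by rewrite sL ?mulr0//; apply: le_trans h; rewrite /Q; move: yK t1; lra.
  apply: (le_trans (hw _ (bump_test t y) (bump_ge0 t y))).
  have [cb [B hB] [rad r0 sb] _] := nb; have mb := continuous_measurable2 cb.
  apply: bump_average_le => //.
    apply: (loc_bounded_integrableM _ _ mb sb hB); first exact: measurable_funB.
    apply: continuous_loc_bounded; apply: (@lipschitz_continuous _ Lr) => a b.
    by rewrite (_ : 1 - rho a - (1 - rho b) = - (rho a - rho b)) ?normrN//; ring.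
  move=> z hz; have := rho_lip y z; have : Lr * enorm (y - z) <= Lr * (2 * t).
    by rewrite ler_wpM2l// -enormN opprB.
  by move=> h /ler_normlP[]; lra.
have e1 : 0 <= Lr * (2 * t) by rewrite mulr_ge0 ?mulr_ge0// ltW.
have hu n := @upper_bound n t g G Q (Lr * (2 * t)) C.
have hlim : w x + e + A * (Lr * (2 * t) + G * C * vol Q * E n) @[n --> \oo] -->
   w x + e + A * (Lr * (2 * t) + G * C * vol Q * 0).
  by apply: cvgD; [exact: cvg_cst|]; apply: cvgMr; apply: cvgD; [exact: cvg_cst|exact: cvgMr].
apply: (@le_trans _ _ (w x + e + A * (Lr * (2 * t) + G * C * vol Q * 0))); last first.
  rewrite mulr0 addr0 -addrA lerD2l mulrDr mulr1 lerD2l (_ : A * (Lr * (2 * t)) = 2 * C1 * t); last by rewrite /C1; ring.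
  by rewrite mulrC; apply: ler_wpM2r => //; exact: mulr_ge0.
apply: (ler_cvg_to (@odo_ext_cvg x) hlim); near=> n.
have rn : regular n by near: n; exact: reg_near.
have [n0 _ _ _] := rn.
have ni1 : n%:R^-1 <= 1 :> R by rewrite invf_le1 ?ltr0n// ler1n.
have nid : n%:R^-1 < d / 2 :> R by near: n; apply: (cvgr_lt _ natr_inv_cvg0); rewrite divr_gt0.
have xn := @enorm_nearest R n x n0.
have hz : enorm (pt n (nearest n x) : R * R) <= K + m.
  have := enormB x (x - pt n (nearest n x)); rewrite subKr.
  by move: xK xn ni1 hM; lra.
apply: (le_trans (hu n rn t0 mg g0 hG sg C0 hC e1 hL _ hz)); rewrite lerD2r.
apply: bump_average_le => //.
  have [cb [B hB] _ _] := bump_nice t (pt n (nearest n x) : R * R).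
  exact: (integrable_conv mg hG sg (continuous_measurable2 cb) hB).
move=> z hzz; apply: (le_trans (gw z)); apply: hd.
rewrite -(subrKA (pt n (nearest n x))); apply: (le_lt_trans (enormD _ _)).
rewrite -[X in _ + X]enormN opprB; move: xn nid hzz td; lra.
Unshelve. all: by end_near. Qed.

End Convergence.

(** * The symbol of the generator *)

Section Symbol.
Context {R : realType}.
Local Notation mu := (@lebesgue_measure R).
Local Notation P := (measurableTypeR R * measurableTypeR R)%type.
Local Notation measurable2 := (@measurable _ P).
Local Notation mfun2 f := (@measurable_fun _ _ P R setT f).
Local Notation L1 D f := (mu2.-integrable (D : set P) (EFin \o f)).

Context (alpha r M : R) (halpha : 1 < alpha < 2) (hr : 0 < r < M) (hM : 1 < M).
Context (hk : forall n : nat, (0 < n)%N -> 0 < kn r M alpha n).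

Local Notation k_ := (kn r M alpha).
Local Notation F_ := (Fn r M).
Local Notation w_ := (wn r M alpha).
Local Notation c_ := (cn r M alpha).
Local Notation p_ := (pn r M alpha).
Local Notation c := (cc r M alpha).
Local Notation box n := (sites (Nbox M n)).
Local Notation L_M := (LM r M alpha).

Let alpha_gt1 : 1 < alpha. Proof. by case/andP: halpha. Qed.
Let alpha_lt2 : alpha < 2. Proof. by case/andP: halpha. Qed.
Let alpha_gt0 : 0 < alpha. Proof. exact: lt_trans ltr01 alpha_gt1. Qed.
Let M_gt0 : 0 < M. Proof. exact: lt_trans ltr01 hM. Qed.

Local Opaque kn Fn wn cn pn.
Local Notation b := (2 + alpha).
Local Notation psi := (psiM r M alpha).
Implicit Types (x y th : R * R).

Lemma normr_sin_le (u : R) : `|sin u| <= `|u|.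
Proof.
have := @mean_value R (fun t => sin (t * u)) (fun t => cos (t * u) * u) `|u|.
rewrite mul1r mul0r sin0 subr0; apply => [s|s _]; last first.
  by rewrite normrM ler_piMl// cos_max.
have h : is_derive s (1 : R) (fun t : R => t * u) u.
  by apply: is_derive_eq; rewrite /GRing.scale /= mulr0 add0r mulr1.
by apply: is_derive1_comp; exact: is_derive_sin.
Qed.

Lemma normr_cosB_le (u v : R) : `|cos u - cos v| <= `|u - v| * `|u + v| / 2.
Proof.
pose p := (u + v) / 2; pose q := (u - v) / 2.
have -> : u = p + q by rewrite /p /q; field.
have -> : v = p - q by rewrite /p /q; field.
have -> : cos (p + q) - cos (p - q) = - (2 * (sin p * sin q)) by rewrite cosD cosB; ring.
clearbody p q.
have -> : p + q - (p - q) = 2 * q by ring.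
have -> : p + q + (p - q) = 2 * p by ring.
rewrite normrN !normrM normr_nat (_ : 2 * `|q| * (2 * `|p|) / 2 = 2 * (`|p| * `|q|)); last by field.
by rewrite ler_pM2l// ler_pM ?normr_sin_le.
Qed.

Lemma one_sub_cos_double (u : R) : 1 - cos (2 * u) <= 4 * (1 - cos u).
Proof.
have -> : cos (2 * u) = 2 * cos u ^+ 2 - 1.
  by rewrite mulrDl mul1r cosD -!expr2 sin2cos2; ring.
have := cos_le1 u; have := cos_geN1 u => h1 h2.
rewrite -subr_ge0 (_ : _ - _ = 2 * (1 - cos u) ^+ 2); last by ring.
by rewrite mulr_ge0// sqr_ge0.
Qed.

(** A real plane wave; the phase makes the family stable under translation and replaces complex
    exponentials. *)
Definition wave th (be : R) x : R := cos (edot th x + be).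

Lemma edotDr th x y : edot th (x + y) = edot th x + edot th y.
Proof. by rewrite /edot /=; ring. Qed.

Lemma edotNr th x : edot th (- x) = - edot th x.
Proof. by rewrite /edot /=; ring. Qed.

Lemma edotC th x : edot th x = edot x th.
Proof. by rewrite /edot mulrC [X in _ + X]mulrC. Qed.

Lemma d2_wave th be x y : d2 (wave th be) x y = - 2 * (1 - cos (edot th y)) * wave th be x.
Proof.
rewrite /d2 /wave !edotDr edotNr [_ + - _ + be]addrAC [_ + edot th y + be]addrAC.
by move: (edot th x + be) (edot th y) => a a'; rewrite cosB cosD; ring.
Qed.

Lemma d2_lip_wave th be x : d2_lip (enorm th ^+ 2) (wave th be) x.
Proof.
move=> y z; rewrite !d2_wave -mulrBl normrM.
have -> : -2 * (1 - cos (edot th y)) - -2 * (1 - cos (edot th z)) = 2 * (cos (edot th y) - cos (edot th z)) by ring.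
apply: (@le_trans _ _ (2 * `|cos (edot th y) - cos (edot th z)|)).
  by rewrite normrM [X in X * _ * _]ger0_norm// ler_piMr ?mulr_ge0// cos_max.
apply: (@le_trans _ _ (`|edot th (y - z)| * `|edot th (y + z)|)).
  rewrite !edotDr edotNr -ler_pdivlMl//.
  by apply: (le_trans (normr_cosB_le _ _)); rewrite mulrC.
have -> : enorm th ^+ 2 * enorm (y - z) * (enorm y + enorm z) =
  (enorm th * enorm (y - z)) * (enorm th * (enorm y + enorm z)) by ring.
apply: ler_pM => //; first exact: normr_edot_le.
apply: (le_trans (normr_edot_le _ _)); rewrite ler_wpM2l ?enorm_ge0//; exact: enormD.
Qed.

Lemma measurable_cos_comp (f : R * R -> R) : mfun2 f -> mfun2 (fun x => cos (f x)).
Proof. move=> mf; apply: measurableT_comp => //.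
by apply: continuous_measurable_fun; exact: continuous_cos. Qed.

Lemma measurable_wave th be : mfun2 (wave th be).
Proof. by apply: measurable_cos_comp; apply: measurable_funD => //; exact: measurable_edot. Qed.

Lemma LM_wave th be x : L_M (wave th be) x = - psi th * wave th be x.
Proof.
rewrite LM_kernelE /psiM.
have Lk : L1 (eball M) (fun y => (1 - cos (edot th y)) / enorm y `^ b).
  have := integrable_kernel M halpha (sqr_ge0 (enorm th)) (measurable_wave th 0) (@d2_lip_wave th 0 0).
  move=> /(integrable2Z (- 2^-1) (measurable_eball M)).
  rewrite (_ : (fun x => _) = (fun y => (1 - cos (edot th y)) / enorm y `^ b))//.
  apply/funext => y; rewrite d2_wave /wave (_ : edot th 0 = 0); last by rewrite /edot /=; ring.
  by rewrite addr0 cos0; move: (_ `^ _)^-1 => a; field.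
have -> : \int[mu2]_(y in eball M) (d2 (wave th be) x y * (enorm y `^ b)^-1) =
   \int[mu2]_(y in eball M) ((- 2 * wave th be x) * ((1 - cos (edot th y)) / enorm y `^ b)).
  by apply: eq_Rintegral => y _; rewrite d2_wave; ring.
rewrite RintegralZl//; last exact: measurable_eball.
by move: (\int[mu2]_(y in _) _) => a; field.
Qed.

(** The radial profile of the symbol after dilation. It increases with its argument because the
    integrand is nonnegative, and this makes psi radially increasing. *)
Definition psi0 (rho : R) : R := \int[mu2]_(y in eball rho) ((1 - cos y.1) / enorm y `^ b).

Let ker_ge0 (u a : R) : 0 <= a -> 0 <= (1 - cos u) / a.
Proof. by move=> a0; rewrite divr_ge0// subr_ge0 cos_le1. Qed.

Lemma integrable_ker th (rho : R) : L1 (eball rho) (fun y => (1 - cos (edot th y)) / enorm y `^ b).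
Proof.
apply: (@dominated_integrable2 _ _ _ (fun y => enorm th ^+ 2 * (enorm y `^ alpha)^-1)).
- exact: measurable_eball.
- apply: measurable_funM; last exact: measurable_enorm_powR.
  by apply: measurable_funB => //; apply: measurable_cos_comp; exact: measurable_edot.
- apply: integrable2Z; first exact: measurable_eball.
  by apply: integrable_near0; rewrite alpha_gt0 alpha_lt2.
- move=> y _; have := d2_kernel_bound halpha y (sqr_ge0 (enorm th)) (@d2_lip_wave th 0 0).
  rewrite d2_wave /wave (_ : edot th 0 = 0); last by rewrite /edot /=; ring.
  rewrite addr0 cos0 mulr1 -mulrA normrM normrN normr_nat.
  by apply: le_trans; rewrite ler_peMl// ler1n.
Qed.

Lemma psi0E (rho : R) : psi0 rho = \int[mu2]_(y in eball rho) ((1 - cos (edot (1, 0) y)) / enorm y `^ b).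
Proof. by apply: eq_Rintegral => y _; rewrite /edot /= mul1r mul0r addr0. Qed.

Lemma psi0_le (a a' : R) : a <= a' -> psi0 a <= psi0 a'.
Proof.
move=> aa; rewrite !psi0E Rintegral_indicM [leRHS]Rintegral_indicM; apply: le_Rintegral => //.
- by apply: integrable_indic; [exact: measurable_eball|exact: integrable_ker].
- by apply: integrable_indic; [exact: measurable_eball|exact: integrable_ker].
move=> y _; rewrite !indicE; have [ya|ya] := ltP (enorm y) a.
  by rewrite !mem_set//; exact: lt_le_trans aa.
rewrite memNset; last by rewrite /eball /= ltNge ya.
by rewrite mul0r mulr_ge0// ker_ge0// powR_ge0.
Qed.

(** Rotate [th] onto the first axis and dilate by |th|: the exponent is 2 + alpha from the kernel
    minus 2 from the area. *)
Lemma psiE th : th != 0 -> psi th = c * (enorm th `^ alpha * psi0 (enorm th * M)).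
Proof.
move=> th0; set t := enorm th; have t0 : 0 < t.
  by rewrite lt_neqAle eq_sym enorm_eq0 th0 enorm_ge0.
have tn : t != 0 by rewrite gt_eqF.
have hcs : (th.1 / t) ^+ 2 + (th.2 / t) ^+ 2 = 1.
  by rewrite !expr_div_n -mulrDl -enorm_sqr mulfV// expf_neq0.
have ti : 0 < t^-1 by rewrite invr_gt0.
have hT := scales_measure_comp (@affine_scales_measure R 0 0 t^-1 ti) (rotation_scales_measure hcs).
set T := (X in scales_measure X _) in hT.
have TE y : T y = (t^-1 * (th.1 / t * y.1 - th.2 / t * y.2), t^-1 * (th.2 / t * y.1 + th.1 / t * y.2)).
  by rewrite /T /= !add0r.
have nT y : enorm (T y) = t^-1 * enorm y.
  rewrite TE (@enorm_scale _ t^-1 (th.1 / t * y.1 - th.2 / t * y.2, th.2 / t * y.1 + th.1 / t * y.2)).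
  rewrite ger0_norm ?(ltW ti)//; congr (_ * Num.sqrt _) => /=.
  by rewrite -[RHS]mul1r -hcs; ring.
have eT y : edot th (T y) = y.1.
  rewrite TE /edot /= -[RHS]mul1r -hcs; by field.
have pT : T @^-1` eball M = eball (t * M).
  by rewrite /preimage /eball; apply/funext => y /=; rewrite nT mulrC ltr_pdivrMr// [M * _]mulrC.
have mk : mfun2 (fun y => (1 - cos (edot th y)) / enorm y `^ b).
  apply: measurable_funM; last exact: measurable_enorm_powR.
  by apply: measurable_funB => //; apply: measurable_cos_comp; exact: measurable_edot.
have k0 : 0 < 1 * t^-1 ^- 2 by rewrite mul1r invr_gt0 exprn_gt0.
have := scales_Rintegral hT k0 (measurable_eball M) mk.
rewrite pT; have -> : \int[mu2]_(x in eball (t * M)) ((1 - cos (edot th (T x))) / enorm (T x) `^ b) = t `^ b * psi0 (t * M).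
  rewrite psi0E -RintegralZl//; [|exact: measurable_eball|exact: integrable_ker].
  apply: eq_Rintegral => y _; rewrite eT nT powRM ?enorm_ge0 ?(ltW ti)//.
  have -> : t^-1 `^ b = (t `^ b)^-1 by rewrite -powR_inv1 ?(ltW t0)// -powRrM mulN1r powRN.
  by rewrite invfM invrK mulrCA /edot /= mul1r mul0r addr0.
rewrite mul1r exprVn invrK => h; rewrite /psiM; congr (_ * _).
have tt : t ^+ 2 != 0 by rewrite expf_neq0.
apply: (mulfI tt); rewrite -h mulrA; congr (_ * _).
by rewrite powRD ?tn ?implybT// powR_mulrn// ltW.
Qed.

Lemma psiM0 : psi 0 = 0.
Proof.
rewrite /psiM (@eq_Rintegral _ _ _ mu2 (eball M) (cst 0)); last first.
  by move=> y _; rewrite /edot /= !mul0r addr0 cos0 subrr mul0r.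
by rewrite Rintegral_cst ?mul0r ?mulr0//; exact: measurable_eball.
Qed.

Let c0 : 0 < c. Proof. exact: cc_gt0. Qed.

Lemma psi_ge0 th : 0 <= psi th.
Proof.
rewrite /psiM mulr_ge0 ?(ltW c0)// Rintegral_ge0// => y _.
by rewrite ker_ge0 ?powR_ge0.
Qed.

Lemma psi0_ge0 (rho : R) : 0 <= psi0 rho.
Proof. by rewrite Rintegral_ge0// => y _; rewrite ker_ge0 ?powR_ge0. Qed.

Lemma psi_mono th th' : th != 0 -> enorm th <= enorm th' -> psi th <= psi th'.
Proof.
move=> th0 h; have th'0 : th' != 0.
  by rewrite -enorm_eq0 gt_eqF// (lt_le_trans _ h)// lt_neqAle eq_sym enorm_eq0 th0 enorm_ge0.
rewrite !psiE// ler_wpM2l ?(ltW c0)//; apply: ler_pM; rewrite ?powR_ge0 ?psi0_ge0//.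
  by apply: ge0_ler_powR; rewrite ?nnegrE ?enorm_ge0// (ltW alpha_gt0).
by apply: psi0_le; rewrite ler_wpM2r// (ltW M_gt0).
Qed.

Lemma psi_double th : psi (2 * th.1, 2 * th.2) <= 4 * psi th.
Proof.
rewrite /psiM mulrCA ler_wpM2l ?(ltW c0)// -RintegralZl//; [|exact: measurable_eball|exact: integrable_ker].
apply: le_Rintegral.
- exact: measurable_eball.
- exact: integrable_ker.
- by apply: integrable2Z; [exact: measurable_eball|exact: integrable_ker].
move=> y _; rewrite mulrA ler_wpM2r ?invr_ge0 ?powR_ge0//.
have -> : edot (2 * th.1, 2 * th.2) y = 2 * edot th y by rewrite /edot /=; ring.
exact: one_sub_cos_double.
Qed.

Local Notation p1 := (psi (1, 0)).

Lemma psi_unit_gt0 : 0 < p1.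
Proof.
rewrite /psiM; apply: (mulr_gt0 c0).
have h14 : (1 / 4 : R) <= 1 / 2 by lra.
pose D : set P := [set x | 1 / 4 <= x.1 <= 1 / 2 /\ 1 / 4 <= x.2 <= 1 / 2].
have mD : measurable2 D by exact: measurable_box.
have hD := mu2_box h14 h14; rewrite -/D in hD.
have Doo : (mu2 D < +oo)%E by rewrite hD ltry.
have c4 : cos (1 / 4 : R) < 1.
  rewrite -[X in _ < X](cos0 R) ltr_cos ?in_itv /= ?lexx ?pi_ge0//; have := pi_ge2 R; lra.
pose e := 1 - cos (1 / 4 : R).
have e0 : 0 < e by rewrite subr_gt0.
have DB x : D x -> 0 < enorm x < M /\ e <= 1 - cos (edot (1, 0) x).
  move=> [/andP[x1 x2] /andP[x3 x4]]; have xp : 0 < x.1 by lra.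
  split.
    apply/andP; split.
      by apply: lt_le_trans (enorm_ge_fst x); rewrite normr_gt0 gt_eqF.
    apply: lt_trans hM; rewrite enorm_lt//.
    have h1 : x.1 ^+ 2 <= (1 / 2) ^+ 2 by rewrite ler_pXn2r ?nnegrE//; lra.
    have h2 : x.2 ^+ 2 <= (1 / 2) ^+ 2 by rewrite ler_pXn2r ?nnegrE//; lra.
    by move: h1 h2; rewrite expr1n !expr2; lra.
  rewrite /edot /= mul1r mul0r addr0 lerD2l lerN2.
  rewrite -[_ <= _]negbK -ltNge ltr_cos ?in_itv /= -?leNgt//; have := pi_ge2 R; lra.
apply: (@lt_le_trans _ _ (\int[mu2]_(x in D) (e * (M `^ b)^-1))).
  rewrite Rintegral_cst// mulr_gt0 ?mulr_gt0 ?invr_gt0 ?powR_gt0//.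
  rewrite (_ : fine (mu2 D) = (1 / 2 - 1 / 4) * (1 / 2 - 1 / 4)); last exact: (congr1 fine hD).
  by apply: mulr_gt0; lra.
rewrite Rintegral_indicM [leRHS]Rintegral_indicM; apply: le_Rintegral => //.
- by apply: integrable_indic => //; exact: integrable2_cst.
- by apply: integrable_indic; [exact: measurable_eball|exact: integrable_ker].
move=> x _; rewrite !indicE; case: (boolP (x \in D)) => [|_]; last first.
  by rewrite mul0r mulr_ge0// ker_ge0// powR_ge0.
rewrite inE => Dx; have [/andP[x0 xM] h] := DB x Dx; rewrite mem_set// !mul1r.
apply: ler_pM => //; first exact: ltW.
  by rewrite invr_ge0 powR_ge0.
by apply: le_powR_inv => //; [exact: ltW|rewrite addr_gt0].
Qed.

Lemma psi_lower_far th : 1 <= enorm th -> p1 * enorm th `^ alpha <= psi th.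
Proof.
move=> h; have th0 : th != 0 by rewrite -enorm_eq0 gt_eqF// (lt_le_trans _ h).
have e1 : enorm ((1, 0) : R * R) = 1 by rewrite /enorm /= expr0n addr0 expr1n sqrtr1.
have n10 : ((1, 0) : R * R) != 0 by rewrite -enorm_eq0 e1 oner_eq0.
rewrite !psiE// e1 powR1 !mul1r -mulrA; apply: ler_wpM2l; first exact: ltW.
rewrite mulrC; apply: ler_wpM2l; first exact: powR_ge0.
by apply: psi0_le; rewrite ler_peMl// (ltW M_gt0).
Qed.

(** Double [th] until its norm reaches 1: if 2^(-k-1) <= |th| < 2^(-k), then p1 <= psi (2^(k+1) th)
    <= 4^(k+1) psi th, and 4^(k+1) |th|^2 <= 4 gives the factor 1/4. *)
Lemma psi_lower_near th : enorm th < 1 -> p1 / 4 * enorm th ^+ 2 <= psi th.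
Proof.
have [->|th0] := eqVneq th 0; first by rewrite enorm0 expr0n mulr0 psi_ge0.
move=> h; have t0 : 0 < enorm th by rewrite lt_neqAle eq_sym enorm_eq0 th0 enorm_ge0.
have [|k /andP[k1 k2]] := @dyadic_scale_near R 1 (enorm th); first by rewrite t0.
rewrite mul1r in k1 k2.
have dbl j : psi (2 ^+ j * th.1, 2 ^+ j * th.2) <= 4 ^+ j * psi th.
  elim: j => [|j IHj]; first by rewrite !expr0 !mul1r; case: (th).
  rewrite exprS -!mulrA; apply: (le_trans (@psi_double (2 ^+ j * th.1, 2 ^+ j * th.2))).
  by rewrite exprS -mulrA ler_pM2l.
have e1 : enorm ((1, 0) : R * R) = 1 by rewrite /enorm /= expr0n addr0 expr1n sqrtr1.
have n10 : ((1, 0) : R * R) != 0 by rewrite -enorm_eq0 e1 oner_eq0.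
have : p1 <= psi (2 ^+ k.+1 * th.1, 2 ^+ k.+1 * th.2).
  apply: psi_mono => //; rewrite e1 enorm_scale ger0_norm ?exprn_ge0//.
  by rewrite mulrC -ler_pdivrMr ?exprn_gt0// mul1r -exprVn.
move=> /le_trans /(_ (dbl k.+1)) hp.
rewrite -(@ler_pM2l _ (4 ^+ k.+1)) ?exprn_gt0//; apply: le_trans hp.
have -> : 4 ^+ k.+1 * (p1 / 4 * enorm th ^+ 2) = p1 * (2 ^+ k * enorm th) ^+ 2.
  by rewrite exprS exprMn -exprM mulnC exprM (_ : 2 ^+ 2 = 4); [field|ring].
rewrite ler_piMr ?psi_ge0// expr_le1// ?mulr_ge0 ?exprn_ge0 ?(ltW t0)//.
by rewrite mulrC -ler_pdivlMr ?exprn_gt0// -exprVn ltW// -[ltRHS]mul1r.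
Qed.

(** Up to sign psi th is L_M of a wave at the origin, hence a limit of finite sums of cosines in
    [th]. *)
Lemma measurable_psi : mfun2 psi.
Proof.
apply: (@measurable_fun_cvg _ _ R setT (fun n th => - (n%:R `^ alpha * \sum_(y <- box n) p_ n y * (cos (edot th (pt n y)) - 1)))).
  move=> n; apply: measurable_funN; apply: measurable_funM => //.
  under eq_fun => x do rewrite (big_nth 0) big_mkord.
  apply: measurable_sum => i; apply: measurable_funM => //; apply: measurable_funB => //.
  apply: measurable_cos_comp; rewrite (_ : (fun x => _) = edot (pt n (nth 0 (box n) i))).
    exact: measurable_edot.
  by apply/funext => x; rewrite edotC.
move=> th _; have := @Ln_cvg R alpha r M halpha hr hM hk (wave th 0) 0 _ (sqr_ge0 (enorm th)) (measurable_wave th 0) (@d2_lip_wave th 0 0).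
rewrite LM_wave /wave (_ : edot th 0 = 0); last by rewrite /edot /=; ring.
rewrite addr0 cos0 mulr1 => /cvgN; rewrite opprK; apply: cvg_trans; apply: near_eq_cvg; near=> n.
rewrite /Ln; congr (- (_ * _)); apply: eq_bigr => y _; congr (_ * (_ - _)).
  by rewrite add0r addr0.
by rewrite /edot /= !mulr0 !addr0 cos0.
Unshelve. all: by end_near. Qed.

End Symbol.

(** * Oscillatory integrals of radial functions *)

Section Oscillation.
Context {R : realType}.
Local Notation mu := (@lebesgue_measure R).
Local Notation P := (measurableTypeR R * measurableTypeR R)%type.
Local Notation measurable2 := (@measurable _ P).
Local Notation mfun2 f := (@measurable_fun _ _ P R setT f).
Local Notation L1 D f := (mu2.-integrable (D : set P) (EFin \o f)).
Implicit Types (x th : R * R).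

(** Its width pi / |x| is the origin of the factor 1 / |x| in the tail bounds. *)
Definition strip (x : R * R) : set P := [set th | `|edot th x| <= pi / 2].

Lemma measurable_edotl x : mfun2 (edot^~ x).
Proof.
rewrite (_ : edot^~ x = edot x); first exact: measurable_edot.
by apply/funext => th; rewrite edotC.
Qed.

Lemma measurable_strip x : measurable2 (strip x).
Proof.
rewrite (_ : strip x = (edot^~ x) @^-1` [set` `[- (pi / 2), pi / 2]]); last first.
  by apply/seteqP; split => th; rewrite /strip /= in_itv /= ler_norml.
by rewrite -[X in measurable X]setTI; apply: measurable_edotl.
Qed.

Lemma edotDl th th' x : edot (th + th') x = edot th x + edot th' x.
Proof. by rewrite /edot /=; ring. Qed.

Lemma integrable_translate (f : R * R -> R) (a : R * R) : mfun2 f -> L1 setT f ->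
  L1 setT (fun x => f (x + a)).
Proof.
move=> mf Lf; have hT := @affine_scales_measure R a.1 a.2 1 ltr01.
have k0 : 0 < (1 ^- 2 : R) by rewrite expr1n invr1.
have := scales_integrable hT k0 measurableT mf Lf; rewrite preimage_setT.
rewrite (_ : f \o _ = (fun x => f (x + a)))//; apply/funext => -[u v] /=.
by rewrite !mul1r [in RHS]addrC; case: a {hT}.
Qed.

(* The shift by [p = pi x / |x|^2] changes the sign of the cosine, so twice the integral
   is that of cos * (f - f(. + p)). The second factor changes sign only across the line
   [edot th x = - pi / 2]; replacing cos by this sign and shifting back leaves twice the
   integral over the strip. *)
Lemma oscillation (f : R * R -> R) x : x != 0 -> mfun2 f -> (forall th, 0 <= f th) -> L1 setT f ->
  (forall th th', enorm th <= enorm th' -> f th' <= f th) ->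
  `|\int[mu2]_th (cos (edot th x) * f th)| <= \int[mu2]_(th in strip x) f th.
Proof.
move=> x0 mf f0 Lf hf.
have xp : 0 < enorm x ^+ 2 by rewrite exprn_gt0// lt_neqAle eq_sym enorm_eq0 x0 enorm_ge0.
pose l := pi / enorm x ^+ 2; pose p : R * R := (l * x.1, l * x.2).
have px th : edot (th + p) x = edot th x + pi.
  rewrite edotDl; congr (_ + _); rewrite -[RHS](@divfK _ (enorm x ^+ 2)) ?gt_eqF// -/l enorm_sqr.
  by rewrite /edot /=; ring.
have px' th : edot (th - p) x = edot th x - pi.
  by have := px (th - p); rewrite subrK => ->; rewrite addrK.
have np th : enorm (th + p) ^+ 2 = enorm th ^+ 2 + l * (2 * edot th x + pi).
  have e : l * pi = l ^+ 2 * enorm x ^+ 2 by rewrite [l ^+ 2]expr2 -mulrA /l divfK ?gt_eqF.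
  by rewrite mulrDr e !enorm_sqr /p /edot /=; ring.
have l0 : 0 < l by rewrite divr_gt0 ?pi_gt0.
have mcos : mfun2 (fun th => cos (edot th x)).
  by apply: measurable_cos_comp; exact: measurable_edotl.
have mfp : mfun2 (fun th => f (th + p)) by exact: measurable_translate.
have Lfp : L1 setT (fun th => f (th + p)).
  exact: integrable_translate.
have dom (h g : R * R -> R) : mfun2 h -> (forall th, `|h th| <= 1) -> mfun2 g -> L1 setT g ->
    L1 setT (fun th => h th * g th).
  move=> mh h1 mg Lg; apply: (@dominated_integrable2 _ _ _ (fun th => `|g th|)) => //.
  - exact: measurable_funM.
  - by have := integrable_norm Lg.
  - by move=> th _; rewrite normrM ler_piMl.
pose s th : R := if - (pi / 2) <= edot th x then 1 else -1.
have s1 th : `|s th| <= 1 by rewrite /s; case: ifP; rewrite ?normrN normr1.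
have ms : mfun2 s.
  apply: measurable_fun_if => //; apply: (measurable_fun_bool true).
  rewrite (_ : _ @^-1` _ = (edot^~ x) @^-1` [set` `[- (pi / 2), +oo[]); last first.
    by apply/seteqP; split => th; rewrite /= in_itv /= andbT.
  by apply: measurable_edotl.
have h2 : 2 * \int[mu2]_th (cos (edot th x) * f th) = \int[mu2]_th (cos (edot th x) * (f th - f (th + p))).
  have : \int[mu2]_th (cos (edot th x) * f (th + p)) = - \int[mu2]_th (cos (edot th x) * f th).
    have mF : mfun2 (fun th => cos (edot (th - p) x) * f th).
      apply: measurable_funM => //.
      rewrite (_ : (fun th => cos _) = (fun th => cos (edot th x - pi))); last by apply/funext => th; rewrite px'.
      by apply: measurable_cos_comp; apply: measurable_funB => //; exact: measurable_edotl.
    have := Rintegral_translate p mF.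
    have -> : (fun th => cos (edot (th + p - p) x) * f (th + p)) = (fun th => cos (edot th x) * f (th + p)).
      by apply/funext => th; rewrite addrK.
    move=> ->; rewrite -[RHS]mulN1r -RintegralZl//; last by apply: dom => // th; exact: cos_max.
    by apply: eq_Rintegral => th _; rewrite px' cosB cospi sinpi; ring.
  move=> e; under [RHS]eq_Rintegral => th _ do rewrite mulrBr.
  rewrite RintegralB//; [|by apply: dom => // th; exact: cos_max|by apply: dom => // th; exact: cos_max].
  by rewrite e opprK mulrDl mul1r.
have h3 : 2 * `|\int[mu2]_th (cos (edot th x) * f th)| <= \int[mu2]_th (s th * f th - s th * f (th + p)).
  rewrite -[X in X * _](@ger0_norm _ 2)// -normrM h2.
  apply: norm_Rintegral_le => //.
  - by apply: measurable_funM => //; exact: measurable_funB.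
  - by apply: integrable2B => //; exact: dom.
  - move=> th _; rewrite normrM -mulrBr.
    apply: (@le_trans _ _ `|f th - f (th + p)|); first by rewrite ler_piMl// cos_max.
    rewrite /s; case: ifP => h.
      rewrite mul1r ger0_norm// subr_ge0; apply: hf.
      rewrite -(@ler_pXn2r _ 2) ?nnegrE ?enorm_ge0// np lerDl mulr_ge0 ?(ltW l0)//; lra.
    rewrite mulN1r ler0_norm// subr_le0; apply: hf.
    rewrite -(@ler_pXn2r _ 2) ?nnegrE ?enorm_ge0// np gerDl mulr_ge0_le0 ?(ltW l0)//.
    by move/negbT: h; rewrite -ltNge; lra.
rewrite -(@ler_pM2l _ 2)//; apply: (le_trans h3).
rewrite RintegralB//; [|exact: dom|exact: dom].
have mG : mfun2 (fun th => s (th - p) * f th).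
  by apply: measurable_funM => //; exact: measurable_translate.
have Lsf : L1 setT (fun th => s (th - p) * f th).
  by apply: dom => //; exact: measurable_translate.
have := Rintegral_translate p mG.
have -> : (fun th => s (th + p - p) * f (th + p)) = (fun th => s th * f (th + p)).
  by apply/funext => th; rewrite addrK.
move=> ->; rewrite -RintegralB//; last exact: dom.
have mS := measurable_strip x.
rewrite [X in 2 * X]Rintegral_indicM -RintegralZl//; last by apply: integrable_indic => //; exact: integrableS Lf.
apply: le_Rintegral => //.
- by apply: integrable2B => //; exact: dom.
- by apply: integrable2Z => //; apply: integrable_indic => //; exact: integrableS Lf.
move=> th _; rewrite -mulrBl /s px' mulrA ler_wpM2r//.
have pip := pi_gt0 R.
rewrite indicE; case: ifPn => h; case: ifPn => h'.
- by rewrite subrr mulr_ge0.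
- rewrite mem_set ?mulr1 ?opprK//; rewrite /strip /= ler_norml h /=.
  by move: h'; rewrite -ltNge; lra.
- by exfalso; move: h; rewrite -ltNge; lra.
- by rewrite subrr mulr_ge0.
Qed.

(** * Integrals of decaying functions over the strip *)

Context (tau : R) (tau0 : 0 < tau).

Definition decay th : R := (Num.max 1 (enorm th) `^ (1 + tau))^-1.

Lemma measurable_decay : mfun2 decay.
Proof.
rewrite (_ : decay = (fun u : R => u `^ (- (1 + tau))) \o (fun th => Num.max 1 (enorm th))).
  apply: measurableT_comp; first exact: measurable_powR.
  by apply: measurable_maxr => //; exact: measurable_enorm.
by apply/funext => th; rewrite /decay /= powRN.
Qed.

Lemma decay_ge0 th : 0 <= decay th.
Proof. by rewrite invr_ge0 powR_ge0. Qed.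

Lemma mu2_strip_ball x (rho : R) : x != 0 -> 0 <= rho ->
  (mu2 (strip x `&` eball rho) <= (2 * pi / enorm x * rho)%:E)%E.
Proof.
move=> x0 r0; set t := enorm x; have t0 : 0 < t.
  by rewrite lt_neqAle eq_sym enorm_eq0 x0 enorm_ge0.
have tn : t != 0 by rewrite gt_eqF.
have hcs : (x.1 / t) ^+ 2 + (x.2 / t) ^+ 2 = 1.
  by rewrite !expr_div_n -mulrDl -enorm_sqr mulfV// expf_neq0.
have [mT hT] := rotation_scales_measure hcs.
set T := (X in forall A, _ -> mu2 (X @^-1` A) = _) in hT mT.
have mA : measurable2 (strip x `&` eball rho).
  by apply: measurableI; [exact: measurable_strip|exact: measurable_eball].
have := hT _ mA; rewrite mul1e => <-.
have eT y : edot (T y) x = t * y.1.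
  have e : t ^+ 2 = x.1 ^+ 2 + x.2 ^+ 2 by rewrite enorm_sqr.
  rewrite /T /edot /=; apply: (mulfI tn); rewrite mulrA -expr2 e; by field.
have nT y : enorm (T y) = enorm y.
  congr Num.sqrt; rewrite /T /= -[RHS]mul1r -hcs; ring.
have a0 : - (pi / (2 * t)) <= pi / (2 * t).
  by rewrite ge0_cp// divr_ge0 ?pi_ge0// mulr_ge0// ltW.
have b0 : - rho <= rho by rewrite ge0_cp.
apply: (@le_trans _ _ (mu2 ([set y : P | - (pi / (2 * t)) <= y.1 <= pi / (2 * t) /\ - rho <= y.2 <= rho] : set P))).
  apply: le_measure; rewrite ?inE.
  - by rewrite -[X in measurable X]setTI; apply: mT.
  - exact: measurable_box.
  move=> y [/= h1 h2]; rewrite -!ler_norml; split.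
    move: h1; rewrite /strip /= eT normrM ger0_norm ?(ltW t0)//.
    move=> h; rewrite ler_pdivlMr ?mulr_gt0// (_ : _ * (2 * t) = 2 * (t * `|y.1|)); [lra|ring].
  by rewrite (le_trans (enorm_ge_snd y))// -nT ltW.
rewrite mu2_box// lee_fin le_eqVlt; apply/orP/or_introl/eqP.
by field.
Qed.

(** At infinity a strip is one-dimensional, so any exponent above 1 is integrable: its part in the
    ball of radius 2^j has area O(2^j / |x|), and the dyadic terms have ratio 2^(-tau). *)
Lemma strip_decay : exists2 C : R, 0 <= C & forall x, x != 0 ->
  L1 (strip x) decay /\ \int[mu2]_(th in strip x) decay th <= C / enorm x.
Proof.
pose q : R := 2 `^ (- tau).
have q0 : 0 < q by exact: powR_gt0.
have q1 : q < 1.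
  rewrite /q powRN invf_lt1 ?powR_gt0// -[X in X < _](powRr0 2); exact: ltr_powR2.
exists (2 `^ (1 + tau) * (2 * pi) / (1 - q)).
  by rewrite divr_ge0 ?mulr_ge0 ?powR_ge0 ?pi_ge0// subr_ge0 ltW.
move=> x x0; have t0 : 0 < enorm x by rewrite lt_neqAle eq_sym enorm_eq0 x0 enorm_ge0.
have := @dyadic_integrable R (strip x) decay (fun j => strip x `&` eball (2 ^+ j))
  (fun j => 2 `^ (1 + tau) * ((2 ^+ j) `^ (1 + tau))^-1) (fun j => 2 * pi / enorm x * 2 ^+ j)
  (2 `^ (1 + tau) * (2 * pi) / enorm x) q.
case.
- exact: measurable_strip.
- exact: measurable_decay.
- by move=> z _; exact: decay_ge0.
- by move=> k; apply: measurableI; [exact: measurable_strip|exact: measurable_eball].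
- by move=> k; apply: mu2_strip_ball => //; rewrite exprn_ge0.
- by move=> k; rewrite mulr_ge0 ?invr_ge0 ?powR_ge0.
- move=> k; rewrite le_eqVlt; apply/orP/or_introl/eqP.
  have p2 : 0 < (2 ^+ k : R) by rewrite exprn_gt0.
  rewrite powR_exprn// !powRDp// powRr1// /q powRN exprVn exprMn.
  by field; rewrite !gt_eqF ?exprn_gt0 ?powR_gt0.
- by rewrite (ltW q0).
- move=> z zs; right.
  have [z1|z1] := leP 1 (enorm z).
    have [k /andP[k1 k2]] := dyadic_scale_far z1; exists k.+1 => //.
    rewrite /decay max_r//; rewrite -[leRHS]invrK invfM invrK.
    rewrite lef_pV2 ?posrE ?powR_gt0 ?mulr_gt0 ?invr_gt0 ?powR_gt0 ?exprn_gt0//; last exact: lt_le_trans z1.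
    rewrite -ler_pdivlMl ?invr_gt0 ?powR_gt0// invrK -powRM//; last by rewrite (le_trans _ z1).
    by apply: ge0_ler_powR; rewrite ?nnegrE ?exprn_ge0 ?mulr_ge0 ?enorm_ge0 ?addr_ge0 ?(ltW tau0)// exprS ler_pM2l.
  exists 0%N => //.
  rewrite /decay max_l ?(ltW z1)// expr0 !powR1 invr1 mulr1.
  apply: (@le_trans _ _ (2 `^ 0)); first by rewrite powRr0.
  by apply: ler_powR; rewrite ?ler1n// addr_ge0// ltW.
move=> L h; split => //; apply: (le_trans h); rewrite le_eqVlt; apply/orP/or_introl/eqP.
by rewrite mulrAC.
Qed.

End Oscillation.

(** * Convergence of the Fourier integral of the Green function *)

Section Green.
Context {R : realType}.
Local Notation mu := (@lebesgue_measure R).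
Local Notation P := (measurableTypeR R * measurableTypeR R)%type.
Local Notation measurable2 := (@measurable _ P).
Local Notation mfun2 f := (@measurable_fun _ _ P R setT f).
Local Notation L1 D f := (mu2.-integrable (D : set P) (EFin \o f)).

Context (alpha r M : R) (halpha : 1 < alpha < 2) (hr : 0 < r < M) (hM : 1 < M).
Context (hk : forall n : nat, (0 < n)%N -> 0 < kn r M alpha n).

Local Notation k_ := (kn r M alpha).
Local Notation F_ := (Fn r M).
Local Notation w_ := (wn r M alpha).
Local Notation c_ := (cn r M alpha).
Local Notation p_ := (pn r M alpha).
Local Notation c := (cc r M alpha).
Local Notation box n := (sites (Nbox M n)).
Local Notation L_M := (LM r M alpha).

Let alpha_gt1 : 1 < alpha. Proof. by case/andP: halpha. Qed.
Let alpha_gt0 : 0 < alpha. Proof. exact: lt_trans ltr01 alpha_gt1. Qed.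
Local Opaque kn Fn wn cn pn psiM.
Local Notation psi := (psiM r M alpha).
Local Notation p1 := (psi (1, 0)).
Local Notation vol rad := (fine (mu2 (eball rad : set P))).
Implicit Types (x y th : R * R).

Let p10 : 0 < p1. Proof. exact: psi_unit_gt0. Qed.

Lemma loc_lipschitz_continuous (f : R * R -> R) : (forall rad : R, exists C : R, forall x y,
    enorm x <= rad -> enorm y <= rad -> `|f x - f y| <= C * enorm (x - y)) -> continuous f.
Proof.
move=> h x; have [C hC] := h (enorm x + 1).
apply/cvgrPdist_le => e e0; have C1 : 0 < `|C| + 1 by rewrite ltr_wpDl.
have xc : enorm (x - y) @[y --> x] --> enorm (x - x).
  by apply: continuous_comp; [apply: continuousB => //; exact: cst_continuous|exact: continuous_enorm].
rewrite subrr enorm0 in xc; near=> y.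
have y1 : enorm (x - y) <= 1.
  by near: y; apply: (cvgr_le _ xc); exact: ltr01.
have y2 : enorm (x - y) <= e / (`|C| + 1).
  by near: y; apply: (cvgr_le _ xc); rewrite divr_gt0.
have ny : enorm y <= enorm x + 1.
  by have := enormB x (x - y); rewrite subKr => /le_trans; apply; rewrite lerD2l.
apply: (le_trans (hC x y _ ny)); first by rewrite lerDl.
move: y2; rewrite ler_pdivlMr// mulrC; apply: le_trans.
by rewrite ler_wpM2r ?enorm_ge0// (le_trans (ler_norm C))// lerDl.
Unshelve. all: by end_near. Qed.

Lemma psi_inv_le th : 1 <= enorm th -> (psi th)^-1 <= p1^-1 * (enorm th `^ alpha)^-1.
Proof.
move=> h; have h0 := lt_le_trans ltr01 h.
have := psi_lower_far halpha hr hM hk h; rewrite -invfM => h1.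
have h2 : 0 < p1 * enorm th `^ alpha by rewrite mulr_gt0// powR_gt0.
by rewrite lef_pV2 ?posrE// (lt_le_trans h2).
Qed.

Lemma psi_inv_le1 th : 1 <= enorm th -> (psi th)^-1 <= p1^-1.
Proof.
move=> h; apply: (le_trans (psi_inv_le h)); rewrite ler_piMr ?invr_ge0 ?(ltW p10)//.
have h1 : 1 <= enorm th `^ alpha.
  by rewrite -(powRr0 (enorm th)); apply: ler_powR => //; exact: ltW.
by rewrite invf_le1// (lt_le_trans ltr01).
Qed.

Lemma psi_inv_sqr th : enorm th <= 1 -> enorm th ^+ 2 / psi th <= 4 / p1.
Proof.
rewrite le_eqVlt => /orP[/eqP h|h].
  rewrite h expr1n mul1r; apply: (le_trans (psi_inv_le1 _)); first by rewrite h.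
  by rewrite ler_peMl ?invr_ge0 ?(ltW p10)// ler1n.
have [->|th0] := eqVneq th 0.
  by rewrite enorm0 expr0n mul0r divr_ge0// ltW.
have t0 : 0 < enorm th by rewrite lt_neqAle eq_sym enorm_eq0 th0 enorm_ge0.
have h1 := psi_lower_near halpha hr hM hk h.
have ps0 : 0 < psi th by apply: lt_le_trans h1; rewrite mulr_gt0 ?divr_gt0 ?exprn_gt0.
by rewrite ler_pdivrMr// mulrC -ler_pdivrMr ?divr_gt0// invf_div mulrC.
Qed.

(** The difference of two cosines is O(|th|^2) at 0, which compensates the zero of psi; a single
    cosine would not. *)
Definition wave_quotient x x' th := (cos (edot th x) - cos (edot th x')) / psi th.

Lemma wave_quotient_bound x x' (rad : R) th : 1 <= rad -> enorm th <= rad ->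
  `|wave_quotient x x' th| <= 2 / p1 * rad ^+ 2 * enorm (x - x') * (enorm x + enorm x').
Proof.
move=> rad1 thr; rewrite /wave_quotient normrM [X in _ * X]ger0_norm ?invr_ge0 ?psi_ge0//.
have h1 : `|cos (edot th x) - cos (edot th x')| <= enorm th ^+ 2 * (enorm (x - x') * (enorm x + enorm x')) / 2.
  apply: (le_trans (normr_cosB_le _ _)); rewrite ler_pM2r ?invr_gt0// -edotNr -!edotDr.
  rewrite (_ : _ ^+ 2 * _ = (enorm th * enorm (x - x')) * (enorm th * (enorm x + enorm x'))); last by ring.
  apply: ler_pM => //; first exact: normr_edot_le.
  by apply: (le_trans (normr_edot_le _ _)); rewrite ler_wpM2l ?enorm_ge0// enormD.
have h2 : enorm th ^+ 2 / psi th <= 4 / p1 * rad ^+ 2.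
  have [/ltW h|h] := ltP (enorm th) 1.
    apply: (le_trans (psi_inv_sqr h)); rewrite ler_peMr ?divr_ge0 ?(ltW p10)//.
    by rewrite expr_ge1// (le_trans ler01).
  rewrite [leRHS]mulrC; apply: ler_pM; rewrite ?sqr_ge0 ?invr_ge0 ?psi_ge0//.
    by rewrite ler_pXn2r// nnegrE ?enorm_ge0// (le_trans ler01).
  by apply: (le_trans (psi_inv_le1 h)); rewrite ler_peMl ?invr_ge0 ?(ltW p10)// ler1n.
apply: (le_trans (ler_wpM2r _ h1)); first by rewrite invr_ge0 psi_ge0.
have d0 : 0 <= enorm (x - x') * (enorm x + enorm x') by rewrite mulr_ge0 ?addr_ge0 ?enorm_ge0.
have {}h2 := ler_wpM2r d0 h2.
have -> : enorm th ^+ 2 * (enorm (x - x') * (enorm x + enorm x')) / 2 / psi th =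
   enorm th ^+ 2 / psi th * (enorm (x - x') * (enorm x + enorm x')) / 2 by ring.
have -> : 2 / p1 * rad ^+ 2 * enorm (x - x') * (enorm x + enorm x') =
   4 / p1 * rad ^+ 2 * (enorm (x - x') * (enorm x + enorm x')) / 2.
  by move: p1^-1 => q; field.
by rewrite ler_pM2r ?invr_gt0.
Qed.

Lemma measurable_wave_quotient x x' : mfun2 (wave_quotient x x').
Proof.
apply: measurable_funM.
  by apply: measurable_funB; apply: measurable_cos_comp; exact: measurable_edotl.
rewrite (_ : (fun th => (psi th)^-1) = (fun u : R => u `^ (-1)) \o psi).
  by apply: measurableT_comp; [exact: measurable_powR|exact: measurable_psi].
by apply/funext => th /=; rewrite powR_inv1 ?psi_ge0.
Qed.

Lemma integrable_wave_quotient x x' (rad : R) : L1 (eball rad) (wave_quotient x x').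
Proof.
pose rad' := Num.max 1 rad.
apply: (bounded_integrable (C := 2 / p1 * rad' ^+ 2 * enorm (x - x') * (enorm x + enorm x'))).
- exact: measurable_eball.
- exact: mu2_eball_lty.
- exact: measurable_wave_quotient.
- move=> th; rewrite /eball /= => h; apply: wave_quotient_bound; first by rewrite le_max lexx.
  by rewrite le_max (ltW h) orbT.
Qed.

Context (x0 : R * R) (hx0 : enorm x0 = 1).

Definition green_part (rad : R) x : R := \int[mu2]_(th in eball rad) wave_quotient x x0 th.

Lemma green_part_lip (rad : R) x x' : 1 <= rad ->
  `|green_part rad x - green_part rad x'| <=
  2 / p1 * rad ^+ 2 * vol rad * enorm (x - x') * (enorm x + enorm x').
Proof.
move=> r1; have mB := @measurable_eball R rad.
rewrite /green_part -RintegralB//; try exact: integrable_wave_quotient.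
have -> : \int[mu2]_(th in eball rad) (wave_quotient x x0 th - wave_quotient x' x0 th) =
    \int[mu2]_(th in eball rad) wave_quotient x x' th.
  apply: eq_Rintegral => th _; rewrite /wave_quotient -mulrBl; congr (_ * _); ring.
have h := @norm_Rintegral_bounded R (eball rad) (wave_quotient x x')
   (2 / p1 * rad ^+ 2 * enorm (x - x') * (enorm x + enorm x')) mB (mu2_eball_lty rad)
   (measurable_wave_quotient x x').
apply: (le_trans (h _)) => [th /ltW hth|]; first exact: wave_quotient_bound.
by rewrite le_eqVlt; apply/orP/or_introl/eqP; ring.
Qed.

Lemma green_part_bound (rad : R) x : 1 <= rad ->
  `|green_part rad x| <= 2 / p1 * rad ^+ 2 * vol rad * (enorm x + 1) ^+ 2.
Proof.
move=> r1; have V0 : 0 <= vol rad by rewrite fine_ge0.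
have -> : green_part rad x = green_part rad x - green_part rad x0.
  rewrite [X in _ - X]/green_part (@eq_Rintegral _ _ _ mu2 (eball rad) (cst 0)).
    by rewrite Rintegral_cst ?mul0r ?subr0//; exact: measurable_eball.
  by move=> th _; rewrite /wave_quotient subrr mul0r.
apply: (le_trans (green_part_lip x x0 r1)); rewrite hx0 -mulrA ler_wpM2l//.
  by rewrite mulr_ge0// mulr_ge0 ?sqr_ge0// divr_ge0// ltW.
by rewrite expr2 ler_wpM2r ?addr_ge0 ?enorm_ge0// -hx0 enormB.
Qed.

Lemma measurable_green_part (rad : R) : 1 <= rad -> mfun2 (green_part rad).
Proof.
move=> r1; apply: continuous_measurable2; apply: loc_lipschitz_continuous => K.
have V0 : 0 <= vol rad by rewrite fine_ge0.
have [K0|K0] := ltP K 0.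
  by exists 0 => x y xK; have := lt_le_trans (le_lt_trans xK K0) (enorm_ge0 x); rewrite ltxx.
exists (2 / p1 * rad ^+ 2 * vol rad * (K + K)) => x y xK yK.
apply: (le_trans (green_part_lip x y r1)); rewrite [leRHS]mulrAC.
rewrite ler_wpM2l ?lerD//.
rewrite mulr_ge0 ?enorm_ge0// mulr_ge0// mulr_ge0 ?sqr_ge0// divr_ge0// ltW//.
Qed.

(** alpha = tau + (1 + tau): the decay |th|^(-alpha) is split into the rate a^(-tau) and an exponent
    above 1, integrable along the strip. *)
Let tau := (alpha - 1) / 2.
Let tau0 : 0 < tau. Proof. by rewrite divr_gt0// subr_gt0. Qed.

(** Cut off to an annulus, 1 / psi is not radially decreasing. It is a difference of two radially
    decreasing functions, [f] and [f2], both equal inside the ball of radius a to the value h of 1 /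
    psi on its boundary; [oscillation] applies to each. *)
Lemma annulus_wave : exists2 C : R, 0 <= C & forall x (a b : R), x != 0 -> 1 <= a -> a <= b ->
  `|\int[mu2]_th (cos (edot th x) * ((\1_(eball b) th - \1_(eball a) th) / psi th))| <= C * a `^ (- tau) / enorm x.
Proof.
have [C C0 hC] := @strip_decay R tau tau0.
exists (2 * (p1^-1 * C)); first by rewrite !mulr_ge0// invr_ge0 ltW.
move=> x a b xn a1 ab; have a0 := lt_le_trans ltr01 a1.
have xp : 0 < enorm x by rewrite lt_neqAle eq_sym enorm_eq0 xn enorm_ge0.
have ea : enorm ((a, 0) : R * R) = a by rewrite /enorm /= expr0n addr0 sqrtr_sqr ger0_norm// ltW.
pose h := (psi (a, 0))^-1.
have h0 : 0 <= h by rewrite invr_ge0 psi_ge0.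
have ne th : 1 <= enorm th -> th != 0 by move=> h1; rewrite -enorm_eq0 gt_eqF// (lt_le_trans _ h1).
have psip th : 1 <= enorm th -> 0 < psi th.
  move=> h1; apply: lt_le_trans (psi_lower_far halpha hr hM hk h1).
  by rewrite mulr_gt0// powR_gt0// (lt_le_trans _ h1).
have mono th th' : 1 <= enorm th -> enorm th <= enorm th' -> (psi th')^-1 <= (psi th)^-1.
  move=> h1 h2; rewrite lef_pV2 ?posrE ?psip ?(le_trans h1)//.
  by apply: psi_mono => //; exact: ne.
pose f th : R := if enorm th < a then h else if enorm th < b then (psi th)^-1 else 0.
pose f2 th : R := if enorm th < a then h else 0.
have inv0 th : 0 <= (psi th)^-1 by rewrite invr_ge0 psi_ge0.
have f0 th : 0 <= f th by rewrite /f; case: ifP => // _; case: ifP.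
have f20 th : 0 <= f2 th by rewrite /f2; case: ifP.
have mlt (t : R) : measurable_fun setT (fun th : P => enorm th < t).
  by apply: measurable_fun_ltr => //; exact: measurable_enorm.
have mi : mfun2 (fun th => (psi th)^-1).
  rewrite (_ : (fun th => (psi th)^-1) = (fun u : R => u `^ (-1)) \o psi).
    by apply: measurableT_comp; [exact: measurable_powR|exact: measurable_psi].
  by apply/funext => th /=; rewrite powR_inv1 ?psi_ge0.
have mf : mfun2 f.
  apply: measurable_fun_ifT => //; exact: measurable_fun_ifT.
have mf2 : mfun2 f2 by exact: measurable_fun_ifT.
have fmono th th' : enorm th <= enorm th' -> f th' <= f th.
  move=> le; rewrite /f; have [t1|t1] := ltP (enorm th) a.
    case: ifPn => // t2; case: ifPn => // t3; apply: mono; rewrite ea// leNgt//.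
  rewrite ltNge (le_trans t1 le) /=; have [t2|t2] := ltP (enorm th) b.
    by case: ifPn => // t3; apply: mono => //; exact: le_trans t1.
  by rewrite ltNge (le_trans t2 le).
have f2mono th th' : enorm th <= enorm th' -> f2 th' <= f2 th.
  move=> le; rewrite /f2; have [t1|t1] := ltP (enorm th) a; first by case: ifP.
  by rewrite ltNge (le_trans t1 le).
have pdec (u : R) th : 1 <= u -> a <= u -> enorm th <= u -> p1^-1 * (u `^ alpha)^-1 <= p1^-1 * a `^ (- tau) * decay tau th.
  move=> u1 au thu; have u0 := lt_le_trans ltr01 u1.
  rewrite -mulrA ler_wpM2l ?invr_ge0 ?(ltW p10)// /decay powRN -invfM.
  rewrite (_ : alpha = tau + (1 + tau)); last by rewrite /tau; field.
  rewrite powRDp// lef_pV2 ?posrE ?mulr_gt0 ?powR_gt0// ?lt_max ?ltr01//.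
  apply: ler_pM; rewrite ?powR_ge0//.
    by apply: ge0_ler_powR; rewrite ?nnegrE ?(ltW tau0) ?(ltW a0) ?(ltW u0).
  apply: ge0_ler_powR; rewrite ?nnegrE ?addr_ge0 ?(ltW tau0) ?(ltW u0)//.
    by rewrite le_max ler01.
  by rewrite ge_max u1.
have ha th : enorm th < a -> h <= p1^-1 * a `^ (- tau) * decay tau th.
  move=> t1; have h1 := psi_inv_le (th := (a, 0)); rewrite ea in h1.
  by apply: (le_trans (h1 a1)); apply: pdec => //; exact: ltW.
have fdec th : f th <= p1^-1 * a `^ (- tau) * decay tau th.
  rewrite /f; case: ifPn => [/ha//|]; rewrite -leNgt => t1; case: ifP => _.
    apply: (le_trans (psi_inv_le _)); first exact: le_trans t1.
    by apply: pdec => //; exact: le_trans t1.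
  by rewrite mulr_ge0 ?decay_ge0// mulr_ge0 ?powR_ge0// invr_ge0 ltW.
have f2dec th : f2 th <= p1^-1 * a `^ (- tau) * decay tau th.
  rewrite /f2; case: ifPn => [/ha//|_].
  by rewrite mulr_ge0 ?decay_ge0// mulr_ge0 ?powR_ge0// invr_ge0 ltW.
have fB th : `|f th| <= h + p1^-1.
  rewrite ger0_norm// /f; case: ifPn => [_|]; first by rewrite lerDl invr_ge0 ltW.
  rewrite -leNgt => t1; case: ifP => _; last by rewrite addr_ge0// invr_ge0 ltW.
  by apply: (le_trans (psi_inv_le1 (le_trans a1 t1))); rewrite lerDr.
have f2B th : `|f2 th| <= h by rewrite ger0_norm// /f2; case: ifP.
have sf : supported b f.
  by move=> th t1; rewrite /f !ltNge t1 (le_trans ab t1).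
have sf2 : supported a f2 by move=> th t1; rewrite /f2 ltNge t1.
have Lf : L1 setT f by exact: supported_integrable mf sf (fun th _ => fB th).
have Lf2 : L1 setT f2 by exact: supported_integrable mf2 sf2 (fun th _ => f2B th).
have [Ld hd] := hC x xn.
have mS := measurable_strip x.
have key g : mfun2 g -> (forall th, 0 <= g th) -> L1 setT g ->
    (forall th th', enorm th <= enorm th' -> g th' <= g th) ->
    (forall th, g th <= p1^-1 * a `^ (- tau) * decay tau th) ->
    `|\int[mu2]_th (cos (edot th x) * g th)| <= p1^-1 * a `^ (- tau) * (C / enorm x).
  move=> mg g0 Lg gm gd; apply: (le_trans (oscillation xn mg g0 Lg gm)).
  apply: (@le_trans _ _ (\int[mu2]_(th in strip x) (p1^-1 * a `^ (- tau) * decay tau th))).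
    apply: le_Rintegral => //; first exact: integrableS Lg.
    exact: integrable2Z.
  rewrite RintegralZl// ler_wpM2l// mulr_ge0 ?powR_ge0// invr_ge0 ltW//.
have Lcos g : mfun2 g -> L1 setT g -> L1 setT (fun th => cos (edot th x) * g th).
  move=> mg Lg; apply: (@dominated_integrable2 _ _ _ (fun th => `|g th|)) => //.
  - by apply: measurable_funM => //; apply: measurable_cos_comp; exact: measurable_edotl.
  - by have := integrable_norm Lg.
  - by move=> th _; rewrite normrM ler_piMl// cos_max.
have -> : \int[mu2]_th (cos (edot th x) * ((\1_(eball b) th - \1_(eball a) th) / psi th)) =
   \int[mu2]_th (cos (edot th x) * f th) - \int[mu2]_th (cos (edot th x) * f2 th).
  rewrite -RintegralB//; try exact: Lcos.
  apply: eq_Rintegral => th _; rewrite -mulrBr; congr (_ * _); rewrite /f /f2 !indicE.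
  have [t1|t1] := ltP (enorm th) a.
    by rewrite !mem_set ?subrr ?mul0r//; exact: lt_le_trans ab.
  rewrite [th \in eball a]memNset; last by rewrite /eball /= ltNge t1.
  rewrite !subr0; have [t2|t2] := ltP (enorm th) b; first by rewrite mem_set// mul1r.
  by rewrite memNset ?mul0r// /eball /= ltNge t2.
apply: (le_trans (ler_normB _ _)).
apply: (le_trans (lerD (key f mf f0 Lf fmono fdec) (key f2 mf2 f20 Lf2 f2mono f2dec))).
by rewrite le_eqVlt; apply/orP/or_introl/eqP; ring.
Qed.

Let x0n : x0 != 0. Proof. by rewrite -enorm_eq0 hx0 oner_eq0. Qed.

(** The summand 1 comes from the wave at x0, for which 1 / |x0| = 1. *)
Lemma green_tail : exists2 C : R, 0 <= C & forall x (a b : R), x != 0 -> 1 <= a -> a <= b ->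
  `|green_part b x - green_part a x| <= C * a `^ (- tau) * ((enorm x)^-1 + 1).
Proof.
have [C C0 hC] := annulus_wave; exists C => // x a b xn a1 ab.
have mi : mfun2 (fun th => (psi th)^-1).
  rewrite (_ : (fun th => (psi th)^-1) = (fun u : R => u `^ (-1)) \o psi).
    by apply: measurableT_comp; [exact: measurable_powR|exact: measurable_psi].
  by apply/funext => th /=; rewrite powR_inv1 ?psi_ge0.
pose A th : R := (\1_(eball b) th - \1_(eball a) th) / psi th.
have mA : mfun2 A.
  by apply: measurable_funM => //; apply: measurable_funB; apply: measurable_indic2; exact: measurable_eball.
have sA : supported b A.
  move=> th t1; rewrite /A !indicE !memNset ?subrr ?mul0r//; rewrite /eball /= ltNge.
    by rewrite (le_trans ab t1).
  by rewrite t1.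
have A1 th : `|A th| <= p1^-1.
  rewrite /A !indicE; have [t1|t1] := ltP (enorm th) a.
    by rewrite !mem_set ?subrr ?mul0r ?normr0 ?invr_ge0 ?(ltW p10)//; exact: lt_le_trans ab.
  rewrite [th \in eball a]memNset; last by rewrite /eball /= ltNge t1.
  rewrite subr0 normrM [X in _ * X]ger0_norm ?invr_ge0 ?psi_ge0//.
  apply: (@le_trans _ _ (1 * (psi th)^-1)); last by rewrite mul1r; exact: psi_inv_le1 (le_trans a1 t1).
  by rewrite ler_wpM2r ?invr_ge0 ?psi_ge0//; case: (_ \in _); rewrite ?normr1 ?normr0.
have LA y : L1 setT (fun th => cos (edot th y) * A th).
  apply: (@supported_integrable _ _ b p1^-1) => [|th /sA ->|th _]; last 2 first.
  - by rewrite mulr0.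
  - by rewrite normrM; apply: le_trans (A1 th); rewrite ler_piMl// cos_max.
  by apply: measurable_funM => //; apply: measurable_cos_comp; exact: measurable_edotl.
have LW (t : R) : L1 setT (fun th => \1_(eball t) th * wave_quotient x x0 th).
  by apply: integrable_indic; [exact: measurable_eball|exact: integrable_wave_quotient].
have -> : green_part b x - green_part a x =
   \int[mu2]_th (cos (edot th x) * A th) - \int[mu2]_th (cos (edot th x0) * A th).
  rewrite /green_part Rintegral_indicM [X in _ - X]Rintegral_indicM.
  rewrite -RintegralB// -RintegralB//; apply: eq_Rintegral => th _.
  by rewrite /wave_quotient /A; ring.
apply: (le_trans (ler_normB _ _)); rewrite mulrDr mulr1; apply: lerD; first exact: hC.
by have := hC x0 a b x0n a1 ab; rewrite hx0 divr1.
Qed.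

End Green.

(** * The potential of the source *)

Section GreenConv.
Context {R : realType}.
Local Notation mu := (@lebesgue_measure R).
Local Notation P := (measurableTypeR R * measurableTypeR R)%type.
Local Notation measurable2 := (@measurable _ P).
Local Notation mfun2 f := (@measurable_fun _ _ P R setT f).
Local Notation L1 D f := (mu2.-integrable (D : set P) (EFin \o f)).

Context (alpha r M : R) (halpha : 1 < alpha < 2) (hr : 0 < r < M) (hM : 1 < M).
Context (hk : forall n : nat, (0 < n)%N -> 0 < kn r M alpha n).

Local Notation k_ := (kn r M alpha).
Local Notation F_ := (Fn r M).
Local Notation w_ := (wn r M alpha).
Local Notation c_ := (cn r M alpha).
Local Notation p_ := (pn r M alpha).
Local Notation c := (cc r M alpha).
Local Notation box n := (sites (Nbox M n)).
Local Notation L_M := (LM r M alpha).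

Let alpha_gt1 : 1 < alpha. Proof. by case/andP: halpha. Qed.
Local Opaque kn Fn wn cn pn psiM.
Local Notation psi := (psiM r M alpha).
Local Notation vol rad := (fine (mu2 (eball rad : set P))).
Implicit Types (x y z th : R * R).
Context (x0 : R * R) (hx0 : enorm x0 = 1).
Local Notation gp := (green_part alpha r M x0).
Local Notation G := (GM r M alpha x0).
Let tau := (alpha - 1) / 2.
Let tau0 : 0 < tau. Proof. by rewrite divr_gt0// subr_gt0. Qed.
Let kap : R := ((2 * pi) ^+ 2)^-1.
Let kap0 : 0 < kap. Proof. by rewrite invr_gt0 exprn_gt0// mulr_gt0// pi_gt0. Qed.

Lemma powRN_cvg0 (q : R) : 0 < q -> (t `^ (- q)) @[t --> +oo] --> (0 : R).
Proof.
move=> q0; apply/cvgrPdist_le => e e0.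
exists (Num.max 1 (e `^ (- q^-1))); split; first by rewrite num_real.
move=> t; rewrite gt_max => /andP[t1 te].
have t0 := lt_trans ltr01 t1.
rewrite sub0r normrN ger0_norm ?powR_ge0// powRN.
rewrite -[leRHS]invrK lef_pV2 ?posrE ?powR_gt0 ?invr_gt0//.
have -> : e^-1 = (e `^ (- q^-1)) `^ q.
  by rewrite -powRrM mulNr mulVf ?gt_eqF// powR_inv1 ?ltW.
by apply: ge0_ler_powR; rewrite ?nnegrE ?powR_ge0 ?(ltW q0) ?(ltW t0) ?(ltW te).
Qed.

(** The tail bound makes the truncated integrals Cauchy, so the [lim] in [GM] is a true limit and
    inherits the bound. *)
Lemma green_cvg : exists2 C : R, 0 <= C & forall x, x != 0 ->
  (forall a : R, 1 <= a -> `|G x - kap * gp a x| <= C * a `^ (- tau) * ((enorm x)^-1 + 1)).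
Proof.
have [C C0 hC] := green_tail halpha hr hM hk hx0.
exists (kap * C); first by rewrite mulr_ge0// ltW.
move=> x xn a a1.
have xi : 0 <= (enorm x)^-1 + 1 by rewrite addr_ge0// invr_ge0 enorm_ge0.
have D0 : 0 <= C * ((enorm x)^-1 + 1) by rewrite mulr_ge0.
have cv : cvg (gp t x @[t --> +oo]).
  apply: cauchy_cvg; apply: cauchy_exP => e e0.
  have hl : C * ((enorm x)^-1 + 1) * t `^ (- tau) @[t --> +oo] --> 0.
    by rewrite -[X in _ --> X](mulr0 (C * ((enorm x)^-1 + 1))); apply: cvgMr; exact: powRN_cvg0.
  have [K [_ hK]] := cvgr_lt _ hl _ e0.
  pose b := Num.max 1 (K + 1).
  have b1 : 1 <= b by rewrite le_max lexx.
  have bK : K < b by rewrite lt_max ltrDl ltr01 orbT.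
  exists (gp b x); exists b; split; first exact: num_real.
  move=> t bt; rewrite /ball /= distrC.
  apply: (le_lt_trans (hC x b t xn b1 (ltW bt))).
  by rewrite mulrAC; exact: hK.
have h : `|kap * gp t x - kap * gp a x| @[t --> +oo] --> `|G x - kap * gp a x|.
  by apply: cvg_norm; apply: cvgB; [exact: cvgMr|exact: cvg_cst].
apply: (cvgr_to_le h); exists a; split; first exact: num_real.
move=> t at' /=; rewrite -mulrBr normrM ger0_norm ?(ltW kap0)// -!mulrA ler_wpM2l ?(ltW kap0)//.
by rewrite mulrA; exact: hC x a t xn a1 (ltW at').
Qed.

Lemma mu2_set1 x : mu2 ([set x] : set P) = 0%E.
Proof.
have := @mu2_box R x.1 x.1 x.2 x.2 (lexx _) (lexx _); rewrite subrr mul0r => h; rewrite -[RHS]h.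
congr (mu2 _); apply/seteqP; split => [y ->|[y1 y2] /= [h1 h2]]; first by rewrite /= !lexx.
by case: (x) h1 h2 => a b /=; rewrite -!eq_le => /eqP -> /eqP ->.
Qed.

Lemma measurable_point x : measurable2 [set x].
Proof.
rewrite (_ : [set x] = [set y : P | x.1 <= y.1 <= x.1 /\ x.2 <= y.2 <= x.2]); first exact: measurable_box.
apply/seteqP; split => [y ->|[y1 y2] /= [h1 h2]]; first by rewrite /= !lexx.
by case: (x) h1 h2 => a b /=; rewrite -!eq_le => /eqP -> /eqP ->.
Qed.

(** Nothing is known of convergence at the origin, so the approximating functions are given the
    value [G 0] there. *)
Lemma measurable_GM : mfun2 G.
Proof.
have m0 : measurable_fun setT (fun x : P => x == 0 :> R * R).
  apply: (measurable_fun_bool true).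
  rewrite (_ : _ @^-1` _ = [set 0]); last by apply/seteqP; split => x /= /eqP.
  by rewrite setTI; exact: measurable_point.
pose h (n : nat) x := if x == 0 then G 0 else kap * gp n.+1%:R x.
apply: (@measurable_fun_cvg _ _ R setT h) => [n|x _].
  apply: measurable_fun_ifT => //; apply: measurable_funM => //.
  by apply: measurable_green_part => //; rewrite ler1n.
rewrite /h; case: eqVneq => [->|xn]; first exact: cvg_cst.
have [C C0 hC] := green_cvg.
apply/cvgrPdist_le => e e0.
have hl : C * ((enorm x)^-1 + 1) * n.+1%:R `^ (- tau) @[n --> \oo] --> 0.
  rewrite -[X in _ --> X](mulr0 (C * ((enorm x)^-1 + 1))); apply: cvgMr.
  by have := natr_powRN_cvg0 tau0; rewrite -cvg_shiftS.
near=> n; apply: (le_trans (hC x xn n.+1%:R _)); first by rewrite ler1n.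
rewrite mulrAC; near: n; exact: (cvgr_le _ hl).
Unshelve. all: by end_near. Qed.

Lemma GM_bound : exists C : R, forall z, z != 0 -> `|G z| <= C * ((enorm z)^-1 + 1) + C * (enorm z + 1) ^+ 2.
Proof.
have [C C0 hC] := green_cvg; have V0 : 0 <= vol 1 by rewrite fine_ge0.
pose D := kap * (2 / psi (1, 0) * 1 ^+ 2 * vol 1).
exists (Num.max C D) => z zn.
have h1 := hC z zn 1 (lexx _); rewrite powR1 mulr1 in h1.
have h2 : `|kap * gp 1 z| <= D * (enorm z + 1) ^+ 2.
  rewrite normrM ger0_norm ?(ltW kap0)// /D -mulrA ler_wpM2l ?(ltW kap0)//.
  exact: (green_part_bound halpha hr hM hk hx0).
rewrite -[G z](subrK (kap * gp 1 z)); apply: (le_trans (ler_normD _ _)); apply: lerD.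
  apply: (le_trans h1); rewrite ler_wpM2r ?le_max ?lexx//.
  by rewrite addr_ge0// invr_ge0 enorm_ge0.
by apply: (le_trans h2); rewrite ler_wpM2r ?sqr_ge0// le_max lexx orbT.
Qed.

Lemma integrable_inv_enorm (rad : R) : L1 (eball rad) (fun z => (enorm z)^-1 + 1).
Proof.
apply: integrable2D; [exact: measurable_eball| |].
  rewrite (_ : (fun z => (enorm z)^-1) = (fun z => (enorm z `^ 1)^-1)).
    by apply: integrable_near0; rewrite ltr01 ltr1n.
  by apply/funext => z; rewrite powRr1 ?enorm_ge0.
by apply: integrable2_cst; [exact: measurable_eball|exact: mu2_eball_lty].
Qed.

Lemma integrable_GM (rad : R) : L1 (eball rad) G.
Proof.
have [C hC] := GM_bound.
apply: (@dominated_integrable2 _ _ _ (fun z => `|C| * ((enorm z)^-1 + 1) + (`|C| * (`|rad| + 1) ^+ 2 + `|G 0|))).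
- exact: measurable_eball.
- exact: measurable_GM.
- apply: integrable2D; first exact: measurable_eball.
    by apply: integrable2Z; [exact: measurable_eball|exact: integrable_inv_enorm].
  by apply: integrable2_cst; [exact: measurable_eball|exact: mu2_eball_lty].
move=> z; rewrite /eball /= => zr.
have z0 := enorm_ge0 z; have zi : 0 <= (enorm z)^-1 + 1 by rewrite addr_ge0// invr_ge0.
have [->|zn] := eqVneq z 0.
  by rewrite enorm0 invr0 add0r mulr1 addrA lerDr addr_ge0// mulr_ge0// sqr_ge0.
apply: (le_trans (hC z zn)); apply: lerD; first by rewrite ler_wpM2r// ler_norm.
rewrite -[leLHS]addr0; apply: lerD => //.
apply: (@le_trans _ _ (`|C| * (enorm z + 1) ^+ 2)); first by rewrite ler_wpM2r ?sqr_ge0 ?ler_norm.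
by rewrite ler_wpM2l// ler_pXn2r ?nnegrE ?addr_ge0// lerD2r (le_trans (ltW zr))// ler_norm.
Qed.

Lemma Rintegral_eq_off_point (D : set P) (f g : R * R -> R) x : measurable2 D -> mfun2 f -> mfun2 g ->
  (forall z, z != x -> f z = g z) -> \int[mu2]_(z in D) f z = \int[mu2]_(z in D) g z.
Proof.
move=> mD mf mg fg; congr fine; apply: ae_eq_integral => //.
- by apply/measurable_EFinP; exact: measurable_funTS.
- by apply/measurable_EFinP; exact: measurable_funTS.
exists [set x]; split; [exact: measurable_point|exact: mu2_set1|].
move=> z /= h; apply: contrapT => zx; apply: h => _; rewrite fg//.
by apply/eqP => e; apply: zx.
Qed.

(** * Convolution with the source *)

Section Source.
Context (rho : R * R -> R) (B R0 Lr : R).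
Hypotheses (mrho : mfun2 rho) (hB : forall x, `|rho x| <= B) (R00 : 0 < R0) (srho : supported R0 rho).
Hypotheses (Lr0 : 0 <= Lr) (rho_lip : forall x y, `|rho x - rho y| <= Lr * enorm (x - y)).

Definition potential x : R := \int[mu2]_y (G (x - y) * rho y).

Let B0 : 0 <= B. Proof. exact: le_trans (hB 0). Qed.

Lemma supported_reflect (K : R) x : enorm x <= K -> supported (K + R0) (fun z => rho (x - z)).
Proof.
move=> xK z hz; apply: srho; have := enormB x (x - z); rewrite subKr => h.
by rewrite -(lerD2l (enorm x)); apply: le_trans h; apply: le_trans hz; rewrite lerD2r.
Qed.

Lemma integrable_conv_loc (g h : R * R -> R) (Q C : R) : mfun2 g -> L1 (eball Q) g -> mfun2 h ->
  (forall z, `|h z| <= C) -> supported Q h -> L1 setT (fun z => g z * h z).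
Proof.
move=> mg Lg mh hC sh; have mQ := @measurable_eball R Q.
have : L1 setT (fun z => \1_(eball Q) z * (g z * h z)).
  apply: integrable_indic => //; apply: (@dominated_integrable2 _ _ _ (fun z => C * `|g z|)) => //.
  - exact: measurable_funM.
  - by apply: integrable2Z => //; have := integrable_norm Lg.
  - by move=> z _; rewrite normrM mulrC ler_wpM2r.
congr (mu2.-integrable _ _); apply/funext => z /=; rewrite indicE.
have [zQ|zQ] := ltP (enorm z) Q; first by rewrite mem_set// mul1r.
by rewrite sh// mulr0 mulr0.
Qed.

Lemma conv_reflect (g : R * R -> R) x : mfun2 g ->
  \int[mu2]_y (g (x - y) * rho y) = \int[mu2]_z (g z * rho (x - z)).
Proof.
move=> mg; rewrite -(Rintegral_reflect x).
  by apply: eq_Rintegral => y _; rewrite subKr.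
by apply: measurable_funM => //; exact: measurable_reflect.
Qed.

Lemma norm_conv_loc_le (g h : R * R -> R) (Q C : R) : mfun2 g -> L1 (eball Q) g -> mfun2 h ->
  (forall z, `|h z| <= C) -> supported Q h ->
  `|\int[mu2]_z (g z * h z)| <= C * \int[mu2]_(z in eball Q) `|g z|.
Proof.
move=> mg Lg mh hC sh; have mQ := @measurable_eball R Q.
have La : L1 (eball Q) (fun z => `|g z|) by have := integrable_norm Lg.
rewrite (@supported_Rintegral _ (fun z => g z * h z) Q); last by move=> z /sh ->; rewrite mulr0.
rewrite -RintegralZl//; apply: norm_Rintegral_le => //.
- exact: measurable_funM.
- exact: integrable2Z.
- by move=> z _; rewrite normrM mulrC ler_wpM2r.
Qed.

(** The reflection y -> x - y moves the dependence on x to the Lipschitz function [rho]; of [G] only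
    local integrability is used. *)
Lemma potential_continuous : continuous potential.
Proof.
apply: loc_lipschitz_continuous => K.
exists (Lr * \int[mu2]_(z in eball (K + R0)) `|G z|) => x y xK yK.
have mG := measurable_GM.
rewrite /potential !conv_reflect// -RintegralB//; last 2 first.
- exact: integrable_conv_loc mG (integrable_GM (K + R0)) (measurable_reflect x mrho) (fun z => hB _) (supported_reflect xK).
- exact: integrable_conv_loc mG (integrable_GM (K + R0)) (measurable_reflect y mrho) (fun z => hB _) (supported_reflect yK).
under eq_Rintegral => z _ do rewrite -mulrBr.
rewrite mulrAC; apply: (@norm_conv_loc_le _ (fun z => rho (x - z) - rho (y - z))) => //.
- exact: integrable_GM.
- by apply: measurable_funB; exact: measurable_reflect.
- by move=> z; apply: (le_trans (rho_lip _ _)); rewrite opprB addrA subrK.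
- by move=> z hz; rewrite (supported_reflect xK)// (supported_reflect yK)// subr0.
Qed.

(** The singularity 1 / |z| of the pointwise tail bound is locally integrable in the plane, so after
    convolution the rate is uniform on bounded sets. *)
Lemma potential_tail (K : R) : exists2 C : R, 0 <= C & forall x (a : R), enorm x <= K -> 1 <= a ->
  `|potential x - \int[mu2]_y (kap * gp a (x - y) * rho y)| <= C * a `^ (- tau).
Proof.
have [C C0 hC] := green_cvg; have mQ := @measurable_eball R (K + R0).
have I0 : 0 <= \int[mu2]_(z in eball (K + R0)) ((enorm z)^-1 + 1).
  by rewrite Rintegral_ge0// => z _; rewrite addr_ge0// invr_ge0 enorm_ge0.
exists (B * (C * \int[mu2]_(z in eball (K + R0)) ((enorm z)^-1 + 1))); first by rewrite !mulr_ge0.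
move=> x a xK a1; have mG := measurable_GM.
have mgp : mfun2 (fun z => kap * gp a z).
  by apply: measurable_funM => //; exact: measurable_green_part.
have Lgp : L1 (eball (K + R0)) (fun z => kap * gp a z).
  have V0 : 0 <= vol a by rewrite fine_ge0.
  apply: (bounded_integrable (C := kap * (2 / psi (1, 0) * a ^+ 2 * vol a * (`|K + R0| + 1) ^+ 2))) => //.
    exact: mu2_eball_lty.
  move=> z zr; rewrite normrM ger0_norm ?(ltW kap0)// ler_wpM2l ?(ltW kap0)//.
  apply: (le_trans (green_part_bound halpha hr hM hk hx0 z a1)).
  rewrite ler_wpM2l//.
    rewrite mulr_ge0// mulr_ge0 ?sqr_ge0// divr_ge0// ltW//; exact: psi_unit_gt0.
  rewrite ler_pXn2r ?nnegrE ?addr_ge0 ?enorm_ge0// lerD2r.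
  exact: (le_trans (ltW zr) (ler_norm _)).
have sr := supported_reflect xK; have mr := measurable_reflect x mrho.
rewrite /potential (conv_reflect x mG) (conv_reflect x mgp) -RintegralB//; last 2 first.
- exact: integrable_conv_loc mG (integrable_GM (K + R0)) mr (fun z => hB _) sr.
- exact: integrable_conv_loc mgp Lgp mr (fun z => hB _) sr.
under eq_Rintegral => z _ do rewrite -mulrBl.
have Ld : L1 (eball (K + R0)) (fun z => G z - kap * gp a z).
  by apply: integrable2B => //; exact: integrable_GM.
have md : mfun2 (fun z => G z - kap * gp a z) by exact: measurable_funB.
apply: (le_trans (norm_conv_loc_le md Ld mr (fun z => hB _) sr)).
rewrite -mulrA ler_wpM2l//.
(* The tail bound fails at the origin, a null set, where the integrand is replaced by 0. *)
pose h z : R := if z == 0 then 0 else `|G z - kap * gp a z|.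
have mh : mfun2 h.
  apply: measurable_fun_ifT => //; last exact: measurableT_comp.
  apply: (measurable_fun_bool true).
  rewrite (_ : _ @^-1` _ = [set 0]); last by apply/seteqP; split => z /= /eqP.
  by rewrite setTI; exact: measurable_point.
rewrite (@Rintegral_eq_off_point _ _ h 0) //; last 2 first.
- exact: measurableT_comp.
- by move=> z /negPf z0; rewrite /h z0.
rewrite [leRHS]mulrAC -RintegralZl//; last exact: integrable_inv_enorm.
have hh z : eball (K + R0) z -> `|h z| <= C * a `^ (- tau) * ((enorm z)^-1 + 1).
  move=> _; rewrite /h; case: eqVneq => [_|zn].
    by rewrite normr0 mulr_ge0 ?mulr_ge0 ?powR_ge0 ?addr_ge0 ?invr_ge0 ?enorm_ge0.
  by rewrite normr_id; exact: hC.
apply: (le_trans (ler_norm _)).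
apply: (norm_Rintegral_le mQ mh _ hh).
by apply: integrable2Z => //; exact: integrable_inv_enorm.
Qed.

End Source.

End GreenConv.

(** * Fubini for dominated functions *)

Section DominatedFubini.
Context {d1 d2 : measure_display} {T1 : measurableType d1} {T2 : measurableType d2} {R : realType}.
Context (m1 : {sigma_finite_measure set T1 -> \bar R}) (m2 : {sigma_finite_measure set T2 -> \bar R}).
Context (F : T1 * T2 -> R) (f : T1 -> R) (g : T2 -> R).
Hypotheses (mF : measurable_fun setT F) (Lf : m1.-integrable setT (EFin \o f))
  (Lg : m2.-integrable setT (EFin \o g)) (hF : forall x y, `|F (x, y)| <= f x * g y).

Lemma integrable_section1 x : m2.-integrable setT (EFin \o (fun y => F (x, y))).
Proof.
have mE : measurable_fun setT (EFin \o (fun y => F (x, y))).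
  by apply/measurable_EFinP; apply: measurableT_comp => //; exact: pair1_measurable.
apply: (@le_integrable _ _ _ m2 setT _ _ (EFin \o (fun y => f x * g y))) => //.
  by move=> y _ /=; rewrite lee_fin (le_trans (hF x y))// ler_norm.
have -> : EFin \o (fun y => f x * g y) = (fun y => (f x)%:E * (EFin \o g) y)%E by [].
exact: integrableZl.
Qed.

Lemma integrable_section2 y : m1.-integrable setT (EFin \o (fun x => F (x, y))).
Proof.
have mE : measurable_fun setT (EFin \o (fun x => F (x, y))).
  by apply/measurable_EFinP; apply: measurableT_comp => //; exact: pair2_measurable.
apply: (@le_integrable _ _ _ m1 setT _ _ (EFin \o (fun x => g y * f x))) => //.
  by move=> x _ /=; rewrite lee_fin (le_trans (hF x y))// mulrC ler_norm.
have -> : EFin \o (fun x => g y * f x) = (fun x => (g y)%:E * (EFin \o f) x)%E by [].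
exact: integrableZl.
Qed.

Lemma dominated_integrable_prod : (m1 \x m2)%E.-integrable setT (EFin \o F).
Proof.
have mE : measurable_fun setT (EFin \o F) by exact/measurable_EFinP.
apply/(integrable12ltyP _ _ mE) => /=.
have mg : measurable_fun setT (fun y => `|(EFin \o g) y|%E).
  by apply: measurableT_comp => //; case/integrableP: Lg.
have Gfin : (\int[m2]_y `|(EFin \o g) y|)%E \is a fin_num.
  by rewrite ge0_fin_numE ?integral_ge0//; case/integrableP: Lg.
apply: (@le_lt_trans _ _ (\int[m1]_x (`|(EFin \o f) x| * (\int[m2]_y `|(EFin \o g) y|)))%E).
  apply: ge0_le_integral => //.
  - by move=> x _; exact: integral_ge0.
  - apply: (@measurable_fun_fubini_tonelli_F _ _ _ _ _ m2 (abse \o (EFin \o F))) => //.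
      by apply: measurableT_comp.
    by move=> z; exact: abse_ge0.
  - apply: emeasurable_funM => //; apply: measurableT_comp => //; by case/integrableP: Lf.
  move=> x _; rewrite -ge0_integralZl//.
  apply: ge0_le_integral => //.
  - apply/measurable_EFinP; apply: measurableT_comp => //; apply: measurableT_comp => //.
  - by apply: emeasurable_funM => //; exact: measurable_cst.
  by move=> y _ /=; rewrite lee_fin -normrM (le_trans (hF x y))// ler_norm.
rewrite ge0_integralZr//; last 2 first.
- by apply: measurableT_comp => //; case/integrableP: Lf.
- exact: integral_ge0.
rewrite lte_mul_pinfty ?integral_ge0//; last by rewrite ltey_eq Gfin.
by rewrite ge0_fin_numE ?integral_ge0//; case/integrableP: Lf.
Qed.

Lemma Rintegral_prod : \int[(m1 \x m2)%E]_z F z = \int[m1]_x \int[m2]_y F (x, y).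
Proof.
have h := integral12_prod_meas1 dominated_integrable_prod.
rewrite /Rintegral -h; congr fine; apply: eq_integral => x _ /=.
by rewrite fineK//; apply: integrable_fin_num => //; exact: integrable_section1.
Qed.

Lemma Rintegral_swap : \int[m1]_x \int[m2]_y F (x, y) = \int[m2]_y \int[m1]_x F (x, y).
Proof.
rewrite -Rintegral_prod; have h := integral21_prod_meas1 dominated_integrable_prod.
rewrite /Rintegral -h; congr fine; apply: eq_integral => y _ /=.
by rewrite fineK//; apply: integrable_fin_num => //; exact: integrable_section2.
Qed.

Lemma measurable_Rintegral1 : measurable_fun setT (fun x => \int[m2]_y F (x, y)).
Proof.
by apply: measurableT_comp => //; exact: measurable_fubini_F dominated_integrable_prod.
Qed.

Lemma measurable_Rintegral2 : measurable_fun setT (fun y => \int[m1]_x F (x, y)).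
Proof.
by apply: measurableT_comp => //; exact: measurable_fubini_G dominated_integrable_prod.
Qed.

End DominatedFubini.

(** * The Abel kernel and its Fourier transform *)

Section AbelKernel.
Context {R : realType}.
Local Notation mu := (@lebesgue_measure R).

(** A summation factor chosen over the Gaussian because its cosine transform and the total mass of
    the latter come from elementary primitives. *)
Definition abel (e t : R) : R := expR (- (e * `|t|)).

Lemma continuous_abel e : continuous (abel e).
Proof.
move=> t; apply: (@continuous_comp _ _ _ (fun t : R => - (e * `|t|)) expR); last exact: continuous_expR.
by apply: cvgN; apply: cvgM; [exact: cvg_cst|exact: norm_continuous].
Qed.

Lemma abel_ge0 e t : 0 <= abel e t.
Proof. exact: expR_ge0. Qed.

(** A primitive of (1 + cos (s t)) exp (- e t) that tends to 0 at infinity. *)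
Let half (e s t : R) : R := - (e^-1 * expR (- (e * t))) +
  expR (- (e * t)) * (s * sin (s * t) - e * cos (s * t)) / (e ^+ 2 + s ^+ 2).

(** Adding 1 to the cosine makes the integrand nonnegative, as the fundamental theorem of calculus
    on a half-line used here requires; the case s = 0 later allows the constant part to be
    subtracted. *)
Lemma integral_abel_cos1 (e s : R) : 0 < e ->
  (\int[mu]_t ((1 + cos (s * t)) * abel e t)%:E = (2 * (e^-1 + e / (e ^+ 2 + s ^+ 2)))%:E)%E.
Proof.
move=> e0; have D0 : 0 < e ^+ 2 + s ^+ 2 by rewrite ltr_pwDl ?exprn_gt0// sqr_ge0.
have f0 t : 0 <= (1 + cos (s * t)) * abel e t.
  by rewrite mulr_ge0 ?abel_ge0// -lerBlDl sub0r cos_geN1.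
have cf : continuous (fun t => (1 + cos (s * t)) * abel e t).
  move=> t; apply: cvgM; last exact: continuous_abel.
  apply: cvgD; first exact: cvg_cst.
  apply: (@continuous_comp _ _ _ (fun t : R => s * t) cos); last exact: continuous_cos.
  by apply: cvgM => //; exact: cvg_cst.
rewrite ge0_symfun_integralT//; last first.
  by move=> t /=; rewrite mulrN cosN /abel normrN.
rewrite (_ : [set x | _] = `[0, +oo[%classic); last first.
  by apply/seteqP; split => x/=; rewrite in_itv/= andbT.
have dh t : is_derive t (1 : R) (half e s) ((1 + cos (s * t)) * expR (- (e * t))).
  have h1 a : is_derive t (1 : R) (fun t : R => a * t) a.
    rewrite (_ : (fun t => a * t) = (fun t => t * a)); last by apply/funext => u; rewrite mulrC.
    by apply: is_derive_eq; rewrite /GRing.scale /= mulr0 add0r mulr1.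
  have hexp : is_derive t (1 : R) (fun t : R => expR (- (e * t))) (expR (- (e * t)) * - e).
    by apply: (@is_derive1_comp _ expR (fun t => - (e * t))).
  have hsin : is_derive t (1 : R) (fun t : R => sin (s * t)) (cos (s * t) * s).
    by apply: (@is_derive1_comp _ sin (fun t => s * t)).
  have hcos : is_derive t (1 : R) (fun t : R => cos (s * t)) (- sin (s * t) * s).
    by apply: (@is_derive1_comp _ cos (fun t => s * t)).
  rewrite /half; apply: is_derive_eq.
  rewrite /GRing.scale /=; field; rewrite gt_eqF//= gt_eqF//.
rewrite (@ge0_continuous_FTC2y R _ (half e s) 0 0).
- rewrite /half !mulr0 oppr0 expR0 sin0 cos0 !mulr0 mul1r sub0r !mulr1.
  by rewrite -EFinD -EFinM; congr EFin; field; rewrite gt_eqF//= gt_eqF.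
- by move=> t _.
- exact: continuous_subspaceT.
- have ecv : expR (- (e * t)) @[t --> +oo] --> (0 : R).
    apply: (@cvg_comp _ _ _ (fun t : R => e * t) (fun u => expR (- u)) _ +oo%R); last exact: cvgr_expR.
    by apply: gt0_cvgMry.
  rewrite [X in _ --> X](_ : 0 = - (e^-1 * 0) + 0); last by rewrite mulr0 oppr0 addr0.
  apply: cvgD; first by apply: cvgN; apply: cvgM => //; exact: cvg_cst.
  apply/cvgrPdist_le => d d0.
  pose B := (`|s| + e) / (e ^+ 2 + s ^+ 2).
  have B0 : 0 < B by rewrite divr_gt0// ltr_wpDl.
  have /cvgrPdist_le /(_ (d / B)) := ecv; rewrite divr_gt0// => /(_ isT).
  apply: filterS => t; rewrite !sub0r !normrN ler_pdivlMr// => h.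
  apply: le_trans h; rewrite -mulrA normrM ler_wpM2l// normrM normfV (gtr0_norm D0) /B.
  rewrite ler_wpM2r ?invr_ge0 ?(ltW D0)//; apply: (le_trans (ler_normB _ _)).
  by rewrite !normrM (gtr0_norm e0); apply: lerD; rewrite ler_piMr ?(ltW e0)// ?sin_max ?cos_max.
- by move=> t _; apply: ex_derive.
- apply: cvg_at_right_filter; apply: differentiable_continuous; apply/derivable1_diffP; exact: ex_derive.
- move=> t; rewrite in_itv /= andbT => t0.
  by rewrite derive1E derive_val /abel ger0_norm ?ltW.
Qed.

Lemma measurable_abel e : measurable_fun setT (abel e).
Proof. by apply: continuous_measurable_fun; exact: continuous_abel. Qed.

Lemma measurable_cosM (s : R) : measurable_fun setT (fun t : R => cos (s * t)).
Proof.
apply: continuous_measurable_fun => t.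
apply: (@continuous_comp _ _ _ (fun t : R => s * t) cos); last exact: continuous_cos.
by apply: cvgM => //; exact: cvg_cst.
Qed.

Lemma integrable_abel_cos1 (e s : R) : 0 < e ->
  mu.-integrable setT (EFin \o (fun t => (1 + cos (s * t)) * abel e t)).
Proof.
move=> e0; apply/integrableP; split.
  apply/measurable_EFinP; apply: measurable_funM; last exact: measurable_abel.
  by apply: measurable_funD => //; exact: measurable_cosM.
rewrite (_ : (\int[mu]_x _)%E = \int[mu]_t ((1 + cos (s * t)) * abel e t)%:E)%E.
  by rewrite integral_abel_cos1// ltry.
by apply: eq_integral => t _ /=; rewrite ger0_norm// mulr_ge0 ?abel_ge0// -lerBlDl sub0r cos_geN1.
Qed.

Lemma integrable_abelM (e : R) (f : R -> R) : 0 < e -> measurable_fun setT f -> (forall t, `|f t| <= 1) ->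
  mu.-integrable setT (EFin \o (fun t => f t * abel e t)).
Proof.
move=> e0 mf f1; apply: le_integrable (integrable_abel_cos1 0 e0) => //.
  by apply/measurable_EFinP; apply: measurable_funM => //; exact: measurable_abel.
move=> t _ /=; rewrite lee_fin mul0r cos0 !normrM.
by apply: ler_pM => //; apply: (le_trans (f1 t)); rewrite ger0_norm ?lerDl.
Qed.

Lemma integrable_abel (e : R) : 0 < e -> mu.-integrable setT (EFin \o abel e).
Proof.
move=> e0; apply: le_integrable (integrable_abel_cos1 0 e0) => //.
  by apply/measurable_EFinP; exact: measurable_abel.
by move=> t _ /=; rewrite lee_fin mul0r cos0 normrM ler_peMl// ger0_norm ?lerDl.
Qed.

Lemma Rintegral_abel (e : R) : 0 < e -> \int[mu]_t abel e t = 2 / e.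
Proof.
move=> e0; have := integral_abel_cos1 0 e0.
have L := integrable_abel e0.
move=> /(congr1 fine); rewrite /= expr0n addr0.
have -> : fine (\int[mu]_t ((1 + cos (0 * t)) * abel e t)%:E) = 2 * \int[mu]_t abel e t.
  by rewrite -RintegralZl//; congr fine; apply: eq_integral => t _; rewrite mul0r cos0.
move: (\int[mu]_t abel e t) => I h.
have {}h : I = e^-1 + e / e ^+ 2 by lra.
by rewrite h; field; rewrite gt_eqF.
Qed.

(** 2 pi times the density of the Cauchy law of scale e. *)
Definition cauchy (e s : R) : R := 2 * e / (e ^+ 2 + s ^+ 2).

Lemma Rintegral_abel_cos (e s : R) : 0 < e -> \int[mu]_t (cos (s * t) * abel e t) = cauchy e s.
Proof.
move=> e0; have Lc := integrable_abelM e0 (measurable_cosM s) (fun t => cos_max _).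
have L := integrable_abel e0.
have := integral_abel_cos1 s e0 => /(congr1 fine) /=.
have -> : fine (\int[mu]_t ((1 + cos (s * t)) * abel e t)%:E) =
    \int[mu]_t abel e t + \int[mu]_t (cos (s * t) * abel e t).
  by rewrite -RintegralD//; congr fine; apply: eq_integral => t _; rewrite mulrDl mul1r.
rewrite Rintegral_abel// /cauchy; move: (\int[mu]_t _) => I h.
by apply: (@addrI _ (2 / e)); rewrite h; field; rewrite !gt_eqF//= ltr_pwDl ?exprn_gt0 ?sqr_ge0.
Qed.

Lemma cauchy_gt0 e s : 0 < e -> 0 < cauchy e s.
Proof. by move=> e0; rewrite /cauchy !(mulr_gt0, invr_gt0)// ltr_pwDl ?exprn_gt0 ?sqr_ge0. Qed.

Lemma continuous_cauchy e : 0 < e -> continuous (cauchy e).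
Proof.
move=> e0 s; apply: cvgM; first exact: cvg_cst.
apply: cvgV; first by rewrite gt_eqF// ltr_pwDl ?exprn_gt0 ?sqr_ge0.
by apply: cvgD; [exact: cvg_cst|exact: exprn_continuous].
Qed.

Lemma integral_cauchy1 : (\int[mu]_s (cauchy 1 s)%:E = (2 * pi)%:E)%E.
Proof.
rewrite ge0_symfun_integralT; last 3 first.
- by move=> s; exact/ltW/cauchy_gt0.
- exact: continuous_cauchy.
- by move=> s; rewrite /cauchy /= sqrrN.
rewrite (_ : [set x | _] = `[0, +oo[%classic); last first.
  by apply/seteqP; split => x/=; rewrite in_itv/= andbT.
have da t : is_derive t (1 : R) (fun t : R => 2 * atan t) (cauchy 1 t).
  rewrite (_ : (fun t => 2 * atan t) = 2 *: (atan : R -> R)) //.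
  by apply: is_derive_eq; rewrite /GRing.scale /= /cauchy mulr1 expr1n.
rewrite (@ge0_continuous_FTC2y R _ (fun t => 2 * atan t) 0 pi).
- by rewrite atan0 mulr0 -EFinB subr0 -EFinM.
- by move=> t _; exact/ltW/cauchy_gt0.
- by apply: continuous_subspaceT; exact: continuous_cauchy.
- rewrite [X in _ --> X](_ : pi = 2 * (pi / 2)); last by field.
  by apply: cvgM; [exact: cvg_cst|exact: cvgy_atan].
- by move=> t _; apply: ex_derive.
- by apply: cvg_at_right_filter; apply: cvgM; [exact: cvg_cst|exact: continuous_atan].
- by move=> t _; rewrite derive1E derive_val.
Qed.

Lemma integrable_cauchy1 : mu.-integrable setT (EFin \o cauchy 1).
Proof.
apply/integrableP; split.
  by apply/measurable_EFinP; exact: continuous_measurable_fun (continuous_cauchy ltr01).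
rewrite (_ : (\int[mu]_x _)%E = \int[mu]_t (cauchy 1 t)%:E)%E.
  by rewrite integral_cauchy1 ltry.
by apply: eq_integral => t _ /=; rewrite ger0_norm// ltW// cauchy_gt0.
Qed.

(** * Tensor products of one-dimensional integrals *)

Local Notation P := (measurableTypeR R * measurableTypeR R)%type.
Local Notation mfun2 f := (@measurable_fun _ _ P R setT f).
Local Notation L1 D f := (mu2.-integrable (D : set P) (EFin \o f)).

Lemma measurable_tensor (f g : R -> R) : measurable_fun setT f -> measurable_fun setT g ->
  mfun2 (fun z => f z.1 * g z.2).
Proof.
by move=> mf mg; apply: measurable_funM; [exact: measurableT_comp mf measurable_fst|exact: measurableT_comp mg measurable_snd].
Qed.

Lemma integrable_normr (f : R -> R) : mu.-integrable setT (EFin \o f) ->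
  mu.-integrable setT (EFin \o (fun t => `|f t|)).
Proof. by move=> Lf; have := integrable_norm Lf. Qed.

Lemma integrable_tensor (f g : R -> R) : mu.-integrable setT (EFin \o f) -> mu.-integrable setT (EFin \o g) ->
  L1 setT (fun z => f z.1 * g z.2).
Proof.
move=> Lf Lg; apply: (@dominated_integrable_prod _ _ _ _ R mu mu _ (fun t => `|f t|) (fun t => `|g t|)).
- by apply: measurable_tensor; apply/measurable_EFinP; [case/integrableP: Lf|case/integrableP: Lg].
- exact: integrable_normr.
- exact: integrable_normr.
- by move=> x y; rewrite normrM.
Qed.

Lemma Rintegral_tensor (f g : R -> R) : mu.-integrable setT (EFin \o f) -> mu.-integrable setT (EFin \o g) ->
  \int[mu2]_(z in (setT : set P)) (f z.1 * g z.2) = (\int[mu]_t f t) * (\int[mu]_t g t).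
Proof.
move=> Lf Lg.
rewrite (@Rintegral_prod _ _ _ _ R mu mu _ (fun t => `|f t|) (fun t => `|g t|)).
- rewrite -RintegralZr//; apply: eq_Rintegral => x _ /=; exact: RintegralZl.
- by apply: measurable_tensor; apply/measurable_EFinP; [case/integrableP: Lf|case/integrableP: Lg].
- exact: integrable_normr.
- exact: integrable_normr.
- by move=> x y; rewrite normrM.
Qed.

Definition abel2 (e : R) (th : R * R) : R := abel e th.1 * abel e th.2.
Definition cauchy2 (e : R) (z : R * R) : R := cauchy e z.1 * cauchy e z.2.

Lemma Rintegral_abel2_cos (e : R) (z : R * R) : 0 < e ->
  \int[mu2]_(th in (setT : set P)) (cos (edot th z) * abel2 e th) = cauchy2 e z.
Proof.
move=> e0; have mc s := measurable_cosM s.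
have ms s : measurable_fun setT (fun t : R => sin (s * t)).
  apply: continuous_measurable_fun => t.
  apply: (@continuous_comp _ _ _ (fun t : R => s * t) sin); last exact: continuous_sin.
  by apply: cvgM => //; exact: cvg_cst.
have Lc s := integrable_abelM e0 (mc s) (fun t => cos_max _).
have Ls s := integrable_abelM e0 (ms s) (fun t => sin_max _).
have -> : (fun th => cos (edot th z) * abel2 e th) = (fun th =>
    (cos (z.1 * th.1) * abel e th.1) * (cos (z.2 * th.2) * abel e th.2) -
    (sin (z.1 * th.1) * abel e th.1) * (sin (z.2 * th.2) * abel e th.2)).
  by apply/funext => th; rewrite /abel2 /edot cosD ![_ * th.1]mulrC ![_ * th.2]mulrC; ring.
rewrite RintegralB//; last 2 first.
- exact: integrable_tensor (Lc z.1) (Lc z.2).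
- exact: integrable_tensor (Ls z.1) (Ls z.2).
rewrite (Rintegral_tensor (Lc z.1) (Lc z.2)) !Rintegral_abel_cos// -/(cauchy2 e z).
set S := fun th : P => _; suff: \int[mu2]_(th in setT) S th = 0 by move=> ->; rewrite subr0.
have mS : mfun2 S by apply: (@measurable_tensor (fun t => sin (z.1 * t) * abel e t) (fun t => sin (z.2 * t) * abel e t));
  apply: measurable_funM => //; exact: measurable_abel.
have c01 : (0 : R) ^+ 2 + 1 ^+ 2 = 1 by rewrite expr0n expr1n add0r.
(* A quarter turn followed by the swap is the reflection (a, b) -> (a, - b), under which the product
   of sines changes sign; its integral therefore vanishes. *)
have hT := scales_measure_comp (@swap_scales_measure R) (rotation_scales_measure c01).
have := @scales_Rintegral R _ _ setT S hT _ measurableT mS.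
rewrite preimage_setT mulr1 mul1r => /(_ ltr01).
have -> : (fun th : P => S (((fun z0 : R * R => (z0.2, z0.1)) \o
   (fun z0 : R * R => (0 * z0.1 - 1 * z0.2, 1 * z0.1 + 0 * z0.2))) th)) = (fun th => -1 * S th).
  apply/funext => th; rewrite /S /= !mul0r !mul1r add0r addr0 /abel normrN mulrN sinN; ring.
rewrite RintegralZl//; last exact: integrable_tensor (Ls z.1) (Ls z.2).
move: (\int[mu2]_(_ in _) _) => I h; lra.
Qed.

End AbelKernel.

(** * Fourier inversion *)

Section Inversion.
Context {R : realType}.
Local Notation mu := (@lebesgue_measure R).
Local Notation P := (measurableTypeR R * measurableTypeR R)%type.
Local Notation measurable2 := (@measurable _ P).
Local Notation mfun2 f := (@measurable_fun _ _ P R setT f).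
Local Notation L1 D f := (mu2.-integrable (D : set P) (EFin \o f)).
Implicit Types (x y z th h : R * R).

(* The product of two sigma-finite measures has no inferable sigma-finite structure. *)
Definition plane_measure : set P -> \bar R := (mu \x mu)%E.
HB.instance Definition _ := Measure.on plane_measure.

Lemma plane_measure_sigma_finite : sigma_finite setT plane_measure.
Proof.
exists (fun n : nat => eball n%:R).
  apply/seteqP; split => // x _; exists (Num.truncn (enorm x)).+1 => //.
  by rewrite /eball /= truncnS_gt.
by move=> n; split; [exact: measurable_eball|exact: mu2_eball_lty].
Qed.

HB.instance Definition _ := Measure_isSigmaFinite.Build _ _ _ plane_measure plane_measure_sigma_finite.

Section Fubini2.
Context (F : P * P -> R) (f g : R * R -> R).
Hypotheses (mF : measurable_fun setT F) (Lf : L1 setT f) (Lg : L1 setT g)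
  (hF : forall x y, `|F (x, y)| <= f x * g y).

Lemma Rintegral2_swap : \int[mu2]_x \int[mu2]_y F (x, y) = \int[mu2]_y \int[mu2]_x F (x, y).
Proof. exact: (Rintegral_swap (m1 := plane_measure) (m2 := plane_measure) mF Lf Lg hF). Qed.

Lemma measurable_Rintegral21 : mfun2 (fun x => \int[mu2]_y F (x, y)).
Proof. exact: (measurable_Rintegral1 (m1 := plane_measure) (m2 := plane_measure) mF Lf Lg hF). Qed.

Lemma measurable_Rintegral22 : mfun2 (fun y => \int[mu2]_x F (x, y)).
Proof. exact: (measurable_Rintegral2 (m1 := plane_measure) (m2 := plane_measure) mF Lf Lg hF). Qed.

End Fubini2.

(** The real part of exp (- i th . y) times the integral of exp (i th . x) g x: the integrand of the
    inversion formula at [y], without complex numbers. *)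
Definition ft (g : R * R -> R) y th : R := \int[mu2]_x (wave th (- edot th y) x * g x).

Lemma wave_max th be x : `|wave th be x| <= 1.
Proof. exact: cos_max. Qed.

Lemma integrable_waveM (g : R * R -> R) th be : mfun2 g -> L1 setT g ->
  L1 setT (fun x => wave th be x * g x).
Proof.
move=> mg Lg; apply: (@dominated_integrable2 _ _ _ (fun x => `|g x|)) => //.
- by apply: measurable_funM => //; exact: measurable_wave.
- by have := integrable_norm Lg.
- by move=> x _; rewrite normrM ler_piMl ?wave_max.
Qed.

Lemma ft_bound (g : R * R -> R) y th : mfun2 g -> L1 setT g -> `|ft g y th| <= \int[mu2]_x `|g x|.
Proof.
move=> mg Lg; apply: norm_Rintegral_le => //.
- by apply: measurable_funM => //; exact: measurable_wave.
- by have := integrable_norm Lg.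
- by move=> x _; rewrite normrM ler_piMl ?wave_max.
Qed.

Lemma measurable_wave_joint y : measurable_fun [set: P * P] (fun p => wave p.2 (- edot p.2 y) p.1).
Proof.
apply: (@measurableT_comp _ _ _ _ _ _ (cos : R -> R)).
  by apply: continuous_measurable_fun; exact: continuous_cos.
have m11 : measurable_fun [set: P * P] (fun p => p.1.1) by exact: measurableT_comp measurable_fst measurable_fst.
have m12 : measurable_fun [set: P * P] (fun p => p.1.2) by exact: measurableT_comp measurable_snd measurable_fst.
have m21 : measurable_fun [set: P * P] (fun p => p.2.1) by exact: measurableT_comp measurable_fst measurable_snd.
have m22 : measurable_fun [set: P * P] (fun p => p.2.2) by exact: measurableT_comp measurable_snd measurable_snd.
apply: measurable_funD.
  by apply: measurable_funD; apply: measurable_funM.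
by apply: measurableT_comp => //; apply: measurable_funD; apply: measurable_funM.
Qed.

Lemma measurable_abel2 e : mfun2 (abel2 e).
Proof. by apply: measurable_tensor; exact: measurable_abel. Qed.

Lemma abel2_ge0 e th : 0 <= abel2 e th.
Proof. by rewrite mulr_ge0 ?abel_ge0. Qed.

Lemma abel2_gt0 e th : 0 < abel2 e th.
Proof. by rewrite mulr_gt0 ?expR_gt0. Qed.

Lemma abel2_le1 e th : 0 <= e -> abel2 e th <= 1.
Proof.
have h t : 0 <= e -> abel e t <= 1 by move=> e0; rewrite -expR0 ler_expR oppr_le0 mulr_ge0.
by move=> e0; rewrite mulr_ile1 ?abel_ge0 ?h.
Qed.

Lemma integrable_abel2 e : 0 < e -> L1 setT (abel2 e).
Proof. by move=> e0; apply: integrable_tensor; exact: integrable_abel. Qed.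

Section Swap.
Context (g : R * R -> R) (y : R * R) (e : R).
Hypotheses (mg : mfun2 g) (Lg : L1 setT g) (e0 : 0 < e).

Let F (p : P * P) : R := wave p.2 (- edot p.2 y) p.1 * g p.1 * abel2 e p.2.

Let mF : measurable_fun setT F.
Proof.
apply: measurable_funM; first apply: measurable_funM.
- exact: measurable_wave_joint.
- exact: measurableT_comp mg measurable_fst.
- exact: measurableT_comp (measurable_abel2 e) measurable_snd.
Qed.

Let LNg : L1 setT (fun x => `|g x|). Proof. by have := integrable_norm Lg. Qed.

Let hF x th : `|F (x, th)| <= `|g x| * abel2 e th.
Proof.
rewrite /F /= 2!normrM [X in _ * X]ger0_norm ?abel2_ge0// ler_wpM2r ?abel2_ge0//.
by rewrite ler_piMl ?wave_max.
Qed.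

Let inner th : \int[mu2]_x F (x, th) = ft g y th * abel2 e th.
Proof. by rewrite /F /= -RintegralZr//; exact: integrable_waveM. Qed.

Lemma measurable_ft_abel : mfun2 (fun th => ft g y th * abel2 e th).
Proof.
have := measurable_Rintegral22 mF LNg (integrable_abel2 e0) hF.
by rewrite (_ : (fun th => _) = (fun th => ft g y th * abel2 e th))//; apply/funext => th; exact: inner.
Qed.

Lemma ft_abel : \int[mu2]_th (ft g y th * abel2 e th) = \int[mu2]_x (g x * cauchy2 e (x - y)).
Proof.
rewrite (_ : \int[mu2]_th _ = \int[mu2]_th \int[mu2]_x F (x, th)); last first.
  by apply: eq_Rintegral => th _; rewrite inner.
rewrite -(Rintegral2_swap mF LNg (integrable_abel2 e0) hF); apply: eq_Rintegral => x _.
rewrite -Rintegral_abel2_cos// -RintegralZl//; last first.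
  apply: (@dominated_integrable2 _ _ _ (abel2 e)) => //.
  - by apply: measurable_funM; [apply: measurable_cos_comp; exact: measurable_edotl|exact: measurable_abel2].
  - exact: integrable_abel2.
  - by move=> th _; rewrite normrM (ger0_norm (abel2_ge0 _ _)) ler_piMl ?abel2_ge0 ?cos_max.
by apply: eq_Rintegral => th _; rewrite /F /= /wave edotDr edotNr; ring.
Qed.

End Swap.

(** Fubini needs an integrable function of [th], so measurability is obtained after multiplication
    by [abel2 1], a positive function that is then divided out. *)
Lemma measurable_ft (g : R * R -> R) y : mfun2 g -> L1 setT g -> mfun2 (ft g y).
Proof.
move=> mg Lg; have m := measurable_ft_abel y mg Lg ltr01.
rewrite (_ : ft g y = (fun th => (ft g y th * abel2 1 th) * (abel2 1 th)^-1)).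
  apply: measurable_funM => //; rewrite (_ : (fun th => _) = (fun th => expR `|th.1| * expR `|th.2|)).
    by apply: measurable_funM; apply: measurableT_comp => //; apply: measurableT_comp.
  by apply/funext => th; rewrite /abel2 /abel !mul1r !expRN invfM !invrK.
by apply/funext => th; rewrite mulfK// gt_eqF// abel2_gt0.
Qed.

Lemma measurable_cauchy2 (e : R) : 0 < e -> mfun2 (cauchy2 e).
Proof. by move=> e0; apply: measurable_tensor; apply: continuous_measurable_fun; exact: continuous_cauchy. Qed.

Lemma cauchy2_ge0 (e : R) z : 0 < e -> 0 <= cauchy2 e z.
Proof. by move=> e0; rewrite mulr_ge0// ltW// cauchy_gt0. Qed.

Lemma integrable_cauchy2 : L1 setT (cauchy2 (1 : R)).
Proof. by apply: integrable_tensor; exact: integrable_cauchy1. Qed.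

Lemma Rintegral_cauchy2 : \int[mu2]_(z in (setT : set P)) cauchy2 (1 : R) z = (2 * pi) ^+ 2.
Proof.
rewrite (Rintegral_tensor integrable_cauchy1 integrable_cauchy1) expr2.
by rewrite /Rintegral integral_cauchy1.
Qed.

Section Bounded.
Context (g : R * R -> R) (C : R).
Hypotheses (mg : mfun2 g) (gC : forall x, `|g x| <= C).

Let dil (e : R) y z : R * R := (y.1 + e * z.1, y.2 + e * z.2).

Let mdil (e : R) y : 0 < e -> mfun2 (fun z => g (dil e y z) * cauchy2 1 z).
Proof.
move=> e0; apply: measurable_funM; last exact: measurable_cauchy2.
have [mT _] := affine_scales_measure y.1 y.2 e0; exact: measurableT_comp mg mT.
Qed.

Let hdil (e : R) y z : `|g (dil e y z) * cauchy2 1 z| <= C * cauchy2 1 z.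
Proof. by rewrite normrM (ger0_norm (cauchy2_ge0 _ ltr01)) ler_wpM2r ?cauchy2_ge0. Qed.

Lemma ft_cauchy y (e : R) : 0 < e ->
  \int[mu2]_x (g x * cauchy2 e (x - y)) = \int[mu2]_z (g (dil e y z) * cauchy2 1 z).
Proof.
move=> e0; have hT := affine_scales_measure y.1 y.2 e0.
have k0 : 0 < e ^- 2 by rewrite invr_gt0 exprn_gt0.
have mG : mfun2 (fun x => g x * cauchy2 e (x - y)).
  apply: measurable_funM => //; apply: measurable_translate; exact: measurable_cauchy2.
have := scales_Rintegral hT k0 measurableT mG; rewrite preimage_setT.
rewrite (_ : \int[mu2]_(x in _) _ = e ^- 2 * \int[mu2]_z (g (dil e y z) * cauchy2 1 z)); last first.
  rewrite -RintegralZl//; last first.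
    apply: (@dominated_integrable2 _ _ _ (fun z => C * cauchy2 1 z)) => //; first exact: mdil.
    by apply: integrable2Z => //; exact: integrable_cauchy2.
  apply: eq_Rintegral => z _; rewrite [RHS]mulrCA; congr (_ * _).
  rewrite /cauchy2 /= ![_ + _ * _]addrC !addrK /cauchy !expr1n; field.
  rewrite !gt_eqF// ?ltr_pwDl ?exprn_gt0 ?sqr_ge0//.
by move/mulfI => ->//; rewrite gt_eqF.
Qed.

Lemma cauchy_approx y : {for y, continuous g} ->
  \int[mu2]_x (g x * cauchy2 n.+1%:R^-1 (x - y)) @[n --> \oo] --> (2 * pi) ^+ 2 * g y.
Proof.
move=> cg; rewrite (_ : (fun n => _) =
    (fun n => \int[mu2]_z (g (dil n.+1%:R^-1 y z) * cauchy2 1 z))); last first.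
  by apply/funext => n; apply: ft_cauchy.
rewrite (_ : _ * g y = \int[mu2]_(z in (setT : set P)) (g y * cauchy2 1 z)); last first.
  by rewrite RintegralZl//; [rewrite Rintegral_cauchy2 mulrC|exact: integrable_cauchy2].
have [||z _||_] // := @Rintegral_dominated_cvg R setT (fun n z => g (dil n.+1%:R^-1 y z) * cauchy2 1 z)
   (fun z => g y * cauchy2 1 z) (fun z => C * cauchy2 1 z) measurableT.
- by move=> n; exact: mdil.
- by apply: integrable2Z => //; exact: integrable_cauchy2.
apply: cvgM; last exact: cvg_cst.
have hd : dil n.+1%:R^-1 y z @[n --> \oo] --> y.
  rewrite {2}[y]surjective_pairing.
  have h (a b : R) : a + n.+1%:R^-1 * b @[n --> \oo] --> a.
    rewrite -{2}[a]addr0 -[X in _ + X](mul0r b); apply: cvgD; first exact: cvg_cst.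
    by apply: cvgM; [exact: cvg_harmonic|exact: cvg_cst].
  exact: cvg_pair (h _ _) (h _ _).
exact: (cvg_comp _ _ hd cg).
Qed.

End Bounded.

(** The Abel means have two limits: the integral of [ft], by domination, and (2 pi)^2 g y, since by
    Fubini they are averages of [g] against concentrating Cauchy kernels of mass (2 pi)^2. *)
Lemma ft_inversion_abel (g : R * R -> R) (C : R) y : mfun2 g -> (forall x, `|g x| <= C) ->
  L1 setT g -> {for y, continuous g} -> L1 setT (ft g y) ->
  \int[mu2]_th ft g y th = (2 * pi) ^+ 2 * g y.
Proof.
move=> mg gC Lg cg Lft; have h1 := cauchy_approx mg gC cg.
have mft := measurable_ft y mg Lg.
have [||th _|n th _|_ h2] // := @Rintegral_dominated_cvg R setT
   (fun n th => ft g y th * abel2 n.+1%:R^-1 th) (ft g y) (fun th => `|ft g y th|) measurableT.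
- by move=> n; apply: measurable_funM => //; exact: measurable_abel2.
- by have := integrable_norm Lft.
- rewrite -{2}[ft g y th]mulr1; apply: cvgM; first exact: cvg_cst.
  have h t : abel (n.+1%:R^-1 : R) t @[n --> \oo] --> (1 : R).
    have h0 : - (n.+1%:R^-1 * `|t|) @[n --> \oo] --> (0 : R).
      by rewrite -oppr0 -(mul0r `|t|); apply: cvgN; apply: cvgM; [exact: cvg_harmonic|exact: cvg_cst].
    by have := cvg_comp _ _ h0 (@continuous_expR R 0); rewrite expR0.
  by have := cvgM (h th.1) (h th.2); rewrite mulr1 => H; exact: H.
- by rewrite normrM (ger0_norm (abel2_ge0 _ _)) ler_piMr ?abel2_le1.
rewrite (_ : (fun n => _) = (fun n => \int[mu2]_x (g x * cauchy2 n.+1%:R^-1 (x - y)))) in h2.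
  exact: cvg_unique h2 h1.
by apply/funext => n; rewrite ft_abel.
Qed.

Lemma integrable_translateM (W g : R * R -> R) h : mfun2 W -> (forall x, `|W x| <= 1) -> mfun2 g -> L1 setT g ->
  L1 setT (fun x => W x * g (x + h)).
Proof.
move=> mW W1 mg Lg; apply: (@dominated_integrable2 _ _ _ (fun x => `|g (x + h)|)) => //.
- by apply: measurable_funM => //; exact: measurable_translate.
- by have := integrable_norm (integrable_translate h mg Lg).
- by move=> x _; rewrite normrM ler_piMl.
Qed.

(* The difference operator multiplies [ft] by [2 cos (th . h) - 2]. *)
Lemma ft_d2 (g : R * R -> R) y th h : mfun2 g -> L1 setT g -> cos (edot th h) = -1 ->
  ft (fun x => d2 g x h) y th = - 4 * ft g y th.
Proof.
move=> mg Lg hc; set W := wave th (- edot th y).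
have mW : mfun2 W by exact: measurable_wave.
have W1 x : `|W x| <= 1 by exact: wave_max.
have mWt a : mfun2 (fun x => W (x + a)) by exact: measurable_translate.
have Lt a : L1 setT (fun x => W x * g (x + a)) by exact: integrable_translateM.
have Lg0 : L1 setT (fun x => W x * g x) by exact: integrable_waveM.
have Ls a : L1 setT (fun x => W (x + a) * g x).
  have := integrable_translateM 0 (mWt a) (fun x => W1 _) mg Lg.
  by rewrite (_ : (fun x => W (x + a) * g (x + 0)) = (fun x => W (x + a) * g x))//; apply/funext => x; rewrite addr0.
have sh a : \int[mu2]_x (W x * g (x + a)) = \int[mu2]_x (W (x - a) * g x).
  have mF : mfun2 (fun x => W (x - a) * g x) by exact: measurable_funM.
  by rewrite -(Rintegral_translate a mF); apply: eq_Rintegral => x _; rewrite addrK.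
have -> : ft (fun x => d2 g x h) y th = \int[mu2]_x (W x * g (x + h)) + \int[mu2]_x (W x * g (x - h)) - 2 * ft g y th.
  rewrite /ft -/W -RintegralZl// -(RintegralD measurableT (Lt h) (Lt (- h))) -RintegralB//; last 2 first.
  - exact: integrable2D (Lt h) (Lt (- h)).
  - exact: integrable2Z.
  by apply: eq_Rintegral => x _; rewrite /d2; ring.
rewrite !sh opprK -(RintegralD measurableT (Ls (- h)) (Ls h)).
rewrite (_ : \int[mu2]_x _ = \int[mu2]_x (-2 * (W x * g x))).
  rewrite RintegralZl// -/(ft g y th); ring.
apply: eq_Rintegral => x _; have := d2_wave th (- edot th y) x h; rewrite -/W hc /d2 => e.
by rewrite -mulrDl mulrA; congr (_ * _); rewrite addrC; lra.
Qed.

Lemma test_partial (f : R * R -> R) v : test_function f -> v = (1, 0) \/ v = (0, 1) ->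
  test_function ('D_v f).
Proof.
move=> hf hv k; have [[df d1 d2] cK] := hf k.+1; split; first by case: hv => ->.
apply: subclosed_compact cK _; first exact: tsupport_closed.
rewrite [X in _ `<=` X](proj1 (closure_id _) (@tsupport_closed R f)); apply: closure_subset.
move=> x /=; have [//|fx] := pselect (tsupport f x).
by rewrite (derive_outside v (@tsupport_closed R f) (@tsupport0 R f) fx) eqxx.
Qed.

Lemma norm_d2_le (C : R) (f : R * R -> R) x h : d2_lip C f x -> `|d2 f x h| <= C * enorm h ^+ 2.
Proof. by move=> /(_ h 0); rewrite d2_0 !subr0 enorm0 addr0 expr2 mulrA. Qed.

(** The partial derivatives have second differences O(|h|^2), so by the mean value theorem d2 f
    changes by O(|h|^3) under translation by h; the outer second difference is a difference of two
    such changes. An exponent above 2 is what integrability over the plane asks for. *)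
Lemma d2_d2_bound (f : R * R -> R) : test_function f ->
  exists2 C : R, 0 <= C & forall x h, `|d2 (fun z => d2 f z h) x h| <= C * enorm h ^+ 3.
Proof.
move=> hf; have [_ _ _ [C1 C10 h1]] := test_nice (test_partial hf (or_introl erefl)).
have [_ _ _ [C2 C20 h2]] := test_nice (test_partial hf (or_intror erefl)).
have df x : differentiable f x by have [[]] := hf 1%N.
exists (2 * (C1 + C2)) => [|x h]; first by rewrite mulr_ge0// addr_ge0.
have key z : `|d2 f (z + h) h - d2 f z h| <= (C1 + C2) * enorm h ^+ 3.
  have := @mean_value R (fun t => f ((z + h) + t *: h) + f ((z - h) + t *: h) - 2 * f (z + t *: h))
    (fun t => 'D_h f ((z + h) + t *: h) + 'D_h f ((z - h) + t *: h) - 2 * 'D_h f (z + t *: h))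
    ((C1 + C2) * enorm h ^+ 3).
  rewrite !scale1r !scale0r !addr0 /d2 subrK addrK => H; apply: H => t.
    have i1 := is_derive_line (df (z + h + t *: h)).
    have i2 := is_derive_line (df (z - h + t *: h)).
    have i3 := is_derive_line (df (z + t *: h)).
    apply: is_derive_eq; rewrite /GRing.scale /=; ring.
  move=> _; rewrite (derive_partials _ (df (z + h + t *: h))) (derive_partials _ (df (z - h + t *: h)))
    (derive_partials _ (df (z + t *: h))) (addrAC z h) (addrAC z (- h)).
  set p := z + t *: h.
  have := norm_d2_le h (h1 p); have := norm_d2_le h (h2 p).
  rewrite (_ : _ - _ = h.1 * d2 ('D_(1, 0) f) p h + h.2 * d2 ('D_(0, 1) f) p h); last by rewrite /d2; ring.
  move=> b2 b1; apply: (le_trans (ler_normD _ _)); rewrite mulrDl !normrM.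
  rewrite [C1 * _](_ : _ = enorm h * (C1 * enorm h ^+ 2)); last by ring.
  rewrite [C2 * _](_ : _ = enorm h * (C2 * enorm h ^+ 2)); last by ring.
  by apply: lerD; apply: ler_pM; rewrite ?enorm_ge_fst ?enorm_ge_snd.
have -> : d2 (fun z => d2 f z h) x h = (d2 f (x + h) h - d2 f x h) - (d2 f (x - h + h) h - d2 f (x - h) h).
  by rewrite subrK /d2; ring.
apply: (le_trans (ler_normB _ _)); rewrite -mulrA mulr2n mulrDl mul1r; apply: lerD; exact: key.
Qed.

(* With [h = pi th / |th|^2] taking second differences twice multiplies [ft] by 16, while
   the iterated difference of a test function is O(|h|^3). *)
Lemma ft_decay (f : R * R -> R) : test_function f ->
  exists2 C : R, 0 <= C & forall y th, 1 <= enorm th -> `|ft f y th| <= C * (enorm th `^ 3)^-1.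
Proof.
move=> hf; have [C C0 hC] := d2_d2_bound hf.
have [cf [B hB] [rad rad0 sf] _] := test_nice hf.
have mf : mfun2 f by exact: continuous_measurable2.
have Lf : L1 setT f by apply: (supported_integrable mf sf (fun x _ => hB x)).
(* Each of the two second differences enlarges the support by |h| <= pi. *)
pose Q := rad + 2 * pi; pose V : R := fine (mu2 (eball Q : set P)).
have V0 : 0 <= V by rewrite fine_ge0.
have pi0 : 0 < pi :> R by exact: pi_gt0.
exists (C * pi ^+ 3 * V) => [|y th th1]; first by rewrite !mulr_ge0 ?exprn_ge0// ltW.
have th0 : 0 < enorm th by exact: lt_le_trans th1.
pose l := pi / enorm th ^+ 2; pose h : R * R := (l * th.1, l * th.2).
have hh : enorm h = pi / enorm th.
  rewrite enorm_scale ger0_norm ?divr_ge0 ?exprn_ge0 ?(ltW th0) ?(ltW pi0)// /l; field.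
  by rewrite gt_eqF.
have hc : cos (edot th h) = -1.
  rewrite -cospi; congr cos; rewrite (_ : edot th h = l * enorm th ^+ 2); last by rewrite enorm_sqr /edot /=; ring.
  by rewrite /l divfK// expf_neq0// gt_eqF.
have hpi : enorm h <= pi by rewrite hh ler_pdivrMr// ler_peMr// ltW.
have d2s (g : R * R -> R) a : supported a g -> supported (a + pi) (fun z => d2 g z h).
  move=> sg x hx; have n1 : a <= enorm (x + h).
    have := enormB (x + h) h; rewrite addrK => hxh; rewrite -(lerD2r pi) (le_trans hx)// (le_trans hxh)// lerD2l//.
  have n2 : a <= enorm (x - h).
    have := enormD (x - h) h; rewrite subrK => hxh; rewrite -(lerD2r pi) (le_trans hx)// (le_trans hxh)// lerD2l//.
  by rewrite /d2 !sg ?mulr0 ?addr0 ?subr0// (le_trans _ hx)// lerDl ltW.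
have md2 (g : R * R -> R) : mfun2 g -> mfun2 (fun z => d2 g z h).
  move=> mg; apply: measurable_funB; last exact: measurable_funM.
  by apply: measurable_funD; exact: measurable_translate.
have bd2 (g : R * R -> R) a : (forall x, `|g x| <= a) -> forall x, `|d2 g x h| <= 4 * a.
  move=> ga x; apply: (le_trans (ler_normB _ _)); rewrite normrM normr_nat.
  have := ler_normD (g (x + h)) (g (x - h)); have := ga (x + h); have := ga (x - h); have := ga x; lra.
have m1 := md2 _ mf; have s1 := d2s _ _ sf; have b1 := bd2 _ _ hB.
have L1' : L1 setT (fun z => d2 f z h) by exact: (supported_integrable m1 s1 (fun x _ => b1 x)).
have m2 := md2 _ m1; have s2 := d2s _ _ s1.
have e16 : 16 * ft f y th = ft (fun x => d2 (fun z => d2 f z h) x h) y th.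
  by rewrite (ft_d2 y m1 L1' hc) (ft_d2 y mf Lf hc); ring.
have b2 : `|ft (fun x => d2 (fun z => d2 f z h) x h) y th| <= C * enorm h ^+ 3 * V.
  rewrite /ft (@supported_Rintegral _ _ Q); last first.
    by move=> x hx; rewrite s2 ?mulr0// (le_trans _ hx)// /Q; lra.
  apply: norm_Rintegral_bounded.
  - exact: measurable_eball.
  - exact: mu2_eball_lty.
  - by apply: measurable_funM => //; exact: measurable_wave.
  by move=> x _; rewrite normrM (le_trans _ (hC x h))// ler_piMl ?wave_max.
have -> : C * pi ^+ 3 * V * (enorm th `^ 3)^-1 = C * enorm h ^+ 3 * V.
  by rewrite hh powR_mulrn ?(ltW th0)//; field; rewrite gt_eqF.
have : `|ft f y th| <= `|16 * ft f y th|.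
  by rewrite normrM normr_nat ler_peMl// ler1n.
by move/le_trans; apply; rewrite e16.
Qed.

Lemma ft_dominated (f : R * R -> R) : test_function f ->
  exists2 d : R * R -> R, L1 setT d & forall y th, `|ft f y th| <= d th.
Proof.
move=> hf; have [C C0 hC] := ft_decay hf.
have [cf [B hB] [rad rad0 sf] _] := test_nice hf.
have mf : mfun2 f by exact: continuous_measurable2.
have Lf : L1 setT f by apply: (supported_integrable mf sf (fun x _ => hB x)).
pose I := \int[mu2]_(x in (setT : set P)) `|f x|.
have I0 : 0 <= I by exact: Rintegral_ge0.
have mB := @measurable_eball R 1; have mBc := measurableC mB.
exists (fun th => \1_(eball 1) th * I + \1_(~` eball 1) th * (C * (enorm th `^ 3)^-1)).
  apply: integrable2D => //; apply: integrable_indic => //.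
    by apply: integrable2_cst => //; exact: mu2_eball_lty.
  by apply: integrable2Z => //; apply: integrable_far; rewrite ltr_nat.
move=> y th; have [h|h] := ltP (enorm th) 1.
  rewrite !indicE mem_set// memNset; last by apply.
  by rewrite mul1r mul0r addr0; exact: ft_bound.
rewrite !indicE memNset ?mem_set ?mul0r ?add0r ?mul1r; [exact: hC| |]; by rewrite /eball /= ltNge h.
Qed.

Lemma ft_inversion (f : R * R -> R) y : test_function f ->
  \int[mu2]_(th in eball n%:R) ft f y th @[n --> \oo] --> (2 * pi) ^+ 2 * f y.
Proof.
move=> hf; have [d Ld hd] := ft_dominated hf.
have [cf [B hB] [rad rad0 sf] _] := test_nice hf.
have mf : mfun2 f by exact: continuous_measurable2.
have Lf : L1 setT f by apply: (supported_integrable mf sf (fun x _ => hB x)).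
have mft := measurable_ft y mf Lf.
have Lft : L1 setT (ft f y) by apply: (@dominated_integrable2 _ _ _ d).
rewrite -(ft_inversion_abel mf hB Lf (cf y) Lft).
rewrite (_ : (fun n : nat => _) = (fun n : nat => \int[mu2]_th (\1_(eball n%:R) th * ft f y th))); last first.
  by apply/funext => n; rewrite [LHS]Rintegral_indicM.
have [||th _|n th _|_ h] // := @Rintegral_dominated_cvg R setT
   (fun n th => \1_(eball n%:R) th * ft f y th) (ft f y) d measurableT.
- by move=> n; apply: measurable_funM => //; apply: measurable_indic2; exact: measurable_eball.
- apply: (@cvg_near_cst _ _ _ _ _ _); near=> n.
  rewrite indicE mem_set ?mul1r//= /eball /=.
  by near: n; exact: nbhs_infty_gtr.
- by rewrite normrM (le_trans _ (hd y th))// ler_piMl// indicE; case: (_ \in _); rewrite ?normr1 ?normr0.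
Unshelve. all: by end_near.
Qed.

End Inversion.

(** * The weak equation of the potential *)

Section WeakEquation.
Context {R : realType}.
Local Notation mu := (@lebesgue_measure R).
Local Notation P := (measurableTypeR R * measurableTypeR R)%type.
Local Notation measurable2 := (@measurable _ P).
Local Notation mfun2 f := (@measurable_fun _ _ P R setT f).
Local Notation L1 D f := (mu2.-integrable (D : set P) (EFin \o f)).

Context (alpha r M : R) (halpha : 1 < alpha < 2) (hr : 0 < r < M) (hM : 1 < M).
Context (hk : forall n : nat, (0 < n)%N -> 0 < kn r M alpha n).

Local Notation k_ := (kn r M alpha).
Local Notation F_ := (Fn r M).
Local Notation w_ := (wn r M alpha).
Local Notation c_ := (cn r M alpha).
Local Notation p_ := (pn r M alpha).
Local Notation c := (cc r M alpha).
Local Notation box n := (sites (Nbox M n)).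
Local Notation L_M := (LM r M alpha).

Let alpha_gt1 : 1 < alpha. Proof. by case/andP: halpha. Qed.
Let M_gt0 : 0 < M. Proof. exact: lt_trans ltr01 hM. Qed.

Local Opaque kn Fn wn cn pn psiM.
Local Notation psi := (psiM r M alpha).
Local Notation vol rad := (fine (mu2 (eball rad : set P))).
Implicit Types (x y z th : R * R).
Context (x0 : R * R) (hx0 : enorm x0 = 1).
Local Notation gp := (green_part alpha r M x0).
Local Notation p1 := (psi (1, 0)).
Let tau := (alpha - 1) / 2.
Let tau0 : 0 < tau. Proof. by rewrite divr_gt0// subr_gt0. Qed.
Let kap : R := ((2 * pi) ^+ 2)^-1.
Let kap0 : 0 < kap. Proof. by rewrite invr_gt0 exprn_gt0// mulr_gt0// pi_gt0. Qed.
Let p10 : 0 < p1. Proof. exact: psi_unit_gt0. Qed.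

Lemma psi_gt0 th : th != 0 -> 0 < psi th.
Proof.
move=> tn; have t0 : 0 < enorm th by rewrite lt_neqAle eq_sym enorm_eq0 tn enorm_ge0.
have [h|h] := leP 1 (enorm th).
  by apply: lt_le_trans (psi_lower_far halpha hr hM hk h); rewrite mulr_gt0// powR_gt0.
by apply: lt_le_trans (psi_lower_near halpha hr hM hk h); rewrite mulr_gt0 ?exprn_gt0 ?divr_gt0.
Qed.

Lemma measurable_difference : measurable_fun [set: P * P] (fun p => p.1 - p.2 : P).
Proof.
have m11 : measurable_fun [set: P * P] (fun p => p.1.1) by exact: measurableT_comp measurable_fst measurable_fst.
have m12 : measurable_fun [set: P * P] (fun p => p.1.2) by exact: measurableT_comp measurable_snd measurable_fst.
have m21 : measurable_fun [set: P * P] (fun p => p.2.1) by exact: measurableT_comp measurable_fst measurable_snd.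
have m22 : measurable_fun [set: P * P] (fun p => p.2.2) by exact: measurableT_comp measurable_snd measurable_snd.
by apply: measurable_fun_pair; apply: measurable_funB.
Qed.

Context (phi : R * R -> R) (hphi : test_function phi).
Let np := test_nice hphi.
Local Notation Lphi := (L_M phi).

Let mphi : mfun2 phi. Proof. by case: np => c0 _ _ _; exact: continuous_measurable2. Qed.
Let mL : mfun2 Lphi. Proof. by apply: measurable_LM => //; exact: np. Qed.

Lemma LM_test_support : exists2 Q : R, 0 < Q & supported Q Lphi.
Proof.
case: np => _ _ [rad rad0 sp] _; exists (rad + M); first by rewrite addr_gt0.
exact: LM_supported sp.
Qed.

Lemma integrable_LM_test : L1 setT Lphi.
Proof.
have [Q _ sL] := LM_test_support; have [C hC] := LM_bounded halpha hr hM hk np.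
exact: (supported_integrable mL sL (fun x _ => hC x)).
Qed.
Let LL := integrable_LM_test.

Lemma Rintegral_wave_LM th be :
  \int[mu2]_x (wave th be x * Lphi x) = - psi th * \int[mu2]_x (wave th be x * phi x).
Proof.
have mw := measurable_wave th be.
have bw : loc_bounded (wave th be) by move=> K; exists 1 => x _; exact: wave_max.
have [_ <-] := LM_dual halpha hr hM hk mw bw (sqr_ge0 (enorm th)) (d2_lip_wave th be) np.
have Lp : L1 setT phi.
  by case: np => _ [B hB] [rad _ sp] _; exact: (supported_integrable mphi sp (fun x _ => hB x)).
rewrite -RintegralZl//; last exact: integrable_waveM.
by apply: eq_Rintegral => x _; rewrite LM_wave// mulrA.
Qed.

(** The case of frequency 0. It eliminates the normalizing wave at x0 from the pairing of the Green
    function with L_M phi. *)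
Lemma Rintegral_LM0 : \int[mu2]_x Lphi x = 0.
Proof.
have := Rintegral_wave_LM 0 0; rewrite psiM0 oppr0 mul0r => <-; apply: eq_Rintegral => x _.
by rewrite /wave /edot /= !mul0r !addr0 cos0 mul1r.
Qed.

(** * The identity for the truncated kernel *)

Section Radius.
Context (a : R) (a1 : 1 <= a).

Let F y (p : P * P) : R := \1_(eball a) p.2 * wave_quotient alpha r M (p.1 - y) x0 p.2 * Lphi p.1.

Let mF y : measurable_fun setT (F y).
Proof.
apply: measurable_funM; last exact: measurableT_comp mL measurable_fst.
apply: measurable_funM.
  by apply: measurableT_comp measurable_snd; apply: measurable_indic2; exact: measurable_eball.
rewrite /wave_quotient; apply: measurable_funM.
  apply: measurable_funB.
    rewrite (_ : (fun p => _) = (fun p : P * P => wave p.2 (- edot p.2 y) p.1)); last first.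
      by apply/funext => p; rewrite /wave edotDr edotNr.
    exact: measurable_wave_joint.
  have m : mfun2 (fun th => cos (edot th x0)) by apply: measurable_cos_comp; exact: measurable_edotl.
  exact: measurableT_comp m measurable_snd.
have m : mfun2 (fun th => (psi th)^-1).
  rewrite (_ : (fun th => (psi th)^-1) = (fun u : R => u `^ (-1)) \o psi).
    by apply: measurableT_comp; [exact: measurable_powR|exact: measurable_psi].
  by apply/funext => th /=; rewrite powR_inv1 ?psi_ge0.
exact: measurableT_comp m measurable_snd.
Qed.

Let V : R := vol a.
Let V0 : 0 <= V. Proof. by rewrite fine_ge0. Qed.

Let Lind : L1 setT (fun th => \1_(eball a) th * 1).
Proof.
have mB := @measurable_eball R a; apply: integrable_indic => //.
by apply: integrable2_cst => //; exact: mu2_eball_lty.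
Qed.

Let bound y : exists2 K : R, 0 <= K & forall x th, `|F y (x, th)| <= K * `|Lphi x| * (\1_(eball a) th * 1).
Proof.
have [Q Q0 sL] := LM_test_support.
exists (2 / p1 * a ^+ 2 * (Q + enorm y + 1) * (Q + enorm y + 1)).
  have Q1 : 0 <= Q + enorm y + 1 by rewrite !addr_ge0 ?enorm_ge0 ?(ltW Q0).
  by rewrite mulr_ge0// mulr_ge0// mulr_ge0 ?sqr_ge0// divr_ge0// ltW.
move=> x th; have [xQ|xQ] := leP Q (enorm x).
  by rewrite /F /= (sL x xQ) normr0 mulr0 normr0 mulr0 mul0r.
have xy : enorm (x - y) <= Q + enorm y by rewrite (le_trans (enormB _ _))// lerD2r ltW.
rewrite /F /= mulr1 indicE; have [ht|ht] := boolP (th \in eball a); last by rewrite !mul0r normr0 mulr0.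
rewrite mul1r mulr1 normrM ler_wpM2r//.
move: ht; rewrite inE => ht.
apply: (le_trans (wave_quotient_bound halpha hr hM hk _ _ a1 (ltW ht))).
have K0 : 0 <= 2 / p1 * a ^+ 2 by rewrite mulr_ge0 ?sqr_ge0 ?divr_ge0 ?ltW.
rewrite hx0 -[leLHS]mulrA -[leRHS]mulrA ler_wpM2l//.
apply: ler_pM; rewrite ?enorm_ge0 ?addr_ge0 ?enorm_ge0//; last by rewrite lerD2r.
by rewrite (le_trans (enormB _ _))// hx0 lerD2r.
Qed.

Let LNL : L1 setT (fun x => `|Lphi x|). Proof. by have := integrable_norm LL. Qed.

(* At [th = 0] the quotient is [0 / 0 = 0], hence the exception at one point. *)
Lemma green_part_LM y :
  \int[mu2]_x (gp a (x - y) * Lphi x) = - \int[mu2]_(th in eball a) ft phi y th.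
Proof.
have [K K0 hK] := bound y; have mB := @measurable_eball R a.
have LK : L1 setT (fun x => K * `|Lphi x|) by exact: integrable2Z.
have Lq x : L1 setT (fun th => \1_(eball a) th * wave_quotient alpha r M (x - y) x0 th).
  by apply: integrable_indic => //; exact: integrable_wave_quotient.
have -> : \int[mu2]_x (gp a (x - y) * Lphi x) = \int[mu2]_x \int[mu2]_th F y (x, th).
  apply: eq_Rintegral => x _; rewrite /green_part [X in X * _]Rintegral_indicM -RintegralZr//.
rewrite (Rintegral2_swap (mF y) LK Lind hK).
have Lp : L1 setT phi.
  by case: np => _ [B hB] [rad _ sp] _; exact: (supported_integrable mphi sp (fun x _ => hB x)).
have mft := measurable_ft y mphi Lp.
have Lft : L1 setT (fun th => \1_(eball a) th * ft phi y th).
  apply: integrable_indic => //; have [d Ld hd] := ft_dominated hphi.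
  apply: (bounded_integrable (C := \int[mu2]_x `|phi x|)) => //; first exact: mu2_eball_lty.
  by move=> th _; exact: ft_bound.
rewrite [X in - X]Rintegral_indicM -[RHS]mulN1r -RintegralZl//.
apply: (@Rintegral_eq_off_point _ setT _ _ 0) => //.
- exact: measurable_Rintegral22 (mF y) LK Lind hK.
- apply: measurable_funM => //; apply: measurable_funM => //; exact: measurable_indic2.
move=> th tn; have pt0 := psi_gt0 tn.
have -> : \int[mu2]_x F y (x, th) = \int[mu2]_x (\1_(eball a) th / psi th *
   (wave th (- edot th y) x * Lphi x - cos (edot th x0) * Lphi x)).
  apply: eq_Rintegral => x _; rewrite /F /= /wave_quotient /wave edotDr edotNr.
  by move: (\1_(eball a) th : R) => i; ring.
have Lw := @integrable_waveM R Lphi th (- edot th y) mL LL.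
rewrite RintegralZl//; last by apply: integrable2B => //; exact: integrable2Z.
rewrite RintegralB//; last exact: integrable2Z.
rewrite RintegralZl// Rintegral_LM0 mulr0 subr0 Rintegral_wave_LM -/(ft phi y th).
move: (\1_(eball a) th : R) => i; field; by rewrite gt_eqF.
Qed.

Section Source.
Context (rho : R * R -> R) (B R0 : R).
Hypotheses (mrho : mfun2 rho) (hB : forall x, `|rho x| <= B) (R00 : 0 < R0) (srho : supported R0 rho).

Let H (p : P * P) : R := gp a (p.1 - p.2) * Lphi p.1 * rho p.2.

Let mH : measurable_fun setT H.
Proof.
apply: measurable_funM; last exact: measurableT_comp mrho measurable_snd.
apply: measurable_funM; last exact: measurableT_comp mL measurable_fst.
exact: measurableT_comp (measurable_green_part halpha hr hM hk x0 a1) measurable_difference.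
Qed.

Let Lrho : L1 setT rho. Proof. exact: (supported_integrable mrho srho (fun x _ => hB x)). Qed.
Let LNrho : L1 setT (fun x => `|rho x|). Proof. by have := integrable_norm Lrho. Qed.

Let KH := 2 / p1 * a ^+ 2 * V.
Let KH0 : 0 <= KH.
Proof. by rewrite mulr_ge0// mulr_ge0 ?sqr_ge0// divr_ge0// ltW. Qed.

Let gp_le (q : R) z : enorm z <= q -> `|gp a z| <= KH * (q + 1) ^+ 2.
Proof.
move=> zq; apply: (le_trans (green_part_bound halpha hr hM hk hx0 z a1)).
have q0 := le_trans (enorm_ge0 z) zq.
by rewrite -/V -/KH ler_wpM2l// ler_pXn2r ?nnegrE ?addr_ge0 ?enorm_ge0// lerD2r.
Qed.

Let gp_loc : loc_bounded (gp a).
Proof. by move=> q; exists (KH * (q + 1) ^+ 2) => z; exact: gp_le. Qed.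

Let gp_loc' x : loc_bounded (fun y => gp a (x - y)).
Proof.
move=> q; exists (KH * (enorm x + q + 1) ^+ 2) => y yq; apply: gp_le.
by rewrite (le_trans (enormB _ _))// lerD2l.
Qed.

Let boundH : exists2 K : R, 0 <= K & forall x y, `|H (x, y)| <= K * `|Lphi x| * `|rho y|.
Proof.
have [Q Q0 sL] := LM_test_support.
exists (KH * (Q + R0 + 1) ^+ 2); first by rewrite mulr_ge0 ?sqr_ge0.
move=> x y; rewrite /H /= 2!normrM.
have [xQ|xQ] := leP Q (enorm x); first by rewrite (sL x xQ) normr0 !mulr0 !mul0r.
have [yQ|yQ] := leP R0 (enorm y); first by rewrite (srho yQ) normr0 !mulr0.
rewrite ler_wpM2r// ler_wpM2r//; apply: gp_le.
by rewrite (le_trans (enormB _ _))// lerD// ltW.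
Qed.

Lemma green_part_loc_bounded x : loc_bounded (fun y => gp a (x - y)).
Proof. exact: gp_loc'. Qed.

Lemma weak_fubini :
  [/\ mfun2 (fun y => \int[mu2]_x (gp a (x - y) * Lphi x) * rho y),
      mfun2 (fun x => Lphi x * \int[mu2]_y (gp a (x - y) * rho y)) &
  \int[mu2]_x (Lphi x * \int[mu2]_y (gp a (x - y) * rho y)) =
  \int[mu2]_y (\int[mu2]_x (gp a (x - y) * Lphi x) * rho y)].
Proof.
have [K K0 hK] := boundH.
have LK : L1 setT (fun x => K * `|Lphi x|) by exact: integrable2Z.
have mg := measurable_green_part halpha hr hM hk x0 a1.
have e1 x : \int[mu2]_y H (x, y) = Lphi x * \int[mu2]_y (gp a (x - y) * rho y).
  rewrite -RintegralZl//; last exact: loc_bounded_integrableM (measurable_reflect x mg) (gp_loc' x) mrho srho hB.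
  by apply: eq_Rintegral => y _; rewrite /H /=; ring.
have e2 y : \int[mu2]_x H (x, y) = \int[mu2]_x (gp a (x - y) * Lphi x) * rho y.
  have [Q _ sL] := LM_test_support; have [C hC] := LM_bounded halpha hr hM hk np.
  have lb : loc_bounded (fun x => gp a (x - y)) by exact: (loc_bounded_translate (- y) gp_loc).
  rewrite -RintegralZr//; exact: loc_bounded_integrableM (measurable_translate (- y) mg) lb mL sL hC.
split.
- have := measurable_Rintegral22 mH LK LNrho hK; congr (measurable_fun _ _); exact/funext.
- have := measurable_Rintegral21 mH LK LNrho hK; congr (measurable_fun _ _); exact/funext.
transitivity (\int[mu2]_x \int[mu2]_y H (x, y)); first by apply: eq_Rintegral => x _; rewrite e1.
rewrite (Rintegral2_swap mH LK LNrho hK); by apply: eq_Rintegral => y _; rewrite e2.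
Qed.

End Source.
End Radius.

(** * Removal of the truncation *)

Section Potential.
Context (rho : R * R -> R) (B R0 Lr : R).
Hypotheses (mrho : mfun2 rho) (hB : forall x, `|rho x| <= B) (R00 : 0 < R0) (srho : supported R0 rho).
Hypotheses (rho_lip : forall x y, `|rho x - rho y| <= Lr * enorm (x - y)).
Local Notation U := (potential alpha r M x0 rho).

Let n1 (n : nat) : 1 <= n.+1%:R :> R. Proof. by rewrite ler1n. Qed.

Let Lrho : L1 setT rho. Proof. exact: (supported_integrable mrho srho (fun x _ => hB x)). Qed.
Let LNrho : L1 setT (fun x => `|rho x|). Proof. by have := integrable_norm Lrho. Qed.

Let kapE (n : nat) x : \int[mu2]_y (kap * gp n.+1%:R (x - y) * rho y) = kap * \int[mu2]_y (gp n.+1%:R (x - y) * rho y).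
Proof.
rewrite -RintegralZl//; first by apply: eq_Rintegral => y _; rewrite mulrA.
exact: loc_bounded_integrableM (measurable_reflect x (measurable_green_part halpha hr hM hk x0 (n1 n))) (green_part_loc_bounded (n1 n) x) mrho srho hB.
Qed.

(** The potential of the truncated kernel; its pairing with L_M phi is, up to the factor - kap, that
    of [rho] with the truncated inversion integral [J] of phi. The radius n + 1 satisfies the
    condition a >= 1 of the tail bounds. *)
Let A (n : nat) x := \int[mu2]_y (kap * gp n.+1%:R (x - y) * rho y).

Let J (n : nat) y := \int[mu2]_(th in eball n.+1%:R) ft phi y th.

Let mA (n : nat) : mfun2 (fun x => Lphi x * A n x).
Proof.
have [_ m2 _] := weak_fubini (n1 n) mrho hB srho.
rewrite (_ : (fun x => _) = (fun x => kap * (Lphi x * \int[mu2]_y (gp n.+1%:R (x - y) * rho y)))).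
  exact: measurable_funM.
by apply/funext => x; rewrite /A kapE mulrCA.
Qed.

Let mJ (n : nat) : mfun2 (fun y => - kap * (J n y * rho y)).
Proof.
have [m1 _ _] := weak_fubini (n1 n) mrho hB srho.
rewrite (_ : (fun x => _) = (fun y => kap * (\int[mu2]_x (gp n.+1%:R (x - y) * Lphi x) * rho y))).
  exact: measurable_funM.
by apply/funext => y; rewrite (green_part_LM (n1 n)) -/(J n y); ring.
Qed.

Let hJ : exists2 D : R, 0 <= D & forall n y, `|J n y| <= D.
Proof.
have [d Ld hd] := ft_dominated hphi.
exists (\int[mu2]_th d th); first by apply: Rintegral_ge0 => // th _; exact: le_trans (hd 0 th).
move=> n y; rewrite /J [X in `|X|]Rintegral_indicM; have mB := @measurable_eball R n.+1%:R.
have Lp : L1 setT phi.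
  by case: np => _ [B' hB'] [rad _ sp] _; exact: (supported_integrable mphi sp (fun x _ => hB' x)).
apply: norm_Rintegral_le => //.
- by apply: measurable_funM; [exact: measurable_indic2|exact: measurable_ft].
- by move=> th _; rewrite normrM (le_trans _ (hd y th))// ler_piMl// indicE; case: (_ \in _); rewrite ?normr1 ?normr0.
Qed.

Let AE (n : nat) : \int[mu2]_x (Lphi x * A n x) = \int[mu2]_y (- kap * (J n y * rho y)).
Proof.
have [m1 m2 e] := weak_fubini (n1 n) mrho hB srho.
have [Q _ sL] := LM_test_support; have [C hC] := LM_bounded halpha hr hM hk np.
have [C0 hC0] : exists C0 : R, forall x, Lphi x != 0 -> `|\int[mu2]_y (gp n.+1%:R (x - y) * rho y)| <= C0.
  have [C1 C10 h1] := potential_tail halpha hr hM hk hx0 mrho hB srho Q.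
  have := continuous_loc_bounded (potential_continuous halpha hr hM hk hx0 mrho hB srho rho_lip) => /(_ Q)[C2 h2].
  exists ((C1 * n.+1%:R `^ (- tau) + C2) / kap) => x xn.
  have xQ : enorm x <= Q by apply: contra_neqT xn; rewrite -ltNge => /ltW /sL.
  have := h1 x n.+1%:R xQ (n1 n); rewrite kapE => h.
  rewrite ler_pdivlMr// mulrC -{1}(gtr0_norm kap0) -normrM -(subrK (U x) (kap * _)).
  by apply: (le_trans (ler_normD _ _)); rewrite distrC; apply: lerD => //; exact: h2.
have Lc : L1 setT (fun x => Lphi x * \int[mu2]_y (gp n.+1%:R (x - y) * rho y)).
  apply: (@dominated_integrable2 _ _ _ (fun x => `|C0| * `|Lphi x|)) => //.
    by apply: integrable2Z => //; have := integrable_norm LL.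
  move=> x _; rewrite normrM mulrC; have [->|xn] := eqVneq (Lphi x) 0; first by rewrite normr0 !mulr0.
  by rewrite ler_wpM2r// (le_trans (hC0 x xn))// ler_norm.
transitivity (kap * \int[mu2]_x (Lphi x * \int[mu2]_y (gp n.+1%:R (x - y) * rho y))).
  by rewrite -RintegralZl//; apply: eq_Rintegral => x _; rewrite /A kapE mulrCA.
rewrite e -RintegralZl//; first by apply: eq_Rintegral => y _; rewrite (green_part_LM (n1 n)) -/(J n y); ring.
have [D D0 hD] := hJ.
apply: (@dominated_integrable2 _ _ _ (fun y => D * `|rho y|)) => //; last first.
- by move=> y _; rewrite (green_part_LM (n1 n)) normrM normrN ler_wpM2r//; exact: hD.
- exact: integrable2Z.
Qed.

(** Both sides of [AE] converge: the left one by the tail bound, uniform on the support of L_M phi,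
    the right one by Fourier inversion, dominated by a multiple of |rho|. *)
Lemma potential_weak : \int[mu2]_x (U x * Lphi x) = - \int[mu2]_x (rho x * phi x).
Proof.
have [Q _ sL] := LM_test_support; have [CL hCL] := LM_bounded halpha hr hM hk np.
have cU := potential_continuous halpha hr hM hk hx0 mrho hB srho rho_lip.
have mU := continuous_measurable2 cU.
have LU : L1 setT (fun x => U x * Lphi x).
  exact: loc_bounded_integrableM mU (continuous_loc_bounded cU) mL sL hCL.
have [C1 C10 h1] := potential_tail halpha hr hM hk hx0 mrho hB srho Q.
have LN : L1 setT (fun x => `|Lphi x|) by have := integrable_norm LL.
pose q (n : nat) : R := C1 * n.+1%:R `^ (- tau).
have D (n : nat) x : `|U x * Lphi x - Lphi x * A n x| <= q n * `|Lphi x|.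
  rewrite [U x * _]mulrC -mulrBr normrM mulrC.
  have [xQ|xQ] := leP Q (enorm x); first by rewrite (sL x xQ) normr0 !mulr0.
  by rewrite ler_wpM2r//; exact: h1 (ltW xQ) (n1 n).
have LD (n : nat) : L1 setT (fun x => U x * Lphi x - Lphi x * A n x).
  apply: (@dominated_integrable2 _ _ _ (fun x => q n * `|Lphi x|)) => //.
  - apply: measurable_funB; [exact: measurable_funM|exact: mA].
  - exact: integrable2Z.
have LA (n : nat) : L1 setT (fun x => Lphi x * A n x).
  rewrite (_ : (fun x => _) = (fun x => U x * Lphi x - (U x * Lphi x - Lphi x * A n x))).
    exact: integrable2B.
  by apply/funext => x; rewrite subKr.
have cA : \int[mu2]_x (Lphi x * A n x) @[n --> \oo] --> \int[mu2]_x (U x * Lphi x).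
  apply/subr_cvg0/norm_cvg0P.
  apply: (@squeeze_cvgr _ _ _ _ (fun=> 0) (fun n => q n * \int[mu2]_x `|Lphi x|)); last 2 first.
  - exact: cvg_cst.
  - rewrite -(mul0r (\int[mu2]_x `|Lphi x|)); apply: cvgM; last exact: cvg_cst.
    rewrite -[X in _ --> X](mulr0 C1); apply: cvgM; first exact: cvg_cst.
    by have := natr_powRN_cvg0 tau0; rewrite -(cvg_shiftS (fun n : nat => n%:R `^ (- tau))).
  near=> n; rewrite normr_ge0 /= distrC -RintegralB// -RintegralZl//.
  by apply: norm_Rintegral_le => //; [apply: measurable_funB; [exact: measurable_funM|exact: mA]|exact: integrable2Z].
have [D' D'0 hD'] := hJ.
have [||y _|n y _|Lrp cJ] // := @Rintegral_dominated_cvg R setT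
   (fun n y => - kap * (J n y * rho y)) (fun y => - (rho y * phi y)) (fun y => kap * D' * `|rho y|) measurableT.
- exact: integrable2Z.
- have -> : - (rho y * phi y) = - kap * (((2 * pi) ^+ 2 * phi y) * rho y).
    have pi0 : pi != 0 :> R by rewrite gt_eqF// pi_gt0.
    have k1 : kap * (2 * pi) ^+ 2 = 1 by rewrite mulVf// expf_neq0// mulf_neq0.
    move: k1; move: ((2 * pi) ^+ 2) (kap) => S k k1.
    by transitivity (- (k * S) * (phi y * rho y)); [rewrite k1|]; ring.
  apply: cvgM; first exact: cvg_cst.
  apply: cvgM; last exact: cvg_cst.
  have := @ft_inversion R phi y hphi; rewrite -(cvg_shiftS (fun n : nat => \int[mu2]_(th in eball n%:R) ft phi y th)); exact.
- by rewrite !normrM normrN (gtr0_norm kap0) -mulrA ler_wpM2l ?(ltW kap0)// ler_wpM2r.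
rewrite (_ : (fun n => \int[mu2]_x _) = (fun n => \int[mu2]_x (Lphi x * A n x))) in cJ; last first.
  by apply/funext => n; rewrite AE.
rewrite (cvg_unique _ cA cJ) //; rewrite -[RHS]mulN1r -RintegralZl//.
  by apply: eq_Rintegral => x _; rewrite mulN1r.
by case: np => _ [B' hB'] [rad _ sp] _; exact: loc_bounded_integrableM mrho (fun _ => ex_intro _ B (fun x _ => hB x)) mphi sp hB'.
Unshelve. all: by end_near.
Qed.

End Potential.
End WeakEquation.

(** * The obstacle and its majorant *)

Section Final.
Context {R : realType}.
Local Notation mu := (@lebesgue_measure R).
Local Notation P := (measurableTypeR R * measurableTypeR R)%type.
Local Notation measurable2 := (@measurable _ P).
Local Notation mfun2 f := (@measurable_fun _ _ P R setT f).
Local Notation L1 D f := (mu2.-integrable (D : set P) (EFin \o f)).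

Context (alpha r M : R) (halpha : 1 < alpha < 2) (hr : 0 < r < M) (hM : 1 < M).
Context (hk : forall n : nat, (0 < n)%N -> 0 < kn r M alpha n).

Local Notation k_ := (kn r M alpha).
Local Notation F_ := (Fn r M).
Local Notation w_ := (wn r M alpha).
Local Notation c_ := (cn r M alpha).
Local Notation p_ := (pn r M alpha).
Local Notation c := (cc r M alpha).
Local Notation box n := (sites (Nbox M n)).
Local Notation L_M := (LM r M alpha).

Local Opaque kn Fn wn cn pn psiM.
Implicit Types (x y z : R * R).
Context (x0 : R * R) (hx0 : enorm x0 = 1).
Context (rho : R * R -> R) (hrho : Cck 2 rho).
Local Notation gam := (obstacle r M alpha x0 rho).
Local Notation U := (potential alpha r M x0 rho).
Local Notation s2 := (sigma2 r M alpha).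

Lemma source_facts : exists B R0 Lr : R, [/\ 0 < R0, 0 <= Lr, (forall x, `|rho x| <= B),
  supported R0 rho & forall x y, `|rho x - rho y| <= Lr * enorm (x - y)].
Proof.
have [_ [B hB] [R0 R00 sr] _] := Cck2_nice hrho.
have [ck cK] := hrho; have [Lr Lr0 hL] := Ck1_lip cK (Ck_pred ck) (@tsupport0 R rho).
exists B, R0, Lr; split => // x y.
by have := hL y (x - y); rewrite (addrC y) subrK.
Qed.

Let crho : continuous rho. Proof. by have [? _ _ _] := Cck2_nice hrho. Qed.
Let mrho : mfun2 rho. Proof. exact: continuous_measurable2 crho. Qed.

Let cU : continuous U.
Proof.
have [B [R0 [Lr [R00 _ hB sr hL]]]] := source_facts.
have h := potential_continuous halpha hr hM hk hx0 mrho hB sr hL; exact: h.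
Qed.

Lemma continuous_sq : continuous (fun x : R * R => enorm x ^+ 2).
Proof.
by move=> x; apply: (@continuous_comp _ _ _ enorm (fun t : R => t ^+ 2)); [exact: continuous_enorm|exact: exprn_continuous].
Qed.

Lemma obstacle_continuous : continuous gam.
Proof.
move=> x; apply: cvgB; last exact: cU.
by apply: cvgN; apply: cvgM; [exact: continuous_sq|exact: cvg_cst].
Qed.

Lemma continuous_integrableM (f g : R * R -> R) : continuous f -> nice g -> L1 setT (fun x => f x * g x).
Proof.
move=> cf [cg [B hB] [rad _ sg] _].
exact: loc_bounded_integrableM (continuous_measurable2 cf) (continuous_loc_bounded cf) (continuous_measurable2 cg) sg hB.
Qed.

Lemma continuous_integrableLM (f g : R * R -> R) : continuous f -> nice g -> L1 setT (fun x => f x * L_M g x).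
Proof.
move=> cf ng; have [_ _ [rad _ sg] _] := ng; have [B hB] := LM_bounded halpha hr hM hk ng.
have mL : mfun2 (L_M g) by apply: measurable_LM.
exact: loc_bounded_integrableM (continuous_measurable2 cf) (continuous_loc_bounded cf) mL (LM_supported alpha r hM sg) hB.
Qed.

Lemma nice_integrable (f : R * R -> R) : nice f -> L1 setT f.
Proof.
move=> [cf [B hB] [rad _ sf] _].
exact: (supported_integrable (continuous_measurable2 cf) sf (fun x _ => hB x)).
Qed.

(** The paraboloid contributes -1, because L_M |x|^2 = sigma^2, and minus the potential contributes
    [rho]. *)
Lemma obstacle_weak phi : test_function phi ->
  \int[mu2]_x (gam x * L_M phi x) = - \int[mu2]_x ((1 - rho x) * phi x).
Proof.
move=> hphi; have np := test_nice hphi; have s20 := sigma2_gt0 halpha hr hM hk.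
have [B [R0 [Lr [R00 _ hB sr hL]]]] := source_facts.
have eU := potential_weak halpha hr hM hk hx0 hphi mrho hB sr hL.
have [_ esq] := LM_dual halpha hr hM hk measurable_sq (continuous_loc_bounded continuous_sq) (ler0n _ 2) d2_lip_sq np.
have Lp := nice_integrable np.
have Lrp := continuous_integrableM crho np.
have {}esq : \int[mu2]_x (enorm x ^+ 2 * L_M phi x) = s2 * \int[mu2]_x phi x.
  by rewrite -esq -RintegralZl//; apply: eq_Rintegral => x _; rewrite LM_sq.
have -> : \int[mu2]_x ((1 - rho x) * phi x) = \int[mu2]_x phi x - \int[mu2]_x (rho x * phi x).
  by rewrite -RintegralB//; apply: eq_Rintegral => x _; rewrite mulrBl mul1r.
have -> : \int[mu2]_x (gam x * L_M phi x) =
    - s2^-1 * \int[mu2]_x (enorm x ^+ 2 * L_M phi x) - \int[mu2]_x (U x * L_M phi x).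
  have L1q := continuous_integrableLM continuous_sq np.
  have L2q := continuous_integrableLM cU np.
  rewrite -RintegralZl// -RintegralB//; last exact: integrable2Z.
  by apply: eq_Rintegral => x _; rewrite /obstacle -/(U x); ring.
rewrite esq eU mulrA mulNr mulVf ?gt_eqF//; ring.
Qed.

Lemma continuous_locally_integrable (f : R * R -> R) : continuous f -> locally_integrable2 f.
Proof.
move=> cf; have mf := continuous_measurable2 cf; split => // K cK.
have mK := compact_measurable2 cK; have [rad rad0 Kr] := compact_sub_eball cK.
have [C hC] := continuous_loc_bounded cf rad.
apply: (bounded_integrable (C := C)) => //.
- apply: le_lt_trans (mu2_eball_lty rad); apply: le_measure; rewrite ?inE//; exact: measurable_eball.
- by move=> x Kx; apply: hC; apply: ltW; exact: Kr.
Qed.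

Section Odometer.
Context (xs : nat -> nat -> site)
  (hxs : forall n : nat, (0 < n)%N -> toppling_sequence r M alpha n (fun y : site => rho (pt n y)) (xs n)).
Local Notation v := (limit_odo alpha r M rho xs).

Lemma limit_odo_facts : [/\ continuous v, (forall x, 0 <= v x),
  (forall phi, nice phi -> \int[mu2]_x (step_ext n (final_mass r M alpha n (fun y : site => rho (pt n y)) (xs n)) x * phi x)
     @[n --> \oo] --> \int[mu2]_x (rho x * phi x) + \int[mu2]_x (v x * L_M phi x)),
  (forall phi, nice phi -> (forall x, 0 <= phi x) ->
     \int[mu2]_x (v x * L_M phi x) <= \int[mu2]_x ((1 - rho x) * phi x)) &
  (forall w : R * R -> R, continuous w -> (forall x, 0 <= w x) ->
     (forall phi, test_function phi -> (forall x, 0 <= phi x) ->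
       \int[mu2]_x (w x * L_M phi x) <= \int[mu2]_x ((1 - rho x) * phi x)) ->
     forall x, v x <= w x)].
Proof.
have [B [R0 [Lr [R00 Lr0 hB sr hL]]]] := source_facts.
have [E Ecvg [E0 hE]] := generator_error halpha hr hM hk.
have hB' x : rho x <= B by exact: le_trans (ler_norm _) (hB x).
(* The regularization eps of the barriers is given its least admissible value. *)
have [V [K [V0 K0 hVK]]] := odometer_bounds halpha hr hM hk (lexx (16 * (M + 1) ^+ 2)) hB' R00 sr xs.
split.
- exact: (limit_odo_continuous halpha hr hM hk E0 Ecvg hE Lr0 hL hxs V0 K0 hVK).
- exact: (limit_odo_ge0 halpha hr hM hk E0 Ecvg hE Lr0 hL hxs V0 K0 hVK).
- exact: (final_mass_cvg halpha hr hM hk E0 Ecvg hE mrho Lr0 hL hxs V0 K0 hVK).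
- exact: (limit_odo_super halpha hr hM hk E0 Ecvg hE mrho Lr0 hL hxs V0 K0 hVK).
- exact: (limit_odo_least halpha hr hM hk E0 Ecvg hE mrho Lr0 hL hxs V0 K0 hVK).
Qed.

Lemma majorant_obstacle x : majorant r M alpha gam x = v x + gam x.
Proof.
have [cv v0 _ vsup vleast] := limit_odo_facts; have cg := obstacle_continuous.
rewrite /majorant; set S := (X in inf X).
(* The infimum is attained, which also shows that [inf] is taken over a nonempty set. *)
have inS : S (v x + gam x).
  exists (fun x => v x + gam x) => //; split.
  - by move=> z; apply: cvgD; [exact: cv|exact: cg].
  - split.
      by apply: continuous_locally_integrable => z; apply: cvgD; [exact: cv|exact: cg].
    move=> phi hphi phi0 _; have np := test_nice hphi.
    rewrite (_ : \int[mu2]_x _ = \int[mu2]_x (v x * L_M phi x) + \int[mu2]_x (gam x * L_M phi x)).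
      by rewrite obstacle_weak// subr_le0; exact: vsup.
    rewrite -RintegralD//; first by apply: eq_Rintegral => z _; rewrite mulrDl.
    + exact: continuous_integrableLM.
    + exact: continuous_integrableLM.
  - by move=> z; rewrite lerDr.
have lbS : lbound S (v x + gam x).
  move=> _ [f [cf [_ sf] hf] <-]; rewrite -lerBrDr.
  apply: (vleast (fun x => f x - gam x)).
  - by move=> z; apply: cvgB; [exact: cf|exact: cg].
  - by move=> z; rewrite subr_ge0.
  move=> phi hphi phi0; have np := test_nice hphi.
  rewrite (_ : \int[mu2]_x _ = \int[mu2]_x (f x * L_M phi x) - \int[mu2]_x (gam x * L_M phi x)).
    by rewrite obstacle_weak// opprK gerDr; apply: sf.
  rewrite -RintegralB//; first by apply: eq_Rintegral => z _; rewrite mulrBl.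
  + exact: continuous_integrableLM.
  + exact: continuous_integrableLM.
apply/eqP; rewrite eq_le; apply/andP; split.
  by apply: ge_inf => //; exists (v x + gam x).
by apply: lb_le_inf => //; exists (v x + gam x).
Qed.

Lemma odometerE x : odometer r M alpha x0 rho x = v x.
Proof. by rewrite /odometer majorant_obstacle addrK. Qed.

End Odometer.
End Final.

Theorem theorem1p2 (R : realType) (alpha r M : R)
    (halpha : 1 < alpha < 2) (hr : 0 < r < M) (hM : 1 < M)
    (hk : forall n : nat, (0 < n)%N -> 0 < kn r M alpha n)
    (x0 : R * R) (hx0 : enorm x0 = 1)
    (rho : R * R -> R) (hrho : Cck 2 rho) (hrho0 : forall x, 0 <= rho x)
    (xs : nat -> nat -> site)
    (hxs : forall n : nat, (0 < n)%N ->
       toppling_sequence r M alpha n (fun y => rho (pt n y)) (xs n))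
    (phi : R * R -> R) (hphi : test_function phi) :
  let nu (n : nat) := final_mass r M alpha n (fun y => rho (pt n y)) (xs n) in
  let u := odometer r M alpha x0 rho in
  (\int[mu2]_x (step_ext n (nu n) x * phi x)) @[n --> \oo] -->
    \int[mu2]_x (rho x * phi x) + \int[mu2]_x (u x * LM r M alpha phi x).
Proof.
move=> nu u.
have [_ _ cvg_nu _ _] := limit_odo_facts halpha hr hM hk hrho hxs.
have -> : \int[mu2]_x (u x * LM r M alpha phi x) =
    \int[mu2]_x (limit_odo alpha r M rho xs x * LM r M alpha phi x).
  apply: eq_Rintegral => x _; congr (_ * _).
  exact: (odometerE halpha hr hM hk hx0 hrho hxs).
by apply: cvg_nu; exact: test_nice.
Qed.
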